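(* There exists a constant $c \leq 1.16$ with the following property. Let $u: U \to \mathbb{R}$ be a smooth function on an open set $U\subset\mathbb{R}^{2}$ such that $\mathrm{Hess}(u)$ is positive definite and $\det \mathrm{Hess}(u) = 1$ everywhere, and let $g$ be the Hessian metric $g|_x=\mathrm{Hess}(u)|_x$ on $U$. Let $C:[0,\gamma)\to U$, $0<\gamma<\infty$, be a minimal unit-speed geodesic with respect to $g$ realizing the shortest $g$-distance $\gamma=\mathrm{dist}_g(C(0),\partial U)$ from $C(0)$ to $\partial U$. Then $$\sqrt{\mathrm{Ric}(C'(s),C'(s))} \leq \frac{c}{\gamma-s}\quad\text{for all } s \in [0,\gamma).$$ Moreover, $c$ cannot be made smaller than $1.11$, i.e. any constant $c$ with this property satisfies $c\geq 1.11$.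
   Context: $\mathrm{Ric}$ is the Ricci tensor of $g$. $\mathrm{dist}_g(x,\partial U)$ is the intrinsic $g$-distance from $x$ to the boundary, i.e. the infimum of the $g$-lengths of all piecewise $C^1$ curves $[0,1)\to U$ starting at $x$ and eventually leaving every compact subset of $U$. ''$C$ realizes this distance'' means that $C$ is a unit-speed geodesic starting at $C(0)$, minimizing $g$-length between any two of its points, eventually leaving every compact subset of $U$ as $s\to\gamma$, and with total length $\gamma=\mathrm{dist}_g(C(0),\partial U)$. *)

(* Defs.v *)
From Stdlib Require Import Reals List.
From Coquelicot Require Import Coquelicot.

Open Scope R_scope.

(** A function on an open set [U] is represented by a total function on
    [R * R]; the partial derivatives at a point of [U] depend only on its
    values near that point, hence never on its values outside [U]. *)

Inductive axis := ax1 | ax2.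

Definition sum2 (f : axis -> R) : R := f ax1 + f ax2.

Definition coord (i : axis) (p : R * R) : R :=
  match i with ax1 => fst p | ax2 => snd p end.

Definition update (i : axis) (p : R * R) (t : R) : R * R :=
  match i with ax1 => (t, snd p) | ax2 => (fst p, t) end.

Definition ex_partial (i : axis) (f : R * R -> R) (p : R * R) : Prop :=
  ex_derive (fun t => f (update i p t)) (coord i p).

Definition partial (i : axis) (f : R * R -> R) (p : R * R) : R :=
  Derive (fun t => f (update i p t)) (coord i p).

Fixpoint Ck_on (n : nat) (U : R * R -> Prop) (f : R * R -> R) : Prop :=
  (forall p, U p -> continuous f p) /\
  match n with
  | O => True
  | S m => forall i, (forall p, U p -> ex_partial i f p) /\
                     Ck_on m U (partial i f)
  end.

Definition smooth_on (U : R * R -> Prop) (f : R * R -> R) : Prop :=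
  forall n, Ck_on n U f.

Definition det2 (A : axis -> axis -> R) : R :=
  A ax1 ax1 * A ax2 ax2 - A ax1 ax2 * A ax2 ax1.

Definition inv2 (A : axis -> axis -> R) (i j : axis) : R :=
  match i, j with
  | ax1, ax1 => A ax2 ax2 / det2 A
  | ax1, ax2 => - A ax1 ax2 / det2 A
  | ax2, ax1 => - A ax2 ax1 / det2 A
  | ax2, ax2 => A ax1 ax1 / det2 A
  end.

Definition bilin (A : axis -> axis -> R) (v w : R * R) : R :=
  sum2 (fun i => sum2 (fun j => A i j * coord i v * coord j w)).

Definition pos_def (A : axis -> axis -> R) : Prop :=
  (forall i j, A i j = A j i) /\ forall v, v <> (0, 0) -> 0 < bilin A v v.

Definition Hess (u : R * R -> R) (p : R * R) (i j : axis) : R :=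
  partial i (partial j u) p.

Definition tensor_field := R * R -> axis -> axis -> R.

(** [christoffel g p k i j] is Gamma^k_{ij}(p). *)
Definition christoffel (g : tensor_field) (p : R * R) (k i j : axis) : R :=
  sum2 (fun l => / 2 * inv2 (g p) k l *
    (partial i (fun q => g q j l) p + partial j (fun q => g q i l) p
     - partial l (fun q => g q i j) p)).

(** [riemann g p l k i j] is the component R^l_{kij} of
    R(d_i, d_j) d_k = nabla_i nabla_j d_k - nabla_j nabla_i d_k.  With this
    convention the trace over [l = i] is the Ricci tensor that is positive on
    round spheres. *)
Definition riemann (g : tensor_field) (p : R * R) (l k i j : axis) : R :=
  partial i (fun q => christoffel g q l j k) p
  - partial j (fun q => christoffel g q l i k) p
  + sum2 (fun m => christoffel g p l i m * christoffel g p m j k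
                 - christoffel g p l j m * christoffel g p m i k).

Definition Ric (g : tensor_field) (p : R * R) (j k : axis) : R :=
  sum2 (fun i => riemann g p i k i j).

Definition gnorm (g : tensor_field) (p v : R * R) : R :=
  sqrt (bilin (g p) v v).

(** A curve on an interval [D] is a total function [R -> R * R] of which only
    the values on [D] matter.  Its derivative on [D] is taken relative to [D],
    i.e. it is one-sided at an end point that belongs to [D]. *)

Definition ivl_cc (a b t : R) : Prop := a <= t <= b.
Definition ivl_co (a b t : R) : Prop := a <= t < b.

Definition is_derive_within (D : R -> Prop) (c : R -> R * R) (t : R)
    (v : R * R) : Prop :=
  filterdiff c (within D (locally t)) (fun h : R => scal h v).

Definition C1_within (D : R -> Prop) (c v : R -> R * R) : Prop :=
  forall t, D t ->
    is_derive_within D c t (v t) /\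
    filterlim v (within D (locally t)) (locally (v t)).

(** [D] is one of the intervals [[a, b]] and [[a, b)]. *)
Definition piecewise_C1 (D : R -> Prop) (a b : R) (c : R -> R * R) : Prop :=
  exists (n : nat) (sigma : nat -> R),
    sigma O = a /\ sigma n = b /\
    forall i, (i < n)%nat ->
      sigma i < sigma (S i) /\
      exists v, C1_within (fun t => D t /\ ivl_cc (sigma i) (sigma (S i)) t) c v.

(** Two-sided derivative, used under integrals only: for a piecewise C^1 curve
    it is the actual velocity except at finitely many parameters. *)
Definition velocity (c : R -> R * R) (t : R) : R * R :=
  (Derive (fun r => fst (c r)) t, Derive (fun r => snd (c r)) t).

Definition speed (g : tensor_field) (c : R -> R * R) (t : R) : R :=
  gnorm g (c t) (velocity c t).

Definition curve_length (g : tensor_field) (c : R -> R * R) (a b : R) : R :=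
  RInt (speed g c) a b.

Definition has_length (g : tensor_field) (c : R -> R * R) (a b l : R) : Prop :=
  is_RInt_gen (speed g c) (at_point a) (at_left b) l.

Definition compact_set (K : R * R -> Prop) : Prop :=
  forall F : (R * R -> Prop) -> Prop,
    (forall V, F V -> open V) ->
    (forall p, K p -> exists V, F V /\ V p) ->
    exists l : list (R * R -> Prop),
      (forall V, In V l -> F V) /\
      (forall p, K p -> exists V, In V l /\ V p).

Definition leaves_compacts (U : R * R -> Prop) (c : R -> R * R) (a b : R)
    : Prop :=
  forall K, compact_set K -> (forall p, K p -> U p) ->
    exists T, a <= T < b /\ forall t, T < t < b -> ~ K (c t).

Definition curve_to_boundary (U : R * R -> Prop) (x : R * R) (c : R -> R * R)
    : Prop :=
  (forall t, ivl_co 0 1 t -> U (c t)) /\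
  piecewise_C1 (ivl_co 0 1) 0 1 c /\
  c 0 = x /\
  leaves_compacts U c 0 1.

(** Curves of infinite length do not affect the infimum; it is [p_infty] when
    no curve to the boundary has finite length. *)
Definition dist_boundary (U : R * R -> Prop) (g : tensor_field) (x : R * R)
    : Rbar :=
  Glb_Rbar (fun l => exists c, curve_to_boundary U x c /\ has_length g c 0 1 l).

(** The geodesic equation as a first-order system, [v] being the velocity of
    [c]. *)
Definition geodesic (g : tensor_field) (D : R -> Prop) (c v : R -> R * R)
    : Prop :=
  forall s, D s ->
    is_derive_within D c s (v s) /\
    is_derive_within D v s
      (- bilin (christoffel g (c s) ax1) (v s) (v s),
       - bilin (christoffel g (c s) ax2) (v s) (v s)).

Definition minimizing (U : R * R -> Prop) (g : tensor_field) (D : R -> Prop)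
    (c : R -> R * R) : Prop :=
  forall s1 s2, D s1 -> D s2 -> s1 <= s2 ->
    forall e : R -> R * R,
      (forall t, ivl_cc 0 1 t -> U (e t)) ->
      piecewise_C1 (ivl_cc 0 1) 0 1 e ->
      e 0 = c s1 -> e 1 = c s2 ->
      curve_length g c s1 s2 <= curve_length g e 0 1.

(** [v] is the derivative of [c] on [[0, gamma)], one-sided at [0]. *)
Record realizes_dist_boundary (U : R * R -> Prop) (g : tensor_field)
    (c v : R -> R * R) (gamma : R) : Prop := {
  rdb_in : forall s, ivl_co 0 gamma s -> U (c s);
  rdb_unit_speed : forall s, ivl_co 0 gamma s -> gnorm g (c s) (v s) = 1;
  rdb_geodesic : geodesic g (ivl_co 0 gamma) c v;
  rdb_minimizing : minimizing U g (ivl_co 0 gamma) c;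
  rdb_leaves : leaves_compacts U c 0 gamma;
  rdb_length : has_length g c 0 gamma gamma;
  rdb_dist : dist_boundary U g (c 0) = Finite gamma
}.

(** [sqrt] vanishes on negative reals, but the Ricci tensor of a Hessian metric
    of determinant 1 in dimension two is nonnegative. *)
Definition ricci_bound (k : R) : Prop :=
  forall (U : R * R -> Prop) (u : R * R -> R),
    open U ->
    smooth_on U u ->
    (forall p, U p -> pos_def (Hess u p)) ->
    (forall p, U p -> det2 (Hess u p) = 1) ->
    forall (gamma : R) (C C' : R -> R * R),
      0 < gamma ->
      realizes_dist_boundary U (Hess u) C C' gamma ->
      forall s, 0 <= s < gamma ->
        sqrt (bilin (Ric (Hess u) (C s)) (C' s) (C' s)) <= k / (gamma - s).

(* Main.v *)
Require Import Defs.
From Stdlib Require Import Reals List Lra Lia Psatz Classical ClassicalEpsilon Wf_nat ZArith.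
From Coquelicot Require Import Coquelicot.
Open Scope R_scope.

(** A Hessian metric of determinant 1 has Gauss curvature [K >= 0] with
    [Laplace log K = 6 K] where [K > 0]. As [u] solves a Monge-Ampere equation, the
    traces of the third derivatives of [u] vanish, so that the energy
    [(y - x) . (grad u y - grad u x)] of a segment has the second variation of a
    squared distance in the flat plane. Among the polygonal chains
    [p = X_0, ..., X_n] of energy [E < r^2], where [r] is less than the distance
    to the boundary, maximize [K(X_n) (r^2 - E)^2]. Moving the vertices of a
    maximizer along discretely parallel frames, scaled linearly from [0] at [p]
    to [1] at [X_n], gives [3 K (r^2 - E)^2 <= 4 r^2 + O(n^(-1/2))], hence
    [K(p) r^2 <= 4 / 3] and [sqrt Ric <= (2 / sqrt 3) / r] on unit vectors. A
    maximizer exists because chains shorter than the distance to the boundary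
    stay in a compact set, as in the Hopf-Rinow theorem: otherwise a sequence of
    chains could be continued to a curve that leaves every compact set and is
    too short.

    For the lower bound take the image of a disc under [z + conj z ^ 2 / 2],
    with [grad u = z - conj z ^ 2 / 2]. In the parameter [z] the metric is
    [(1 - |z|^2) |dz|^2], the radii are minimal geodesics, and at the centre
    [K = 2], while the distance to the boundary is almost [pi / 4]. *)

(** * Smooth functions of two variables *)

(** In a smooth treatment the function to maximize would be [K (r^2 - d^2)^2], with [d] the distance
    from [p]. Laplacian comparison in nonnegative curvature gives [Laplace d^2 <= 4], and
    [|grad d^2|^2 = 4 d^2]; with the equation for [log K] the conditions at a maximum read [3 K (r^2
    - d^2)^2 <= 4 (r^2 - d^2) + 4 d^2], in which [d] cancels on the right. This is the origin of
    [4 / 3]. The obstacle is that [d] is not smooth at the cut locus, and that geodesics and Jacobi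
    fields depend on the theory of differential equations. The chain energy takes the place of
    [d^2]: it is a smooth function of finitely many vertices, so that only derivative tests in one
    variable are applied, and the comparison constant 4 comes from the elementary fact that a
    positive symmetric matrix of determinant 1 has trace at least 2. The price is an error in every
    leg, which has to remain small after summation over all legs. The gap between
    [2 / sqrt 3 = 1.1547...] and [1.16] leaves room for a radius [r] slightly smaller than the
    distance to the boundary. *)

Lemma Ck_on_partial n U f i : Ck_on (S n) U f -> Ck_on n U (partial i f).
Proof. intros [_ H]; apply (H i). Qed.

Lemma smooth_partial U f i : smooth_on U f -> smooth_on U (partial i f).
Proof. intros H n; apply Ck_on_partial, H. Qed.

Lemma smooth_continuous U f p : smooth_on U f -> U p -> continuous f p.
Proof. intros H; apply (H O). Qed.

Lemma smooth_ex_partial U f i p : smooth_on U f -> U p -> ex_partial i f p.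
Proof. intros H; destruct (H 1%nat) as [_ H1]; apply (H1 i). Qed.

Lemma locally_slice i (P : R * R -> Prop) p :
  locally p P -> locally (coord i p) (fun t => P (update i p t)).
Proof.
  intros [d Hd]; exists d; intros t Ht; apply Hd.
  destruct p as [x y], i; split; try exact Ht; apply ball_center.
Qed.

Lemma update_coord i p : update i p (coord i p) = p.
Proof. now destruct i, p. Qed.

Lemma partial_ext_on U f g i p :
  open U -> (forall q, U q -> f q = g q) -> U p -> partial i f p = partial i g p.
Proof.
  intros Ho H Hp; apply Derive_ext_loc.
  apply filter_imp with (fun t => U (update i p t)).
  - intros t Ht; now apply H.
  - apply locally_slice, Ho, Hp.
Qed.

Lemma ex_partial_ext_on U f g i p :
  open U -> (forall q, U q -> f q = g q) -> U p -> ex_partial i f p -> ex_partial i g p.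
Proof.
  intros Ho H Hp; apply ex_derive_ext_loc.
  apply filter_imp with (fun t => U (update i p t)).
  - intros t Ht; now apply H.
  - apply locally_slice, Ho, Hp.
Qed.

Lemma continuous_ext_on (U : R * R -> Prop) (f g : R * R -> R) p :
  open U -> (forall q, U q -> f q = g q) -> U p -> continuous f p -> continuous g p.
Proof.
  intros Ho H Hp Hc. apply continuous_ext_loc with f; trivial.
  apply filter_imp with U; [ intros q Hq; try (now apply H); symmetry; now apply H | apply Ho, Hp ].
Qed.

Lemma Ck_ext_on n : forall U f g,
  open U -> (forall q, U q -> f q = g q) -> Ck_on n U f -> Ck_on n U g.
Proof.
  induction n as [|n IH]; intros U f g Ho H [Hc Hd].
  - split; trivial. intros p Hp; now apply (continuous_ext_on U f g p Ho H Hp), Hc.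
  - split. { intros p Hp; now apply (continuous_ext_on U f g p Ho H Hp), Hc. }
    intros i; destruct (Hd i) as [He Hk]; split.
    + intros p Hp; now apply (ex_partial_ext_on U f g i p Ho H Hp), He.
    + apply IH with (partial i f); trivial.
      intros q Hq; now apply partial_ext_on with U.
Qed.

Lemma smooth_ext_on U f g :
  open U -> (forall q, U q -> f q = g q) -> smooth_on U f -> smooth_on U g.
Proof. intros Ho H Hs n; now apply Ck_ext_on with f. Qed.

(** The chain rule along a curve needs joint differentiability, which partial derivatives provide
    when one of them is continuous near the point; smoothness on an open set supplies this. *)
Lemma is_derive_along_path U f x y dx dy t :
  open U -> smooth_on U f -> U (x t, y t) -> is_derive x t dx -> is_derive y t dy ->
  is_derive (fun s => f (x s, y s)) t
    (dx * partial ax1 f (x t, y t) + dy * partial ax2 f (x t, y t)).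
Proof.
  intros Ho Hs HU Hx Hy.
  assert (Hf : filterdiff (fun q : R * R => f (fst q, snd q)) (locally (x t, y t))
    (fun v : R * R => plus (scal (fst v) (partial ax1 f (x t, y t)))
                           (scal (snd v) (partial ax2 f (x t, y t))))).
  { apply (is_derive_filterdiff (fun a b => f (a, b)) (x t) (y t)
             (fun a b => partial ax1 f (a, b))).
    - apply filter_imp with U; [ | now apply Ho ].
      intros [a b] Hq; apply Derive_correct, (smooth_ex_partial U f ax1 (a, b) Hs Hq).
    - apply Derive_correct, (smooth_ex_partial U f ax2 (x t, y t) Hs HU).
    - apply continuous_ext with (partial ax1 f); [ now intros [a b] | ].
      apply smooth_continuous with U; trivial. now apply smooth_partial. }
  assert (E := filterdiff_comp'_2 x y (fun a b => f (a, b)) t _ _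
    (fun a b => plus (scal a (partial ax1 f (x t, y t))) (scal b (partial ax2 f (x t, y t))))
    Hx Hy Hf).
  eapply filterdiff_ext_lin; [ exact E | ].
  intros s; unfold scal, plus; simpl; unfold mult; simpl; ring.
Qed.

Lemma is_derive_partial U f i p :
  smooth_on U f -> U p -> is_derive (fun t => f (update i p t)) (coord i p) (partial i f p).
Proof. intros Hs Hp; apply Derive_correct, (smooth_ex_partial U f i p Hs Hp). Qed.

Lemma is_derive_partial_eq i f p l :
  is_derive (fun t => f (update i p t)) (coord i p) l -> partial i f p = l.
Proof. apply is_derive_unique. Qed.

Lemma continuity_2d_pt_of_continuous (f : R * R -> R) x y :
  continuous f (x, y) -> continuity_2d_pt (fun a b => f (a, b)) x y.
Proof.
  intros H; apply continuity_2d_pt_filterlim.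
  apply filterlim_ext with f; [ now intros [a b] | exact H ].
Qed.

Lemma locally_2d_of_locally (P : R * R -> Prop) x y :
  locally (x, y) P -> locally_2d (fun a b => P (a, b)) x y.
Proof. intros H; apply locally_2d_locally; revert H; now apply filter_imp; intros [a b]. Qed.

Lemma partial_comm U f p :
  open U -> smooth_on U f -> U p ->
  partial ax1 (partial ax2 f) p = partial ax2 (partial ax1 f) p.
Proof.
  intros Ho Hs Hp; destruct p as [x y].
  assert (Hs1 := smooth_partial U f ax1 Hs). assert (Hs2 := smooth_partial U f ax2 Hs).
  unfold partial at 1 3; simpl.
  apply (Schwarz (fun a b => f (a, b)) x y).
  - apply (locally_2d_of_locally (fun q => ex_partial ax1 f q /\ ex_partial ax2 f q /\
       ex_partial ax1 (partial ax2 f) q /\ ex_partial ax2 (partial ax1 f) q)).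
    apply filter_imp with U; [ | now apply Ho ].
    intros q Hq; repeat split; apply smooth_ex_partial with U; trivial.
  - apply (continuity_2d_pt_of_continuous (partial ax1 (partial ax2 f))).
    apply smooth_continuous with U; trivial. now apply smooth_partial.
  - apply (continuity_2d_pt_of_continuous (partial ax2 (partial ax1 f))).
    apply smooth_continuous with U; trivial. now apply smooth_partial.
Qed.

Lemma Ck_on_le n m U f : (m <= n)%nat -> Ck_on n U f -> Ck_on m U f.
Proof.
  revert m f; induction n as [|n IH]; intros m f Hm Hf.
  - now replace m with O by lia.
  - destruct m as [|m]; destruct Hf as [Hc Hd]; split; trivial.
    intros i; destruct (Hd i) as [He Hk]; split; trivial. apply IH; [lia | trivial].
Qed.

(** Turns a closed formula for the partial derivatives into one more order of smoothness; this
    drives the inductions for sums, products, reciprocals and the inverse of the deltoid map. *)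
Lemma Ck_on_S n U f f' :
  open U -> (forall p, U p -> continuous f p) ->
  (forall i p, U p -> is_derive (fun t => f (update i p t)) (coord i p) (f' i p)) ->
  (forall i, Ck_on n U (f' i)) -> Ck_on (S n) U f.
Proof.
  intros Ho Hc Hd Hk; split; trivial. intros i; split.
  - intros p Hp; exists (f' i p); now apply Hd.
  - apply Ck_ext_on with (f' i); trivial.
    intros q Hq; symmetry; now apply is_derive_partial_eq, Hd.
Qed.

Lemma Ck_on_is_derive n U f i p : Ck_on (S n) U f -> U p ->
  is_derive (fun t => f (update i p t)) (coord i p) (partial i f p).
Proof. intros [_ H] Hp; apply Derive_correct, (proj1 (H i)), Hp. Qed.

Lemma Ck_on_continuous n U f p : Ck_on n U f -> U p -> continuous f p.
Proof. destruct n; intros [H _]; apply H. Qed.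

Lemma Ck_on_const n U c : open U -> Ck_on n U (fun _ => c).
Proof.
  intros Ho; revert c; induction n as [|n IH]; intros c.
  - split; trivial. intros p _; apply continuous_const.
  - apply Ck_on_S with (fun _ _ => 0); trivial.
    + intros p _; apply continuous_const.
    + intros i p _; apply (@is_derive_const R_AbsRing R_NormedModule).
Qed.

Lemma Ck_on_plus n U f g :
  open U -> Ck_on n U f -> Ck_on n U g -> Ck_on n U (fun p => f p + g p).
Proof.
  intros Ho; revert f g; induction n as [|n IH]; intros f g Hf Hg.
  - split; trivial. intros p Hp.
    apply (continuous_plus f g p); [apply Hf | apply Hg]; trivial.
  - apply Ck_on_S with (fun i p => partial i f p + partial i g p); trivial.
    + intros p Hp; apply (continuous_plus f g p);
        [apply (Ck_on_continuous _ _ _ _ Hf) | apply (Ck_on_continuous _ _ _ _ Hg)]; trivial.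
    + intros i p Hp; apply (@is_derive_plus R_AbsRing R_NormedModule);
        now apply Ck_on_is_derive with n U.
    + intros i; apply IH; now apply Ck_on_partial.
Qed.

Lemma Ck_on_mult n U f g :
  open U -> Ck_on n U f -> Ck_on n U g -> Ck_on n U (fun p => f p * g p).
Proof.
  intros Ho; revert f g; induction n as [|n IH]; intros f g Hf Hg.
  - split; trivial. intros p Hp.
    apply (continuous_mult f g p); [apply Hf | apply Hg]; trivial.
  - apply Ck_on_S with (fun i p => partial i f p * g p + f p * partial i g p); trivial.
    + intros p Hp; apply (continuous_mult f g p);
        [apply (Ck_on_continuous _ _ _ _ Hf) | apply (Ck_on_continuous _ _ _ _ Hg)]; trivial.
    + intros i p Hp.
      assert (H := is_derive_mult _ _ (coord i p) _ _
        (Ck_on_is_derive n U f i p Hf Hp) (Ck_on_is_derive n U g i p Hg Hp) Rmult_comm).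
      cbv beta in H; rewrite !update_coord in H; exact H.
    + intros i; apply Ck_on_plus; trivial; apply IH;
        first [now apply Ck_on_partial | apply Ck_on_le with (S n); auto].
Qed.

Lemma Ck_on_inv n U f : open U -> (forall p, U p -> f p <> 0) ->
  Ck_on n U f -> Ck_on n U (fun p => / f p).
Proof.
  intros Ho H0.
  assert (Hc : forall m, Ck_on m U f -> forall p, U p -> continuous (fun p => / f p) p).
  { intros m Hf p Hp. apply (continuous_comp f Rinv p).
    - now apply (Ck_on_continuous _ _ _ _ Hf).
    - apply continuity_pt_filterlim, continuity_pt_inv;
        [ apply continuity_pt_id | now apply H0 ]. }
  induction n as [|n IH]; intros Hf.
  - split; trivial. now apply (Hc O).
  (* The derivative is written with products of [/ f] only, so that the induction hypothesis and
     closure under products apply to it. *)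
  - apply Ck_on_S with (fun i p => (- 1) * (partial i f p * (/ f p * / f p))); trivial.
    + now apply (Hc (S n)).
    + intros i p Hp.
      assert (H := is_derive_inv _ (coord i p) _ (Ck_on_is_derive n U f i p Hf Hp)).
      cbv beta in H; rewrite !update_coord in H.
      replace (-1 * _) with (- partial i f p / f p ^ 2); [ now apply H, H0 | ].
      field; now apply H0.
    + intros i; apply Ck_on_mult; trivial; [ now apply Ck_on_const | ].
      assert (Hi : Ck_on n U (fun p => / f p)) by (apply IH, Ck_on_le with (S n); auto).
      apply Ck_on_mult; trivial; [ now apply Ck_on_partial | now apply Ck_on_mult ].
Qed.

Lemma smooth_const U c : open U -> smooth_on U (fun _ => c).
Proof. intros Ho n; now apply Ck_on_const. Qed.

Lemma smooth_plus U f g :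
  open U -> smooth_on U f -> smooth_on U g -> smooth_on U (fun p => f p + g p).
Proof. intros Ho Hf Hg n; now apply Ck_on_plus. Qed.

Lemma smooth_mult U f g :
  open U -> smooth_on U f -> smooth_on U g -> smooth_on U (fun p => f p * g p).
Proof. intros Ho Hf Hg n; now apply Ck_on_mult. Qed.

Lemma smooth_inv U f : open U -> (forall p, U p -> f p <> 0) ->
  smooth_on U f -> smooth_on U (fun p => / f p).
Proof. intros Ho H0 Hf n; now apply Ck_on_inv. Qed.

Lemma smooth_opp U f : open U -> smooth_on U f -> smooth_on U (fun p => - f p).
Proof.
  intros Ho Hf; apply smooth_ext_on with (fun p => -1 * f p); trivial.
  - intros; ring.
  - apply smooth_mult; trivial. now apply smooth_const.
Qed.

Lemma smooth_minus U f g :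
  open U -> smooth_on U f -> smooth_on U g -> smooth_on U (fun p => f p - g p).
Proof. intros Ho Hf Hg; apply smooth_plus; trivial. now apply smooth_opp. Qed.

Lemma smooth_pow U f n : open U -> smooth_on U f -> smooth_on U (fun p => f p ^ n).
Proof.
  intros Ho Hf; induction n as [|n IH]; simpl.
  - now apply smooth_const.
  - now apply smooth_mult.
Qed.

Lemma smooth_div U f g : open U -> (forall p, U p -> g p <> 0) ->
  smooth_on U f -> smooth_on U g -> smooth_on U (fun p => f p / g p).
Proof. intros Ho H0 Hf Hg; apply smooth_mult; trivial. now apply smooth_inv. Qed.

(** * Curvature of a Hessian metric of determinant 1 *)

Record monge_ampere (U : R * R -> Prop) (u : R * R -> R) : Prop := {
  ma_open : open U;
  ma_smooth : smooth_on U u;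
  ma_pos : forall p, U p -> pos_def (Hess u p);
  ma_det : forall p, U p -> det2 (Hess u p) = 1 }.

Definition h11 (u : R * R -> R) : R * R -> R := partial ax1 (partial ax1 u).
Definition h12 (u : R * R -> R) : R * R -> R := partial ax1 (partial ax2 u).
Definition h22 (u : R * R -> R) : R * R -> R := partial ax2 (partial ax2 u).

(** Both orders of mixed indices give the same function, so that the symmetry of the Hessian holds
    by computation once [Hess_hs] has been applied. *)
Definition hs (i j : axis) : (R * R -> R) -> R * R -> R :=
  match i, j with ax1, ax1 => h11 | ax2, ax2 => h22 | _, _ => h12 end.

Section MongeAmpere.
Variables (U : R * R -> Prop) (u : R * R -> R).
Hypothesis MA : monge_ampere U u.

Let Ho := ma_open _ _ MA.
Let Hs := ma_smooth _ _ MA.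

Lemma Hess_hs p i j : U p -> Hess u p i j = hs i j u p.
Proof.
  intros Hp; destruct i, j; try reflexivity.
  unfold Hess; simpl; unfold h12; symmetry; now apply (partial_comm U).
Qed.

Lemma smooth_hs i j : smooth_on U (hs i j u).
Proof. destruct i, j; simpl; repeat apply smooth_partial; exact Hs. Qed.

Lemma h_det p : U p -> h11 u p * h22 u p - h12 u p * h12 u p = 1.
Proof.
  intros Hp; rewrite <- (ma_det _ _ MA p Hp); unfold det2.
  now rewrite !Hess_hs.
Qed.

Lemma h11_pos p : U p -> 0 < h11 u p.
Proof.
  intros Hp; destruct (ma_pos _ _ MA p Hp) as [_ H].
  specialize (H (1, 0)); unfold bilin, sum2 in H; simpl in H.
  change (Hess u p ax1 ax1) with (h11 u p) in H.
  match type of H with _ -> 0 < ?X => replace X with (h11 u p) in H by ring end.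
  apply H; intros E; injection E; lra.
Qed.

Lemma h22_eq p : U p -> h22 u p = (1 + h12 u p ^ 2) / h11 u p.
Proof. intros Hp; assert (H := h_det p Hp); assert (H1 := h11_pos p Hp); field_simplify_eq; lra. Qed.

Lemma h22_pos p : U p -> 0 < h22 u p.
Proof.
  intros Hp; rewrite h22_eq by trivial; assert (H1 := h11_pos p Hp).
  apply Rdiv_lt_0_compat; nra.
Qed.

Lemma d2_h11 p : U p -> partial ax2 (h11 u) p = partial ax1 (h12 u) p.
Proof.
  intros Hp; unfold h11.
  rewrite <- (partial_comm U); trivial; [ | now apply smooth_partial ].
  apply partial_ext_on with U; trivial. intros q Hq; exact (Hess_hs q ax2 ax1 Hq).
Qed.

Lemma d2_h12 p : U p -> partial ax2 (h12 u) p = partial ax1 (h22 u) p.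
Proof.
  intros Hp; unfold h12.
  rewrite <- (partial_comm U); trivial; now apply smooth_partial.
Qed.

End MongeAmpere.

(* [exact] matches [Derive f x] with [is_derive f x l] up to eta. *)
Ltac rewrite_derivatives :=
  repeat match goal with
  | H : is_derive _ ?x ?l |- context [Derive ?g ?x] =>
      replace (Derive g x) with l by (symmetry; exact (is_derive_unique _ _ _ H))
  end.

Lemma is_derive_det (A B G : R -> R) x a b g :
  is_derive A x a -> is_derive B x b -> is_derive G x g ->
  is_derive (fun t => A t * G t - B t * B t) x (a * G x + A x * g - 2 * B x * b).
Proof.
  intros HA HB HG; auto_derive; [ repeat split; eexists; eassumption | ].
  rewrite_derivatives.
  ring.
Qed.

(** * Higher derivatives of a potential whose Hessian has determinant 1 *)

Definition t111 (u : R * R -> R) : R * R -> R := partial ax1 (h11 u).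
Definition t112 (u : R * R -> R) : R * R -> R := partial ax2 (h11 u).
Definition t122 (u : R * R -> R) : R * R -> R := partial ax2 (h12 u).
Definition t222 (u : R * R -> R) : R * R -> R := partial ax2 (h22 u).

(** One representative for each multi-index: the total symmetry of the third derivatives becomes
    definitional, and Schwarz's theorem enters through [partial_hs]. *)
Definition ts (i j k : axis) : (R * R -> R) -> R * R -> R :=
  match i, j, k with
  | ax1, ax1, ax1 => t111
  | ax1, ax1, ax2 | ax1, ax2, ax1 | ax2, ax1, ax1 => t112
  | ax2, ax2, ax1 | ax2, ax1, ax2 | ax1, ax2, ax2 => t122
  | ax2, ax2, ax2 => t222
  end.

Section Jets.
Variables (U : R * R -> Prop) (u : R * R -> R).
Hypothesis MA : monge_ampere U u.

Let Ho := ma_open _ _ MA.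

Lemma smooth_ts i j k : smooth_on U (ts i j k u).
Proof.
  destruct i, j, k; simpl; apply smooth_partial;
    first [exact (smooth_hs U u MA ax1 ax1) | exact (smooth_hs U u MA ax1 ax2)
          | exact (smooth_hs U u MA ax2 ax2)].
Qed.

Lemma partial_hs i j k p : U p -> partial i (hs j k u) p = ts i j k u p.
Proof.
  intros Hp; destruct i, j, k; simpl; try reflexivity.
  - symmetry; now apply (d2_h11 U).
  - symmetry; now apply (d2_h11 U).
  - symmetry; now apply (d2_h12 U).
Qed.

Lemma is_derive_constant_on (f : R * R -> R) i p (c l : R) : U p -> (forall q, U q -> f q = c) ->
  is_derive (fun t => f (update i p t)) (coord i p) l -> l = 0.
Proof.
  intros Hp Hf Hl. rewrite <- (is_derive_unique _ _ _ Hl).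
  change (partial i f p = 0). rewrite (partial_ext_on U f (fun _ => c)); trivial.
  apply is_derive_partial_eq, (@is_derive_const R_AbsRing R_NormedModule).
Qed.

Lemma is_derive_hs i j k p : U p ->
  is_derive (fun t => hs j k u (update i p t)) (coord i p) (ts i j k u p).
Proof. intros Hp; rewrite <- partial_hs by trivial. apply (is_derive_partial U); trivial. now apply smooth_hs. Qed.

(** The derivative of [log det] is a trace against the inverse matrix, and the inverse of a matrix
    of determinant 1 is its adjugate. So the [Hess u]-trace of the third derivatives vanishes. *)
Lemma det_derivative i p : U p ->
  ts i ax1 ax1 u p * h22 u p + h11 u p * ts i ax2 ax2 u p
  - 2 * h12 u p * ts i ax1 ax2 u p = 0.
Proof.
  intros Hp.
  apply (is_derive_constant_on (fun q => h11 u q * h22 u q - h12 u q * h12 u q) i p 1); trivial.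
  - intros q Hq; now apply (h_det U).
  - assert (H := is_derive_det _ _ _ _ _ _ _ (is_derive_hs i ax1 ax1 p Hp) (is_derive_hs i ax1 ax2 p Hp) (is_derive_hs i ax2 ax2 p Hp)).
    cbv beta in H; rewrite !update_coord in H; exact H.
Qed.

(** The differentiated determinant equation is solved for the derivative with the most indices
    [ax2]. In this way all jets are reduced to derivatives with at most one such index, which serve
    as free variables. *)
Lemma t122_eq p : U p ->
  t122 u p = (2 * h12 u p * t112 u p - t111 u p * h22 u p) / h11 u p.
Proof.
  intros Hp; assert (H := det_derivative ax1 p Hp); simpl in H.
  assert (H1 := h11_pos U u MA p Hp). field_simplify_eq; lra.
Qed.

Lemma t222_eq p : U p ->
  t222 u p = (2 * h12 u p * t122 u p - t112 u p * h22 u p) / h11 u p.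
Proof.
  intros Hp; assert (H := det_derivative ax2 p Hp); simpl in H.
  assert (H1 := h11_pos U u MA p Hp). field_simplify_eq; lra.
Qed.

Definition q1111 (p : R * R) : R := partial ax1 (t111 u) p.
Definition q1112 (p : R * R) : R := partial ax1 (t112 u) p.
Definition q1122 (p : R * R) : R := partial ax2 (t112 u) p.
Definition q1222 (p : R * R) : R := partial ax2 (t122 u) p.

Lemma d2_t111 p : U p -> partial ax2 (t111 u) p = q1112 p.
Proof.
  intros Hp; unfold t111, q1112, t112; symmetry; apply (partial_comm U); trivial.
  exact (smooth_hs U u MA ax1 ax1).
Qed.

Lemma d1_t122 p : U p -> partial ax1 (t122 u) p = q1122 p.
Proof.
  intros Hp; unfold t122, q1122.
  rewrite (partial_comm U); trivial; [ | exact (smooth_hs U u MA ax1 ax2) ].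
  apply partial_ext_on with U; trivial. intros q Hq. exact (partial_hs ax1 ax1 ax2 q Hq).
Qed.

Lemma d1_t222 p : U p -> partial ax1 (t222 u) p = q1222 p.
Proof.
  intros Hp; unfold t222, q1222.
  rewrite (partial_comm U); trivial; [ | exact (smooth_hs U u MA ax2 ax2) ].
  apply partial_ext_on with U; trivial. intros q Hq. exact (partial_hs ax1 ax2 ax2 q Hq).
Qed.

Lemma is_derive_ts i j k l p : U p ->
  is_derive (fun t => ts j k l u (update i p t)) (coord i p) (partial i (ts j k l u) p).
Proof. intros Hp; apply (is_derive_partial U); trivial. now apply smooth_ts. Qed.

Lemma is_derive_det2 (A B G A' B' G' : R -> R) x a b g a' b' g' :
  is_derive A x a -> is_derive B x b -> is_derive G x g ->
  is_derive A' x a' -> is_derive B' x b' -> is_derive G' x g' ->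
  is_derive (fun t => A' t * G t + A t * G' t - 2 * B t * B' t) x
    (a' * G x + A' x * g + a * G' x + A x * g' - 2 * b * B' x - 2 * B x * b').
Proof.
  intros HA HB HG HA' HB' HG'; auto_derive; [ repeat split; eexists; eassumption | ].
  rewrite_derivatives.
  ring.
Qed.

Lemma det_derivative2 i j p : U p ->
  partial i (ts j ax1 ax1 u) p * h22 u p + ts j ax1 ax1 u p * ts i ax2 ax2 u p
  + ts i ax1 ax1 u p * ts j ax2 ax2 u p + h11 u p * partial i (ts j ax2 ax2 u) p
  - 2 * ts i ax1 ax2 u p * ts j ax1 ax2 u p
  - 2 * h12 u p * partial i (ts j ax1 ax2 u) p = 0.
Proof.
  intros Hp.
  apply (is_derive_constant_on (fun q => ts j ax1 ax1 u q * h22 u q + h11 u q * ts j ax2 ax2 u q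
    - 2 * h12 u q * ts j ax1 ax2 u q) i p 0); trivial.
  - intros q Hq; now apply det_derivative.
  - assert (H := is_derive_det2 _ _ _ _ _ _ _ _ _ _ _ _ _
      (is_derive_hs i ax1 ax1 p Hp) (is_derive_hs i ax1 ax2 p Hp) (is_derive_hs i ax2 ax2 p Hp)
      (is_derive_ts i j ax1 ax1 p Hp) (is_derive_ts i j ax1 ax2 p Hp) (is_derive_ts i j ax2 ax2 p Hp)).
    cbv beta in H; rewrite !update_coord in H; exact H.
Qed.

Lemma q1122_eq p : U p ->
  q1122 p = - (q1111 p * h22 u p + 2 * t111 u p * t122 u p - 2 * t112 u p * t112 u p
     - 2 * h12 u p * q1112 p) / h11 u p.
Proof.
  intros Hp; assert (H := det_derivative2 ax1 ax1 p Hp); simpl in H.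
  rewrite d1_t122 in H by trivial. fold (q1111 p) (q1112 p) in H.
  assert (H1 := h11_pos U u MA p Hp). field_simplify_eq; [ | lra]. lra.
Qed.

Lemma q1222_eq p : U p ->
  q1222 p = - (q1112 p * h22 u p + t112 u p * t122 u p + t111 u p * t222 u p
     - 2 * t122 u p * t112 u p - 2 * h12 u p * q1122 p) / h11 u p.
Proof.
  intros Hp; assert (H := det_derivative2 ax1 ax2 p Hp); simpl in H.
  rewrite d1_t222, d1_t122 in H by trivial. fold (q1112 p) in H.
  assert (H1 := h11_pos U u MA p Hp). field_simplify_eq; [ | lra]. lra.
Qed.
End Jets.

(* The Gauss curvature in terms of [h11], [h12] and the derivatives of [h11];
   the other derivatives are eliminated by means of [det = 1]. *)
Definition curvature_expr (a b a1 a2 : R) : R :=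
  (a1 ^ 2 + (a * a2 - b * a1) ^ 2) / (2 * a ^ 3).

Definition curvature (u : R * R -> R) (p : R * R) : R :=
  curvature_expr (h11 u p) (h12 u p) (t111 u p) (t112 u p).

Definition inv_hs (k l : axis) (u : R * R -> R) (p : R * R) : R :=
  match k, l with
  | ax1, ax1 => h22 u p | ax2, ax2 => h11 u p | _, _ => - h12 u p end.

Section Ricci.
Variables (U : R * R -> Prop) (u : R * R -> R).
Hypothesis MA : monge_ampere U u.

Let Ho := ma_open _ _ MA.

Lemma inv2_Hess k l p : U p -> inv2 (Hess u p) k l = inv_hs k l u p.
Proof.
  intros Hp; unfold inv2; rewrite (ma_det _ _ MA p Hp).
  destruct k, l; rewrite !(Hess_hs U u MA) by trivial; simpl; field.
Qed.

Lemma partial_Hess i j k p : U p -> partial i (fun q => Hess u q j k) p = ts i j k u p.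
Proof.
  intros Hp; rewrite <- (partial_hs U u MA) by trivial.
  apply partial_ext_on with U; trivial. intros q Hq; now apply (Hess_hs U u MA).
Qed.

(** For a Hessian metric the three derivatives in a Christoffel symbol are the same third derivative
    of [u], and two of them cancel. *)
Definition chr (k i j : axis) (p : R * R) : R :=
  / 2 * (inv_hs k ax1 u p * ts i j ax1 u p + inv_hs k ax2 u p * ts i j ax2 u p).

Lemma christoffel_eq p k i j : U p -> christoffel (Hess u) p k i j = chr k i j p.
Proof.
  intros Hp; unfold christoffel, chr, sum2.
  rewrite !inv2_Hess by trivial. rewrite !partial_Hess by trivial.
  destruct k, i, j; simpl; ring.
Qed.

Lemma is_derive_half (A B C D : R -> R) x a b c d s :
  is_derive A x a -> is_derive B x b -> is_derive C x c -> is_derive D x d ->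
  is_derive (fun t => / 2 * (A t * C t + s * B t * D t)) x
    (/ 2 * (a * C x + A x * c + s * b * D x + s * B x * d)).
Proof.
  intros HA HB HC HD; auto_derive; [ repeat split; eexists; eassumption | ].
  rewrite_derivatives.
  ring.
Qed.

Definition inv_ts (m k l : axis) (p : R * R) : R :=
  match k, l with
  | ax1, ax1 => ts m ax2 ax2 u p | ax2, ax2 => ts m ax1 ax1 u p
  | _, _ => - ts m ax1 ax2 u p end.

Lemma is_derive_inv_hs m k l p : U p ->
  is_derive (fun t => inv_hs k l u (update m p t)) (coord m p) (inv_ts m k l p).
Proof.
  intros Hp; destruct k, l; simpl.
  - exact (is_derive_hs U u MA m ax2 ax2 p Hp).
  - exact (is_derive_opp _ _ _ (is_derive_hs U u MA m ax1 ax2 p Hp)).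
  - exact (is_derive_opp _ _ _ (is_derive_hs U u MA m ax1 ax2 p Hp)).
  - exact (is_derive_hs U u MA m ax1 ax1 p Hp).
Qed.

Lemma partial_christoffel m k i j p : U p ->
  partial m (fun q => christoffel (Hess u) q k i j) p =
  / 2 * (inv_ts m k ax1 p * ts i j ax1 u p + inv_hs k ax1 u p * partial m (ts i j ax1 u) p
       + inv_ts m k ax2 p * ts i j ax2 u p + inv_hs k ax2 u p * partial m (ts i j ax2 u) p).
Proof.
  intros Hp. rewrite (partial_ext_on U _ (chr k i j)); trivial;
    [ | now intros; apply christoffel_eq ].
  apply is_derive_partial_eq.
  assert (H := is_derive_half _ _ _ _ _ _ _ _ _ 1
    (is_derive_inv_hs m k ax1 p Hp) (is_derive_inv_hs m k ax2 p Hp)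
    (is_derive_ts U u MA m i j ax1 p Hp) (is_derive_ts U u MA m i j ax2 p Hp)).
  cbv beta in H; rewrite !update_coord in H. unfold chr.
  eapply is_derive_ext; [ | replace (/ 2 * _) with (/ 2 *
      (inv_ts m k ax1 p * ts i j ax1 u p + inv_hs k ax1 u p * partial m (ts i j ax1 u) p +
       1 * inv_ts m k ax2 p * ts i j ax2 u p +
       1 * inv_hs k ax2 u p * partial m (ts i j ax2 u) p)) by ring; exact H ].
  intros t; simpl; ring.
Qed.

(** In dimension two the Ricci tensor is the Gauss curvature times the metric. The fourth
    derivatives cancel once everything is expressed by the free jets, so that the curvature involves
    derivatives of [u] up to order three. *)
Lemma Ric_eq p j k : U p ->
  Ric (Hess u) p j k = curvature u p * hs j k u p.
Proof.
  intros Hp; unfold Ric, sum2, riemann, sum2.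
  rewrite !partial_christoffel, !christoffel_eq by trivial.
  unfold chr, curvature, curvature_expr.
  assert (H1 := h11_pos U u MA p Hp).
  destruct j, k; simpl;
  rewrite ?(d1_t122 U u MA), ?(d1_t222 U u MA), ?(d2_t111 U u MA) by trivial;
  fold (q1111 u p) (q1112 u p) (q1122 u p) (q1222 u p);
  rewrite ?(q1122_eq U u MA), ?(t222_eq U u MA), ?(t122_eq U u MA), ?(h22_eq U u MA) by trivial;
  field; lra.
Qed.

Lemma Ric_bilin p v : U p ->
  bilin (Ric (Hess u) p) v v = curvature u p * bilin (Hess u p) v v.
Proof.
  intros Hp; unfold bilin, sum2; rewrite !Ric_eq, !(Hess_hs U u MA) by trivial.
  simpl; ring.
Qed.

Lemma curvature_nonneg p : U p -> 0 <= curvature u p.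
Proof.
  intros Hp; assert (H1 := h11_pos U u MA p Hp); unfold curvature, curvature_expr.
  apply Rmult_le_pos; [ apply Rplus_le_le_0_compat; apply pow2_ge_0 | ].
  apply Rlt_le, Rinv_0_lt_compat; assert (H := pow_lt _ 3 H1); lra.
Qed.
End Ricci.

(** * The differential equation for the curvature *)

Definition curvature_expr_d (a b c d a' b' c' d' : R) : R :=
  (2 * c * c' + 2 * (a * d - b * c) * (a' * d + a * d' - b' * c - b * c')) / (2 * a ^ 3)
  - 3 * a' * (c ^ 2 + (a * d - b * c) ^ 2) / (2 * a ^ 4).

Lemma is_derive_curvature_expr (A B C D : R -> R) x a b c d :
  A x <> 0 ->
  is_derive A x a -> is_derive B x b -> is_derive C x c -> is_derive D x d ->
  is_derive (fun t => curvature_expr (A t) (B t) (C t) (D t)) x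
    (curvature_expr_d (A x) (B x) (C x) (D x) a b c d).
Proof.
  intros H0 HA HB HC HD; unfold curvature_expr; auto_derive.
  - repeat split; try (eexists; eassumption).
    repeat apply Rmult_integral_contrapositive_currified; trivial; lra.
  - rewrite_derivatives.
    unfold curvature_expr_d; field; trivial.
Qed.

(** The second derivative of [curvature_expr] along two directions marked 1 and 2; the arguments
    marked 12 are mixed second derivatives, and [m] is the term [a d - b c] that is squared in the
    numerator. *)
Definition curvature_expr_dd (a b c d a1 b1 c1 d1 a2 b2 c2 d2 a12 b12 c12 d12 : R) : R :=
  let m := a * d - b * c in
  let m1 := a1 * d + a * d1 - b1 * c - b * c1 in
  let m2 := a2 * d + a * d2 - b2 * c - b * c2 in
  let m12 := a12 * d + a1 * d2 + a2 * d1 + a * d12 - b12 * c - b1 * c2 - b2 * c1 - b * c12 in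
  (2 * c2 * c1 + 2 * c * c12 + 2 * m2 * m1 + 2 * m * m12) / (2 * a ^ 3)
  - 3 * a2 * (2 * c * c1 + 2 * m * m1) / (2 * a ^ 4)
  - 3 * a1 * (2 * c * c2 + 2 * m * m2) / (2 * a ^ 4)
  - 3 * a12 * (c ^ 2 + m ^ 2) / (2 * a ^ 4)
  + 12 * a1 * a2 * (c ^ 2 + m ^ 2) / (2 * a ^ 5).

Lemma is_derive_curvature_expr_d (A B C D A1 B1 C1 D1 : R -> R) x
    a b c d a1 b1 c1 d1 :
  A x <> 0 ->
  is_derive A x a -> is_derive B x b -> is_derive C x c -> is_derive D x d ->
  is_derive A1 x a1 -> is_derive B1 x b1 -> is_derive C1 x c1 -> is_derive D1 x d1 ->
  is_derive (fun t => curvature_expr_d (A t) (B t) (C t) (D t) (A1 t) (B1 t) (C1 t) (D1 t)) x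
    (curvature_expr_dd (A x) (B x) (C x) (D x) (A1 x) (B1 x) (C1 x) (D1 x)
       a b c d a1 b1 c1 d1).
Proof.
  intros H0 HA HB HC HD HA1 HB1 HC1 HD1; unfold curvature_expr_d; auto_derive.
  - repeat split; try (eexists; eassumption);
    repeat apply Rmult_integral_contrapositive_currified; trivial; lra.
  - rewrite_derivatives.
    unfold curvature_expr_dd; cbv zeta; field; trivial.
Qed.

Lemma curvature_algebra a b a1 a2 a11 a12 a111 a112 : 0 < a ->
  let g := (1 + b ^ 2) / a in
  let b2 := (2 * b * a2 - a1 * g) / a in
  let g2 := (2 * b * b2 - a2 * g) / a in
  let a22 := - (a11 * g + 2 * a1 * b2 - 2 * a2 * a2 - 2 * b * a12) / a in
  let b22 := - (a12 * g + a2 * b2 + a1 * g2 - 2 * b2 * a2 - 2 * b * a22) / a in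
  let a122 := - (a111 * g + 3 * a11 * b2 + 3 * a1 * a22 - 6 * a2 * a12 - 2 * b * a112) / a in
  let a222 := - (a112 * g + 2 * a12 * b2 + 2 * a1 * b22 - 3 * a2 * a22 + a11 * g2
                 - 2 * b2 * a12 - 2 * b * a122) / a in
  let k := curvature_expr a b a1 a2 in
  let k1 := curvature_expr_d a b a1 a2 a1 a2 a11 a12 in
  let k2 := curvature_expr_d a b a1 a2 a2 b2 a12 a22 in
  let k11 := curvature_expr_dd a b a1 a2 a1 a2 a11 a12 a1 a2 a11 a12 a11 a12 a111 a112 in
  let k12 := curvature_expr_dd a b a1 a2 a2 b2 a12 a22 a1 a2 a11 a12 a12 a22 a112 a122 in
  let k22 := curvature_expr_dd a b a1 a2 a2 b2 a12 a22 a2 b2 a12 a22 a22 b22 a122 a222 in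
  k * (g * k11 - 2 * b * k12 + a * k22) - (g * k1 ^ 2 - 2 * b * k1 * k2 + a * k2 ^ 2)
  = 6 * k ^ 3.
Proof.
  intros Ha; cbv zeta; unfold curvature_expr, curvature_expr_d, curvature_expr_dd; cbv zeta.
  field; lra.
Qed.

Section CurvaturePDE.
Variables (U : R * R -> Prop) (u : R * R -> R).
Hypothesis MA : monge_ampere U u.

Let Ho := ma_open _ _ MA.

Lemma smooth_q1111 : smooth_on U (q1111 u).
Proof. apply (smooth_partial U _ ax1), (smooth_ts U u MA ax1 ax1 ax1). Qed.
Lemma smooth_q1112 : smooth_on U (q1112 u).
Proof. apply (smooth_partial U _ ax1), (smooth_ts U u MA ax1 ax1 ax2). Qed.
Lemma smooth_q1122 : smooth_on U (q1122 u).
Proof. apply (smooth_partial U _ ax2), (smooth_ts U u MA ax1 ax1 ax2). Qed.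

Lemma d2_q1111 p : U p -> partial ax2 (q1111 u) p = partial ax1 (q1112 u) p.
Proof.
  intros Hp; unfold q1111.
  rewrite <- (partial_comm U (t111 u)); trivial; [ | exact (smooth_ts U u MA ax1 ax1 ax1) ].
  apply partial_ext_on with U; trivial. intros q Hq; now apply (d2_t111 U).
Qed.

Lemma d2_q1112 p : U p -> partial ax2 (q1112 u) p = partial ax1 (q1122 u) p.
Proof.
  intros Hp; unfold q1112, q1122.
  symmetry; apply (partial_comm U); trivial. exact (smooth_ts U u MA ax1 ax1 ax2).
Qed.

Lemma is_derive_det3 (A B G T1 T2 T3 Q1 Q2 Q3 : R -> R) x a b g t1 t2 t3 r1 r2 r3 :
  is_derive A x a -> is_derive B x b -> is_derive G x g ->
  is_derive T1 x t1 -> is_derive T2 x t2 -> is_derive T3 x t3 ->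
  is_derive Q1 x r1 -> is_derive Q2 x r2 -> is_derive Q3 x r3 ->
  is_derive (fun t => Q1 t * G t + 2 * T1 t * T3 t + A t * Q3 t - 2 * T2 t * T2 t
                      - 2 * B t * Q2 t) x
    (r1 * G x + Q1 x * g + 2 * t1 * T3 x + 2 * T1 x * t3 + a * Q3 x + A x * r3
     - 4 * T2 x * t2 - 2 * b * Q2 x - 2 * B x * r2).
Proof.
  intros HA HB HG H1 H2 H3 HQ1 HQ2 HQ3; auto_derive; [ repeat split; eexists; eassumption | ].
  rewrite_derivatives.
  ring.
Qed.

(** It suffices to differentiate the second derivative of [det] along [ax1] once more: the two
    choices of [i] yield both derivatives of order five that have to be eliminated. *)
Lemma det_derivative3 i p : U p ->
  partial i (q1111 u) p * h22 u p + q1111 u p * ts i ax2 ax2 u p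
  + 2 * partial i (t111 u) p * t122 u p + 2 * t111 u p * partial i (t122 u) p
  + ts i ax1 ax1 u p * q1122 u p + h11 u p * partial i (q1122 u) p
  - 4 * t112 u p * partial i (t112 u) p - 2 * ts i ax1 ax2 u p * q1112 u p
  - 2 * h12 u p * partial i (q1112 u) p = 0.
Proof.
  intros Hp.
  apply (is_derive_constant_on U u MA (fun q => q1111 u q * h22 u q + 2 * t111 u q * t122 u q
    + h11 u q * q1122 u q - 2 * t112 u q * t112 u q - 2 * h12 u q * q1112 u q) i p 0); trivial.
  - intros q Hq; rewrite (q1122_eq U u MA q Hq).
    assert (H1 := h11_pos U u MA q Hq); field; lra.
  - assert (H := is_derive_det3 _ _ _ _ _ _ _ _ _ _ _ _ _ _ _ _ _ _ _
      (is_derive_hs U u MA i ax1 ax1 p Hp) (is_derive_hs U u MA i ax1 ax2 p Hp) (is_derive_hs U u MA i ax2 ax2 p Hp)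
      (is_derive_ts U u MA i ax1 ax1 ax1 p Hp) (is_derive_ts U u MA i ax1 ax1 ax2 p Hp) (is_derive_ts U u MA i ax1 ax2 ax2 p Hp)
      (is_derive_partial U _ i p smooth_q1111 Hp) (is_derive_partial U _ i p smooth_q1112 Hp)
      (is_derive_partial U _ i p smooth_q1122 Hp)).
    cbv beta in H; rewrite !update_coord in H; exact H.
Qed.

Lemma d1_q1122_eq p : U p -> partial ax1 (q1122 u) p =
  - (partial ax1 (q1111 u) p * h22 u p + 3 * q1111 u p * t122 u p + 3 * t111 u p * q1122 u p
     - 6 * t112 u p * q1112 u p - 2 * h12 u p * partial ax1 (q1112 u) p) / h11 u p.
Proof.
  intros Hp; assert (H := det_derivative3 ax1 p Hp); simpl in H.
  rewrite (d1_t122 U u MA p Hp) in H. fold (q1111 u p) (q1112 u p) in H.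
  assert (H1 := h11_pos U u MA p Hp). field_simplify_eq; [ | lra]. lra.
Qed.

Lemma d2_q1122_eq p : U p -> partial ax2 (q1122 u) p =
  - (partial ax1 (q1112 u) p * h22 u p + 2 * q1112 u p * t122 u p + 2 * t111 u p * q1222 u p
     - 3 * t112 u p * q1122 u p + q1111 u p * t222 u p - 2 * t122 u p * q1112 u p
     - 2 * h12 u p * partial ax1 (q1122 u) p) / h11 u p.
Proof.
  intros Hp; assert (H := det_derivative3 ax2 p Hp); simpl in H.
  rewrite (d2_q1111 p Hp), (d2_q1112 p Hp), (d2_t111 U u MA p Hp) in H.
  fold (q1122 u p) (q1222 u p) in H.
  assert (H1 := h11_pos U u MA p Hp). field_simplify_eq; [ | lra]. lra.
Qed.

Lemma is_derive_curvature i p : U p -> is_derive (fun t => curvature u (update i p t)) (coord i p)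
  (curvature_expr_d (h11 u p) (h12 u p) (t111 u p) (t112 u p)
     (ts i ax1 ax1 u p) (ts i ax1 ax2 u p) (partial i (t111 u) p) (partial i (t112 u) p)).
Proof.
  intros Hp.
  assert (H := is_derive_curvature_expr
    (fun t => h11 u (update i p t)) (fun t => h12 u (update i p t))
    (fun t => t111 u (update i p t)) (fun t => t112 u (update i p t)) (coord i p) (ts i ax1 ax1 u p)
    (ts i ax1 ax2 u p) (partial i (t111 u) p) (partial i (t112 u) p)).
  cbv beta in H; rewrite !update_coord in H.
  apply H.
  - assert (H1 := h11_pos U u MA p Hp); lra.
  - exact (is_derive_hs U u MA i ax1 ax1 p Hp).
  - exact (is_derive_hs U u MA i ax1 ax2 p Hp).
  - exact (is_derive_ts U u MA i ax1 ax1 ax1 p Hp).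
  - exact (is_derive_ts U u MA i ax1 ax1 ax2 p Hp).
Qed.

Lemma partial_curvature i p : U p -> partial i (curvature u) p =
  curvature_expr_d (h11 u p) (h12 u p) (t111 u p) (t112 u p)
     (ts i ax1 ax1 u p) (ts i ax1 ax2 u p) (partial i (t111 u) p) (partial i (t112 u) p).
Proof. intros Hp; now apply is_derive_partial_eq, is_derive_curvature. Qed.

Lemma partial2_curvature j i p : U p -> partial j (partial i (curvature u)) p =
  curvature_expr_dd (h11 u p) (h12 u p) (t111 u p) (t112 u p)
     (ts i ax1 ax1 u p) (ts i ax1 ax2 u p) (partial i (t111 u) p) (partial i (t112 u) p)
     (ts j ax1 ax1 u p) (ts j ax1 ax2 u p) (partial j (t111 u) p) (partial j (t112 u) p)
     (partial j (ts i ax1 ax1 u) p) (partial j (ts i ax1 ax2 u) p)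
     (partial j (partial i (t111 u)) p) (partial j (partial i (t112 u)) p).
Proof.
  intros Hp.
  rewrite (partial_ext_on U _ _ j p Ho (partial_curvature i) Hp).
  apply is_derive_partial_eq.
  assert (H := is_derive_curvature_expr_d
    (fun t => h11 u (update j p t)) (fun t => h12 u (update j p t))
    (fun t => t111 u (update j p t)) (fun t => t112 u (update j p t))
    (fun t => ts i ax1 ax1 u (update j p t)) (fun t => ts i ax1 ax2 u (update j p t))
    (fun t => partial i (t111 u) (update j p t)) (fun t => partial i (t112 u) (update j p t))
    (coord j p) (ts j ax1 ax1 u p)
    (ts j ax1 ax2 u p) (partial j (t111 u) p) (partial j (t112 u) p)
    (partial j (ts i ax1 ax1 u) p) (partial j (ts i ax1 ax2 u) p)
    (partial j (partial i (t111 u)) p) (partial j (partial i (t112 u)) p)).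
  cbv beta in H; rewrite !update_coord in H.
  apply H; clear H.
  - assert (H1 := h11_pos U u MA p Hp); lra.
  - exact (is_derive_hs U u MA j ax1 ax1 p Hp).
  - exact (is_derive_hs U u MA j ax1 ax2 p Hp).
  - exact (is_derive_ts U u MA j ax1 ax1 ax1 p Hp).
  - exact (is_derive_ts U u MA j ax1 ax1 ax2 p Hp).
  - exact (is_derive_ts U u MA j i ax1 ax1 p Hp).
  - exact (is_derive_ts U u MA j i ax1 ax2 p Hp).
  - apply (is_derive_partial U); trivial.
    apply smooth_partial; exact (smooth_ts U u MA ax1 ax1 ax1).
  - apply (is_derive_partial U); trivial.
    apply smooth_partial; exact (smooth_ts U u MA ax1 ax1 ax2).
Qed.

Lemma smooth_curvature : smooth_on U (curvature u).
Proof.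
  assert (S1 := smooth_hs U u MA ax1 ax1). assert (S2 := smooth_hs U u MA ax1 ax2).
  assert (S3 := smooth_ts U u MA ax1 ax1 ax1). assert (S4 := smooth_ts U u MA ax1 ax1 ax2).
  simpl in *. unfold curvature, curvature_expr. apply smooth_div; trivial.
  - intros p Hp; assert (H1 := pow_lt _ 3 (h11_pos U u MA p Hp)); lra.
  - apply smooth_plus; trivial; [ now apply smooth_pow | ].
    apply smooth_pow; trivial. apply smooth_minus; trivial; now apply smooth_mult.
  - apply smooth_mult; trivial; [ now apply smooth_const | now apply smooth_pow ].
Qed.

(* [Laplace log K = 6 K].  The Laplacian of [g] is the trace of the coordinate
   Hessian because the Christoffel symbols are trace free. *)
Lemma curvature_pde p : U p ->
  let k := curvature u p in
  let k1 := partial ax1 (curvature u) p in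
  let k2 := partial ax2 (curvature u) p in
  k * (h22 u p * partial ax1 (partial ax1 (curvature u)) p
       - 2 * h12 u p * partial ax1 (partial ax2 (curvature u)) p
       + h11 u p * partial ax2 (partial ax2 (curvature u)) p)
  - (h22 u p * k1 ^ 2 - 2 * h12 u p * k1 * k2 + h11 u p * k2 ^ 2) = 6 * k ^ 3.
Proof.
  intros Hp; cbv zeta.
  rewrite !partial2_curvature, !partial_curvature by trivial. unfold curvature.
  change (partial ax1 (partial ax1 (t111 u)) p) with (partial ax1 (q1111 u) p).
  change (partial ax1 (partial ax1 (t112 u)) p) with (partial ax1 (q1112 u) p).
  change (partial ax1 (partial ax2 (t112 u)) p) with (partial ax1 (q1122 u) p).
  change (partial ax2 (partial ax2 (t112 u)) p) with (partial ax2 (q1122 u) p).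
  rewrite (partial_ext_on U (partial ax2 (t111 u)) (q1112 u) ax1 p Ho (d2_t111 U u MA) Hp).
  rewrite (partial_ext_on U (partial ax2 (t111 u)) (q1112 u) ax2 p Ho (d2_t111 U u MA) Hp).
  rewrite (d2_q1112 p Hp). cbn [ts].
  rewrite (d2_t111 U u MA p Hp), (d1_t122 U u MA p Hp).
  fold (q1111 u p) (q1112 u p) (q1122 u p) (q1222 u p).
  rewrite (d2_q1122_eq p Hp), (d1_q1122_eq p Hp), (q1222_eq U u MA p Hp),
    (q1122_eq U u MA p Hp), (t222_eq U u MA p Hp), (t122_eq U u MA p Hp), (h22_eq U u MA p Hp).
  assert (H := curvature_algebra (h11 u p) (h12 u p) (t111 u p) (t112 u p) (q1111 u p)
    (q1112 u p) (partial ax1 (q1111 u) p) (partial ax1 (q1112 u) p) (h11_pos U u MA p Hp)).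
  cbv zeta in H. rewrite <- H.
  repeat f_equal; try ring; field; assert (H1 := h11_pos U u MA p Hp); lra.
Qed.
End CurvaturePDE.

(** * Polygonal paths and escape to the boundary *)

(** Coordinates are treated one after the other, thinning out the sequence each time. The index maps
    satisfy [k <= phi k] instead of being increasing, which is enough for them to tend to
    infinity. *)
Lemma bounded_subsequence (f : nat -> nat -> R) (m : nat) (B : R) :
  (forall k i, (i < m)%nat -> Rabs (f k i) <= B) ->
  exists (phi : nat -> nat) (g : nat -> R), (forall k, (k <= phi k)%nat) /\
    forall i, (i < m)%nat -> is_lim_seq (fun k => f (phi k) i) (g i).
Proof.
  induction m as [|m IH]; intros Hb.
  - exists (fun k => k), (fun _ => 0); split; [ auto | intros i Hi; lia ].
  - destruct IH as (phi & g & Hphi & Hg); [ intros; apply Hb; lia | ].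
    destruct (Bolzano_Weierstrass (fun k => f (phi k) m) (fun x => - B <= x <= B)) as [l Hl].
    { apply compact_P3. }
    { intros n; apply Rabs_le_between, Hb; lia. }
    assert (Hex : forall k, exists p, (k <= p)%nat /\ Rabs (f (phi p) m - l) < / (INR k + 1)).
    { intros k; assert (Hk : 0 < / (INR k + 1)) by (apply Rinv_0_lt_compat; pose (pos_INR k); lra).
      destruct (Hl (disc l (mkposreal _ Hk)) k) as (p & Hp & Hd).
      - exists (mkposreal _ Hk); intros y Hy; exact Hy.
      - exists p; split; [ lia | exact Hd ]. }
    set (psi := fun k => proj1_sig (constructive_indefinite_description _ (Hex k))).
    assert (Hpsi : forall k, (k <= psi k)%nat /\ Rabs (f (phi (psi k)) m - l) < / (INR k + 1)).
    { intros k; unfold psi; destruct constructive_indefinite_description; trivial. }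
    exists (fun k => phi (psi k)), (fun i => if Nat.eq_dec i m then l else g i); split.
    + intros k; specialize (Hphi (psi k)); destruct (Hpsi k); lia.
    + intros i Hi; destruct (Nat.eq_dec i m) as [-> | Hne].
      * apply is_lim_seq_spec; intros eps.
        assert (L := is_lim_seq_INR). apply is_lim_seq_spec in L.
        destruct (L (/ eps)) as [N HN]. exists N; intros n Hn.
        destruct (Hpsi n) as [_ H]; eapply Rlt_trans; [ exact H | ].
        specialize (HN n Hn); assert (He := cond_pos eps).
        assert (0 < / eps) by now apply Rinv_0_lt_compat.
        rewrite <- (Rinv_inv eps); apply Rinv_lt_contravar; [ apply Rmult_lt_0_compat; lra | lra ].
      * apply (is_lim_seq_subseq (fun k => f (phi k) i) (g i) psi).
        -- intros P [N HN]; exists N; intros n Hn; apply HN; destruct (Hpsi n); lia.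
        -- apply Hg; lia.
Qed.

(** * The sup distance and a compact exhaustion of an open set *)

Definition supd (x y : R * R) : R := Rmax (Rabs (fst x - fst y)) (Rabs (snd x - snd y)).

Lemma supd_lt x y e : supd x y < e <-> Rabs (fst x - fst y) < e /\ Rabs (snd x - snd y) < e.
Proof.
  unfold supd; split; [ intros H | intros [H1 H2]; now apply Rmax_lub_lt ].
  split; eapply Rle_lt_trans; try exact H; [ apply Rmax_l | apply Rmax_r ].
Qed.

Lemma supd_le x y e : supd x y <= e <-> Rabs (fst x - fst y) <= e /\ Rabs (snd x - snd y) <= e.
Proof.
  unfold supd; split; [ intros H | intros [H1 H2]; now apply Rmax_lub ].
  split; eapply Rle_trans; try exact H; [ apply Rmax_l | apply Rmax_r ].
Qed.

Lemma supd_triang x y z : supd x z <= supd x y + supd y z.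
Proof.
  apply supd_le; split.
  - replace (fst x - fst z) with ((fst x - fst y) + (fst y - fst z)) by ring.
    eapply Rle_trans; [ apply Rabs_triang | apply Rplus_le_compat; apply Rmax_l ].
  - replace (snd x - snd z) with ((snd x - snd y) + (snd y - snd z)) by ring.
    eapply Rle_trans; [ apply Rabs_triang | apply Rplus_le_compat; apply Rmax_r ].
Qed.

Lemma supd_sym x y : supd x y = supd y x.
Proof. unfold supd; now rewrite (Rabs_minus_sym (fst x)), (Rabs_minus_sym (snd x)). Qed.

Lemma supd_refl x : supd x x = 0.
Proof. unfold supd; rewrite !Rminus_diag, Rabs_R0; now apply Rmax_left, Rle_refl. Qed.

Lemma supd_nonneg x y : 0 <= supd x y.
Proof. eapply Rle_trans; [ apply Rabs_pos | apply Rmax_l ]. Qed.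

Lemma supd_sqr_le x y : supd x y ^ 2 <= (fst x - fst y) ^ 2 + (snd x - snd y) ^ 2.
Proof.
  unfold supd, Rmax; destruct Rle_dec;
  rewrite pow2_abs; assert (H := pow2_ge_0 (fst x - fst y));
  assert (H' := pow2_ge_0 (snd x - snd y)); lra.
Qed.

Lemma locally_supd (P : R * R -> Prop) p :
  locally p P <-> exists d, 0 < d /\ forall y, supd y p < d -> P y.
Proof.
  split.
  - intros [d Hd]; exists d; split; [ apply cond_pos | ].
    intros y Hy; apply Hd. apply supd_lt in Hy; exact Hy.
  - intros (d & Hd & H); exists (mkposreal d Hd); intros y Hy; apply H.
    apply supd_lt; exact Hy.
Qed.

Lemma bounded_subsequence_2 (x : nat -> R * R) (B : R) :
  (forall k, Rabs (fst (x k)) <= B /\ Rabs (snd (x k)) <= B) ->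
  exists (phi : nat -> nat) (l : R * R), (forall k, (k <= phi k)%nat) /\
    filterlim (fun k => x (phi k)) eventually (locally l).
Proof.
  intros Hb.
  destruct (bounded_subsequence (fun k i => match i with O => fst (x k) | _ => snd (x k) end) 2 B)
    as (phi & g & H1 & H2).
  { intros k [|i] _; apply Hb. }
  exists phi, (g O, g 1%nat); split; trivial.
  assert (A0 := H2 O ltac:(lia)). assert (A1 := H2 1%nat ltac:(lia)).
  apply filterlim_locally; intros e.
  apply is_lim_seq_spec in A0; apply is_lim_seq_spec in A1.
  specialize (A0 e); specialize (A1 e).
  apply (filter_imp _ _ (fun k H => H) (filter_and _ _ A0 A1)).
Qed.

(** The standard compact exhaustion: bounded by [n + 1], and at distance at least [1 / (n + 1)] from
    the complement. The clearance is expressed by membership in [U] and not by a distance, so that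
    [U] may be the whole plane. *)
Definition exhaustion (U : R * R -> Prop) (n : nat) (x : R * R) : Prop :=
  supd x (0, 0) <= INR n + 1 /\ forall y, supd y x < / (INR n + 1) -> U y.

Lemma INR1_pos n : 0 < INR n + 1.
Proof. assert (H := pos_INR n); lra. Qed.

Lemma inv_INR1_pos n : 0 < / (INR n + 1).
Proof. apply Rinv_0_lt_compat, INR1_pos. Qed.

Lemma inv_INR1_small e : 0 < e -> exists n, / (INR n + 1) < e.
Proof.
  intros He; destruct (INR_unbounded (/ e)) as [n Hn]; exists n.
  assert (0 < / e) by now apply Rinv_0_lt_compat.
  rewrite <- (Rinv_inv e); apply Rinv_lt_contravar; [ apply Rmult_lt_0_compat; lra | lra ].
Qed.

Lemma exhaustion_in U n x : exhaustion U n x -> U x.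
Proof. intros [_ H]; apply H; rewrite supd_refl; apply inv_INR1_pos. Qed.

Lemma exhaustion_le U n m x : (n <= m)%nat -> exhaustion U n x -> exhaustion U m x.
Proof.
  intros Hnm [H1 H2]; apply le_INR in Hnm; split; [ lra | ].
  intros y Hy; apply H2; eapply Rlt_le_trans; [ exact Hy | ].
  apply Rinv_le_contravar; [ apply INR1_pos | lra ].
Qed.

Lemma exhaustion_covers U x : open U -> U x -> exists n, exhaustion U n x.
Proof.
  intros Ho Hx; destruct (proj1 (locally_supd U x) (Ho x Hx)) as (d & Hd & H).
  destruct (inv_INR1_small d Hd) as [n Hn]. destruct (INR_unbounded (supd x (0, 0))) as [m Hm].
  exists (Nat.max n m); assert (A := le_INR _ _ (Nat.le_max_l n m)).
  assert (A' := le_INR _ _ (Nat.le_max_r n m)). split; [ lra | ].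
  intros y Hy; apply H; eapply Rlt_le_trans; [ exact Hy | ].
  eapply Rle_trans; [ | apply Rlt_le, Hn ].
  apply Rinv_le_contravar; [ apply INR1_pos | lra ].
Qed.

(** Half of the clearance is left, and [1 / (2 (n + 1))] is the clearance of index [2 n + 1]. *)
Lemma exhaustion_near U n x y :
  exhaustion U n x -> supd y x <= / (2 * (INR n + 1)) -> exhaustion U (2 * n + 1) y.
Proof.
  intros [H1 H2] Hy; assert (Hn := pos_INR n).
  assert (E : INR (2 * n + 1) + 1 = 2 * (INR n + 1)).
  { rewrite plus_INR, mult_INR; simpl; ring. }
  assert (Hi : / (2 * (INR n + 1)) <= 1).
  { rewrite <- Rinv_1; apply Rinv_le_contravar; lra. }
  split; rewrite E.
  - assert (A := supd_triang y x (0, 0)). assert (B := Rle_trans _ _ _ Hy Hi).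
    clear Hy Hi E; lra.
  - intros z Hz; apply H2. eapply Rle_lt_trans; [ apply (supd_triang z y) | ].
    replace (/ (INR n + 1)) with (/ (2 * (INR n + 1)) + / (2 * (INR n + 1))) by (field; lra). lra.
Qed.

Lemma exhaustion_limit U n (x : nat -> R * R) l :
  filterlim x eventually (locally l) -> (forall k, exhaustion U n (x k)) -> exhaustion U n l.
Proof.
  intros Hl Hx.
  assert (Hc : forall d, 0 < d -> exists k, supd (x k) l < d).
  { intros d Hd; assert (H := proj1 (filterlim_locally x l) Hl (mkposreal d Hd)).
    destruct H as [N HN]; exists N; apply supd_lt; exact (HN N (le_n _)). }
  split.
  - apply Rnot_lt_le; intros H.
    destruct (Hc (supd l (0, 0) - (INR n + 1))) as [k Hk]; [ lra | ].
    destruct (Hx k) as [H1 _]. assert (A := supd_triang l (x k) (0, 0)).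
    rewrite (supd_sym l (x k)) in A; lra.
  - intros y Hy; destruct (Hc (/ (INR n + 1) - supd y l)) as [k Hk]; [ lra | ].
    destruct (Hx k) as [_ H2]; apply H2. assert (A := supd_triang y l (x k)).
    rewrite (supd_sym l (x k)) in A; lra.
Qed.

Lemma exhaustion_bounded_seq U n (x : nat -> R * R) : (forall k, exhaustion U n (x k)) ->
  forall k, Rabs (fst (x k)) <= INR n + 1 /\ Rabs (snd (x k)) <= INR n + 1.
Proof.
  intros H k; destruct (H k) as [H1 _]; apply supd_le in H1; simpl in H1.
  now rewrite !Rminus_0_r in H1.
Qed.

(** If not, points where [|f|] exceeds [k] accumulate at a point of the exhaustion set, where [f] is
    continuous. *)
Lemma bounded_on_exhaustion U (f : R * R -> R) n :
  (forall p, U p -> continuous f p) ->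
  exists B, 0 < B /\ forall p, exhaustion U n p -> Rabs (f p) <= B.
Proof.
  intros Hf; apply NNPP; intros Hn.
  assert (Hk : forall k : nat, exists p, exhaustion U n p /\ INR k < Rabs (f p)).
  { intros k; apply NNPP; intros H; apply Hn; exists (INR k + 1); split; [ apply INR1_pos | ].
    intros p Hp; apply Rnot_lt_le; intros Hlt; apply H; exists p; split; trivial; lra. }
  set (x := fun k => proj1_sig (constructive_indefinite_description _ (Hk k))).
  assert (Hx : forall k, exhaustion U n (x k) /\ INR k < Rabs (f (x k))).
  { intros k; unfold x; destruct constructive_indefinite_description; trivial. }
  destruct (bounded_subsequence_2 x (INR n + 1)) as (phi & l & Hphi & Hl).
  { apply (exhaustion_bounded_seq U); apply Hx. }
  assert (HU : U l).
  { apply (exhaustion_in U n), (exhaustion_limit U n (fun k => x (phi k))); trivial.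
    intros; apply Hx. }
  assert (L := filterlim_comp _ _ _ _ _ _ _ _ Hl (Hf l HU)).
  assert (L' := proj1 (filterlim_locally _ _) L (mkposreal 1 Rlt_0_1)).
  destruct (INR_unbounded (Rabs (f l) + 1)) as [K HK]. destruct L' as [N HN].
  specialize (HN (Nat.max N K) (Nat.le_max_l _ _)).
  destruct (Hx (phi (Nat.max N K))) as [_ H].
  assert (A := le_INR _ _ (Nat.le_trans _ _ _ (Nat.le_max_r N K) (Hphi (Nat.max N K)))).
  change (Rabs (f (x (phi (Nat.max N K))) - f l) < 1) in HN.
  assert (T := Rabs_triang (f (x (phi (Nat.max N K))) - f l) (f l)).
  replace (f (x (phi (Nat.max N K))) - f l + f l) with (f (x (phi (Nat.max N K)))) in T by ring.
  lra.
Qed.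

(** * Segments, their energy and polygonal paths *)

Definition seg (x y : R * R) (t : R) : R * R :=
  (fst x + t * (fst y - fst x), snd x + t * (snd y - snd x)).

Lemma seg_0 x y : seg x y 0 = x.
Proof. destruct x; unfold seg; simpl; f_equal; ring. Qed.

Lemma seg_1 x y : seg x y 1 = y.
Proof. destruct y; unfold seg; simpl; f_equal; ring. Qed.

Lemma seg_seg_l x y s t : seg x (seg x y s) t = seg x y (t * s).
Proof. unfold seg; simpl; f_equal; ring. Qed.

Lemma seg_seg_r x y s t : seg (seg x y s) y t = seg x y (s + t * (1 - s)).
Proof. unfold seg; simpl; f_equal; ring. Qed.

Lemma supd_seg_le x y q t d :
  0 <= t <= 1 -> supd x q <= d -> supd y q <= d -> supd (seg x y t) q <= d.
Proof.
  intros Ht Hx Hy; apply supd_le in Hx; apply supd_le in Hy; apply supd_le.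
  rewrite !Rabs_le_between in *; unfold seg; simpl; split; split; nra.
Qed.

Lemma supd_seg_lt x y q t d :
  0 <= t <= 1 -> supd x q < d -> supd y q < d -> supd (seg x y t) q < d.
Proof.
  intros Ht Hx Hy.
  apply Rle_lt_trans with (Rmax (supd x q) (supd y q)); [ | now apply Rmax_lub_lt ].
  apply supd_seg_le; trivial; [ apply Rmax_l | apply Rmax_r ].
Qed.

Definition in_seg (U : R * R -> Prop) (x y : R * R) : Prop :=
  forall t, 0 <= t <= 1 -> U (seg x y t).

Lemma in_seg_l U x y s : 0 <= s <= 1 -> in_seg U x y -> in_seg U x (seg x y s).
Proof. intros Hs H t Ht; rewrite seg_seg_l; apply H; nra. Qed.

Lemma in_seg_r U x y s : 0 <= s <= 1 -> in_seg U x y -> in_seg U (seg x y s) y.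
Proof. intros Hs H t Ht; rewrite seg_seg_r; apply H; nra. Qed.

Lemma in_seg_fst U x y : in_seg U x y -> U x.
Proof. intros H; rewrite <- (seg_0 x y); apply H; lra. Qed.

Lemma in_seg_snd U x y : in_seg U x y -> U y.
Proof. intros H; rewrite <- (seg_1 x y); apply H; lra. Qed.

Lemma is_derive_seg_fst x y t : is_derive (fun s => fst (seg x y s)) t (fst y - fst x).
Proof. unfold seg; simpl; auto_derive; trivial; ring. Qed.

Lemma is_derive_seg_snd x y t : is_derive (fun s => snd (seg x y s)) t (snd y - snd x).
Proof. unfold seg; simpl; auto_derive; trivial; ring. Qed.

Lemma is_derive_along_seg U f x y t : open U -> smooth_on U f -> U (seg x y t) ->
  is_derive (fun s => f (seg x y s)) t
    ((fst y - fst x) * partial ax1 f (seg x y t) + (snd y - snd x) * partial ax2 f (seg x y t)).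
Proof.
  intros Ho Hs HU.
  exact (is_derive_along_path U f (fun s => fst (seg x y s)) (fun s => snd (seg x y s)) _ _ t
           Ho Hs HU (is_derive_seg_fst x y t) (is_derive_seg_snd x y t)).
Qed.

Lemma MVT_01 (f df : R -> R) : (forall t, 0 <= t <= 1 -> is_derive f t (df t)) ->
  exists t, 0 <= t <= 1 /\ f 1 - f 0 = df t.
Proof.
  intros H; destruct (MVT_gen f 0 1 df) as (c & Hc & E).
  - rewrite Rmin_left, Rmax_right by lra; intros; apply H; lra.
  - rewrite Rmin_left, Rmax_right by lra; intros z Hz.
    apply continuity_pt_filterlim, (ex_derive_continuous f); exists (df z); now apply H.
  - rewrite Rmin_left, Rmax_right in Hc by lra. exists c; split; trivial; lra.
Qed.

Lemma MVT_seg U f x y : open U -> smooth_on U f -> in_seg U x y ->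
  exists t, 0 <= t <= 1 /\ f y - f x =
    (fst y - fst x) * partial ax1 f (seg x y t) + (snd y - snd x) * partial ax2 f (seg x y t).
Proof.
  intros Ho Hs HU.
  destruct (MVT_01 (fun s => f (seg x y s)) (fun t => (fst y - fst x) * partial ax1 f (seg x y t)
    + (snd y - snd x) * partial ax2 f (seg x y t))) as (t & Ht & E).
  - intros t Ht; apply is_derive_along_seg with U; auto.
  - exists t; split; trivial. now rewrite seg_0, seg_1 in E.
Qed.

(* For [u] convex this is the pairing [(y - x) . (grad u y - grad u x)], which
   dominates the square of the [Hess u]-length of the straight segment. *)
Definition leg_energy (u : R * R -> R) (x y : R * R) : R :=
  (fst y - fst x) * (partial ax1 u y - partial ax1 u x)
  + (snd y - snd x) * (partial ax2 u y - partial ax2 u x).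

Definition hform (u : R * R -> R) (p : R * R) (v w : R) : R :=
  h11 u p * v ^ 2 + 2 * h12 u p * v * w + h22 u p * w ^ 2.

Definition htr (u : R * R -> R) (p : R * R) : R := h11 u p + h22 u p.

(** The last index is the cost, the sum of the square roots of the leg energies. It dominates the
    length in the metric and, like a length, does not increase when a leg is subdivided. *)
Inductive path (U : R * R -> Prop) (u : R * R -> R) : R * R -> R * R -> R -> Prop :=
| path_nil x : U x -> path U u x x 0
| path_cons x y z c : in_seg U x y -> path U u y z c ->
    path U u x z (sqrt (leg_energy u x y) + c).

Section Paths.
Variables (U : R * R -> Prop) (u : R * R -> R).
Hypothesis MA : monge_ampere U u.

Let Ho := ma_open _ _ MA.
Let Hs := ma_smooth _ _ MA.

(** For determinant 1 the Cayley-Hamilton theorem reads [H^2 + 1 = tr(H) H], so that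
    [tr(H) H(v, v) = |H v|^2 + |v|^2]. *)
Lemma hform_ge p v w : U p -> v ^ 2 + w ^ 2 <= htr u p * hform u p v w.
Proof.
  intros Hp; assert (D := h_det U u MA p Hp); unfold htr, hform.
  assert (E : (h11 u p + h22 u p) * (h11 u p * v ^ 2 + 2 * h12 u p * v * w + h22 u p * w ^ 2)
    - (v ^ 2 + w ^ 2) * (h11 u p * h22 u p - h12 u p * h12 u p)
    = (h11 u p * v + h12 u p * w) ^ 2 + (h12 u p * v + h22 u p * w) ^ 2) by ring.
  rewrite D in E.
  assert (A := pow2_ge_0 (h11 u p * v + h12 u p * w)).
  assert (B := pow2_ge_0 (h12 u p * v + h22 u p * w)). lra.
Qed.

Lemma htr_ge p : U p -> 2 <= htr u p.
Proof.
  intros Hp; assert (D := h_det U u MA p Hp); unfold htr.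
  assert (A := h11_pos U u MA p Hp). assert (B := h22_pos U u MA p Hp).
  assert (C := pow2_ge_0 (h11 u p - h22 u p)). assert (C' := pow2_ge_0 (h12 u p)). nra.
Qed.

Lemma hform_nonneg p v w : U p -> 0 <= hform u p v w.
Proof.
  intros Hp; assert (A := hform_ge p v w Hp); assert (B := htr_ge p Hp).
  assert (C := pow2_ge_0 v); assert (D := pow2_ge_0 w).
  destruct (Rle_lt_dec 0 (hform u p v w)); trivial. nra.
Qed.

Lemma hform_le p v w : U p -> hform u p v w <= htr u p * (v ^ 2 + w ^ 2).
Proof.
  intros Hp; assert (D := h_det U u MA p Hp).
  assert (A := h11_pos U u MA p Hp). assert (B := h22_pos U u MA p Hp).
  assert (E : h11 u p * (htr u p * (v ^ 2 + w ^ 2) - hform u p v w)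
    = (h11 u p * w - h12 u p * v) ^ 2 + (h11 u p * h22 u p - h12 u p * h12 u p) * v ^ 2).
  { unfold htr, hform; ring. }
  rewrite D in E.
  assert (C := pow2_ge_0 (h11 u p * w - h12 u p * v)). assert (C' := pow2_ge_0 v). nra.
Qed.

Lemma is_derive_grad_along_seg x y v w t : U (seg x y t) ->
  is_derive (fun s => v * partial ax1 u (seg x y s) + w * partial ax2 u (seg x y s)) t
    (v * ((fst y - fst x) * h11 u (seg x y t) + (snd y - snd x) * h12 u (seg x y t))
     + w * ((fst y - fst x) * h12 u (seg x y t) + (snd y - snd x) * h22 u (seg x y t))).
Proof.
  intros HU.
  assert (D1 := is_derive_along_seg U _ x y t Ho (smooth_partial U u ax1 Hs) HU).
  assert (D2 := is_derive_along_seg U _ x y t Ho (smooth_partial U u ax2 Hs) HU).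
  assert (E : partial ax2 (partial ax1 u) (seg x y t) = h12 u (seg x y t)).
  { exact (Hess_hs U u MA _ ax2 ax1 HU). }
  rewrite E in D1.
  apply (@is_derive_plus R_AbsRing R_NormedModule); apply is_derive_scal; assumption.
Qed.

Lemma leg_energy_MVT x y : in_seg U x y ->
  exists t, 0 <= t <= 1 /\
    leg_energy u x y = hform u (seg x y t) (fst y - fst x) (snd y - snd x).
Proof.
  intros HU.
  destruct (MVT_01 _ _ (fun t Ht =>
    is_derive_grad_along_seg x y (fst y - fst x) (snd y - snd x) t (HU t Ht))) as (t & Ht & E).
  exists t; split; trivial. rewrite seg_0, seg_1 in E.
  unfold leg_energy, hform. nra.
Qed.

Lemma leg_energy_nonneg x y : in_seg U x y -> 0 <= leg_energy u x y.
Proof. intros H; destruct (leg_energy_MVT x y H) as (t & Ht & ->). now apply hform_nonneg, H. Qed.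

(** Together with [leg_le_supd] this makes cost and sup distance comparable wherever the trace of
    the Hessian is bounded, in particular on the exhaustion sets. *)
Lemma supd_le_leg x y T : in_seg U x y -> (forall t, 0 <= t <= 1 -> htr u (seg x y t) <= T) ->
  supd x y <= sqrt T * sqrt (leg_energy u x y).
Proof.
  intros HU HT; assert (Hn := leg_energy_nonneg x y HU).
  destruct (leg_energy_MVT x y HU) as (t & Ht & E).
  assert (A := hform_ge (seg x y t) (fst y - fst x) (snd y - snd x) (HU t Ht)).
  assert (B := htr_ge _ (HU t Ht)). specialize (HT t Ht).
  rewrite <- sqrt_mult_alt by lra.
  rewrite <- (sqrt_pow2 (supd x y)) by apply supd_nonneg.
  apply sqrt_le_1_alt. rewrite supd_sym.
  eapply Rle_trans; [ apply supd_sqr_le | ].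
  eapply Rle_trans; [ exact A | ]. rewrite <- E. now apply Rmult_le_compat_r.
Qed.

Lemma leg_le_supd x y T : in_seg U x y -> (forall t, 0 <= t <= 1 -> htr u (seg x y t) <= T) ->
  sqrt (leg_energy u x y) <= 2 * sqrt T * supd x y.
Proof.
  intros HU HT.
  destruct (leg_energy_MVT x y HU) as (t & Ht & E).
  assert (A := hform_le (seg x y t) (fst y - fst x) (snd y - snd x) (HU t Ht)).
  assert (B := htr_ge _ (HU t Ht)). specialize (HT t Ht).
  assert (P := supd_nonneg x y).
  assert (Q : (fst y - fst x) ^ 2 + (snd y - snd x) ^ 2 <= 2 * supd x y ^ 2).
  { destruct (proj1 (supd_le x y _) (Rle_refl _)) as [H1 H2].
    rewrite <- (pow2_abs (fst y - fst x)), <- (pow2_abs (snd y - snd x)).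
    rewrite (Rabs_minus_sym (fst y)), (Rabs_minus_sym (snd y)).
    assert (P1 := Rabs_pos (fst x - fst y)). assert (P2 := Rabs_pos (snd x - snd y)). nra. }
  assert (S := sqrt_pos T). assert (S2 := pow2_sqrt T ltac:(lra)).
  rewrite <- (sqrt_pow2 (2 * sqrt T * supd x y)) by (apply Rmult_le_pos; lra).
  apply sqrt_le_1_alt. rewrite E.
  replace ((2 * sqrt T * supd x y) ^ 2) with (T * (4 * supd x y ^ 2)) by (rewrite <- S2 at 1; ring).
  assert (R := pow2_ge_0 (supd x y)).
  assert (Z := pow2_ge_0 (fst y - fst x)). assert (Z' := pow2_ge_0 (snd y - snd x)).
  eapply Rle_trans; [ exact A | ]. apply Rmult_le_compat; lra.
Qed.

(** The derivative [D] of [u] in the direction of the segment is nondecreasing along it, by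
    convexity. With its increments [al] and [be] the claim becomes [sqrt (s al) + sqrt ((1 - s) be)
    <= sqrt (al + be)], a case of the Cauchy-Schwarz inequality. *)
Lemma leg_split x y s : in_seg U x y -> 0 <= s <= 1 ->
  sqrt (leg_energy u x (seg x y s)) + sqrt (leg_energy u (seg x y s) y)
  <= sqrt (leg_energy u x y).
Proof.
  intros HU Hsr.
  set (D := fun z => (fst y - fst x) * partial ax1 u z + (snd y - snd x) * partial ax2 u z).
  assert (E1 : leg_energy u x (seg x y s) = s * (D (seg x y s) - D x)).
  { unfold leg_energy, D, seg; simpl; ring. }
  assert (E2 : leg_energy u (seg x y s) y = (1 - s) * (D y - D (seg x y s))).
  { unfold leg_energy, D, seg; simpl; ring. }
  assert (E : leg_energy u x y = (D (seg x y s) - D x) + (D y - D (seg x y s))).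
  { unfold leg_energy, D; ring. }
  assert (M : forall a b, 0 <= a <= b -> b <= 1 -> D (seg x y a) <= D (seg x y b)).
  { intros a b Hab Hb.
    destruct (MVT_gen (fun t => D (seg x y t)) a b (fun t => hform u (seg x y t) (fst y - fst x) (snd y - snd x)))
      as (c & Hc & Ec); rewrite ?Rmin_left, ?Rmax_right in * by lra.
    - intros t Ht. assert (A := is_derive_grad_along_seg x y (fst y - fst x) (snd y - snd x) t
        (HU t ltac:(lra))). unfold D.
      match type of A with is_derive _ _ ?d => replace (hform u (seg x y t) (fst y - fst x) (snd y - snd x)) with d
        by (unfold hform; ring) end. exact A.
    - intros t Ht. apply continuity_pt_filterlim, (ex_derive_continuous (fun t => D (seg x y t))).
      eexists; apply is_derive_grad_along_seg, HU; lra.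
    - assert (P := hform_nonneg (seg x y c) (fst y - fst x) (snd y - snd x) (HU c ltac:(lra))).
      nra. }
  assert (M1 := M 0 s ltac:(lra) ltac:(lra)). assert (M2 := M s 1 ltac:(lra) ltac:(lra)).
  rewrite seg_0 in M1. rewrite seg_1 in M2.
  rewrite E1, E2, E. set (al := D (seg x y s) - D x) in *. set (be := D y - D (seg x y s)) in *.
  assert (Ha : 0 <= al) by (unfold al; lra). assert (Hb : 0 <= be) by (unfold be; lra).
  rewrite (sqrt_mult s al), (sqrt_mult (1 - s) be) by lra.
  assert (S1 := pow2_sqrt s ltac:(lra)). assert (S2 := pow2_sqrt (1 - s) ltac:(lra)).
  assert (S3 := pow2_sqrt al Ha). assert (S4 := pow2_sqrt be Hb).
  assert (P1 := sqrt_pos s). assert (P2 := sqrt_pos (1 - s)).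
  assert (P3 := sqrt_pos al). assert (P4 := sqrt_pos be).
  set (a := sqrt s) in *; set (b := sqrt (1 - s)) in *; set (c := sqrt al) in *;
  set (d := sqrt be) in *.
  rewrite <- (sqrt_pow2 (a * c + b * d)) by (apply Rplus_le_le_0_compat; apply Rmult_le_pos; lra).
  apply sqrt_le_1_alt. rewrite <- S3, <- S4.
  assert (Q := pow2_ge_0 (a * d - b * c)).
  assert (EQ : (a * c + b * d) ^ 2 + (a * d - b * c) ^ 2 = (a ^ 2 + b ^ 2) * (c ^ 2 + d ^ 2)) by ring.
  rewrite S1, S2 in EQ. lra.
Qed.

Lemma path_fst x y c : path U u x y c -> U x.
Proof. intros H; destruct H; trivial. now apply in_seg_fst in H. Qed.

Lemma path_snd x y c : path U u x y c -> U y.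
Proof. induction 1; trivial. Qed.

Lemma path_nonneg x y c : path U u x y c -> 0 <= c.
Proof. induction 1; [ lra | assert (A := sqrt_pos (leg_energy u x y)); lra ]. Qed.

Lemma path_one x y : in_seg U x y -> path U u x y (sqrt (leg_energy u x y)).
Proof.
  intros H; rewrite <- (Rplus_0_r (sqrt _)); apply path_cons; trivial.
  apply path_nil; now apply in_seg_snd in H.
Qed.

Lemma path_app x y z a b : path U u x y a -> path U u y z b -> path U u x z (a + b).
Proof.
  intros H; revert z b; induction H as [x Hx | x y w c Hl Hp IH]; intros z b Hb.
  - now rewrite Rplus_0_l.
  - rewrite Rplus_assoc; apply path_cons; trivial. now apply IH.
Qed.

Lemma continuous_supd_seg x y q t : continuous (fun s => supd (seg x y s) q) t.
Proof.
  unfold supd, seg; simpl.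
  apply (continuous_comp_2 (fun s => Rabs (fst x + s * (fst y - fst x) - fst q))
    (fun s => Rabs (snd x + s * (snd y - snd x) - snd q)) Rmax).
  1,2: apply (continuous_comp _ Rabs); [ | apply continuous_Rabs ];
    apply (ex_derive_continuous (V := R_NormedModule)); auto_derive; trivial.
  apply continuous_ext with (fun p : R * R => (fst p + snd p + Rabs (fst p - snd p)) / 2).
  { intros [a b]; simpl; unfold Rmax, Rabs; destruct Rle_dec, Rcase_abs; lra. }
  apply (continuous_mult (fun p : R * R => fst p + snd p + Rabs (fst p - snd p)) (fun _ => / 2));
    [ | apply continuous_const ].
  apply (continuous_plus (fun p : R * R => fst p + snd p) (fun p => Rabs (fst p - snd p))).
  - apply (continuous_plus (fun p : R * R => fst p) (fun p => snd p));
      [ apply continuous_fst | apply continuous_snd ].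
  - apply (continuous_comp (fun p : R * R => fst p - snd p) Rabs); [ | apply continuous_Rabs ].
    apply (continuous_minus (fun p : R * R => fst p) (fun p => snd p));
      [ apply continuous_fst | apply continuous_snd ].
Qed.

Lemma seg_exit x y q d : supd x q < d <= supd y q ->
  exists t, 0 <= t <= 1 /\ supd (seg x y t) q = d.
Proof.
  intros H.
  destruct (IVT_gen (fun s => supd (seg x y s) q) 0 1 d) as (t & Ht & E).
  - intros t; apply continuity_pt_filterlim, continuous_supd_seg.
  - rewrite seg_0, seg_1, Rmin_left, Rmax_right; lra.
  - rewrite Rmin_left, Rmax_right in Ht by lra. now exists t.
Qed.

(** The leg that crosses the sup-sphere is cut at the crossing point, which by [leg_split] does not
    raise the cost. *)
Lemma path_exit q d x y c : path U u x y c -> supd x q < d <= supd y q ->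
  exists z a b, supd z q = d /\ path U u x z a /\ path U u z y b /\ a + b <= c.
Proof.
  induction 1 as [x Hx | x y z c Hl Hp IH]; intros Hd; [ lra | ].
  destruct (Rlt_le_dec (supd y q) d) as [Hy | Hy].
  - destruct (IH ltac:(lra)) as (w & a & b & Hw & Ha & Hb & Hab).
    exists w, (sqrt (leg_energy u x y) + a), b; repeat split; trivial; [ | lra ].
    now apply path_cons.
  - destruct (seg_exit x y q d ltac:(lra)) as (t & Ht & E).
    exists (seg x y t), (sqrt (leg_energy u x (seg x y t))),
      (sqrt (leg_energy u (seg x y t) y) + c); repeat split; trivial.
    + now apply path_one, in_seg_l.
    + apply path_cons; trivial. now apply in_seg_r.
    + assert (A := leg_split x y t Hl Ht); lra.
Qed.

(** Only the part of the path up to its first exit from the ball is estimated, because the Hessian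
    is controlled only there. *)
Lemma path_cost_ge q d T x y c :
  (forall z, supd z q <= d -> htr u z <= T) ->
  path U u x y c -> supd x q < d <= supd y q -> d - supd x q <= sqrt T * c.
Proof.
  intros HT; induction 1 as [x Hx | x y z c Hl Hp IH]; intros Hd; [ lra | ].
  assert (ST := sqrt_pos T).
  destruct (Rlt_le_dec (supd y q) d) as [Hy | Hy].
  - specialize (IH ltac:(lra)).
    assert (A := supd_le_leg x y T Hl).
    assert (B := supd_triang y x q). rewrite (supd_sym y x) in B.
    assert (A' : supd x y <= sqrt T * sqrt (leg_energy u x y)).
    { apply A; intros t Ht; apply HT, supd_seg_le; lra. }
    lra.
  - destruct (seg_exit x y q d ltac:(lra)) as (t & Ht & E).
    assert (A : supd x (seg x y t) <= sqrt T * sqrt (leg_energy u x (seg x y t))).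
    { apply supd_le_leg; [ now apply in_seg_l | ].
      intros s Hs'; apply HT, supd_seg_le; lra. }
    assert (B := supd_triang (seg x y t) x q). rewrite (supd_sym _ x) in B.
    assert (C := leg_split x y t Hl Ht).
    assert (C' := sqrt_pos (leg_energy u (seg x y t) y)).
    assert (C'' := path_nonneg _ _ _ Hp).
    assert (sqrt T * sqrt (leg_energy u x (seg x y t)) <= sqrt T * (sqrt (leg_energy u x y) + c)).
    { apply Rmult_le_compat_l; lra. }
    lra.
Qed.
End Paths.

(** * Paths that leave every compact set at bounded cost *)

Fixpoint psum (f : nat -> R) (n : nat) : R :=
  match n with O => 0 | S m => psum f m + f m end.

(** The negation says that all points reached at cost below [rho] lie in one exhaustion set, the
    analogue of a relatively compact ball. *)
Definition unbounded_within (U : R * R -> Prop) (u : R * R -> R) (x : R * R) (rho : R) : Prop :=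
  forall n, exists y c, path U u x y c /\ c < rho /\ ~ exhaustion U n y.

Section Escape.
Variables (U : R * R -> Prop) (u : R * R -> R).
Hypothesis MA : monge_ampere U u.

Let Ho := ma_open _ _ MA.

Lemma htr_bounded n : exists T, 0 < T /\ forall p, exhaustion U n p -> htr u p <= T.
Proof.
  destruct (bounded_on_exhaustion U (htr u) n) as (B & HB & H).
  - intros p Hp; unfold htr; apply (continuous_plus (h11 u) (h22 u));
      apply (smooth_continuous U); trivial;
      [ exact (smooth_hs U u MA ax1 ax1) | exact (smooth_hs U u MA ax2 ax2) ].
  - exists B; split; trivial. intros p Hp. eapply Rle_trans; [ apply Rle_abs | now apply H ].
Qed.

(** The escaping paths cross a small sup-sphere around [x] at points [Z k] after costs [A k], and
    both converge along a subsequence. From a fixed late crossing point it is cheap to jump to any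
    later one and to go on along its path, so that this single point inherits the escape property
    with the remaining budget. *)
Lemma escape_step_scale x n rho eps :
  exhaustion U n x -> unbounded_within U u x rho -> 0 < eps ->
  exists y l, path U u x y l /\ supd y x = / (2 * (INR n + 1)) /\
    unbounded_within U u y (rho - l + eps).
Proof.
  intros Hx Hb He. set (m := (2 * n + 1)%nat).
  set (d := / (2 * (INR n + 1))).
  assert (Hd : 0 < d) by (apply Rinv_0_lt_compat; assert (A := INR1_pos n); lra).
  assert (Hk : forall k, exists w : (R * R) * (R * R) * R * R, let '(y, z, a, b) := w in
    ~ exhaustion U (k + m) y /\ supd z x = d /\ path U u x z a /\ path U u z y b /\ a + b < rho).
  (* The offset [m] forces the endpoint out of the sup-ball around [x], so that the path crosses its
     boundary. *)
  { intros k; destruct (Hb (k + m)%nat) as (y & c & Hp & Hc & Hn).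
    assert (Hy : d <= supd y x).
    { apply Rnot_lt_le; intros Hlt; apply Hn, (exhaustion_le U m); [ lia | ].
      apply exhaustion_near with x; trivial; now apply Rlt_le. }
    destruct (path_exit U u MA x d x y c Hp) as (z & a & b & Hz & Ha & Hb' & Hab).
    { rewrite supd_refl; lra. }
    exists (y, z, a, b); repeat split; trivial; lra. }
  set (w := fun k => proj1_sig (constructive_indefinite_description _ (Hk k))).
  assert (Hw : forall k, let '(y, z, a, b) := w k in
    ~ exhaustion U (k + m) y /\ supd z x = d /\ path U u x z a /\ path U u z y b /\ a + b < rho).
  { intros k; unfold w; destruct constructive_indefinite_description; trivial. }
  clearbody w; clear Hk.
  set (Y := fun k => fst (fst (fst (w k)))). set (Z := fun k => snd (fst (fst (w k)))).
  set (A := fun k => snd (fst (w k))). set (B := fun k => snd (w k)).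
  assert (HW : forall k, ~ exhaustion U (k + m) (Y k) /\ supd (Z k) x = d /\
    path U u x (Z k) (A k) /\ path U u (Z k) (Y k) (B k) /\ A k + B k < rho).
  { intros k; specialize (Hw k); unfold Y, Z, A, B; now destruct (w k) as [[[y z] a] b]. }
  clearbody Y Z A B; clear w Hw.
  assert (HZ : forall k, exhaustion U m (Z k)).
  { intros k; destruct (HW k) as (_ & E & _); apply exhaustion_near with x; trivial.
    now apply Req_le. }
  destruct (bounded_subsequence (fun k i => match i with O => fst (Z k) | 1%nat => snd (Z k)
    | _ => A k end) 3 (Rmax (INR m + 1) rho)) as (phi & g & Hphi & Hg).
  { intros k [|[|i]] Hi.
    - eapply Rle_trans; [ apply (exhaustion_bounded_seq U m Z HZ k) | apply Rmax_l ].
    - eapply Rle_trans; [ apply (exhaustion_bounded_seq U m Z HZ k) | apply Rmax_l ].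
    - eapply Rle_trans; [ | apply Rmax_r ].
      destruct (HW k) as (_ & _ & Pa & Pb & S).
      assert (P1 := path_nonneg _ _ _ _ _ Pa). assert (P2 := path_nonneg _ _ _ _ _ Pb).
      rewrite Rabs_right; lra. }
  assert (G0 := Hg O ltac:(lia)). assert (G1 := Hg 1%nat ltac:(lia)).
  assert (G2 := Hg 2%nat ltac:(lia)). cbv beta iota in G0, G1, G2.
  set (q := (g O, g 1%nat)).
  assert (Hq : filterlim (fun k => Z (phi k)) eventually (locally q)).
  { apply filterlim_locally; intros e.
    apply is_lim_seq_spec in G0; apply is_lim_seq_spec in G1.
    exact (filter_imp _ _ (fun k H => H) (filter_and _ _ (G0 e) (G1 e))). }
  assert (Hqm : exhaustion U m q).
  { apply (exhaustion_limit U m (fun k => Z (phi k))); auto. }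
  destruct (htr_bounded (2 * m + 1)) as (T & HT & HTb).
  assert (ST : 0 < sqrt T) by now apply sqrt_lt_R0.
  (* Two points within [dl] of the limit [q] are joined by a segment of cost at most [eps / 4],
     inside a set where [T] bounds the trace. *)
  set (dl := Rmin (/ (2 * (INR m + 1))) (eps / (16 * sqrt T))).
  assert (Hdl : 0 < dl).
  { apply Rmin_pos; [ apply Rinv_0_lt_compat; assert (P := INR1_pos m); lra | ].
    apply Rdiv_lt_0_compat; lra. }
  assert (Hq' := proj1 (filterlim_locally _ _) Hq (mkposreal dl Hdl)).
  apply is_lim_seq_spec in G2.
  assert (He4 : 0 < eps / 4) by lra. specialize (G2 (mkposreal _ He4)).
  destruct (filter_and _ _ Hq' G2) as [N HN]; simpl in HN.
  assert (HN' : forall k, (N <= k)%nat -> supd (Z (phi k)) q < dl /\ Rabs (A (phi k) - g 2%nat) < eps / 4).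
  { intros k Hk; destruct (HN k Hk) as [H1 H2]; split; [ apply supd_lt; exact H1 | exact H2 ]. }
  exists (Z (phi N)), (A (phi N)); repeat split; try apply HW.
  intros n'. set (k := Nat.max N n').
  destruct (HN' N (le_n _)) as [E1 E2]. destruct (HN' k (Nat.le_max_l _ _)) as [E3 E4].
  destruct (HW (phi k)) as (F1 & F2 & F3 & F4 & F5).
  assert (Hin : forall t, 0 <= t <= 1 -> exhaustion U (2 * m + 1) (seg (Z (phi N)) (Z (phi k)) t)).
  { intros t Ht; apply exhaustion_near with q; trivial. apply Rlt_le, supd_seg_lt; trivial;
      eapply Rlt_le_trans; try eassumption; apply Rmin_l. }
  assert (Hseg : in_seg U (Z (phi N)) (Z (phi k))).
  { intros t Ht; eapply exhaustion_in; now apply Hin. }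
  exists (Y (phi k)), (sqrt (leg_energy u (Z (phi N)) (Z (phi k))) + B (phi k)); repeat split.
  - now apply path_cons.
  - assert (L := leg_le_supd U u MA _ _ T Hseg (fun t Ht => HTb _ (Hin t Ht))).
    assert (Tr := supd_triang (Z (phi N)) q (Z (phi k))). rewrite (supd_sym q) in Tr.
    assert (M : dl <= eps / (16 * sqrt T)) by apply Rmin_r.
    assert (M' : 2 * sqrt T * supd (Z (phi N)) (Z (phi k)) <= eps / 4).
    { replace (eps / 4) with (2 * sqrt T * (2 * (eps / (16 * sqrt T)))) by (field; lra).
      apply Rmult_le_compat_l; lra. }
    apply Rabs_lt_between in E2; apply Rabs_lt_between in E4. lra.
  - intros Hex; apply F1, (exhaustion_le U n'); trivial.
    assert (P := Hphi k). unfold k in *; lia.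
Qed.

(** The least index whose exhaustion set contains [x] gives the largest step, so the lower bound
    holds for all such indices. Steps bounded below on each compact set keep the sequence from
    accumulating inside [U]. *)
Lemma escape_step x rho eps :
  U x -> unbounded_within U u x rho -> 0 < eps ->
  exists y l, path U u x y l /\
    (forall n, exhaustion U n x -> / (2 * (INR n + 1)) <= supd y x) /\
    unbounded_within U u y (rho - l + eps).
Proof.
  intros Hx Hb He.
  destruct (dec_inh_nat_subset_has_unique_least_element (fun n => exhaustion U n x))
    as (n & (Hn & Hmin) & _).
  { intros n; apply classic. }
  { now apply exhaustion_covers. }
  destruct (escape_step_scale x n rho eps Hn Hb He) as (y & l & Hp & Hs & Hu).
  exists y, l; repeat split; trivial. rewrite Hs; intros m Hm.
  apply Hmin, le_INR in Hm. assert (P := INR1_pos n). apply Rinv_le_contravar; lra.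
Qed.

Lemma unbounded_within_pos x rho : unbounded_within U u x rho -> 0 < rho.
Proof.
  intros H; destruct (H O) as (y & c & Hp & Hc & _).
  assert (A := path_nonneg _ _ _ _ _ Hp); lra.
Qed.

(** A state is a point with its remaining budget. The losses [eps / 2 ^ (k + 1)] sum to less than
    [eps] and the budgets remain positive, which bounds the total cost. *)
Lemma escape_sequence p rho eps :
  U p -> unbounded_within U u p rho -> 0 < eps ->
  exists (x : nat -> R * R) (l : nat -> R), x O = p /\
    (forall k, path U u (x k) (x (S k)) (l k)) /\
    (forall k n, exhaustion U n (x k) -> / (2 * (INR n + 1)) <= supd (x (S k)) (x k)) /\
    (forall N, psum l N <= rho + eps).
Proof.
  intros Hp Hb He.
  set (S0 := {s : (R * R) * R | U (fst s) /\ unbounded_within U u (fst s) (snd s)}).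
  set (e := fun k : nat => eps * (1 / 2) ^ (S k)).
  assert (Pe : forall k, 0 < e k).
  { intros k; apply Rmult_lt_0_compat; trivial. apply pow_lt; lra. }
  assert (Hex : forall (k : nat) (s : S0), exists s' : S0, exists l,
    path U u (fst (proj1_sig s)) (fst (proj1_sig s')) l /\
    (forall n, exhaustion U n (fst (proj1_sig s)) ->
       / (2 * (INR n + 1)) <= supd (fst (proj1_sig s')) (fst (proj1_sig s))) /\
    snd (proj1_sig s') = snd (proj1_sig s) - l + e k).
  { intros k [[x r] [H1 H2]]; simpl in *.
    destruct (escape_step x r (e k) H1 H2 (Pe k)) as (y & l & Q1 & Q2 & Q3).
    assert (Hy : U (fst (y, r - l + e k)) /\
      unbounded_within U u (fst (y, r - l + e k)) (snd (y, r - l + e k))).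
    { split; trivial. exact (path_snd U u _ _ _ Q1). }
    exists (exist _ (y, r - l + e k) Hy), l; auto. }
  set (next := fun k s => proj1_sig (constructive_indefinite_description _ (Hex k s))).
  assert (Hnext : forall k s, exists l,
    path U u (fst (proj1_sig s)) (fst (proj1_sig (next k s))) l /\
    (forall n, exhaustion U n (fst (proj1_sig s)) ->
       / (2 * (INR n + 1)) <= supd (fst (proj1_sig (next k s))) (fst (proj1_sig s))) /\
    snd (proj1_sig (next k s)) = snd (proj1_sig s) - l + e k).
  { intros k s; unfold next; destruct constructive_indefinite_description; trivial. }
  set (st := nat_rect (fun _ => S0) (exist _ (p, rho) (conj Hp Hb)) next).
  set (x := fun k => fst (proj1_sig (st k))). set (r := fun k => snd (proj1_sig (st k))).
  (* The costs are recovered from the budgets, so that their partial sums telescope. *)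
  exists x, (fun k => r k - r (S k) + e k); split; [ reflexivity | ].
  assert (Hl : forall k, exists l, path U u (x k) (x (S k)) l /\
    (forall n, exhaustion U n (x k) -> / (2 * (INR n + 1)) <= supd (x (S k)) (x k)) /\
    r (S k) = r k - l + e k).
  { intros k; exact (Hnext k (st k)). }
  split; [ | split ].
  - intros k; destruct (Hl k) as (l & H1 & _ & ->).
    replace (r k - (r k - l + e k) + e k) with l by ring; trivial.
  - intros k; destruct (Hl k) as (l & _ & H2 & _); exact H2.
  - intros N.
    assert (E : psum (fun k => r k - r (S k) + e k) N = rho - r N + eps * (1 - (1 / 2) ^ N)).
    { induction N as [|N IH]; simpl psum.
      - change (r O) with rho; simpl; ring.
      - rewrite IH; unfold e; simpl; field. }
    rewrite E.
    assert (P := unbounded_within_pos (x N) (r N) (proj2 (proj2_sig (st N)))).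
    assert (Q : 0 < (1 / 2) ^ N) by (apply pow_lt; lra).
    nra.
Qed.
End Escape.

(** * Derivatives and continuity relative to a set, by estimates *)

Definition derive_in (D : R -> Prop) (f : R -> R) (t l : R) : Prop :=
  forall eps, 0 < eps -> exists d, 0 < d /\
    forall y, D y -> Rabs (y - t) < d -> Rabs (f y - f t - (y - t) * l) <= eps * Rabs (y - t).

Definition continuous_in (D : R -> Prop) (f : R -> R) (t : R) : Prop :=
  forall eps, 0 < eps -> exists d, 0 < d /\
    forall y, D y -> Rabs (y - t) < d -> Rabs (f y - f t) < eps.

Lemma norm_pair_le (x y e : R) : Rabs x <= e -> Rabs y <= e -> norm (x, y) <= 2 * e.
Proof.
  intros Hx Hy.
  eapply Rle_trans; [ apply norm_prod | ]. unfold norm; simpl; unfold abs; simpl.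
  assert (S : sqrt 2 <= 2).
  { rewrite <- (sqrt_pow2 2) at 2 by lra. apply sqrt_le_1_alt; lra. }
  assert (P := sqrt_pos 2). assert (Q := Rmax_lub _ _ _ Hx Hy).
  assert (Q' := Rle_trans _ _ _ (Rabs_pos x) (Rmax_l (Rabs x) (Rabs y))). nra.
Qed.

Lemma norm_pair_ge (x y : R) : Rabs x <= norm (x, y) /\ Rabs y <= norm (x, y).
Proof.
  assert (A := norm_prod x y). unfold norm in A at 1 2; simpl in A.
  destruct A as [A _]. unfold abs in A; simpl in A.
  split; eapply Rle_trans; try exact A; [ apply Rmax_l | apply Rmax_r ].
Qed.

(** Reduces the one-sided derivatives of plane curves, which occur in geodesics and piecewise C^1
    curves, to estimates in each coordinate. *)
Lemma is_derive_within_iff D c t v : D t ->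
  is_derive_within D c t v <->
  derive_in D (fun s => fst (c s)) t (fst v) /\ derive_in D (fun s => snd (c s)) t (snd v).
Proof.
  intros Ht; unfold is_derive_within; split.
  - intros [_ H]. specialize (H t (fun P HP => filter_imp _ _ (fun y Hy _ => Hy) HP)).
    assert (A : forall eps, 0 < eps -> exists d, 0 < d /\ forall y, D y -> Rabs (y - t) < d ->
      norm (minus (minus (c y) (c t)) (scal (minus y t) v)) <= eps * Rabs (y - t)).
    { intros eps He; destruct (H (mkposreal eps He)) as [d Hd].
      exists d; split; [ apply cond_pos | ]. intros y Hy Hyt. exact (Hd y Hyt Hy). }
    split; intros eps He; destruct (A eps He) as (d & Hd & B); exists d; split; trivial;
      intros y Hy Hyt; specialize (B y Hy Hyt);
      destruct (c y) as [a b], (c t) as [a' b'], v as [v1 v2];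
      destruct (norm_pair_ge (a - a' - (y - t) * v1) (b - b' - (y - t) * v2)) as [N1 N2];
      change (norm (a - a' - (y - t) * v1, b - b' - (y - t) * v2) <= eps * Rabs (y - t)) in B;
      simpl; lra.
  - intros [H1 H2]. split.
    { exact (@is_linear_scal_l R_AbsRing (prod_NormedModule R_AbsRing R_NormedModule R_NormedModule) v). }
    intros x Hx eps.
    (* The filter converges to [t] only, because [t] itself belongs to [D]. *)
    assert (E : x = t).
    { apply NNPP; intros Hne.
      assert (Hp : 0 < Rabs (t - x)) by (apply Rabs_pos_lt; intros E; apply Hne; lra).
      assert (A := Hx (ball x (mkposreal _ Hp)) (locally_ball x _)).
      assert (B := locally_singleton _ _ A Ht).
      change (Rabs (t - x) < Rabs (t - x)) in B; lra. }
    subst x. assert (He : 0 < eps / 2) by (assert (P := cond_pos eps); lra).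
    destruct (H1 _ He) as (d1 & Hd1 & A1). destruct (H2 _ He) as (d2 & Hd2 & A2).
    exists (mkposreal _ (Rmin_pos _ _ Hd1 Hd2)); intros y Hyt Hy.
    change (Rabs (y - t) < Rmin d1 d2) in Hyt.
    specialize (A1 y Hy (Rlt_le_trans _ _ _ Hyt (Rmin_l _ _))).
    specialize (A2 y Hy (Rlt_le_trans _ _ _ Hyt (Rmin_r _ _))).
    destruct (c y) as [a b], (c t) as [a' b'], v as [v1 v2]. simpl in A1, A2.
    change (norm (a - a' - (y - t) * v1, b - b' - (y - t) * v2) <= eps * Rabs (y - t)).
    eapply Rle_trans; [ apply norm_pair_le; eassumption | lra ].
Qed.

Lemma continuous_within_iff (D : R -> Prop) (v : R -> R * R) (t : R) :
  filterlim v (within D (locally t)) (locally (v t)) <->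
  continuous_in D (fun s => fst (v s)) t /\ continuous_in D (fun s => snd (v s)) t.
Proof.
  split.
  - intros H; assert (A := proj1 (filterlim_locally v (v t)) H).
    split; intros eps He; destruct (A (mkposreal eps He)) as [d Hd]; exists d;
      (split; [ apply cond_pos | ]); intros y Hy Hyt; apply (Hd y Hyt Hy).
  - intros [H1 H2]; apply filterlim_locally; intros eps.
    destruct (H1 eps (cond_pos eps)) as (d1 & Hd1 & A1).
    destruct (H2 eps (cond_pos eps)) as (d2 & Hd2 & A2).
    exists (mkposreal _ (Rmin_pos _ _ Hd1 Hd2)); intros y Hyt Hy.
    change (Rabs (y - t) < Rmin d1 d2) in Hyt. split.
    + exact (A1 y Hy (Rlt_le_trans _ _ _ Hyt (Rmin_l _ _))).
    + exact (A2 y Hy (Rlt_le_trans _ _ _ Hyt (Rmin_r _ _))).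
Qed.

Lemma is_derive_iff_derive_in f t l : is_derive f t l <-> derive_in (fun _ => True) f t l.
Proof.
  split.
  - intros [_ H] eps He.
    destruct (H t (fun P HP => HP) (mkposreal eps He)) as [d Hd].
    exists d; split; [ apply cond_pos | ]. intros y _ Hy. exact (Hd y Hy).
  - intros H; split; [ exact (@is_linear_scal_l R_AbsRing R_NormedModule l) | ].
    intros x Hx eps. assert (E := @is_filter_lim_locally_unique R_AbsRing R_NormedModule t x Hx); subst x.
    destruct (H eps (cond_pos eps)) as (d & Hd & A).
    exists (mkposreal d Hd); intros y Hy. exact (A y I Hy).
Qed.

Lemma continuous_iff_continuous_in (f : R -> R) t :
  continuous f t <-> continuous_in (fun _ => True) f t.
Proof.
  split.
  - intros H eps He; destruct (proj1 (filterlim_locally _ _) H (mkposreal eps He)) as [d Hd].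
    exists d; split; [ apply cond_pos | ]. intros y _ Hy; exact (Hd y Hy).
  - intros H; apply filterlim_locally; intros eps.
    destruct (H eps (cond_pos eps)) as (d & Hd & A).
    exists (mkposreal d Hd); intros y Hy; exact (A y I Hy).
Qed.

Lemma derive_in_weaken (D D' : R -> Prop) f t l :
  (exists d, 0 < d /\ forall y, D' y -> Rabs (y - t) < d -> D y) ->
  derive_in D f t l -> derive_in D' f t l.
Proof.
  intros (d & Hd & HD) H eps He; destruct (H eps He) as (d' & Hd' & A).
  exists (Rmin d d'); split; [ now apply Rmin_pos | ]. intros y Hy Hyt.
  apply A; [ apply HD; trivial | ]; eapply Rlt_le_trans; try exact Hyt; [ apply Rmin_l | apply Rmin_r ].
Qed.

Lemma continuous_in_weaken (D D' : R -> Prop) f t :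
  (exists d, 0 < d /\ forall y, D' y -> Rabs (y - t) < d -> D y) ->
  continuous_in D f t -> continuous_in D' f t.
Proof.
  intros (d & Hd & HD) H eps He; destruct (H eps He) as (d' & Hd' & A).
  exists (Rmin d d'); split; [ now apply Rmin_pos | ]. intros y Hy Hyt.
  apply A; [ apply HD; trivial | ]; eapply Rlt_le_trans; try exact Hyt; [ apply Rmin_l | apply Rmin_r ].
Qed.

Lemma is_derive_derive_in D f t l : is_derive f t l -> derive_in D f t l.
Proof.
  intros H; apply is_derive_iff_derive_in in H; revert H; apply derive_in_weaken.
  exists 1; split; [ lra | trivial ].
Qed.

Lemma continuous_continuous_in D (f : R -> R) t : continuous f t -> continuous_in D f t.
Proof.
  intros H; apply continuous_iff_continuous_in in H; revert H; apply continuous_in_weaken.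
  exists 1; split; [ lra | trivial ].
Qed.

Lemma derive_in_interior (D : R -> Prop) f t l a b : a < t < b -> (forall y, a < y < b -> D y) ->
  derive_in D f t l -> is_derive f t l.
Proof.
  intros Ht HD H; apply is_derive_iff_derive_in; revert H; apply derive_in_weaken.
  exists (Rmin (t - a) (b - t)); split; [ apply Rmin_pos; lra | ].
  intros y _ Hy; apply HD. apply Rabs_lt_between in Hy.
  assert (A := Rmin_l (t - a) (b - t)). assert (B := Rmin_r (t - a) (b - t)). lra.
Qed.

Lemma derive_in_ext (D : R -> Prop) f g t l : D t -> (forall y, D y -> f y = g y) ->
  derive_in D f t l -> derive_in D g t l.
Proof.
  intros Ht E H eps He; destruct (H eps He) as (d & Hd & A); exists d; split; trivial.
  intros y Hy Hyt; rewrite <- !E by trivial; now apply A.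
Qed.

(** The factor [m] may be 0, since a geodesic arc of length 0 is reparametrized as well; this is why
    [eps] and [d] are divided by [m + 1]. *)
Lemma derive_in_comp_linear (D D' : R -> Prop) f m t l : 0 <= m ->
  (forall y, D' y -> D (m * y)) -> derive_in D f (m * t) l ->
  derive_in D' (fun y => f (m * y)) t (m * l).
Proof.
  intros Hm HD H eps He.
  assert (Hm' : 0 < m + 1) by lra.
  destruct (H (eps / (m + 1))) as (d & Hd & A); [ now apply Rdiv_lt_0_compat | ].
  exists (d / (m + 1)); split; [ now apply Rdiv_lt_0_compat | ].
  intros y Hy Hyt. assert (E : Rabs (m * y - m * t) = m * Rabs (y - t)).
  { rewrite <- Rmult_minus_distr_l, Rabs_mult, (Rabs_right m); lra. }
  assert (P := Rabs_pos (y - t)).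
  assert (F : (m + 1) * Rabs (y - t) < d).
  { apply Rmult_lt_compat_l with (r := m + 1) in Hyt; trivial.
    replace ((m + 1) * (d / (m + 1))) with d in Hyt by (field; lra). lra. }
  replace (f (m * y) - f (m * t) - (y - t) * (m * l)) with
    (f (m * y) - f (m * t) - (m * y - m * t) * l) by ring.
  eapply Rle_trans; [ apply A; [ now apply HD | rewrite E; nra ] | ].
  rewrite E. replace (eps / (m + 1) * (m * Rabs (y - t))) with
    (eps * Rabs (y - t) * (m / (m + 1))) by (field; lra).
  rewrite <- (Rmult_1_r (eps * Rabs (y - t))) at 2. apply Rmult_le_compat_l; [ nra | ].
  apply Rmult_le_reg_r with (m + 1); trivial. unfold Rdiv; rewrite Rmult_assoc, Rinv_l; lra.
Qed.

Lemma continuous_in_comp_linear (D D' : R -> Prop) f m t : 0 <= m ->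
  (forall y, D' y -> D (m * y)) -> continuous_in D f (m * t) ->
  continuous_in D' (fun y => m * f (m * y)) t.
Proof.
  intros Hm HD H eps He.
  assert (Hm' : 0 < m + 1) by lra.
  destruct (H (eps / (m + 1))) as (d & Hd & A); [ now apply Rdiv_lt_0_compat | ].
  exists (d / (m + 1)); split; [ now apply Rdiv_lt_0_compat | ].
  intros y Hy Hyt. assert (E : Rabs (m * y - m * t) = m * Rabs (y - t)).
  { rewrite <- Rmult_minus_distr_l, Rabs_mult, (Rabs_right m); lra. }
  assert (P := Rabs_pos (y - t)).
  assert (F : (m + 1) * Rabs (y - t) < d).
  { apply Rmult_lt_compat_l with (r := m + 1) in Hyt; trivial.
    replace ((m + 1) * (d / (m + 1))) with d in Hyt by (field; lra). lra. }
  rewrite <- Rmult_minus_distr_l, Rabs_mult, (Rabs_right m) by lra.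
  assert (B := A (m * y) (HD _ Hy) ltac:(rewrite E; nra)).
  assert (C := Rabs_pos (f (m * y) - f (m * t))).
  apply Rmult_lt_compat_l with (r := m + 1) in B; trivial.
  replace ((m + 1) * (eps / (m + 1))) with eps in B by (field; lra). lra.
Qed.

Ltac ring_R := match goal with |- ?a = ?b => change (@eq R a b) end; ring.

(** * C^1 curves that follow polygonal paths *)

Definition C1_fun (f f' : R -> R) : Prop :=
  forall t, is_derive f t (f' t) /\ continuous f' t.

Lemma C1_fun_continuous f f' t : C1_fun f f' -> continuous f t.
Proof. intros H; apply (ex_derive_continuous f); exists (f' t); apply H. Qed.

Lemma continuous_Rmax0 (f : R -> R) t : continuous f t -> continuous (fun s => Rmax 0 (f s)) t.
Proof.
  intros H; apply continuous_ext with (fun s => (f s + Rabs (f s)) * / 2).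
  { intros s; unfold Rmax, Rabs; destruct Rle_dec, Rcase_abs; lra. }
  apply (continuous_mult (fun s => f s + Rabs (f s)) (fun _ => / 2)); [ | apply continuous_const ].
  apply (continuous_plus f (fun s => Rabs (f s))); trivial.
  apply (continuous_comp f Rabs); trivial. apply continuous_Rabs.
Qed.

Lemma is_derive_continuous (f : R -> R) t l : is_derive f t l -> continuous f t.
Proof. intros H; apply (ex_derive_continuous f); now exists l. Qed.

Lemma is_RInt_derive_R (F f : R -> R) (a b l : R) :
  (forall x, is_derive F x (f x)) -> (forall x, continuous f x) -> F b - F a = l ->
  is_RInt f a b l.
Proof. intros H1 H2 <-; apply (is_RInt_derive F f a b); intros; [ apply H1 | apply H2 ]. Qed.

(** The velocity [6 t (1 - t)] of a time change of [[0, 1]], extended by 0. As it vanishes at both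
    ends, segments run through in this way fit together to C^1 curves on the whole line; the factor
    6 makes the integral 1. *)
Definition smoothstep' (t : R) : R := 6 * (Rmax 0 t * Rmax 0 (1 - t)).
Definition smoothstep (t : R) : R := RInt smoothstep' 0 t.

Lemma continuous_smoothstep' t : continuous smoothstep' t.
Proof.
  apply (continuous_mult (fun _ => 6) (fun t => Rmax 0 t * Rmax 0 (1 - t)));
    [ apply continuous_const | ].
  apply (continuous_mult (fun t => Rmax 0 t) (fun t => Rmax 0 (1 - t)));
    apply continuous_Rmax0; [ apply continuous_id | ].
  apply (is_derive_continuous _ t (- 1)); auto_derive; trivial; ring.
Qed.

Lemma smoothstep_C1 : C1_fun smoothstep smoothstep'.
Proof.
  intros t; split; [ | apply continuous_smoothstep' ].
  apply (is_derive_RInt smoothstep' smoothstep 0).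
  - apply filter_forall; intros x; apply (@RInt_correct R_CompleteNormedModule), (ex_RInt_continuous smoothstep').
    intros; apply continuous_smoothstep'.
  - apply continuous_smoothstep'.
Qed.

Lemma smoothstep'_nonneg t : 0 <= smoothstep' t.
Proof. unfold smoothstep'; assert (A := Rmax_l 0 t); assert (B := Rmax_l 0 (1 - t)); nra. Qed.

Lemma smoothstep'_out t : t <= 0 \/ 1 <= t -> smoothstep' t = 0.
Proof.
  unfold smoothstep'; intros [H | H];
    [ rewrite (Rmax_left 0 t) by lra | rewrite (Rmax_left 0 (1 - t)) by lra ]; ring.
Qed.

Lemma smoothstep_0 t : t <= 0 -> smoothstep t = 0.
Proof.
  intros Ht; unfold smoothstep. rewrite (RInt_ext _ (fun _ => 0)).
  - rewrite RInt_const; unfold scal; simpl; unfold mult; simpl; ring.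
  - intros x Hx; rewrite Rmin_right, Rmax_left in Hx by lra. apply smoothstep'_out; lra.
Qed.

Lemma smoothstep_at_1 : smoothstep 1 = 1.
Proof.
  unfold smoothstep; apply is_RInt_unique.
  apply is_RInt_ext with (fun t => 6 * t - 6 * t ^ 2).
  { intros x; rewrite Rmin_left, Rmax_right by lra; intros Hx; unfold smoothstep'.
    rewrite !Rmax_right by lra; ring_R. }
  apply (is_RInt_derive_R (fun t => 3 * t ^ 2 - 2 * t ^ 3)); [ intros x | intros x | ring ].
  - auto_derive; trivial; ring.
  - apply (is_derive_continuous _ x (6 - 12 * x)); auto_derive; trivial; ring.
Qed.

Lemma smoothstep_1 t : 1 <= t -> smoothstep t = 1.
Proof.
  intros Ht; rewrite <- smoothstep_at_1; unfold smoothstep.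
  assert (Hex : forall a b, ex_RInt smoothstep' a b).
  { intros; apply (ex_RInt_continuous smoothstep'); intros; apply continuous_smoothstep'. }
  rewrite <- (RInt_Chasles smoothstep' 0 1 t) by apply Hex.
  rewrite (RInt_ext smoothstep' (fun _ => 0) 1 t).
  - rewrite RInt_const; unfold scal, plus; simpl; unfold mult; simpl; ring.
  - intros x Hx; rewrite Rmin_left, Rmax_right in Hx by lra. apply smoothstep'_out; lra.
Qed.

Lemma smoothstep_incr s t : s <= t -> smoothstep s <= smoothstep t.
Proof.
  intros Hst; destruct (MVT_gen smoothstep s t smoothstep') as (c & _ & E).
  - intros; apply smoothstep_C1.
  - intros x _; apply continuity_pt_filterlim, (C1_fun_continuous _ _ x smoothstep_C1).
  - assert (A := smoothstep'_nonneg c). nra.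
Qed.

Lemma smoothstep_bounds t : 0 <= smoothstep t <= 1.
Proof.
  split.
  - destruct (Rle_dec t 0) as [H | H]; [ rewrite smoothstep_0; lra | ].
    rewrite <- (smoothstep_0 0) by lra. apply smoothstep_incr; lra.
  - destruct (Rle_dec 1 t) as [H | H]; [ rewrite smoothstep_1; lra | ].
    rewrite <- smoothstep_at_1. apply smoothstep_incr; lra.
Qed.

Lemma C1_fun_affine f f' a b : C1_fun f f' ->
  C1_fun (fun t => f (a * t + b)) (fun t => a * f' (a * t + b)).
Proof.
  intros H t.
  assert (D : is_derive (fun t => a * t + b) t a) by (auto_derive; trivial; ring).
  split.
  - exact (is_derive_comp f (fun t => a * t + b) t _ _ (proj1 (H (a * t + b))) D).
  - apply (continuous_mult (fun _ => a) (fun t => f' (a * t + b))); [ apply continuous_const | ].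
    apply (continuous_comp (fun t => a * t + b) f'); [ | apply H ].
    apply (is_derive_continuous _ t a D).
Qed.

Lemma C1_fun_plus f f' g g' : C1_fun f f' -> C1_fun g g' ->
  C1_fun (fun t => f t + g t) (fun t => f' t + g' t).
Proof.
  intros Hf Hg t; split.
  - apply (@is_derive_plus R_AbsRing R_NormedModule); [ apply Hf | apply Hg ].
  - apply (continuous_plus f' g'); [ apply Hf | apply Hg ].
Qed.

Lemma C1_fun_const c : C1_fun (fun _ => c) (fun _ => 0).
Proof.
  intros t; split; [ apply (@is_derive_const R_AbsRing R_NormedModule) | apply continuous_const ].
Qed.

Lemma C1_fun_ext f f' g g' : (forall t, f t = g t) -> (forall t, f' t = g' t) ->
  C1_fun f f' -> C1_fun g g'.
Proof.
  intros E E' H t; split.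
  - rewrite <- E'. apply is_derive_ext with f; trivial. apply H.
  - apply continuous_ext with f'; trivial. apply H.
Qed.

Lemma continuous_along (f : R * R -> R) (x y : R -> R) t : continuous f (x t, y t) ->
  continuous x t -> continuous y t -> continuous (fun s => f (x s, y s)) t.
Proof.
  intros Hf Hx Hy. apply (continuous_comp_2 x y (fun a b => f (a, b)) t Hx Hy).
  apply continuous_ext with f; trivial. now intros [a b].
Qed.

Definition curve_speed (u : R * R -> R) (x y x' y' : R -> R) (t : R) : R :=
  sqrt (hform u (x t, y t) (x' t) (y' t)).

(* The velocity vanishes outside (0, 1), so that successive pieces fit together. *)
Record traverses U u p q c (x y x' y' : R -> R) : Prop := {
  tr_C1_x : C1_fun x x';
  tr_C1_y : C1_fun y y';
  tr_before : forall t, t <= 0 -> (x t, y t) = p;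
  tr_after : forall t, 1 <= t -> (x t, y t) = q;
  tr_rest : forall t, t <= 0 \/ 1 <= t -> x' t = 0 /\ y' t = 0;
  tr_between : forall t, exists a b,
    path U u p (x t, y t) a /\ path U u (x t, y t) q b /\ a + b <= c;
  tr_length : RInt (curve_speed u x y x' y') 0 1 <= c }.

Section PathCurve.
Variables (U : R * R -> Prop) (u : R * R -> R).
Hypothesis MA : monge_ampere U u.

Let Ho := ma_open _ _ MA.
Let Hs := ma_smooth _ _ MA.

Lemma continuous_hform_along (x y x' y' : R -> R) t : U (x t, y t) ->
  continuous x t -> continuous y t -> continuous x' t -> continuous y' t ->
  continuous (fun s => hform u (x s, y s) (x' s) (y' s)) t.
Proof.
  intros HU Hx Hy Hx' Hy'.
  assert (C1 := continuous_along _ x y t (smooth_continuous U _ _ (smooth_hs U u MA ax1 ax1) HU) Hx Hy).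
  assert (C2 := continuous_along _ x y t (smooth_continuous U _ _ (smooth_hs U u MA ax1 ax2) HU) Hx Hy).
  assert (C3 := continuous_along _ x y t (smooth_continuous U _ _ (smooth_hs U u MA ax2 ax2) HU) Hx Hy).
  simpl in C1, C2, C3.
  apply continuous_ext with (fun s => h11 u (x s, y s) * (x' s * x' s) +
    (2 * h12 u (x s, y s)) * (x' s * y' s) + h22 u (x s, y s) * (y' s * y' s)).
  { intros s; unfold hform; ring_R. }
  repeat first [ exact C1 | exact C2 | exact C3 | exact Hx' | exact Hy' | apply continuous_const
    | apply @continuous_plus | apply @continuous_mult ].
Qed.

Lemma continuous_curve_speed (x y x' y' : R -> R) t : U (x t, y t) ->
  continuous x t -> continuous y t -> continuous x' t -> continuous y' t ->
  continuous (curve_speed u x y x' y') t.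
Proof.
  intros; apply (continuous_comp (fun s => hform u (x s, y s) (x' s) (y' s)) sqrt);
    [ now apply continuous_hform_along | apply continuous_sqrt ].
Qed.

Lemma ex_RInt_curve_speed (x y x' y' : R -> R) a b : C1_fun x x' -> C1_fun y y' ->
  (forall t, U (x t, y t)) -> ex_RInt (curve_speed u x y x' y') a b.
Proof.
  intros Hx Hy HU; apply (ex_RInt_continuous (curve_speed u x y x' y')); intros t _.
  apply continuous_curve_speed; trivial;
    try (now apply (C1_fun_continuous _ _ t Hx)); try (now apply (C1_fun_continuous _ _ t Hy));
    [ apply Hx | apply Hy ].
Qed.

(** The leg energy is the integral of [h], the squared speed of the affine parametrization, against
    [smoothstep'], which has total mass 1. The length is therefore at most its square root by
    Cauchy-Schwarz, derived here from a pointwise inequality with a free parameter [m]. *)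
Lemma leg_traverses p q : in_seg U p q -> exists x y x' y',
  traverses U u p q (sqrt (leg_energy u p q)) x y x' y'.
Proof.
  intros HU. set (d1 := fst q - fst p). set (d2 := snd q - snd p).
  set (x := fun t => fst p + smoothstep t * d1). set (y := fun t => snd p + smoothstep t * d2).
  set (x' := fun t => smoothstep' t * d1). set (y' := fun t => smoothstep' t * d2).
  assert (Hc : forall c d, C1_fun (fun t => c + smoothstep t * d) (fun t => smoothstep' t * d)).
  { intros c d t; split.
    - assert (A := proj1 (smoothstep_C1 t)). auto_derive; [ now exists (smoothstep' t) | ].
      replace (Derive (fun t => smoothstep t) t) with (smoothstep' t); [ ring | ].
      symmetry; apply is_derive_unique, A.
    - apply (continuous_mult smoothstep' (fun _ => d)); [ | apply continuous_const ].
      apply continuous_smoothstep'. }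
  assert (Hxy : forall t, (x t, y t) = seg p q (smoothstep t)) by reflexivity.
  assert (HUt : forall t, U (x t, y t)) by (intros t; rewrite Hxy; apply HU, smoothstep_bounds).
  exists x, y, x', y'; split; try apply Hc.
  - intros t Ht; now rewrite Hxy, smoothstep_0, seg_0.
  - intros t Ht; now rewrite Hxy, smoothstep_1, seg_1.
  - intros t Ht; unfold x', y'; rewrite smoothstep'_out by trivial; split; ring.
  - intros t; assert (B := smoothstep_bounds t); rewrite Hxy.
    exists (sqrt (leg_energy u p (seg p q (smoothstep t)))),
      (sqrt (leg_energy u (seg p q (smoothstep t)) q)); repeat split.
    + now apply path_one, in_seg_l.
    + now apply path_one, in_seg_r.
    + now apply (leg_split U).
  - set (e := leg_energy u p q).
    assert (He : 0 <= e) by now apply (leg_energy_nonneg U).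
    set (h := fun t => hform u (x t, y t) d1 d2).
    assert (Hch : forall t, continuous h t).
    { intros t; apply (continuous_hform_along x y (fun _ => d1) (fun _ => d2)); trivial;
        try apply continuous_const;
        [ apply (C1_fun_continuous _ _ t (Hc _ _)) | apply (C1_fun_continuous _ _ t (Hc _ _)) ]. }
    assert (Hh : forall t, 0 <= h t) by (intros t; now apply (hform_nonneg U)).
    assert (HI : is_RInt (fun t => smoothstep' t * h t) 0 1 e).
    { set (phi := fun s => d1 * partial ax1 u (seg p q s) + d2 * partial ax2 u (seg p q s)).
      apply (is_RInt_derive_R (fun t => phi (smoothstep t))); [ intros t | intros t | ].
      - assert (B := is_derive_grad_along_seg U u MA p q d1 d2 (smoothstep t)
          (HU _ (smoothstep_bounds t))).
        assert (D := is_derive_comp phi smoothstep t _ _ B (proj1 (smoothstep_C1 t))).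
        match type of D with is_derive _ _ ?l => replace (smoothstep' t * h t) with l end; trivial.
        unfold scal; simpl; unfold mult; simpl. unfold h; rewrite Hxy; unfold hform, d1, d2; ring_R.
      - apply (continuous_mult smoothstep' h); [ apply continuous_smoothstep' | apply Hch ].
      - unfold phi; rewrite (smoothstep_0 0), (smoothstep_1 1), seg_0, seg_1 by lra.
        unfold e, leg_energy, d1, d2; ring. }
    assert (HS : is_RInt smoothstep' 0 1 1).
    { rewrite <- smoothstep_at_1 at 2; apply (@RInt_correct R_CompleteNormedModule), (ex_RInt_continuous smoothstep').
      intros; apply continuous_smoothstep'. }
    (* AM-GM: [sqrt h <= h / (2 m) + m / 2] *)
    assert (HM : forall m, 0 < m -> RInt (curve_speed u x y x' y') 0 1 <= e * / (2 * m) + m / 2).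
    { intros m Hm.
      assert (HJ := is_RInt_plus _ _ _ _ _ _ (is_RInt_scal _ _ _ (/ (2 * m)) _ HI)
                      (is_RInt_scal _ _ _ (m / 2) _ HS)).
      unfold scal, plus in HJ; simpl in HJ; unfold mult in HJ; simpl in HJ.
      replace (e * / (2 * m) + m / 2) with (/ (2 * m) * e + m / 2 * 1) by ring.
      rewrite <- (is_RInt_unique _ _ _ _ HJ).
      apply RInt_le; [ lra | now apply ex_RInt_curve_speed; try apply Hc | eexists; exact HJ | ].
      intros t _; unfold curve_speed.
      assert (S := smoothstep'_nonneg t).
      replace (hform u (x t, y t) (x' t) (y' t)) with (smoothstep' t ^ 2 * h t)
        by (unfold h, hform, x', y'; ring).
      rewrite sqrt_mult_alt by apply pow2_ge_0. rewrite sqrt_pow2 by trivial.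
      assert (Q := sqrt_pos (h t)). assert (Q2 := pow2_sqrt (h t) (Hh t)).
      assert (K : sqrt (h t) <= / (2 * m) * h t + m / 2).
      { rewrite <- Q2 at 2. apply Rmult_le_reg_l with (2 * m); [ lra | ].
        replace (2 * m * (/ (2 * m) * sqrt (h t) ^ 2 + m / 2)) with (sqrt (h t) ^ 2 + m ^ 2)
          by (field; lra). assert (Z := pow2_ge_0 (sqrt (h t) - m)). nra. }
      replace (/ (2 * m) * (smoothstep' t * h t) + m / 2 * smoothstep' t) with
        (smoothstep' t * (/ (2 * m) * h t + m / 2)) by ring.
      now apply Rmult_le_compat_l. }
    (* The best parameter is [m = sqrt e]; [eps] is added because [e] may vanish. *)
    apply le_epsilon; intros eps Heps.
    assert (Q := sqrt_pos e). assert (Q2 := pow2_sqrt e He).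
    eapply Rle_trans; [ apply (HM (sqrt e + eps)); lra | ].
    assert (K : e * / (2 * (sqrt e + eps)) <= sqrt e / 2).
    { rewrite <- Q2 at 1. apply Rmult_le_reg_r with (2 * (sqrt e + eps)); [ lra | ].
      rewrite Rmult_assoc, Rinv_l by lra. nra. }
    lra.
Qed.
End PathCurve.

Lemma psum_ext f g n : (forall k, (k < n)%nat -> f k = g k) -> psum f n = psum g n.
Proof. induction n as [|n IH]; intros H; simpl; trivial. rewrite IH, H; auto. Qed.

Lemma psum_zero_tail f n m : (n <= m)%nat -> (forall k, (n <= k)%nat -> f k = 0) ->
  psum f m = psum f n.
Proof.
  intros Hnm H; induction Hnm as [|m Hm IH]; trivial. simpl; rewrite IH, H by lia; ring.
Qed.

Lemma psum_telescope (xi : nat -> R) n : psum (fun k => xi (S k) - xi k) n = xi n - xi O.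
Proof. induction n as [|n IH]; simpl; [ | rewrite IH ]; ring. Qed.

Lemma C1_fun_psum (f f' : nat -> R -> R) n : (forall k, C1_fun (f k) (f' k)) ->
  C1_fun (fun t => psum (fun k => f k t) n) (fun t => psum (fun k => f' k t) n).
Proof.
  intros H; induction n as [|n IH]; simpl; [ apply C1_fun_const | now apply C1_fun_plus ].
Qed.

Lemma C1_fun_loc f f' : (forall t, exists g g', C1_fun g g' /\
  forall s, Rabs (s - t) < 1 -> f s = g s /\ f' s = g' s) -> C1_fun f f'.
Proof.
  intros H t; destruct (H t) as (g & g' & Hg & E).
  assert (L : locally t (fun s => f s = g s /\ f' s = g' s)).
  { exists (mkposreal 1 Rlt_0_1); intros s Hs; apply E, Hs. }
  split.
  - rewrite (proj2 (locally_singleton _ _ L)). apply is_derive_ext_loc with g; [ | apply Hg ].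
    revert L; apply filter_imp; intros s [H1 _]; now symmetry.
  - apply continuous_ext_loc with g'; [ | apply Hg ].
    revert L; apply filter_imp; intros s [_ H1]; first [ exact H1 | now symmetry ].
Qed.

Lemma INR_up_nat t : t < INR (Z.to_nat (up t)).
Proof.
  destruct (archimed t) as [A _]; rewrite INR_IZR_INZ.
  destruct (Z.le_gt_cases 0 (up t)) as [H | H].
  - rewrite Z2Nat.id; lra || lia.
  - assert (B : IZR (up t) <= 0) by (apply IZR_le; lia).
    assert (C : 0 <= IZR (Z.of_nat (Z.to_nat (up t)))) by (apply IZR_le; lia). lra.
Qed.

(* Only finitely many terms of the sum are nonzero near a given time. *)
Lemma glue_functions (xi : nat -> R) (f f' : nat -> R -> R) :
  (forall k, C1_fun (f k) (f' k)) ->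
  (forall k t, t <= 0 -> f k t = xi k /\ f' k t = 0) ->
  (forall k t, 1 <= t -> f k t = xi (S k) /\ f' k t = 0) ->
  exists F F', C1_fun F F' /\ (forall t, t <= 0 -> F t = xi O /\ F' t = 0) /\
    forall k t, INR k <= t <= INR k + 1 -> F t = f k (t - INR k) /\ F' t = f' k (t - INR k).
Proof.
  intros HC H0 H1.
  (* Term [k] is 0 before time [k] and equal to [xi (S k) - xi k] after time [k + 1], so that the
     completed terms telescope. *)
  set (g := fun t k => f k (t - INR k) - xi k). set (g' := fun t k => f' k (t - INR k)).
  set (N := fun t => Z.to_nat (up t)).
  set (F := fun t => xi O + psum (g t) (N t)). set (F' := fun t => psum (g' t) (N t)).
  assert (EF : forall M t, t <= INR M -> F t = xi O + psum (g t) M /\ F' t = psum (g' t) M).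
  { assert (Z : forall M t k, t <= INR M -> (M <= k)%nat -> g t k = 0 /\ g' t k = 0).
    { intros M t k Ht Hk; apply le_INR in Hk.
      destruct (H0 k (t - INR k)) as [A B]; [ lra | ]. unfold g, g'; rewrite A, B; split; ring. }
    assert (S : forall M M' t, (M <= M')%nat -> t <= INR M ->
      psum (g t) M' = psum (g t) M /\ psum (g' t) M' = psum (g' t) M).
    { intros M M' t HM Ht; split; apply psum_zero_tail; trivial; intros k Hk; now apply (Z M t k). }
    intros M t Ht. assert (Hn : t <= INR (N t)) by apply Rlt_le, INR_up_nat.
    unfold F, F'. destruct (Nat.le_ge_cases M (N t)) as [L | L].
    - destruct (S _ _ t L Ht) as [-> ->]; auto.
    - destruct (S _ _ t L Hn) as [-> ->]; auto. }
  exists F, F'; split; [ | split ].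
  - apply C1_fun_loc; intros t. set (M := N (t + 1)).
    exists (fun s => xi O + psum (g s) M), (fun s => 0 + psum (g' s) M); split.
    + apply C1_fun_plus; [ apply C1_fun_const | ].
      apply (C1_fun_psum (fun k s => g s k) (fun k s => g' s k)); intros k.
      apply C1_fun_ext with (fun s => f k (1 * s + (- INR k)) + (- xi k))
        (fun s => 1 * f' k (1 * s + (- INR k)) + 0).
      * intros s; unfold g; replace (1 * s + - INR k) with (s - INR k) by ring; ring.
      * intros s; unfold g'; replace (1 * s + - INR k) with (s - INR k) by ring; ring.
      * apply C1_fun_plus; [ apply (C1_fun_affine _ _ 1 (- INR k)), HC | apply C1_fun_const ].
    + intros s Hs. apply Rabs_lt_between in Hs.
      destruct (EF M s) as [-> ->]; [ assert (A := INR_up_nat (t + 1)); unfold M, N; lra | ].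
      split; ring.
  - intros t Ht; destruct (EF O t Ht) as [-> ->]; simpl; split; ring.
  - intros k t Ht. destruct (EF (S k) t) as [-> ->]; [ rewrite S_INR; lra | ]. simpl.
    assert (E : forall j, (j < k)%nat -> g t j = xi (S j) - xi j /\ g' t j = 0).
    { intros j Hj; destruct (H1 j (t - INR j)) as [A B].
      - assert (HS : (S j <= k)%nat) by lia. apply le_INR in HS; rewrite S_INR in HS; lra.
      - unfold g, g'; rewrite A, B; auto. }
    rewrite (psum_ext (g t) (fun j => xi (S j) - xi j)) by (intros; now apply E).
    rewrite (psum_ext (g' t) (fun _ => 0)) by (intros; now apply E).
    rewrite psum_telescope, (psum_zero_tail (fun _ => 0) O k) by (lia || trivial).
    unfold g, g'; simpl; split; ring.
Qed.

Section Glue.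
Variables (U : R * R -> Prop) (u : R * R -> R).
Hypothesis MA : monge_ampere U u.

Lemma traverses_in p q c x y x' y' t : traverses U u p q c x y x' y' -> U (x t, y t).
Proof.
  intros H; destruct (tr_between _ _ _ _ _ _ _ _ _ H t) as (a & b & Ha & _).
  now apply path_snd in Ha.
Qed.

Lemma glue_traverses (q : nat -> R * R) (c : nat -> R) (X Y X' Y' : nat -> R -> R) :
  (forall k, traverses U u (q k) (q (S k)) (c k) (X k) (Y k) (X' k) (Y' k)) ->
  exists x y x' y', C1_fun x x' /\ C1_fun y y' /\
    (forall t, t <= 0 -> (x t, y t) = q O /\ x' t = 0 /\ y' t = 0) /\
    (forall k t, INR k <= t <= INR k + 1 -> x t = X k (t - INR k) /\ y t = Y k (t - INR k) /\
         x' t = X' k (t - INR k) /\ y' t = Y' k (t - INR k)) /\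
    (forall t, U (x t, y t)) /\
    (forall n, RInt (curve_speed u x y x' y') 0 (INR n) <= psum c n).
Proof.
  intros T.
  destruct (glue_functions (fun k => fst (q k)) X X') as (x & x' & Hx & Hx0 & Hxk).
  { intros k; apply (T k). }
  { intros k t Ht; destruct (T k) as [_ _ B _ R _ _]; split; [ now rewrite <- (B t Ht) | ].
    apply R; now left. }
  { intros k t Ht; destruct (T k) as [_ _ _ B R _ _]; split; [ now rewrite <- (B t Ht) | ].
    apply R; now right. }
  destruct (glue_functions (fun k => snd (q k)) Y Y') as (y & y' & Hy & Hy0 & Hyk).
  { intros k; apply (T k). }
  { intros k t Ht; destruct (T k) as [_ _ B _ R _ _]; split; [ now rewrite <- (B t Ht) | ].
    apply R; now left. }
  { intros k t Ht; destruct (T k) as [_ _ _ B R _ _]; split; [ now rewrite <- (B t Ht) | ].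
    apply R; now right. }
  assert (HU : forall t, U (x t, y t)).
  { intros t; destruct (Rle_dec t 0) as [Ht | Ht].
    - destruct (Hx0 t Ht) as [-> _], (Hy0 t Ht) as [-> _]. rewrite <- surjective_pairing.
      destruct (tr_between _ _ _ _ _ _ _ _ _ (T O) 0) as (a & b & Ha & _).
      now apply path_fst in Ha.
    - destruct (nfloor_ex t) as [k Hk]; [ lra | ].
      destruct (Hxk k t) as [-> _]; [ lra | ]. destruct (Hyk k t) as [-> _]; [ lra | ].
      apply (traverses_in _ _ _ _ _ _ _ _ (T k)). }
  exists x, y, x', y'. split; [ trivial | split; [ trivial | split; [ | split; [ | split; [ trivial | ]]]]].
  - intros t Ht; destruct (Hx0 t Ht) as [-> ->], (Hy0 t Ht) as [-> ->].
    now rewrite <- surjective_pairing.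
  - intros k t Ht; destruct (Hxk k t Ht), (Hyk k t Ht); auto.
  - assert (Hex : forall a b, ex_RInt (curve_speed u x y x' y') a b).
    { intros; now apply (ex_RInt_curve_speed U). }
    intros n; induction n as [|n IH].
    + simpl; rewrite RInt_point; apply Rle_refl.
    + rewrite <- (RInt_Chasles _ 0 (INR n) (INR (S n))) by apply Hex.
      apply Rplus_le_compat; trivial.
      destruct (T n) as [Cx Cy _ _ _ _ L]; eapply Rle_trans; [ | exact L ]. apply Req_le.
      assert (E := RInt_comp_lin (curve_speed u (X n) (Y n) (X' n) (Y' n)) 1 (- INR n) (INR n) (INR (S n))).
      replace (1 * INR n + - INR n) with 0 in E by ring.
      replace (1 * INR (S n) + - INR n) with 1 in E by (rewrite S_INR; ring).
      rewrite <- E.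
      * apply RInt_ext; intros t Ht.
        rewrite Rmin_left, Rmax_right in Ht by (rewrite S_INR; lra). rewrite S_INR in Ht.
        destruct (Hxk n t) as [E1 E2]; [ lra | ]. destruct (Hyk n t) as [E3 E4]; [ lra | ].
        unfold curve_speed. rewrite E1, E2, E3, E4.
        replace (1 * t + - INR n) with (t - INR n) by ring.
        symmetry; apply Rmult_1_l.
      * apply (ex_RInt_curve_speed U); trivial. intros t; apply (traverses_in _ _ _ _ _ _ _ _ (T n)).
Qed.

(** A curve at rest, used to extend finite paths to the infinite sequences that [glue_traverses]
    expects. *)
Lemma traverses_const p : U p ->
  traverses U u p p 0 (fun _ => fst p) (fun _ => snd p) (fun _ => 0) (fun _ => 0).
Proof.
  intros Hp; split; try apply C1_fun_const; try (intros; now rewrite <- surjective_pairing).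
  - auto.
  - intros t; exists 0, 0; rewrite <- surjective_pairing; repeat split; try now apply path_nil. lra.
  - rewrite (RInt_ext _ (fun _ => 0)).
    + rewrite RInt_const; unfold scal; simpl; unfold mult; simpl; lra.
    + intros t _; unfold curve_speed, hform. replace (_ + _) with 0 by ring. apply sqrt_0.
Qed.

(** The first leg and the rest of the path are glued on [[0, 2]], continued by rest at the endpoint,
    and then run through at double speed. *)
Lemma path_traverses p q c : path U u p q c -> exists x y x' y', traverses U u p q c x y x' y'.
Proof.
  induction 1 as [p Hp | p q r c Hl Hp IH].
  - eexists _, _, _, _; now apply traverses_const.
  - destruct (leg_traverses U u MA p q Hl) as (x0 & y0 & x0' & y0' & T0).
    destruct IH as (x1 & y1 & x1' & y1' & T1).
    destruct (glue_traverses (fun k => match k with O => p | 1%nat => q | _ => r end)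
      (fun k => match k with O => sqrt (leg_energy u p q) | 1%nat => c | _ => 0 end)
      (fun k => match k with O => x0 | 1%nat => x1 | _ => fun _ => fst r end)
      (fun k => match k with O => y0 | 1%nat => y1 | _ => fun _ => snd r end)
      (fun k => match k with O => x0' | 1%nat => x1' | _ => fun _ => 0 end)
      (fun k => match k with O => y0' | 1%nat => y1' | _ => fun _ => 0 end))
      as (x & y & x' & y' & Hx & Hy & H0 & Hk & HU & HL).
    { intros [|[|k]]; trivial. apply traverses_const. now apply path_snd in Hp. }
    assert (H2 : forall t, 2 <= t -> (x t, y t) = r /\ x' t = 0 /\ y' t = 0).
    { intros t Ht; destruct (nfloor_ex t) as [k Hkt]; [ lra | ].
      destruct (Hk k t) as (-> & -> & -> & ->); [ lra | ].
      destruct k as [|[|k]]; simpl in Hkt.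
      - lra.
      - assert (Et : t = 2) by lra. subst t. simpl INR.
        split; [ apply (tr_after _ _ _ _ _ _ _ _ _ T1); lra | ].
        apply (tr_rest _ _ _ _ _ _ _ _ _ T1); lra.
      - now rewrite <- surjective_pairing. }
    assert (Hpq := path_one U u p q Hl).
    exists (fun t => x (2 * t + 0)), (fun t => y (2 * t + 0)),
      (fun t => 2 * x' (2 * t + 0)), (fun t => 2 * y' (2 * t + 0)).
    split; try now apply C1_fun_affine.
    + intros t Ht; apply H0; lra.
    + intros t Ht; apply H2; lra.
    + intros t [Ht | Ht].
      * destruct (H0 (2 * t + 0)) as (_ & -> & ->); lra.
      * destruct (H2 (2 * t + 0)) as (_ & -> & ->); lra.
    + intros t. destruct (Rle_dec t 0) as [h0 | h0]; [ | destruct (Rle_dec 1 t) as [h1 | h1] ].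
      * destruct (H0 (2 * t + 0)) as (-> & _); [ lra | ].
        exists 0, (sqrt (leg_energy u p q) + c); repeat split; [ | | lra ].
        -- apply path_nil; now apply in_seg_fst in Hl.
        -- now apply path_cons.
      * destruct (H2 (2 * t + 0)) as (-> & _); [ lra | ].
        exists (sqrt (leg_energy u p q) + c), 0; repeat split; [ | | lra ].
        -- now apply path_cons.
        -- apply path_nil; now apply path_snd in Hp.
      * destruct (Rle_dec (2 * t + 0) 1) as [h2 | h2].
        -- destruct (Hk O (2 * t + 0)) as (-> & -> & _); [ simpl; lra | ].
           destruct (tr_between _ _ _ _ _ _ _ _ _ T0 (2 * t + 0 - INR 0)) as (a & b & Pa & Pb & Pab).
           exists a, (b + c); repeat split; trivial; [ now apply path_app with q | lra ].
        -- destruct (Hk 1%nat (2 * t + 0)) as (-> & -> & _); [ simpl; lra | ].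
           destruct (tr_between _ _ _ _ _ _ _ _ _ T1 (2 * t + 0 - INR 1)) as (a & b & Pa & Pb & Pab).
           exists (sqrt (leg_energy u p q) + a), b; repeat split; trivial; [ now apply path_cons | lra ].
    + assert (L := HL 2%nat). simpl in L.
      eapply Rle_trans; [ | eapply Rle_trans; [ exact L | lra ] ]. apply Req_le.
      assert (E := RInt_comp_lin (curve_speed u x y x' y') 2 0 0 1).
      replace (2 * 0 + 0) with 0 in E by ring. replace (2 * 1 + 0) with (1 + 1) in E by ring.
      rewrite <- E by now apply (ex_RInt_curve_speed U).
      apply RInt_ext; intros t _; unfold curve_speed, scal; simpl; unfold mult; simpl.
      replace (hform u (x (2 * t + 0), y (2 * t + 0)) (2 * x' (2 * t + 0)) (2 * y' (2 * t + 0)))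
        with (2 ^ 2 * hform u (x (2 * t + 0), y (2 * t + 0)) (x' (2 * t + 0)) (y' (2 * t + 0)))
        by (unfold hform; ring).
      rewrite sqrt_mult_alt, sqrt_pow2 by lra; reflexivity.
Qed.
End Glue.

Lemma psum_bounded_terms_small (l : nat -> R) (B : R) :
  (forall k, 0 <= l k) -> (forall n, psum l n <= B) ->
  forall eta, 0 < eta -> exists K, forall k, (K <= k)%nat -> l k < eta.
Proof.
  intros H0 HB eta He.
  destruct (ex_finite_lim_seq_incr (psum l) B) as [L HL]; trivial.
  { intros n; simpl; specialize (H0 n); lra. }
  assert (HS := proj1 (is_lim_seq_incr_1 _ _) HL).
  apply is_lim_seq_spec in HL; apply is_lim_seq_spec in HS.
  assert (He2 : 0 < eta / 2) by lra.
  destruct (HL (mkposreal _ He2)) as [N1 A1]. destruct (HS (mkposreal _ He2)) as [N2 A2].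
  exists (Nat.max N1 N2); intros k Hk.
  specialize (A1 k ltac:(lia)); specialize (A2 k ltac:(lia)); simpl in A1, A2.
  apply Rabs_lt_between in A1; apply Rabs_lt_between in A2. lra.
Qed.

Section EscapeCurve.
Variables (U : R * R -> Prop) (u : R * R -> R).
Hypothesis MA : monge_ampere U u.

Let Ho := ma_open _ _ MA.

(** A late visit at a point [z] of [exhaustion U n] is impossible, because late pieces are too cheap
    to cover the sup-distance [d]. Either the current piece still has to reach a vertex at least [d]
    away from [z], or this vertex is close to [z], hence in the exhaustion set of index [m], and the
    next piece covers at least [d] by the lower bound on steps. *)
Lemma escape_curve p rho eps :
  U p -> unbounded_within U u p rho -> 0 < eps ->
  exists x y x' y', C1_fun x x' /\ C1_fun y y' /\ (x 0, y 0) = p /\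
    (forall t, U (x t, y t)) /\
    (forall n, RInt (curve_speed u x y x' y') 0 (INR n) <= rho + eps) /\
    (forall n, exists T, forall t, T <= t -> ~ exhaustion U n (x t, y t)).
Proof.
  intros Hp Hb He.
  destruct (escape_sequence U u MA p rho eps Hp Hb He) as (q & l & Hq0 & Hpath & Hstep & Hsum).
  assert (Hl : forall k, 0 <= l k) by (intros k; exact (path_nonneg _ _ _ _ _ (Hpath k))).
  assert (H' : forall k, exists w : (R -> R) * (R -> R) * (R -> R) * (R -> R),
    traverses U u (q k) (q (S k)) (l k) (fst (fst (fst w))) (snd (fst (fst w))) (snd (fst w)) (snd w)).
  { intros k; destruct (path_traverses U u MA _ _ _ (Hpath k)) as (x & y & x' & y' & T).
    now exists (x, y, x', y'). }
  set (w := fun k => proj1_sig (constructive_indefinite_description _ (H' k))).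
  assert (T : forall k, traverses U u (q k) (q (S k)) (l k) (fst (fst (fst (w k))))
    (snd (fst (fst (w k)))) (snd (fst (w k))) (snd (w k))).
  { intros k; unfold w; destruct constructive_indefinite_description; trivial. }
  clearbody w; clear H'.
  destruct (glue_traverses U u MA q l _ _ _ _ T)
    as (x & y & x' & y' & Hx & Hy & H0 & Hk & HU & HL).
  exists x, y, x', y'. split; [ trivial | split; [ trivial | split; [ | split; [ trivial | split ] ]]].
  - rewrite <- Hq0. apply H0; lra.
  - intros n; eapply Rle_trans; [ apply HL | apply Hsum ].
  - intros n. set (m := (2 * n + 1)%nat).
    destruct (htr_bounded U u MA m) as (B & HB & HBm).
    assert (Hm : INR m + 1 = 2 * (INR n + 1)).
    { unfold m; rewrite plus_INR, mult_INR; simpl; ring. }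
    assert (Hn := INR1_pos n).
    set (d := / (2 * (INR m + 1))).
    assert (Hd : 0 < d) by (apply Rinv_0_lt_compat; lra).
    assert (Hd2 : d + d = / (2 * (INR n + 1))) by (unfold d; rewrite Hm; field; lra).
    assert (SB : 0 < sqrt B) by now apply sqrt_lt_R0.
    destruct (psum_bounded_terms_small l (rho + eps) Hl Hsum (d / sqrt B)) as [K HK].
    { now apply Rdiv_lt_0_compat. }
    assert (HK' : forall k, (K <= k)%nat -> sqrt B * l k < d).
    { intros k Hkk; specialize (HK k Hkk). apply Rmult_lt_compat_l with (r := sqrt B) in HK; trivial.
      replace (sqrt B * (d / sqrt B)) with d in HK by (field; lra). exact HK. }
    exists (INR K); intros t Ht Hex.
    destruct (nfloor_ex t) as [k Hkt]; [ assert (P := pos_INR K); lra | ].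
    assert (HKk : (K <= k)%nat).
    { apply Nat.lt_succ_r, INR_lt; rewrite S_INR; lra. }
    destruct (Hk k t) as (Ex & Ey & _); [ lra | ]. rewrite Ex, Ey in Hex.
    destruct (tr_between _ _ _ _ _ _ _ _ _ (T k) (t - INR k)) as (a & b & Pa & Pb & Pab).
    set (z := (fst (fst (fst (w k))) (t - INR k), snd (fst (fst (w k))) (t - INR k))) in *.
    assert (Ha := path_nonneg _ _ _ _ _ Pa).
    assert (Hnear : forall v, supd v z <= d + d -> exhaustion U m v).
    { intros v Hv; apply exhaustion_near with z; trivial. now rewrite <- Hd2. }
    destruct (Rlt_le_dec (supd (q (S k)) z) d) as [Hc | Hc].
    + assert (Hstep' := Hstep (S k) m (Hnear (q (S k)) ltac:(lra))). fold d in Hstep'.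
      assert (C := path_cost_ge U u MA (q (S k)) d B (q (S k)) (q (S (S k))) (l (S k))).
      rewrite supd_refl in C. specialize (HK' (S k) ltac:(lia)).
      assert (d - 0 <= sqrt B * l (S k)); [ | lra ].
      apply C; [ | apply Hpath | lra ].
      intros v Hv; apply HBm, Hnear. assert (Tr := supd_triang v (q (S k)) z). lra.
    + assert (C := path_cost_ge U u MA z d B z (q (S k)) b).
      rewrite supd_refl in C. specialize (HK' k HKk).
      assert (d - 0 <= sqrt B * b); [ | nra ].
      apply C; [ | exact Pb | lra ].
      intros v Hv; apply HBm, Hnear; lra.
Qed.
End EscapeCurve.

(** * Escaping curves and the distance to the boundary *)

Lemma compact_in_exhaustion U K : open U -> compact_set K -> (forall p, K p -> U p) ->
  exists n, forall p, K p -> exhaustion U n p.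
Proof.
  intros Ho HK HKU.
  (* The exhaustion sets with strict inequalities, which makes them open; they still cover [U]. *)
  set (V := fun (n : nat) z => supd z (0, 0) < INR n + 1 /\
    exists r, / (INR n + 1) < r /\ forall y, supd y z < r -> U y).
  assert (HV : forall n z, V n z -> exhaustion U n z).
  { intros n z [H1 (r & Hr & H2)]; split; [ lra | ]. intros y Hy; apply H2; lra. }
  destruct (HK (fun W => exists n, W = V n)) as (l & Hl & Hc).
  - intros W [n ->] z [H1 (r & Hr & H2)]. apply locally_supd.
    set (r' := (r + / (INR n + 1)) / 2).
    exists (Rmin (INR n + 1 - supd z (0, 0)) (r - r')); split; [ apply Rmin_pos; unfold r'; lra | ].
    intros y Hy.
    assert (Hy1 := Rlt_le_trans _ _ _ Hy (Rmin_l _ _)).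
    assert (Hy2 := Rlt_le_trans _ _ _ Hy (Rmin_r _ _)). split.
    + assert (A := supd_triang y z (0, 0)); lra.
    + exists r'; split; [ unfold r'; lra | ]. intros w Hw; apply H2.
      assert (A := supd_triang w y z); lra.
  - intros p Hp. destruct (exhaustion_covers U p Ho (HKU p Hp)) as [n [H1 H2]].
    exists (V (S n)); split; [ now exists (S n) | ]. split.
    + rewrite S_INR; lra.
    + exists (/ (INR n + 1)); split; trivial. rewrite S_INR.
      assert (A := INR1_pos n). apply Rinv_lt_contravar; [ apply Rmult_lt_0_compat | ]; lra.
  - assert (Hb : exists N, forall W, In W l -> forall p, W p -> exhaustion U N p).
    { clear Hc; induction l as [|W l IH].
      - exists O; intros W [].
      - destruct IH as [N HN]; [ intros; apply Hl; now right | ].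
        destruct (Hl W (or_introl eq_refl)) as [n En].
        exists (Nat.max N n); intros W' [<- | HW'] p Hp.
        + apply exhaustion_le with n; [ lia | ]. apply HV. now rewrite <- En.
        + apply exhaustion_le with N; [ lia | ]. now apply HN with W'. }
    destruct Hb as [N HN]; exists N; intros p Hp.
    destruct (Hc p Hp) as (W & HW & HWp). now apply HN with W.
Qed.

Lemma is_RInt_gen_at_left (f L : R -> R) (a b l : R) :
  (exists c, c < b /\ forall T, c < T < b -> is_RInt f a T (L T)) ->
  (forall e, 0 < e -> exists c, c < b /\ forall T, c < T < b -> Rabs (L T - l) < e) ->
  is_RInt_gen f (at_point a) (at_left b) l.
Proof.
  intros (c0 & Hc0 & H) Hlim P [e He].
  destruct (Hlim e (cond_pos e)) as (c & Hc & A).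
  exists (fun x => x = a) (fun T => c0 < T < b /\ c < T < b).
  - reflexivity.
  - assert (Hm : Rmax c0 c < b) by now apply Rmax_lub_lt.
    exists (mkposreal (b - Rmax c0 c) ltac:(lra)); intros T HT HTb.
    change (Rabs (T - b) < b - Rmax c0 c) in HT. apply Rabs_lt_between in HT.
    assert (B1 := Rmax_l c0 c). assert (B2 := Rmax_r c0 c). split; lra.
  - intros x T -> [H1 H2]; exists (L T); split; [ now apply H | ].
    apply He, A, H2.
Qed.

Lemma is_RInt_gen_at_left_inv (f : R -> R) (a b l e : R) :
  is_RInt_gen f (at_point a) (at_left b) l -> 0 < e ->
  exists c, c < b /\ forall T, c < T < b -> exists y, is_RInt f a T y /\ Rabs (y - l) < e.
Proof.
  intros H He.
  destruct (H (ball l (mkposreal e He)) (locally_ball l _)) as [Q S HQ [d Hd] HP].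
  exists (b - d); split; [ assert (A := cond_pos d); lra | ].
  intros T HT. destruct (HP a T) as (y & Hy & B).
  - exact HQ.
  - apply Hd; [ | lra ]. change (Rabs (T - b) < d). apply Rabs_lt_between; lra.
  - exists y; split; trivial.
Qed.

Lemma derive_in_continuous_in D f t l : derive_in D f t l -> continuous_in D f t.
Proof.
  intros H e He. destruct (H 1 Rlt_0_1) as (d & Hd & A).
  assert (Hl : 0 < 2 + Rabs l) by (assert (P := Rabs_pos l); lra).
  exists (Rmin d (e / (2 + Rabs l))); split; [ apply Rmin_pos; trivial; now apply Rdiv_lt_0_compat | ].
  intros y Hy Hyt. specialize (A y Hy (Rlt_le_trans _ _ _ Hyt (Rmin_l _ _))).
  assert (B := Rlt_le_trans _ _ _ Hyt (Rmin_r _ _)).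
  apply Rmult_lt_compat_l with (r := 2 + Rabs l) in B; trivial.
  replace ((2 + Rabs l) * (e / (2 + Rabs l))) with e in B by (field; lra).
  assert (C := Rabs_triang (f y - f t - (y - t) * l) ((y - t) * l)).
  replace (f y - f t - (y - t) * l + (y - t) * l) with (f y - f t) in C by ring.
  rewrite (Rabs_mult (y - t)) in C. assert (P := Rabs_pos (y - t)). nra.
Qed.

Lemma monotone_limit_from_below (L : R -> R) (a b M : R) : a < b ->
  (forall s t, a < s -> s <= t -> t < b -> L s <= L t) -> (forall t, a < t < b -> L t <= M) ->
  exists l, l <= M /\ forall e, 0 < e -> exists c, c < b /\ forall T, c < T < b -> Rabs (L T - l) < e.
Proof.
  intros Hab Hinc HM.
  destruct (completeness (fun y => exists t, a < t < b /\ y = L t)) as [l [H1 H2]].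
  - exists M; intros y (t & Ht & ->); now apply HM.
  - exists (L ((a + b) / 2)), ((a + b) / 2); split; [ lra | trivial ].
  - exists l; split.
    + apply H2; intros y (t & Ht & ->); now apply HM.
    + intros e He. assert (Hex : exists t, a < t < b /\ l - e < L t).
      { apply NNPP; intros Hn; assert (l <= l - e); [ | lra ].
        apply H2; intros y (t & Ht & ->). apply Rnot_lt_le; intros Hlt; apply Hn; now exists t. }
      destruct Hex as (t & Ht & Hlt). exists t; split; [ lra | ]. intros T HT.
      assert (A := Hinc t T ltac:(lra) ltac:(lra) ltac:(lra)).
      assert (B : L T <= l) by (apply H1; exists T; split; [ lra | trivial ]).
      apply Rabs_lt_between; lra.
Qed.

Lemma gnorm_hform U u p v : monge_ampere U u -> U p ->
  gnorm (Hess u) p v = sqrt (hform u p (fst v) (snd v)).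
Proof.
  intros MA Hp; unfold gnorm, bilin, sum2; rewrite !(Hess_hs U u MA) by trivial.
  f_equal; unfold hform; simpl; ring.
Qed.

Section NoEscape.
Variables (U : R * R -> Prop) (u : R * R -> R).
Hypothesis MA : monge_ampere U u.
Variables (gamma : R) (C C' : R -> R * R).
Hypothesis RD : realizes_dist_boundary U (Hess u) C C' gamma.

Lemma geodesic_C1 s : ivl_co 0 gamma s ->
  derive_in (ivl_co 0 gamma) (fun t => fst (C t)) s (fst (C' s)) /\
  derive_in (ivl_co 0 gamma) (fun t => snd (C t)) s (snd (C' s)) /\
  continuous_in (ivl_co 0 gamma) (fun t => fst (C' t)) s /\
  continuous_in (ivl_co 0 gamma) (fun t => snd (C' t)) s.
Proof.
  intros Hs; destruct (rdb_geodesic _ _ _ _ _ RD s Hs) as [H1 H2].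
  apply is_derive_within_iff in H1; trivial. apply is_derive_within_iff in H2; trivial.
  destruct H1 as [A1 A2], H2 as [B1 B2].
  repeat split; trivial; eapply derive_in_continuous_in; eassumption.
Qed.

(** The geodesic up to time [s], followed by the escaping curve, is a competitor in the definition
    of the distance to the boundary, of length at most [s + M]. *)
Lemma dist_boundary_reached s (x y x' y' : R -> R) (M : R) :
  0 <= s < gamma -> C1_fun x x' -> C1_fun y y' -> (x 0, y 0) = C s ->
  (forall t, U (x t, y t)) ->
  (forall n, RInt (curve_speed u x y x' y') 0 (INR n) <= M) ->
  (forall n, exists T, forall t, T <= t -> ~ exhaustion U n (x t, y t)) ->
  gamma <= s + M.
Proof.
  intros Hs Hx Hy H0 HU HM Hleave.
  assert (Ho := ma_open _ _ MA).
  (* A bijection of [[1/2, 1)] onto [[0, infinity)]: the second half of the parameter interval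
     carries the whole escaping curve. *)
  set (tau := fun t => (2 * t - 1) / (1 - t)).
  set (dtau := fun t => / (1 - t) ^ 2).
  assert (Dtau : forall t, t < 1 -> is_derive tau t (dtau t)).
  { intros t Ht; unfold tau, dtau; auto_derive; [ lra | field; lra ]. }
  assert (Ctau : forall t, t < 1 -> continuous dtau t).
  { intros t Ht; apply (is_derive_continuous _ t (2 * / (1 - t) ^ 3)).
    unfold dtau; auto_derive; [ apply Rgt_not_eq; nra | field; lra ]. }
  assert (Htau0 : tau (1 / 2) = 0) by (unfold tau; field).
  set (e := fun t => if Rle_dec t (1 / 2) then C (2 * s * t) else (x (tau t), y (tau t))).
  set (Sp := curve_speed u x y x' y').
  assert (ExS : forall a b, ex_RInt Sp a b) by (intros; now apply (ex_RInt_curve_speed U)).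
  assert (E1 : forall t, t <= 1 / 2 -> e t = C (2 * s * t)).
  { intros t Ht; unfold e; destruct Rle_dec; trivial; contradiction. }
  assert (E2 : forall t, 1 / 2 <= t -> e t = (x (tau t), y (tau t))).
  { intros t Ht; unfold e; destruct Rle_dec as [h | h]; trivial.
    assert (t = 1 / 2) by lra. subst t. rewrite Htau0, H0. f_equal; field. }
  set (D1 := fun t => ivl_co 0 1 t /\ ivl_cc 0 (1 / 2) t).
  set (D2 := fun t => ivl_co 0 1 t /\ ivl_cc (1 / 2) 1 t).
  set (v1 := fun t => (2 * s * fst (C' (2 * s * t)), 2 * s * snd (C' (2 * s * t)))).
  set (v2 := fun t => (dtau t * x' (tau t), dtau t * y' (tau t))).
  assert (Hlin : forall t, D1 t -> ivl_co 0 gamma (2 * s * t)).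
  { intros t [_ Ht]; unfold ivl_cc, ivl_co in *; nra. }
  assert (P1 : C1_within D1 e v1).
  { intros t Ht. destruct (geodesic_C1 _ (Hlin t Ht)) as (A1 & A2 & A3 & A4).
    split.
    - apply is_derive_within_iff; trivial. split.
      + apply (derive_in_ext D1 (fun t => fst (C (2 * s * t)))); trivial.
        { intros r [_ Hr]; rewrite E1; [ trivial | apply Hr ]. }
        apply (derive_in_comp_linear (ivl_co 0 gamma) D1 (fun t => fst (C t)) (2 * s)); trivial; lra.
      + apply (derive_in_ext D1 (fun t => snd (C (2 * s * t)))); trivial.
        { intros r [_ Hr]; rewrite E1; [ trivial | apply Hr ]. }
        apply (derive_in_comp_linear (ivl_co 0 gamma) D1 (fun t => snd (C t)) (2 * s)); trivial; lra.
    - apply continuous_within_iff; split; unfold v1; simpl.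
      + apply (continuous_in_comp_linear (ivl_co 0 gamma) D1 (fun t => fst (C' t)) (2 * s)); trivial; lra.
      + apply (continuous_in_comp_linear (ivl_co 0 gamma) D1 (fun t => snd (C' t)) (2 * s)); trivial; lra. }
  assert (Dxt : forall z z' t, C1_fun z z' -> t < 1 ->
    is_derive (fun t => z (tau t)) t (dtau t * z' (tau t)) /\
    continuous (fun t => dtau t * z' (tau t)) t).
  { intros z z' t Hz Ht; split.
    - exact (is_derive_comp z tau t _ _ (proj1 (Hz (tau t))) (Dtau t Ht)).
    - apply (continuous_mult dtau (fun t => z' (tau t))); [ now apply Ctau | ].
      apply (continuous_comp tau z'); [ | apply Hz ].
      now apply (is_derive_continuous _ t (dtau t)), Dtau. }
  assert (P2 : C1_within D2 e v2).
  { intros t Ht. assert (Ht1 : t < 1) by apply Ht. split.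
    - apply is_derive_within_iff; trivial. split.
      + apply (derive_in_ext D2 (fun t => x (tau t))); trivial.
        { intros r [_ Hr]; rewrite E2; [ trivial | apply Hr ]. }
        apply is_derive_derive_in, (Dxt x x' t Hx Ht1).
      + apply (derive_in_ext D2 (fun t => y (tau t))); trivial.
        { intros r [_ Hr]; rewrite E2; [ trivial | apply Hr ]. }
        apply is_derive_derive_in, (Dxt y y' t Hy Ht1).
    - apply continuous_within_iff; split; unfold v2; simpl; apply continuous_continuous_in.
      + apply (Dxt x x' t Hx Ht1).
      + apply (Dxt y y' t Hy Ht1). }
  assert (CB : curve_to_boundary U (C 0) e).
  { split; [ | split; [ | split ] ].
    - intros t Ht. destruct (Rle_dec t (1 / 2)) as [h | h].
      + rewrite E1 by trivial. apply (rdb_in _ _ _ _ _ RD), Hlin; split; trivial.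
        split; [ apply Ht | trivial ].
      + rewrite E2 by lra. apply HU.
    - exists 2%nat, (fun i => match i with O => 0 | 1%nat => 1 / 2 | _ => 1 end).
      split; [ trivial | split; [ trivial | ] ]. intros [|[|i]] Hi; [ | | lia ].
      + split; [ lra | now exists v1 ].
      + split; [ lra | now exists v2 ].
    - rewrite E1 by lra. now rewrite Rmult_0_r.
    - intros K HK HKU. destruct (compact_in_exhaustion U K Ho HK HKU) as [n Hn].
      destruct (Hleave n) as [T0 HT0].
      set (T1 := Rmax T0 0). assert (HT1 := Rmax_l T0 0 : T0 <= T1).
      assert (HT1' := Rmax_r T0 0 : 0 <= T1).
      assert (Hb1 : (T1 + 1) / (T1 + 2) < 1).
      { apply Rmult_lt_reg_r with (T1 + 2); [ lra | ]. unfold Rdiv; rewrite Rmult_assoc, Rinv_l; lra. }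
      assert (Hb2 : 1 / 2 <= (T1 + 1) / (T1 + 2)).
      { apply Rmult_le_reg_r with (T1 + 2); [ lra | ].
        unfold Rdiv; rewrite (Rmult_assoc (T1 + 1)), Rinv_l; lra. }
      exists ((T1 + 1) / (T1 + 2)); split; [ lra | ]. intros t Ht HKt.
      apply Hn in HKt; revert HKt. rewrite E2 by lra. apply HT0.
      apply Rle_trans with T1; trivial. unfold tau.
      apply Rmult_le_reg_r with (1 - t); [ lra | ]. unfold Rdiv at 1; rewrite Rmult_assoc, Rinv_l by lra.
      assert (Q : T1 + 1 < t * (T1 + 2)).
      { apply Rmult_lt_reg_r with (/ (T1 + 2)); [ apply Rinv_0_lt_compat; lra | ].
        rewrite Rmult_assoc, Rinv_r by lra. unfold Rdiv in Ht; lra. }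
      lra. }
  assert (I1 : is_RInt (speed (Hess u) e) 0 (1 / 2) s).
  { apply is_RInt_ext with (fun _ => 2 * s).
    - rewrite Rmin_left, Rmax_right by lra. intros t Ht.
      assert (HDt : D1 t) by (split; split; lra).
      destruct (P1 t HDt) as [A _]. apply is_derive_within_iff in A; trivial.
      destruct A as [A1 A2].
      apply (derive_in_interior _ _ _ _ 0 (1 / 2)) in A1; [ | lra | intros r Hr; split; split; lra ].
      apply (derive_in_interior _ _ _ _ 0 (1 / 2)) in A2; [ | lra | intros r Hr; split; split; lra ].
      unfold speed, velocity. rewrite (is_derive_unique _ _ _ A1), (is_derive_unique _ _ _ A2).
      rewrite E1 by lra. assert (Hin := Hlin t HDt). unfold v1; simpl.
      assert (Us := rdb_unit_speed _ _ _ _ _ RD _ Hin). unfold gnorm in *.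
      replace (bilin _ _ _) with ((2 * s) ^ 2 * bilin (Hess u (C (2 * s * t))) (C' (2 * s * t)) (C' (2 * s * t)))
        by (unfold bilin, sum2; simpl; ring).
      rewrite sqrt_mult_alt by apply pow2_ge_0. rewrite Us, sqrt_pow2; lra.
    - assert (A := @is_RInt_const R_NormedModule 0 (1 / 2) (2 * s)).
      assert (E : scal (1 / 2 - 0) (2 * s) = s).
      { unfold scal; simpl; unfold mult; simpl. match goal with |- ?a = ?b => change (@eq R a b) end; field. }
      eapply (fun H => eq_ind _ (fun l => is_RInt (fun _ => 2 * s) 0 (1 / 2) l) H _ E); exact A. }
  assert (I2 : forall T, 1 / 2 < T < 1 -> is_RInt (speed (Hess u) e) (1 / 2) T (RInt Sp 0 (tau T))).
  { intros T HT. apply is_RInt_ext with (fun t => scal (dtau t) (Sp (tau t))).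
    - rewrite Rmin_left, Rmax_right by lra. intros t Ht.
      assert (HDt : D2 t) by (split; split; lra).
      destruct (P2 t HDt) as [A _]. apply is_derive_within_iff in A; trivial.
      destruct A as [A1 A2].
      apply (derive_in_interior _ _ _ _ (1 / 2) 1) in A1; [ | lra | intros r Hr; split; split; lra ].
      apply (derive_in_interior _ _ _ _ (1 / 2) 1) in A2; [ | lra | intros r Hr; split; split; lra ].
      unfold speed, velocity. rewrite (is_derive_unique _ _ _ A1), (is_derive_unique _ _ _ A2).
      rewrite E2 by lra. rewrite (gnorm_hform U) by trivial.
      unfold v2, Sp, curve_speed, scal; simpl; unfold mult; simpl.
      assert (Hd : 0 < dtau t) by (apply Rinv_0_lt_compat; nra).
      replace (hform u (x (tau t), y (tau t)) (dtau t * x' (tau t)) (dtau t * y' (tau t)))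
        with (dtau t ^ 2 * hform u (x (tau t), y (tau t)) (x' (tau t)) (y' (tau t)))
        by (unfold hform; ring).
      rewrite sqrt_mult_alt by apply pow2_ge_0. now rewrite sqrt_pow2 by lra.
    - rewrite <- Htau0. apply (is_RInt_comp Sp tau dtau).
      + intros t _. apply (continuous_curve_speed U u MA); trivial;
          try (now apply (C1_fun_continuous _ _ _ Hx)); try (now apply (C1_fun_continuous _ _ _ Hy));
          [ apply Hx | apply Hy ].
      + rewrite Rmin_left, Rmax_right by lra. intros t Ht; split; [ apply Dtau | apply Ctau ]; lra. }
  assert (Hmono : forall a b, 0 <= a -> a <= b -> RInt Sp 0 a <= RInt Sp 0 b).
  { intros a b Ha Hab. rewrite <- (RInt_Chasles Sp 0 a b) by apply ExS.
    assert (A : 0 <= RInt Sp a b) by (apply RInt_ge_0; trivial; intros; apply sqrt_pos).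
    unfold plus; simpl; lra. }
  assert (HM' : forall a, 0 <= a -> RInt Sp 0 a <= M).
  { intros a Ha; destruct (nfloor_ex a Ha) as [n Hn].
    eapply Rle_trans; [ | apply (HM (S n)) ]. apply Hmono; trivial. rewrite S_INR; lra. }
  assert (Htau : forall a b, 1 / 2 <= a -> a <= b -> b < 1 -> 0 <= tau a <= tau b).
  { intros a b Ha Hab Hb; unfold tau; split.
    - apply Rmult_le_pos; [ lra | ]. apply Rlt_le, Rinv_0_lt_compat; lra.
    - replace ((2 * a - 1) / (1 - a)) with (/ (1 - a) - 2) by (field; lra).
      replace ((2 * b - 1) / (1 - b)) with (/ (1 - b) - 2) by (field; lra).
      assert (/ (1 - a) <= / (1 - b)) by (apply Rinv_le_contravar; lra). lra. }
  (* The infimum ranges over convergent improper integrals; convergence holds because the partial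
     lengths increase and are bounded. *)
  destruct (monotone_limit_from_below (fun T => s + RInt Sp 0 (tau T)) (1 / 2) 1 (s + M))
    as (l & Hl & Hlim).
  - lra.
  - intros a b Ha Hab Hb. destruct (Htau a b) as [T1 T2]; try lra.
    apply Rplus_le_compat_l, Hmono; trivial.
  - intros t Ht. apply Rplus_le_compat_l, HM'. apply (Htau t t); lra.
  - assert (Hlen : has_length (Hess u) e 0 1 l).
    { apply is_RInt_gen_at_left with (fun T => s + RInt Sp 0 (tau T)); trivial.
      exists (1 / 2); split; [ lra | ]. intros T HT.
      exact (is_RInt_Chasles _ _ _ _ _ _ I1 (I2 T HT)). }
    assert (HG := Glb_Rbar_correct (fun l => exists c, curve_to_boundary U (C 0) c /\
      has_length (Hess u) c 0 1 l)).
    change (Glb_Rbar _) with (dist_boundary U (Hess u) (C 0)) in HG.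
    rewrite (rdb_dist _ _ _ _ _ RD) in HG. destruct HG as [HG _].
    assert (A := HG l (ex_intro _ e (conj CB Hlen))). simpl in A. lra.
Qed.

Lemma no_escape s r : 0 <= s < gamma -> r < gamma - s -> ~ unbounded_within U u (C s) r.
Proof.
  intros Hs Hr Hb.
  destruct (escape_curve U u MA (C s) r ((gamma - s - r) / 2))
    as (x & y & x' & y' & Hx & Hy & H0 & HU & HL & Hleave); trivial.
  - apply (rdb_in _ _ _ _ _ RD); exact Hs.
  - lra.
  - assert (A := dist_boundary_reached s x y x' y' _ Hs Hx Hy H0 HU HL Hleave). lra.
Qed.
End NoEscape.

(** * The maximum principle on polygonal chains *)

Record frame := Frame { e1x : R; e1y : R; e2x : R; e2y : R }.

Definition fvec (w : axis) (M : frame) : R * R :=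
  match w with ax1 => (e1x M, e1y M) | ax2 => (e2x M, e2y M) end.

(* [M] is orthonormal for the form [H = (a, b; b, g)] of determinant 1 and
   [det M = 1]; the equation [M^T H M = 1] is written as [H M = M^-T]. *)
Definition orthonormal (a b g : R) (M : frame) : Prop :=
  a * e1x M + b * e1y M = e2y M /\ b * e1x M + g * e1y M = - e2x M /\
  a * e2x M + b * e2y M = - e1y M /\ b * e2x M + g * e2y M = e1x M /\
  e1x M * e2y M - e2x M * e1y M = 1.

(** The Gram-Schmidt process applied to the coordinate basis, simplified by [a g - b^2 = 1]. *)
Definition frame_start (a b g : R) : frame :=
  Frame (/ sqrt a) 0 (- b / sqrt a) (sqrt a).

Lemma frame_start_orthonormal a b g : 0 < a -> a * g - b * b = 1 ->
  orthonormal a b g (frame_start a b g).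
Proof.
  intros Ha D; unfold orthonormal, frame_start; simpl.
  assert (S := sqrt_lt_R0 a Ha). assert (S2 := sqrt_sqrt a (Rlt_le _ _ Ha)).
  set (r := sqrt a) in *.
  assert (E : a = r * r) by (symmetry; exact S2).
  repeat split; field_simplify_eq; try lra; rewrite E in *; try ring.
  rewrite <- D; ring.
Qed.

(** [M^T H M = 1] gives [M M^T = H^-1], and the inverse of [H] is its adjugate. *)
Lemma orthonormal_outer a b g M : orthonormal a b g M ->
  e1x M ^ 2 + e2x M ^ 2 = g /\ e1y M ^ 2 + e2y M ^ 2 = a /\
  e1x M * e1y M + e2x M * e2y M = - b.
Proof.
  intros (G1 & G2 & G3 & G4 & G5). split; [ | split ].
  - rewrite <- (Rmult_1_r g), <- G5.
    transitivity (e1x M * (b * e2x M + g * e2y M) + e2x M * - (b * e1x M + g * e1y M)); [ rewrite G2, G4; ring | ring ].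
  - rewrite <- (Rmult_1_r a), <- G5.
    transitivity (e1y M * - (a * e2x M + b * e2y M) + e2y M * (a * e1x M + b * e1y M)); [ rewrite G1, G3; ring | ring ].
  - rewrite <- (Rmult_1_r b), <- G5.
    transitivity (e1x M * - (a * e2x M + b * e2y M) + e2x M * (a * e1x M + b * e1y M)); [ rewrite G1, G3; ring | ring ].
Qed.

(* The discrete parallel transport [M -> M S^(-1/2)], [S = M^T H' M], written
   with [S^(-1/2) = (S^-1 + 1) / sqrt (tr S + 2)] for [det S = 1]. *)
Definition frame_step (a' b' g' : R) (M : frame) : frame :=
  let q x y z w := a' * x * z + b' * (x * w + y * z) + g' * y * w in
  let s11 := q (e1x M) (e1y M) (e1x M) (e1y M) in
  let s12 := q (e1x M) (e1y M) (e2x M) (e2y M) in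
  let s22 := q (e2x M) (e2y M) (e2x M) (e2y M) in
  let t := sqrt (s11 + s22 + 2) in
  let A11 := (s22 + 1) / t in let A12 := - s12 / t in let A22 := (s11 + 1) / t in
  Frame (e1x M * A11 + e2x M * A12) (e1y M * A11 + e2y M * A12)
        (e1x M * A12 + e2x M * A22) (e1y M * A12 + e2y M * A22).

(** The transition matrix [A = S^(-1/2)] is symmetric of determinant 1, and its trace exceeds 2 by
    an amount controlled by [th = - det (H' - H)]: indeed [tr S = tr (H' H^-1) = 2 + th], and
    [(tr A)^2 = tr S + 2]. *)
Lemma frame_step_spec a b g a' b' g' M :
  0 < a' -> a' * g' - b' * b' = 1 -> orthonormal a b g M ->
  exists A11 A12 A22, let M' := frame_step a' b' g' M in
    let th := (b' - b) ^ 2 - (a' - a) * (g' - g) in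
    e1x M' = e1x M * A11 + e2x M * A12 /\ e1y M' = e1y M * A11 + e2y M * A12 /\
    e2x M' = e1x M * A12 + e2x M * A22 /\ e2y M' = e1y M * A12 + e2y M * A22 /\
    A11 * A22 - A12 ^ 2 = 1 /\ 2 <= A11 + A22 /\ (A11 + A22) ^ 2 = 4 + th /\
    orthonormal a' b' g' M'.
Proof.
  intros Ha' D' HM. destruct M as [m11 m21 m12 m22].
  destruct (orthonormal_outer _ _ _ _ HM) as (EG & EA & EB).
  unfold frame_step, orthonormal in *; cbn [e1x e1y e2x e2y] in *; cbv zeta beta.
  set (s11 := a' * m11 * m11 + b' * (m11 * m21 + m21 * m11) + g' * m21 * m21).
  set (s12 := a' * m11 * m12 + b' * (m11 * m22 + m21 * m12) + g' * m21 * m22).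
  set (s22 := a' * m12 * m12 + b' * (m12 * m22 + m22 * m12) + g' * m22 * m22).
  set (t := sqrt (s11 + s22 + 2)).
  destruct HM as (G1 & G2 & G3 & G4 & G5).
  assert (DS : s11 * s22 - s12 ^ 2 = 1).
  { replace (s11 * s22 - s12 ^ 2) with ((a' * g' - b' * b') * (m11 * m22 - m12 * m21) ^ 2)
      by (unfold s11, s12, s22; ring). rewrite D', G5; ring. }
  assert (Hs11 : 0 < s11).
  { assert (E : a' * s11 = (a' * m11 + b' * m21) ^ 2 + (a' * g' - b' * b') * m21 ^ 2)
      by (unfold s11; ring). rewrite D' in E.
    assert (P : 0 <= (a' * m11 + b' * m21) ^ 2) by apply pow2_ge_0.
    assert (P' : 0 <= m21 ^ 2) by apply pow2_ge_0.
    destruct (Rlt_le_dec 0 s11) as [h | h]; trivial.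
    assert (s11 = 0) by nra. nra. }
  assert (Hs22 : 0 < s22).
  { destruct (Rlt_le_dec 0 s22) as [h | h]; trivial. assert (P := pow2_ge_0 s12). nra. }
  assert (HT : 2 <= s11 + s22) by (assert (P := pow2_ge_0 s12); assert (P' := pow2_ge_0 (s11 - s22)); nra).
  assert (ET : s11 + s22 = 2 + ((b' - b) ^ 2 - (a' - a) * (g' - g))).
  { assert (DH : a * g - b * b = 1).
    { rewrite <- EA, <- EG. replace (b * b) with ((m11 * m21 + m12 * m22) ^ 2) by (rewrite EB; ring).
      transitivity ((m11 * m22 - m12 * m21) ^ 2); [ ring | rewrite G5; ring ]. }
    transitivity (a' * (m11 ^ 2 + m12 ^ 2) + 2 * b' * (m11 * m21 + m12 * m22) + g' * (m21 ^ 2 + m22 ^ 2)).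
    - unfold s11, s22; ring.
    - rewrite EG, EA, EB.
      transitivity (- (a' * g' - b' * b') - (a * g - b * b) + 2 + a' * g - 2 * b' * b + g' * a);
        [ rewrite D', DH; ring | ring ]. }
  assert (Ht2 : t ^ 2 = s11 + s22 + 2) by (apply pow2_sqrt; lra).
  assert (Ht : 2 <= t).
  { apply Rsqr_incr_0_var; [ | apply sqrt_pos ]. unfold Rsqr. simpl in Ht2; lra. }
  assert (Ht0 : t <> 0) by lra.
  exists ((s22 + 1) / t), (- s12 / t), ((s11 + 1) / t).
  assert (ES : (s22 + 1) / t + (s11 + 1) / t = t).
  { field_simplify_eq; trivial. lra. }
  repeat (split; [ reflexivity | ]).
  split; [ field_simplify_eq; trivial; lra | ].
  split; [ rewrite ES; trivial | ]. split; [ rewrite ES; lra | ].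
  (* [H' M' = M'^-T] reduces to [H' M (S^-1 + 1) = M^-T (S + 1)], i.e. to [H' M = M^-T S]. *)
  assert (R1 : a' * m11 + b' * m21 = m22 * s11 - m21 * s12).
  { transitivity ((m11 * m22 - m12 * m21) * (a' * m11 + b' * m21));
      [ rewrite G5; ring | unfold s11, s12; ring ]. }
  assert (R2 : b' * m11 + g' * m21 = - m12 * s11 + m11 * s12).
  { transitivity ((m11 * m22 - m12 * m21) * (b' * m11 + g' * m21));
      [ rewrite G5; ring | unfold s11, s12; ring ]. }
  assert (R3 : a' * m12 + b' * m22 = m22 * s12 - m21 * s22).
  { transitivity ((m11 * m22 - m12 * m21) * (a' * m12 + b' * m22));
      [ rewrite G5; ring | unfold s12, s22; ring ]. }
  assert (R4 : b' * m12 + g' * m22 = - m12 * s12 + m11 * s22).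
  { transitivity ((m11 * m22 - m12 * m21) * (b' * m12 + g' * m22));
      [ rewrite G5; ring | unfold s12, s22; ring ]. }
  clearbody t s11 s12 s22.
  split; [ | split; [ | split; [ | split ] ] ].
  - transitivity ((a' * m11 + b' * m21) * ((s22 + 1) / t) + (a' * m12 + b' * m22) * (- s12 / t)); [ ring | ].
    rewrite R1, R3. replace (m22 * ((s11 + 1) / t)) with (m22 * (s11 + (s11 * s22 - s12 ^ 2)) / t) by (rewrite DS; field; trivial).
    field; trivial.
  - transitivity ((b' * m11 + g' * m21) * ((s22 + 1) / t) + (b' * m12 + g' * m22) * (- s12 / t)); [ ring | ].
    rewrite R2, R4. replace (m12 * ((s11 + 1) / t)) with (m12 * (s11 + (s11 * s22 - s12 ^ 2)) / t) by (rewrite DS; field; trivial).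
    field; trivial.
  - transitivity ((a' * m11 + b' * m21) * (- s12 / t) + (a' * m12 + b' * m22) * ((s11 + 1) / t)); [ ring | ].
    rewrite R1, R3. replace (m21 * ((s22 + 1) / t)) with (m21 * (s22 + (s11 * s22 - s12 ^ 2)) / t) by (rewrite DS; field; trivial).
    field; trivial.
  - transitivity ((b' * m11 + g' * m21) * (- s12 / t) + (b' * m12 + g' * m22) * ((s11 + 1) / t)); [ ring | ].
    rewrite R2, R4. replace (m11 * ((s22 + 1) / t)) with (m11 * (s22 + (s11 * s22 - s12 ^ 2)) / t) by (rewrite DS; field; trivial).
    field; trivial.
  - transitivity ((m11 * m22 - m12 * m21) * (((s22 + 1) / t) * ((s11 + 1) / t) - (- s12 / t) ^ 2)); [ ring | ].
    rewrite G5. transitivity ((s11 * s22 - s12 ^ 2 + s11 + s22 + 1) / t ^ 2); [ field; trivial | ].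
    rewrite DS, Ht2. field. lra.
Qed.

Definition hmul (a b g : R) (v : R * R) : R * R := (a * fst v + b * snd v, b * fst v + g * snd v).
Definition dot (v w : R * R) : R := fst v * fst w + snd v * snd w.
Definition lin (l' l : R) (v' v : R * R) : R * R := (l' * fst v' - l * fst v, l' * snd v' - l * snd v).

(** Summed over the frame, the mixed terms produce the trace of the transition matrix [A]: the left
    side is [2 l'^2 + 2 l^2 - 2 l l' tr A], and [tr A >= 2]. *)
Lemma transport_energy a b g a' b' g' M l l' :
  0 < a' -> a' * g' - b' * b' = 1 -> orthonormal a b g M -> 0 <= l -> 0 <= l' ->
  let M' := frame_step a' b' g' M in
  sum2 (fun w => dot (lin l' l (fvec w M') (fvec w M))
     (lin l' l (hmul a' b' g' (fvec w M')) (hmul a b g (fvec w M)))) <= 2 * (l' - l) ^ 2.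
Proof.
  intros Ha' D' HM Hl Hl' M'.
  destruct (frame_step_spec a b g a' b' g' M Ha' D' HM) as
    (A11 & A12 & A22 & E1 & E2 & E3 & E4 & DA & TA & _ & HM'). fold M' in E1, E2, E3, E4, HM'. clearbody M'.
  unfold sum2, dot, lin, hmul, fvec; simpl.
  destruct HM as (G1 & G2 & G3 & G4 & G5), HM' as (G1' & G2' & G3' & G4' & G5').
  rewrite G1, G2, G3, G4, G1', G2', G3', G4'.
  assert (E : e1x M' * e2y M - e1y M' * e2x M - e2x M' * e1y M + e2y M' * e1x M = A11 + A22).
  { rewrite E1, E2, E3, E4. transitivity ((A11 + A22) * (e1x M * e2y M - e2x M * e1y M)); [ ring | ].
    rewrite G5; ring. }
  match goal with |- ?x <= _ => replace x with
    (2 * l' ^ 2 * (e1x M' * e2y M' - e2x M' * e1y M') + 2 * l ^ 2 * (e1x M * e2y M - e2x M * e1y M)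
     - 2 * (l * l') * (e1x M' * e2y M - e1y M' * e2x M - e2x M' * e1y M + e2y M' * e1x M)) by ring end.
  rewrite G5, G5', E. assert (P := Rmult_le_pos _ _ Hl Hl'). nra.
Qed.

Lemma sqrt_sqr_le x y c : 0 <= c -> x ^ 2 + y ^ 2 <= c ^ 2 -> sqrt (x ^ 2 + y ^ 2) <= c.
Proof. intros Hc H; rewrite <- (sqrt_pow2 c) by trivial. now apply sqrt_le_1_alt. Qed.

Lemma norm2_triang x y z w :
  sqrt ((x + z) ^ 2 + (y + w) ^ 2) <= sqrt (x ^ 2 + y ^ 2) + sqrt (z ^ 2 + w ^ 2).
Proof.
  assert (P1 := sqrt_pos (x ^ 2 + y ^ 2)). assert (P2 := sqrt_pos (z ^ 2 + w ^ 2)).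
  assert (S : forall a b, 0 <= a ^ 2 + b ^ 2) by (intros; apply Rplus_le_le_0_compat; apply pow2_ge_0).
  assert (Q1 := pow2_sqrt _ (S x y)). assert (Q2 := pow2_sqrt _ (S z w)).
  apply sqrt_sqr_le; [ lra | ].
  set (A := sqrt (x ^ 2 + y ^ 2)) in *. set (B := sqrt (z ^ 2 + w ^ 2)) in *.
  assert (K : x * z + y * w <= A * B).
  { apply Rsqr_incr_0_var; [ | now apply Rmult_le_pos ]. unfold Rsqr.
    assert (Z := pow2_ge_0 (x * w - y * z)).
    replace (A * B * (A * B)) with (A ^ 2 * B ^ 2) by ring. rewrite Q1, Q2. nra. }
  replace ((A + B) ^ 2) with (A ^ 2 + B ^ 2 + 2 * (A * B)) by ring. rewrite Q1, Q2. nra.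
Qed.

(** In the frame, [d] and [y] have coordinates [X] and [Y], with half sum [P] and half difference
    [Q]. The derivative is [(l' tr A - 2 l) P] plus [2 l'] times the trace-free part of [A] applied
    to [Q]. Here [|P|^2 = dot d y + q] and [|Q|^2 = q], where [q] is a quarter of the squared norm
    of [y - H d] in the inverse form, and twice the trace-free part has norm [sqrt th]. *)
Lemma transport_gradient a b g a' b' g' M l l' (d y : R * R) :
  0 < a' -> a' * g' - b' * b' = 1 -> orthonormal a b g M -> 0 <= l <= l' -> 0 <= dot d y ->
  let M' := frame_step a' b' g' M in
  let D w := dot (lin l' l (fvec w M') (fvec w M)) y
             + dot d (lin l' l (hmul a' b' g' (fvec w M')) (hmul a b g (fvec w M))) in
  let th := (b' - b) ^ 2 - (a' - a) * (g' - g) in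
  let w1 := fst y - (a * fst d + b * snd d) in
  let w2 := snd y - (b * fst d + g * snd d) in
  let q := (g * w1 ^ 2 - 2 * b * w1 * w2 + a * w2 ^ 2) / 4 in
  0 <= th /\ 0 <= q /\
  sqrt (D ax1 ^ 2 + D ax2 ^ 2) <=
    (2 * (l' - l) + l' * th / 4) * sqrt (dot d y + q) + l' * sqrt (th * q).
Proof.
  intros Ha' D' HM Hl He M' D th w1 w2 q.
  destruct (frame_step_spec a b g a' b' g' M Ha' D' HM) as
    (A11 & A12 & A22 & E1 & E2 & E3 & E4 & DA & TA & TA2 & HM'). fold M' in E1, E2, E3, E4, HM'. clearbody M'.
  fold th in TA2.
  destruct (orthonormal_outer _ _ _ _ HM) as (EG & EA & EB).
  destruct HM as (G1 & G2 & G3 & G4 & G5), HM' as (G1' & G2' & G3' & G4' & G5').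
  set (X1 := e2y M * fst d - e2x M * snd d). set (X2 := - e1y M * fst d + e1x M * snd d).
  set (Y1 := e1x M * fst y + e1y M * snd y). set (Y2 := e2x M * fst y + e2y M * snd y).
  set (P1 := (X1 + Y1) / 2). set (P2 := (X2 + Y2) / 2).
  set (Q1 := (Y1 - X1) / 2). set (Q2 := (Y2 - X2) / 2).
  set (ta := A11 + A22) in *.
  assert (Hth : 0 <= th) by nra.
  assert (Eq : Q1 ^ 2 + Q2 ^ 2 = q).
  { assert (F1 : Y1 - X1 = e1x M * w1 + e1y M * w2).
    { unfold Y1, X1, w1, w2. rewrite <- G1.
      replace (e2x M) with (- (b * e1x M + g * e1y M)) by (rewrite G2; ring). ring. }
    assert (F2 : Y2 - X2 = e2x M * w1 + e2y M * w2).
    { unfold Y2, X2, w1, w2. rewrite <- G4.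
      replace (e1y M) with (- (a * e2x M + b * e2y M)) by (rewrite G3; ring). ring. }
    unfold Q1, Q2; rewrite F1, F2.
    unfold q.
    transitivity (((e1x M ^ 2 + e2x M ^ 2) * w1 ^ 2 + 2 * (e1x M * e1y M + e2x M * e2y M) * w1 * w2
      + (e1y M ^ 2 + e2y M ^ 2) * w2 ^ 2) / 4); [ field | rewrite EG, EA, EB; field ]. }
  assert (Hq : 0 <= q) by (rewrite <- Eq; apply Rplus_le_le_0_compat; apply pow2_ge_0).
  split; [ trivial | split; [ trivial | ] ].
  assert (EP : P1 ^ 2 + P2 ^ 2 = dot d y + q).
  { rewrite <- Eq. transitivity (X1 * Y1 + X2 * Y2 + Q1 ^ 2 + Q2 ^ 2); [ unfold P1, P2, Q1, Q2; field | ].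
    replace (X1 * Y1 + X2 * Y2) with (dot d y * (e1x M * e2y M - e2x M * e1y M));
      [ rewrite G5; ring | unfold dot, X1, X2, Y1, Y2; ring ]. }
  assert (D1 : D ax1 = (l' * ta - 2 * l) * P1 + l' * ((A11 - A22) * Q1 + 2 * A12 * Q2)).
  { unfold D, dot, lin, hmul, fvec; simpl. rewrite G1, G2, G1', G2', E1, E2, E3, E4.
    unfold P1, Q1, Q2, ta, X1, Y1, Y2, X2; field. }
  assert (D2 : D ax2 = (l' * ta - 2 * l) * P2 + l' * (2 * A12 * Q1 - (A11 - A22) * Q2)).
  { unfold D, dot, lin, hmul, fvec; simpl. rewrite G3, G4, G3', G4', E1, E2, E3, E4.
    unfold P2, Q1, Q2, ta, X1, Y1, Y2, X2; field. }
  rewrite D1, D2.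
  eapply Rle_trans; [ apply norm2_triang | ]. apply Rplus_le_compat.
  - replace (((l' * ta - 2 * l) * P1) ^ 2 + ((l' * ta - 2 * l) * P2) ^ 2) with
      ((l' * ta - 2 * l) ^ 2 * (P1 ^ 2 + P2 ^ 2)) by ring.
    assert (N : 0 <= l' * ta - 2 * l) by nra.
    rewrite sqrt_mult_alt, sqrt_pow2, EP by (trivial; apply pow2_ge_0).
    apply Rmult_le_compat_r; [ apply sqrt_pos | ].
    (* This follows from [(ta - 2) (ta + 2) = th] and [ta >= 2]. *)
    assert (T : ta - 2 <= th / 4).
    { apply Rmult_le_reg_r with (ta + 2); [ lra | ]. nra. }
    nra.
  - replace ((l' * ((A11 - A22) * Q1 + 2 * A12 * Q2)) ^ 2 + (l' * (2 * A12 * Q1 - (A11 - A22) * Q2)) ^ 2)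
      with (l' ^ 2 * ((ta ^ 2 - 4 * (A11 * A22 - A12 ^ 2)) * (Q1 ^ 2 + Q2 ^ 2))) by (unfold ta; ring).
    rewrite DA, TA2, Eq. replace (4 + th - 4 * 1) with th by ring.
    rewrite sqrt_mult_alt, sqrt_pow2 by (try apply pow2_ge_0; lra). apply Rle_refl.
Qed.

(** * Chains with a fixed number of legs and their maximizers *)

Lemma psum_le f g n : (forall k, (k < n)%nat -> f k <= g k) -> psum f n <= psum g n.
Proof.
  induction n as [|n IH]; intros H; simpl; [ lra | ].
  apply Rplus_le_compat; [ apply IH; auto | apply H; lia ].
Qed.

Lemma psum_nonneg f n : (forall k, (k < n)%nat -> 0 <= f k) -> 0 <= psum f n.
Proof.
  intros H; replace 0 with (psum (fun _ => 0) n); [ now apply psum_le | ].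
  induction n; simpl; [ | rewrite IHn ]; auto; ring.
Qed.

Lemma psum_mono f n m : (m <= n)%nat -> (forall k, (k < n)%nat -> 0 <= f k) -> psum f m <= psum f n.
Proof.
  intros H; induction H as [|n Hn IH]; intros Hf; [ lra | ].
  simpl; assert (A := Hf n ltac:(lia)); assert (B : psum f m <= psum f n) by (apply IH; auto). lra.
Qed.

Lemma psum_plus f g n : psum (fun k => f k + g k) n = psum f n + psum g n.
Proof. induction n as [|n IH]; simpl; [ | rewrite IH ]; ring. Qed.

Lemma psum_scal c f n : psum (fun k => c * f k) n = c * psum f n.
Proof. induction n as [|n IH]; simpl; [ | rewrite IH ]; ring. Qed.

Lemma psum_sqr_le f n : psum f n ^ 2 <= INR n * psum (fun k => f k ^ 2) n.
Proof.
  induction n as [|n IH]; [ simpl; lra | ].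
  rewrite S_INR; cbn [psum]. destruct n as [|n]; [ simpl; lra | ].
  set (S := psum f (Datatypes.S n)) in *. set (Q := psum (fun k => f k ^ 2) (Datatypes.S n)) in *.
  assert (Hn := pos_INR n). rewrite S_INR in *. set (m := INR n + 1) in *.
  assert (Hm : 0 < m) by (unfold m; lra).
  assert (K : 2 * S * f (Datatypes.S n) <= Q + m * f (Datatypes.S n) ^ 2).
  { apply Rmult_le_reg_l with m; trivial.
    assert (Z := pow2_ge_0 (S - m * f (Datatypes.S n))). nra. }
  nra.
Qed.

(** The energy of a chain run through in unit time with equal time steps. By Cauchy-Schwarz it
    dominates the square of the cost; unlike the cost it is smooth in the vertices even where a leg
    degenerates. *)
Definition chain_energy (u : R * R -> R) (X : nat -> R * R) (n : nat) : R :=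
  INR n * psum (fun i => leg_energy u (X i) (X (S i))) n.

Definition chain_from (U : R * R -> Prop) (p : R * R) (X : nat -> R * R) (n : nat) : Prop :=
  X O = p /\ forall i, (i < n)%nat -> in_seg U (X i) (X (S i)).

Section Chains.
Variables (U : R * R -> Prop) (u : R * R -> R).
Hypothesis MA : monge_ampere U u.
Variables (p : R * R) (r : R) (n0 : nat).
Hypothesis Hp : U p.
Hypothesis Hr : 0 < r.
(** The positive form of [no_escape]; it provides the compactness for the maximization. *)
Hypothesis Hreach : forall y c, path U u p y c -> c < r -> exhaustion U n0 y.

Let Ho := ma_open _ _ MA.

Lemma chain_energy_nonneg X n : chain_from U p X n -> 0 <= chain_energy u X n.
Proof.
  intros [_ H]; apply Rmult_le_pos; [ apply pos_INR | apply psum_nonneg ].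
  intros k Hk; now apply (leg_energy_nonneg U), H.
Qed.

Lemma chain_length_le X n : chain_from U p X n ->
  psum (fun i => sqrt (leg_energy u (X i) (X (S i)))) n <= sqrt (chain_energy u X n).
Proof.
  intros [_ H]; rewrite <- (sqrt_pow2 (psum _ n)) by (apply psum_nonneg; intros; apply sqrt_pos).
  apply sqrt_le_1_alt. eapply Rle_trans; [ apply psum_sqr_le | ].
  apply Req_le; unfold chain_energy; f_equal. apply psum_ext; intros k Hk.
  apply pow2_sqrt. now apply (leg_energy_nonneg U), H.
Qed.

Lemma chain_path X n i : chain_from U p X n -> (i <= n)%nat ->
  path U u p (X i) (psum (fun i => sqrt (leg_energy u (X i) (X (S i)))) i).
Proof.
  intros [H0 H]; induction i as [|i IH]; intros Hi; simpl.
  - rewrite H0; now apply path_nil.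
  - apply path_app with (X i); [ apply IH; lia | apply path_one, H; lia ].
Qed.

Lemma chain_cost_lt X n : chain_from U p X n -> chain_energy u X n < r ^ 2 ->
  psum (fun i => sqrt (leg_energy u (X i) (X (S i)))) n < r.
Proof.
  intros H HE; eapply Rle_lt_trans; [ now apply chain_length_le | ].
  rewrite <- (sqrt_pow2 r) by lra. apply sqrt_lt_1_alt; split; trivial. now apply chain_energy_nonneg.
Qed.

Lemma chain_seg_in X n i t : chain_from U p X n -> chain_energy u X n < r ^ 2 ->
  (i < n)%nat -> 0 <= t <= 1 -> exhaustion U n0 (seg (X i) (X (S i)) t).
Proof.
  intros H HE Hi Ht. assert (HS := proj2 H i Hi).
  apply (Hreach _ (psum (fun i => sqrt (leg_energy u (X i) (X (S i)))) i
    + sqrt (leg_energy u (X i) (seg (X i) (X (S i)) t)))).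
  - apply path_app with (X i); [ apply (chain_path X n); trivial; lia | ].
    now apply path_one, in_seg_l.
  - eapply Rle_lt_trans; [ | exact (chain_cost_lt X n H HE) ].
    eapply Rle_trans; [ | apply (psum_mono _ n (S i)); [ lia | intros; apply sqrt_pos ] ].
    simpl; apply Rplus_le_compat_l.
    assert (A := leg_split U u MA _ _ t HS Ht).
    assert (B := sqrt_pos (leg_energy u (seg (X i) (X (S i)) t) (X (S i)))). lra.
Qed.

Lemma chain_vertex_in X n i : chain_from U p X n -> chain_energy u X n < r ^ 2 ->
  (i <= n)%nat -> exhaustion U n0 (X i).
Proof.
  intros H HE Hi; apply (Hreach _ _ (chain_path X n i H Hi)).
  eapply Rle_lt_trans; [ | exact (chain_cost_lt X n H HE) ].
  apply psum_mono; trivial. intros; apply sqrt_pos.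
Qed.

Definition chain_value (X : nat -> R * R) (n : nat) : R :=
  curvature u (X n) * (r ^ 2 - chain_energy u X n) ^ 2.

Lemma filterlim_pair (x y : nat -> R) (a b : R) : is_lim_seq x a -> is_lim_seq y b ->
  filterlim (fun k => (x k, y k)) eventually (locally (a, b)).
Proof.
  intros Hx Hy; apply filterlim_locally; intros e.
  apply is_lim_seq_spec in Hx; apply is_lim_seq_spec in Hy.
  exact (filter_imp _ _ (fun k H => H) (filter_and _ _ (Hx e) (Hy e))).
Qed.

Lemma is_lim_seq_along (f : R * R -> R) (x : nat -> R * R) l : continuous f l ->
  filterlim x eventually (locally l) -> is_lim_seq (fun k => f (x k)) (f l).
Proof. intros Hf Hx. exact (filterlim_comp _ _ _ _ _ _ _ _ Hx Hf). Qed.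

Lemma is_lim_seq_psum (f : nat -> nat -> R) (g : nat -> R) n :
  (forall i, (i < n)%nat -> is_lim_seq (fun k => f k i) (g i)) ->
  is_lim_seq (fun k => psum (f k) n) (psum g n).
Proof.
  induction n as [|n IH]; intros H; simpl; [ apply is_lim_seq_const | ].
  apply is_lim_seq_plus'; [ apply IH; auto | apply H; lia ].
Qed.

(** The constant chain shows that the supremum is at least [curvature u p * r ^ 4 > 0]. The vertices
    stay in one exhaustion set, so a maximizing sequence converges along a subsequence, and its
    limit has energy below [r ^ 2] because the value would be 0 at energy [r ^ 2]. *)
Lemma chain_maximizer n : (0 < n)%nat -> 0 < curvature u p -> exists X,
  chain_from U p X n /\ chain_energy u X n < r ^ 2 /\
  curvature u p * r ^ 4 <= chain_value X n /\
  forall Y, chain_from U p Y n -> chain_energy u Y n < r ^ 2 -> chain_value Y n <= chain_value X n.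
Proof.
  intros Hn HK.
  set (V := fun y => exists X, chain_from U p X n /\ chain_energy u X n < r ^ 2 /\ y = chain_value X n).
  assert (HrR : 0 < r ^ 2) by now apply pow_lt.
  assert (Vp : V (curvature u p * r ^ 4)).
  { exists (fun _ => p).
    assert (E : chain_energy u (fun _ => p) n = 0).
    { unfold chain_energy. rewrite (psum_ext _ (fun _ => 0)).
      - rewrite (psum_zero_tail _ O n); simpl; [ ring | lia | trivial ].
      - intros; unfold leg_energy; ring. }
    split; [ | split ].
    - split; trivial. intros i _ t Ht. replace (seg p p t) with p; trivial.
      unfold seg; rewrite !Rminus_diag, !Rmult_0_r, !Rplus_0_r. apply surjective_pairing.
    - rewrite E; trivial.
    - unfold chain_value; rewrite E; ring. }
  destruct (bounded_on_exhaustion U (curvature u) n0) as (B & HB & HBK).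
  { intros q Hq; apply (smooth_continuous U); trivial. now apply smooth_curvature. }
  destruct (completeness V) as [m [Hm1 Hm2]].
  { exists (B * (r ^ 2) ^ 2); intros y (X & HX & HE & ->). unfold chain_value.
    assert (A := HBK _ (chain_vertex_in X n n HX HE (le_n _))).
    assert (A' := Rle_abs (curvature u (X n))). assert (P := chain_energy_nonneg X n HX).
    apply Rmult_le_compat; [ | apply pow2_ge_0 | lra | apply pow_incr; lra ].
    apply (curvature_nonneg U u MA), (exhaustion_in U n0), (chain_vertex_in X n); auto. }
  { exists (curvature u p * r ^ 4); exact Vp. }
  assert (Hk : forall k : nat, exists X, chain_from U p X n /\ chain_energy u X n < r ^ 2 /\
    m - / (INR k + 1) < chain_value X n).
  { intros k; apply NNPP; intros HN.
    assert (m <= m - / (INR k + 1)); [ | assert (P := inv_INR1_pos k); lra ].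
    apply Hm2; intros y (X & HX & HE & ->). apply Rnot_lt_le; intros Hlt; apply HN; now exists X. }
  set (W := fun k => proj1_sig (constructive_indefinite_description _ (Hk k))).
  assert (HW : forall k, chain_from U p (W k) n /\ chain_energy u (W k) n < r ^ 2 /\
    m - / (INR k + 1) < chain_value (W k) n).
  { intros k; unfold W; destruct constructive_indefinite_description; trivial. }
  clearbody W.
  assert (HWb : forall k i, (i < S n)%nat ->
    Rabs (fst (W k i)) <= INR n0 + 1 /\ Rabs (snd (W k i)) <= INR n0 + 1).
  { intros k i Hi; destruct (HW k) as (A1 & A2 & _).
    assert (A := chain_vertex_in (W k) n i A1 A2 ltac:(lia)).
    exact (exhaustion_bounded_seq U n0 (fun _ => W k i) (fun _ => A) O). }
  destruct (bounded_subsequence (fun k i => fst (W k i)) (S n) (INR n0 + 1)) as (phi & g & Hphi & Hg).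
  { intros k i Hi; now apply HWb. }
  destruct (bounded_subsequence (fun k i => snd (W (phi k) i)) (S n) (INR n0 + 1))
    as (psi & g' & Hpsi & Hg').
  { intros k i Hi; now apply HWb. }
  set (Z := fun k => W (phi (psi k))). set (X := fun i => (g i, g' i)).
  assert (Hpsi' : filterlim psi eventually eventually).
  { intros P [N HN]; exists N; intros k Hk'; apply HN; specialize (Hpsi k); lia. }
  assert (HZ : forall i, (i <= n)%nat -> filterlim (fun k => Z k i) eventually (locally (X i))).
  { intros i Hi. apply filterlim_ext with (fun k => (fst (Z k i), snd (Z k i))).
    { intros k; now rewrite <- surjective_pairing. }
    apply filterlim_pair.
    - apply (is_lim_seq_subseq (fun k => fst (W (phi k) i)) (g i) psi Hpsi'). apply Hg; lia.
    - apply Hg'; lia. }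
  assert (HX0 : X O = p).
  { unfold X; rewrite (surjective_pairing p); f_equal.
    - assert (A := Hg O ltac:(lia)). apply is_lim_seq_unique in A.
      rewrite (Lim_seq_ext _ (fun _ => fst p)), Lim_seq_const in A; [ now injection A | ].
      intros k; now rewrite (proj1 (proj1 (HW (phi k)))).
    - assert (A := Hg' O ltac:(lia)). apply is_lim_seq_unique in A.
      rewrite (Lim_seq_ext _ (fun _ => snd p)), Lim_seq_const in A; [ now injection A | ].
      intros k; now rewrite (proj1 (proj1 (HW (phi (psi k))))). }
  assert (HXU : forall i, (i <= n)%nat -> U (X i)).
  { intros i Hi; apply (exhaustion_in U n0), (exhaustion_limit U n0 (fun k => Z k i)); auto.
    intros k; destruct (HW (phi (psi k))) as (A1 & A2 & _). now apply (chain_vertex_in _ n). }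
  assert (HXc : chain_from U p X n).
  { split; trivial. intros i Hi t Ht.
    apply (exhaustion_in U n0), (exhaustion_limit U n0 (fun k => seg (Z k i) (Z k (S i)) t)).
    - assert (L1 := HZ i ltac:(lia)). assert (L2 := HZ (S i) ltac:(lia)).
      unfold seg; apply filterlim_pair.
      + apply is_lim_seq_plus'; [ | apply (is_lim_seq_scal_l _ t (fst (X (S i)) - fst (X i))), is_lim_seq_minus' ];
        apply (is_lim_seq_along fst); trivial; apply continuous_fst.
      + apply is_lim_seq_plus'; [ | apply (is_lim_seq_scal_l _ t (snd (X (S i)) - snd (X i))), is_lim_seq_minus' ];
        apply (is_lim_seq_along snd); trivial; apply continuous_snd.
    - intros k; destruct (HW (phi (psi k))) as (A1 & A2 & _). now apply (chain_seg_in _ n). }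
  assert (HE : is_lim_seq (fun k => chain_energy u (Z k) n) (chain_energy u X n)).
  { unfold chain_energy.
    apply (is_lim_seq_scal_l _ (INR n) (psum (fun i => leg_energy u (X i) (X (S i))) n)).
    apply (is_lim_seq_psum (fun k i => leg_energy u (Z k i) (Z k (S i)))). intros i Hi.
    assert (L1 := HZ i ltac:(lia)). assert (L2 := HZ (S i) ltac:(lia)).
    assert (U1 := HXU i ltac:(lia)). assert (U2 := HXU (S i) ltac:(lia)).
    assert (S1 := smooth_partial U u ax1 (ma_smooth _ _ MA)).
    assert (S2 := smooth_partial U u ax2 (ma_smooth _ _ MA)).
    unfold leg_energy. apply is_lim_seq_plus'; apply is_lim_seq_mult'; apply is_lim_seq_minus';
      first [ now apply (is_lim_seq_along fst); [ apply continuous_fst | ]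
            | now apply (is_lim_seq_along snd); [ apply continuous_snd | ]
            | now apply is_lim_seq_along; [ now apply (smooth_continuous U) | ] ]. }
  assert (HJ : is_lim_seq (fun k => chain_value (Z k) n) (chain_value X n)).
  { unfold chain_value. apply is_lim_seq_mult'.
    - apply (is_lim_seq_along (curvature u)); [ | apply HZ; lia ].
      apply (smooth_continuous U); [ now apply smooth_curvature | apply HXU; lia ].
    - assert (A : is_lim_seq (fun k => r ^ 2 - chain_energy u (Z k) n) (r ^ 2 - chain_energy u X n))
        by (apply is_lim_seq_minus'; [ apply is_lim_seq_const | trivial ]).
      simpl pow. apply is_lim_seq_mult'; [ exact A | ].
      apply is_lim_seq_mult'; [ exact A | apply is_lim_seq_const ]. }
  assert (Hm : m <= chain_value X n).
  { apply (is_lim_seq_le (fun k => m - / (INR k + 1)) (fun k => chain_value (Z k) n) m (chain_value X n)); trivial.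
    - intros k; destruct (HW (phi (psi k))) as (_ & _ & A).
      eapply Rle_trans; [ | apply Rlt_le, A ]. apply Rplus_le_compat_l, Ropp_le_contravar.
      apply Rinv_le_contravar; [ apply INR1_pos | ]. apply Rplus_le_compat_r, le_INR.
      specialize (Hpsi k); specialize (Hphi (psi k)); lia.
    - replace (Finite m) with (Finite (m - 0)) by (f_equal; ring).
      apply is_lim_seq_minus'; [ apply is_lim_seq_const | ].
      apply is_lim_seq_ext with (fun k => / INR (S k)); [ intros k; now rewrite S_INR | ].
      apply is_lim_seq_incr_1 with (u := fun k => / INR k).
      apply (is_lim_seq_inv _ p_infty); [ apply is_lim_seq_INR | discriminate ]. }
  assert (HEr : chain_energy u X n <= r ^ 2).
  { apply (is_lim_seq_le (fun k => chain_energy u (Z k) n) (fun _ => r ^ 2) (chain_energy u X n) (r ^ 2)); trivial.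
    - intros k; apply Rlt_le, HW.
    - apply is_lim_seq_const. }
  assert (HKm := Hm1 _ Vp).
  exists X; split; [ trivial | split; [ | split ] ].
  - destruct (Req_dec (chain_energy u X n) (r ^ 2)) as [E | E]; [ | lra ].
    exfalso. assert (P : 0 < curvature u p * r ^ 4) by (apply Rmult_lt_0_compat; trivial; now apply pow_lt).
    unfold chain_value in Hm; rewrite E in Hm. replace (_ * _ ^ 2) with 0 in Hm by ring. lra.
  - lra.
  - intros Y HY HYE. eapply Rle_trans; [ | exact Hm ]. apply Hm1; now exists Y.
Qed.
End Chains.

(** * First and second variation at a maximizing chain *)

Lemma local_max_derivatives (f f1 : R -> R) (f2 d : R) : 0 < d ->
  (forall s, Rabs s < d -> is_derive f s (f1 s)) -> is_derive f1 0 f2 ->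
  (forall s, Rabs s < d -> f s <= f 0) -> f1 0 = 0 /\ f2 <= 0.
Proof.
  intros Hd H1 H2 Hmax.
  (* By the mean value theorem between 0 and [s], some [c] on the same side as [s] makes [f1 c]
     vanish or have the sign opposite to [s]. *)
  assert (M : forall s, Rabs s < d -> s <> 0 -> exists c, Rabs c <= Rabs s /\ 0 < c * s /\ f1 c * s <= 0).
  { intros s Hs Hs0.
    assert (Hc : forall x, Rmin 0 s <= x <= Rmax 0 s -> Rabs x <= Rabs s).
    { intros x. unfold Rmin, Rmax; destruct Rle_dec; intros Hx; unfold Rabs;
        destruct (Rcase_abs x), (Rcase_abs s); lra. }
    destruct (MVT_cor2 (fun t => f (t * s)) (fun t => s * f1 (t * s)) 0 1) as (c & Ec & Hc1); [ lra | | ].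
    - intros c Hc1. apply is_derive_Reals.
      apply (is_derive_comp f (fun t => t * s) c); [ apply H1 | auto_derive; trivial; ring ].
      rewrite Rabs_mult, (Rabs_right c) by lra. assert (P := Rabs_pos s). nra.
    - exists (c * s). rewrite Rmult_0_l, Rmult_1_l in Ec. assert (A := Hmax s Hs).
      split; [ | split ].
      + rewrite Rabs_mult, (Rabs_right c) by lra. assert (P := Rabs_pos s). nra.
      + assert (0 < s * s) by nra. nra.
      + lra. }
  assert (E1 : f1 0 = 0).
  { assert (C : continuous f1 0) by now apply (is_derive_continuous f1 0 f2).
    apply cond_eq; intros eps He. rewrite Rminus_0_r.
    destruct (proj1 (continuous_iff_continuous_in f1 0) C (eps / 2)) as (d' & Hd' & A); [ lra | ].
    set (s := Rmin d d' / 2).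
    assert (Hs : 0 < s /\ s < d /\ s < d').
    { assert (B := Rmin_pos _ _ Hd Hd'). assert (B1 := Rmin_l d d'). assert (B2 := Rmin_r d d').
      unfold s; lra. }
    destruct (M s) as (c & C1 & C2 & C3); [ rewrite Rabs_right; lra | lra | ].
    destruct (M (- s)) as (c' & C1' & C2' & C3'); [ rewrite Rabs_left; lra | lra | ].
    assert (K := A c I). assert (K' := A c' I). rewrite Rminus_0_r in K, K'.
    rewrite Rabs_Ropp in C1'. rewrite (Rabs_right s) in C1, C1' by lra.
    specialize (K ltac:(lra)); specialize (K' ltac:(lra)).
    apply Rabs_lt_between in K; apply Rabs_lt_between in K'.
    assert (f1 c <= 0) by nra. assert (0 <= f1 c') by nra. apply Rabs_lt_between; lra. }
  split; trivial. apply Rnot_lt_le; intros Hf2.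
  destruct (proj1 (is_derive_iff_derive_in f1 0 f2) H2 (f2 / 2)) as (d' & Hd' & A); [ lra | ].
  set (s := Rmin d d' / 2).
  assert (Hs : 0 < s /\ s < d /\ s < d').
  { assert (B := Rmin_pos _ _ Hd Hd'). assert (B1 := Rmin_l d d'). assert (B2 := Rmin_r d d').
    unfold s; lra. }
  destruct (M s) as (c & C1 & C2 & C3); [ rewrite Rabs_right; lra | lra | ].
  assert (K := A c I). rewrite Rminus_0_r, E1 in K. rewrite (Rabs_right s) in C1 by lra.
  specialize (K ltac:(lra)).
  assert (Hc : 0 < c) by nra. rewrite (Rabs_right c) in K by lra.
  apply Rabs_le_between in K. assert (f1 c <= 0) by nra. nra.
Qed.

(** The first-order condition turns the mixed term [4 k' e e'] into [- 8 k e'^2]; together with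
    [2 k e'^2] this is the coefficient -6. *)
Lemma max_of_product_sqr (k k1 e e1 : R -> R) (k2 e2 d : R) : 0 < d ->
  (forall s, Rabs s < d -> is_derive k s (k1 s)) -> is_derive k1 0 k2 ->
  (forall s, Rabs s < d -> is_derive e s (e1 s)) -> is_derive e1 0 e2 ->
  (forall s, Rabs s < d -> k s * e s ^ 2 <= k 0 * e 0 ^ 2) -> 0 < e 0 ->
  k1 0 * e 0 = - 2 * k 0 * e1 0 /\ k2 * e 0 ^ 2 - 6 * k 0 * e1 0 ^ 2 + 2 * k 0 * e 0 * e2 <= 0.
Proof.
  intros Hd Hk Hk2 He He2 Hmax H0.
  destruct (local_max_derivatives (fun s => k s * e s ^ 2)
    (fun s => k1 s * e s ^ 2 + 2 * k s * e s * e1 s)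
    (k2 * e 0 ^ 2 + 4 * k1 0 * e 0 * e1 0 + 2 * k 0 * e1 0 ^ 2 + 2 * k 0 * e 0 * e2) d)
    as [A B]; trivial.
  - intros s Hs. assert (D1 := Hk s Hs). assert (D2 := He s Hs).
    auto_derive; [ repeat split; eexists; eassumption | ].
    rewrite_derivatives. ring.
  - assert (Z : Rabs 0 < d) by now rewrite Rabs_R0.
    assert (D1 := Hk 0 Z). assert (D2 := He 0 Z).
    auto_derive; [ repeat split; eexists; eassumption | ].
    rewrite_derivatives. ring.
  - assert (E : k1 0 * e 0 = - 2 * k 0 * e1 0).
    { apply Rmult_eq_reg_r with (e 0); [ | lra ]. lra. }
    split; trivial.
    replace (4 * k1 0 * e 0 * e1 0) with (4 * (k1 0 * e 0) * e1 0) in B by ring. rewrite E in B. lra.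
Qed.

Definition shift (x v : R * R) (s : R) : R * R := (fst x + s * fst v, snd x + s * snd v).

Definition hvec (u : R * R -> R) (p v : R * R) : R * R := hmul (h11 u p) (h12 u p) (h22 u p) v.

(** The covector obtained by inserting [v] twice into the third derivative of [u]. *)
Definition tvec (u : R * R -> R) (p v : R * R) : R * R :=
  (t111 u p * fst v ^ 2 + 2 * t112 u p * fst v * snd v + t122 u p * snd v ^ 2,
   t112 u p * fst v ^ 2 + 2 * t122 u p * fst v * snd v + t222 u p * snd v ^ 2).

Definition grad (u : R * R -> R) (p : R * R) : R * R := (partial ax1 u p, partial ax2 u p).

Definition vsub (v w : R * R) : R * R := (fst v - fst w, snd v - snd w).

Lemma shift_0 x v : shift x v 0 = x.
Proof. destruct x; unfold shift; simpl; f_equal; ring. Qed.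

Section Variation.
Variables (U : R * R -> Prop) (u : R * R -> R).
Hypothesis MA : monge_ampere U u.

Let Ho := ma_open _ _ MA.
Let Hs := ma_smooth _ _ MA.

Lemma is_derive_shift f x v s : smooth_on U f -> U (shift x v s) ->
  is_derive (fun s => f (shift x v s)) s
    (fst v * partial ax1 f (shift x v s) + snd v * partial ax2 f (shift x v s)).
Proof.
  intros Hf HU.
  apply (is_derive_along_path U f (fun s => fst x + s * fst v) (fun s => snd x + s * snd v)); trivial;
    auto_derive; trivial; ring.
Qed.

Lemma is_derive_grad_shift x v s : U (shift x v s) ->
  is_derive (fun s => fst (grad u (shift x v s))) s (fst (hvec u (shift x v s) v)) /\
  is_derive (fun s => snd (grad u (shift x v s))) s (snd (hvec u (shift x v s) v)).
Proof.
  intros HU; split; simpl.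
  - assert (A := is_derive_shift _ x v s (smooth_partial U u ax1 Hs) HU).
    assert (E : partial ax2 (partial ax1 u) (shift x v s) = h12 u (shift x v s)) by exact (Hess_hs U u MA _ ax2 ax1 HU).
    rewrite E in A. replace (h11 u (shift x v s) * fst v + h12 u (shift x v s) * snd v) with
      (fst v * h11 u (shift x v s) + snd v * h12 u (shift x v s)) by ring. exact A.
  - assert (A := is_derive_shift _ x v s (smooth_partial U u ax2 Hs) HU).
    replace (h12 u (shift x v s) * fst v + h22 u (shift x v s) * snd v) with
      (fst v * h12 u (shift x v s) + snd v * h22 u (shift x v s)) by ring. exact A.
Qed.

Lemma is_derive_hs_shift i j x v s : U (shift x v s) ->
  is_derive (fun s => hs i j u (shift x v s)) s
    (fst v * ts ax1 i j u (shift x v s) + snd v * ts ax2 i j u (shift x v s)).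
Proof.
  intros HU. assert (A := is_derive_shift _ x v s (smooth_hs U u MA i j) HU).
  now rewrite !(partial_hs U u MA) in A by trivial.
Qed.

Lemma is_derive_hvec_shift x v s : U (shift x v s) ->
  is_derive (fun s => fst (hvec u (shift x v s) v)) s (fst (tvec u (shift x v s) v)) /\
  is_derive (fun s => snd (hvec u (shift x v s) v)) s (snd (tvec u (shift x v s) v)).
Proof.
  intros HU.
  assert (A1 := is_derive_hs_shift ax1 ax1 x v s HU).
  assert (A2 := is_derive_hs_shift ax1 ax2 x v s HU).
  assert (A3 := is_derive_hs_shift ax2 ax2 x v s HU). cbn [hs ts] in A1, A2, A3.
  assert (L : forall (f g : R -> R) f' g' a b, is_derive f s f' -> is_derive g s g' ->
    is_derive (fun s => f s * a + g s * b) s (f' * a + g' * b)).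
  { intros f g f' g' a b Hf Hg; auto_derive; [ split; [ now exists f' | split; [ now exists g' | trivial ] ] | ].
    rewrite_derivatives. ring. }
  split.
  - assert (D := L _ _ _ _ (fst v) (snd v) A1 A2).
    match type of D with is_derive _ _ ?l => replace (fst (tvec u (shift x v s) v)) with l end; trivial.
    unfold tvec; simpl; ring.
  - assert (D := L _ _ _ _ (fst v) (snd v) A2 A3).
    match type of D with is_derive _ _ ?l => replace (snd (tvec u (shift x v s) v)) with l end; trivial.
    unfold tvec; simpl; ring.
Qed.

Lemma is_derive_dot (a1 a2 b1 b2 : R -> R) s a1' a2' b1' b2' :
  is_derive a1 s a1' -> is_derive a2 s a2' -> is_derive b1 s b1' -> is_derive b2 s b2' ->
  is_derive (fun s => a1 s * b1 s + a2 s * b2 s) s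
    (a1' * b1 s + a2' * b2 s + (a1 s * b1' + a2 s * b2')).
Proof.
  intros H1 H2 H3 H4; auto_derive; [ repeat split; eexists; eassumption | ].
  rewrite_derivatives. ring.
Qed.

Definition leg_d (x v y w : R * R) (s : R) : R :=
  dot (vsub w v) (vsub (grad u (shift y w s)) (grad u (shift x v s)))
  + dot (vsub (shift y w s) (shift x v s)) (vsub (hvec u (shift y w s) w) (hvec u (shift x v s) v)).

Definition leg_dd (x v y w : R * R) : R :=
  2 * dot (vsub w v) (vsub (hvec u y w) (hvec u x v))
  + dot (vsub y x) (vsub (tvec u y w) (tvec u x v)).

Lemma is_derive_shift_sub x v y w s :
  is_derive (fun s => fst (shift y w s) - fst (shift x v s)) s (fst w - fst v) /\
  is_derive (fun s => snd (shift y w s) - snd (shift x v s)) s (snd w - snd v).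
Proof. unfold shift; simpl; split; auto_derive; trivial; ring. Qed.

Lemma is_derive_leg x v y w s : U (shift x v s) -> U (shift y w s) ->
  is_derive (fun s => leg_energy u (shift x v s) (shift y w s)) s (leg_d x v y w s).
Proof.
  intros Hx Hy. destruct (is_derive_shift_sub x v y w s) as [A1 A2].
  destruct (is_derive_grad_shift x v s Hx) as [B1 B2].
  destruct (is_derive_grad_shift y w s Hy) as [C1 C2].
  exact (is_derive_dot _ _ _ _ s _ _ _ _ A1 A2
    (is_derive_minus _ _ _ _ _ C1 B1) (is_derive_minus _ _ _ _ _ C2 B2)).
Qed.

Lemma is_derive_leg_d x v y w : U x -> U y -> is_derive (leg_d x v y w) 0 (leg_dd x v y w).
Proof.
  intros Hx Hy. rewrite <- (shift_0 x v) in Hx. rewrite <- (shift_0 y w) in Hy.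
  destruct (is_derive_shift_sub x v y w 0) as [A1 A2].
  destruct (is_derive_grad_shift x v 0 Hx) as [B1 B2].
  destruct (is_derive_grad_shift y w 0 Hy) as [C1 C2].
  destruct (is_derive_hvec_shift x v 0 Hx) as [D1 D2].
  destruct (is_derive_hvec_shift y w 0 Hy) as [E1 E2].
  assert (Z : forall c : R, is_derive (fun _ => c) 0 0)
    by (intros; apply (@is_derive_const R_AbsRing R_NormedModule)).
  assert (F1 := is_derive_dot _ _ _ _ 0 _ _ _ _ (Z (fst w - fst v)) (Z (snd w - snd v))
    (is_derive_minus _ _ _ _ _ C1 B1) (is_derive_minus _ _ _ _ _ C2 B2)).
  assert (F2 := is_derive_dot _ _ _ _ 0 _ _ _ _ A1 A2
    (is_derive_minus _ _ _ _ _ E1 D1) (is_derive_minus _ _ _ _ _ E2 D2)).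
  assert (F := is_derive_plus _ _ _ _ _ F1 F2).
  match type of F with is_derive _ _ ?l => replace (leg_dd x v y w) with l end; [ exact F | ].
  unfold leg_dd, plus, minus, opp, dot, vsub; simpl; rewrite !shift_0; unfold plus; simpl; ring_R.
Qed.

Lemma is_derive_psum (f f' : nat -> R -> R) n s :
  (forall i, (i < n)%nat -> is_derive (f i) s (f' i s)) ->
  is_derive (fun s => psum (fun i => f i s) n) s (psum (fun i => f' i s) n).
Proof.
  induction n as [|n IH]; intros H; simpl.
  - apply (@is_derive_const R_AbsRing R_NormedModule).
  - apply (@is_derive_plus R_AbsRing R_NormedModule); [ apply IH; auto | apply H; lia ].
Qed.
End Variation.

Fixpoint frames (u : R * R -> R) (X : nat -> R * R) (i : nat) : frame :=
  match i with
  | O => frame_start (h11 u (X O)) (h12 u (X O)) (h22 u (X O))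
  | S j => frame_step (h11 u (X (S j))) (h12 u (X (S j))) (h22 u (X (S j))) (frames u X j)
  end.

(* The variation field: a discretely parallel frame vector, scaled linearly
   from [0] at the first vertex to [1] at the last one. *)
Definition vfield u X n (w : axis) (i : nat) : R * R :=
  (INR i / INR n * fst (fvec w (frames u X i)), INR i / INR n * snd (fvec w (frames u X i))).

Definition varied u X n w (s : R) (i : nat) : R * R := shift (X i) (vfield u X n w i) s.

Lemma finite_bound (f : nat -> R) n : exists B, 0 < B /\ forall i, (i <= n)%nat -> Rabs (f i) <= B.
Proof.
  induction n as [|n (B & HB & H)].
  - exists (Rabs (f O) + 1); split; [ assert (P := Rabs_pos (f O)); lra | ].
    intros i Hi; replace i with O by lia; lra.
  - exists (B + Rabs (f (S n))); split; [ assert (P := Rabs_pos (f (S n))); lra | ].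
    intros i Hi; destruct (Nat.eq_dec i (S n)) as [-> | Hne]; [ lra | ].
    specialize (H i ltac:(lia)). assert (P := Rabs_pos (f (S n))); lra.
Qed.

Section Stationary.
Variables (U : R * R -> Prop) (u : R * R -> R).
Hypothesis MA : monge_ampere U u.

Let Ho := ma_open _ _ MA.

Lemma frames_orthonormal X i : (forall j, (j <= i)%nat -> U (X j)) ->
  orthonormal (h11 u (X i)) (h12 u (X i)) (h22 u (X i)) (frames u X i).
Proof.
  induction i as [|i IH]; intros H; simpl.
  - apply frame_start_orthonormal; [ apply (h11_pos U u MA) | apply (h_det U u MA) ]; auto.
  - destruct (frame_step_spec _ _ _ (h11 u (X (S i))) (h12 u (X (S i))) (h22 u (X (S i))) _
      (h11_pos U u MA _ (H _ (le_n _))) (h_det U u MA _ (H _ (le_n _))) (IH (fun j Hj => H j (le_S _ _ Hj))))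
      as (A11 & A12 & A22 & K). apply K.
Qed.

(** A sum over an orthonormal frame is a trace against [M M^T = H^-1], and this trace of the third
    derivative vanishes by [det_derivative]. *)
Lemma tvec_trace x M c : U x -> orthonormal (h11 u x) (h12 u x) (h22 u x) M ->
  let v w := (c * fst (fvec w M), c * snd (fvec w M)) in
  fst (tvec u x (v ax1)) + fst (tvec u x (v ax2)) = 0 /\
  snd (tvec u x (v ax1)) + snd (tvec u x (v ax2)) = 0.
Proof.
  intros Hx HM v. destruct (orthonormal_outer _ _ _ _ HM) as (Eg & Ea & Eb).
  assert (D1 := det_derivative U u MA ax1 x Hx). assert (D2 := det_derivative U u MA ax2 x Hx). simpl in D1, D2.
  unfold v, tvec, fvec; simpl. split.
  - transitivity (c ^ 2 * (t111 u x * (e1x M ^ 2 + e2x M ^ 2)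
      + 2 * t112 u x * (e1x M * e1y M + e2x M * e2y M) + t122 u x * (e1y M ^ 2 + e2y M ^ 2))); [ ring | ].
    rewrite Eg, Ea, Eb. transitivity (c ^ 2 * 0); [ rewrite <- D1 | ]; ring.
  - transitivity (c ^ 2 * (t112 u x * (e1x M ^ 2 + e2x M ^ 2)
      + 2 * t122 u x * (e1x M * e1y M + e2x M * e2y M) + t222 u x * (e1y M ^ 2 + e2y M ^ 2))); [ ring | ].
    rewrite Eg, Ea, Eb. transitivity (c ^ 2 * 0); [ rewrite <- D2 | ]; ring.
Qed.

(** Summation over the frame removes the third derivatives and leaves twice the expression of
    [transport_energy] for the scale factors [i / n] and [(i + 1) / n]. *)
Lemma sum_leg_dd X n i : (0 < n)%nat -> (forall j, (j <= S i)%nat -> U (X j)) ->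
  sum2 (fun w => leg_dd u (X i) (vfield u X n w i) (X (S i)) (vfield u X n w (S i))) <= 4 / INR n ^ 2.
Proof.
  intros Hn HU. assert (Hn' : 0 < INR n) by now apply lt_0_INR.
  assert (HM := frames_orthonormal X i (fun j Hj => HU j (le_S _ _ Hj))).
  assert (HM' := frames_orthonormal X (S i) HU).
  assert (Hi := HU i ltac:(lia)). assert (Hi' := HU (S i) (le_n _)).
  assert (E := transport_energy _ _ _ (h11 u (X (S i))) (h12 u (X (S i))) (h22 u (X (S i))) _
    (INR i / INR n) (INR (S i) / INR n) (h11_pos U u MA _ Hi') (h_det U u MA _ Hi') HM
    ltac:(apply Rle_div_r; trivial; rewrite Rmult_0_l; apply pos_INR)
    ltac:(apply Rle_div_r; trivial; rewrite Rmult_0_l; apply pos_INR)).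
  cbv zeta in E. change (frame_step _ _ _ (frames u X i)) with (frames u X (S i)) in E.
  destruct (tvec_trace (X i) _ (INR i / INR n) Hi HM) as [T1 T2].
  destruct (tvec_trace (X (S i)) _ (INR (S i) / INR n) Hi' HM') as [T3 T4].
  assert (El : INR (S i) / INR n - INR i / INR n = / INR n) by (rewrite S_INR; field; lra).
  rewrite El in E.
  set (F := sum2 _) in E. apply Rle_trans with (2 * F).
  - apply Req_le. unfold sum2, leg_dd. unfold vfield at 1 2 3 4 7 8 9 10.
    transitivity (2 * F + dot (vsub (X (S i)) (X i))
      (fst (tvec u (X (S i)) (vfield u X n ax1 (S i))) + fst (tvec u (X (S i)) (vfield u X n ax2 (S i)))
       - (fst (tvec u (X i) (vfield u X n ax1 i)) + fst (tvec u (X i) (vfield u X n ax2 i))),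
       snd (tvec u (X (S i)) (vfield u X n ax1 (S i))) + snd (tvec u (X (S i)) (vfield u X n ax2 (S i)))
       - (snd (tvec u (X i) (vfield u X n ax1 i)) + snd (tvec u (X i) (vfield u X n ax2 i))))).
    + unfold F, sum2, dot, vsub, lin, hvec, hmul; cbn [fst snd]. ring.
    + unfold vfield. rewrite T1, T2, T3, T4. unfold dot; cbn [fst snd]; ring.
  - replace (4 / INR n ^ 2) with (2 * (2 * (/ INR n) ^ 2)) by (field; lra). lra.
Qed.

Section AtMaximum.
Variables (p : R * R) (r : R) (n0 n : nat) (X : nat -> R * R).
Hypothesis Hr : 0 < r.
Hypothesis Hn : (0 < n)%nat.
Hypothesis Hreach : forall y c, path U u p y c -> c < r -> exhaustion U n0 y.
Hypothesis HX : chain_from U p X n.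
Hypothesis HE : chain_energy u X n < r ^ 2.
Hypothesis Hmax : forall Y, chain_from U p Y n -> chain_energy u Y n < r ^ 2 ->
  chain_value u r Y n <= chain_value u r X n.
Hypothesis Hpos : 0 < curvature u (X n).

Let Hp : U p.
Proof. rewrite <- (proj1 HX). apply (in_seg_fst U _ (X 1%nat)), (proj2 HX); lia. Qed.

Let HXn : forall i, (i <= n)%nat -> U (X i).
Proof. intros i Hi; now apply (exhaustion_in U n0), (chain_vertex_in U u MA p r n0 Hp Hr Hreach X n). Qed.

(** The segments of the chain have clearance [1 / (n0 + 1)]; a common bound [B] for the finitely
    many field vectors turns it into a range of parameters. *)
Lemma varied_admissible : exists d, 0 < d /\ forall w s, Rabs s < d ->
  (forall i, (i <= n)%nat -> U (varied u X n w s i)) /\ chain_from U p (varied u X n w s) n.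
Proof.
  destruct (finite_bound (fun i => fst (vfield u X n ax1 i)) n) as (B1 & P1 & Q1).
  destruct (finite_bound (fun i => snd (vfield u X n ax1 i)) n) as (B2 & P2 & Q2).
  destruct (finite_bound (fun i => fst (vfield u X n ax2 i)) n) as (B3 & P3 & Q3).
  destruct (finite_bound (fun i => snd (vfield u X n ax2 i)) n) as (B4 & P4 & Q4).
  set (B := B1 + B2 + B3 + B4).
  assert (HB : forall w i, (i <= n)%nat -> Rabs (fst (vfield u X n w i)) <= B /\ Rabs (snd (vfield u X n w i)) <= B).
  { intros w i Hi. specialize (Q1 i Hi); specialize (Q2 i Hi); specialize (Q3 i Hi); specialize (Q4 i Hi).
    unfold B; destruct w; split; lra. }
  assert (HBp : 0 < B) by (unfold B; lra).
  exists (/ (INR n0 + 1) / B); split; [ apply Rdiv_lt_0_compat; trivial; apply inv_INR1_pos | ].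
  intros w s Hs.
  assert (Hsm : Rabs s * B < / (INR n0 + 1)) by (apply Rlt_div_r; trivial).
  assert (Hv : forall i, (i <= n)%nat -> supd (varied u X n w s i) (X i) < / (INR n0 + 1)).
  { intros i Hi. destruct (HB w i Hi) as [A1 A2]. assert (Z := Rabs_pos s).
    apply supd_lt; unfold varied, shift; simpl; split.
    - replace (fst (X i) + _ - fst (X i)) with (s * fst (vfield u X n w i)) by (unfold vfield; simpl; ring).
      rewrite Rabs_mult. eapply Rle_lt_trans; [ | exact Hsm ]. now apply Rmult_le_compat_l.
    - replace (snd (X i) + _ - snd (X i)) with (s * snd (vfield u X n w i)) by (unfold vfield; simpl; ring).
      rewrite Rabs_mult. eapply Rle_lt_trans; [ | exact Hsm ]. now apply Rmult_le_compat_l. }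
  split.
  - intros i Hi. apply (proj2 (chain_vertex_in U u MA p r n0 Hp Hr Hreach X n i HX HE Hi)); auto.
  - split.
    + rewrite <- (proj1 HX). unfold varied, vfield, shift; simpl.
      rewrite (surjective_pairing (X O)). simpl. f_equal; unfold Rdiv; ring.
    + intros i Hi t Ht. apply (proj2 (chain_seg_in U u MA p r n0 Hp Hr Hreach X n i t HX HE Hi Ht)).
      assert (L1 := Hv i ltac:(lia)). assert (L2 := Hv (S i) ltac:(lia)).
      apply supd_lt in L1; apply supd_lt in L2. apply supd_lt.
      destruct L1 as [L1 L1'], L2 as [L2 L2'].
      apply Rabs_lt_between in L1; apply Rabs_lt_between in L1'.
      apply Rabs_lt_between in L2; apply Rabs_lt_between in L2'.
      assert (Hc : forall a b d0, - d0 < a < d0 -> - d0 < b < d0 -> - d0 < (1 - t) * a + t * b < d0).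
      { intros a b d0 Ha Hb; destruct (Rle_dec t (1 / 2)); split; nra. }
      unfold seg; cbn [fst snd]. split; apply Rabs_lt_between.
      * specialize (Hc _ _ _ L1 L2). lra.
      * specialize (Hc _ _ _ L1' L2'). lra.
Qed.

Definition chain_gradient (w : axis) : R :=
  INR n * psum (fun i => leg_d u (X i) (vfield u X n w i) (X (S i)) (vfield u X n w (S i)) 0) n.

(** [max_of_product_sqr] is applied to the factor [r ^ 2 - E], so the derivatives of the energy
    enter with the opposite sign. *)
Lemma stationary_direction w :
  let v := vfield u X n w n in
  let k1 := fst v * partial ax1 (curvature u) (X n) + snd v * partial ax2 (curvature u) (X n) in
  let k2 := fst v * (fst v * partial ax1 (partial ax1 (curvature u)) (X n)
                     + snd v * partial ax1 (partial ax2 (curvature u)) (X n))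
     + snd v * (fst v * partial ax1 (partial ax2 (curvature u)) (X n)
                + snd v * partial ax2 (partial ax2 (curvature u)) (X n)) in
  let e := r ^ 2 - chain_energy u X n in
  k1 * e = 2 * curvature u (X n) * chain_gradient w /\
  k2 * e ^ 2 - 6 * curvature u (X n) * chain_gradient w ^ 2
  - 2 * curvature u (X n) * e * (INR n * psum (fun i => leg_dd u (X i) (vfield u X n w i)
       (X (S i)) (vfield u X n w (S i))) n) <= 0.
Proof.
  intros v k1 k2 e.
  destruct varied_admissible as (d & Hd & Hadm).
  assert (SK := smooth_curvature U u MA).
  set (E := fun s => chain_energy u (varied u X n w s) n).
  assert (DE : forall s, Rabs s < d -> is_derive E s
    (INR n * psum (fun i => leg_d u (X i) (vfield u X n w i) (X (S i)) (vfield u X n w (S i)) s) n)).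
  { intros s Hs; destruct (Hadm w s Hs) as [HU _].
    apply (is_derive_scal (fun s => psum (fun i => leg_energy u (varied u X n w s i) (varied u X n w s (S i))) n)).
    apply (is_derive_psum (fun i s => leg_energy u (varied u X n w s i) (varied u X n w s (S i)))
      (fun i s => leg_d u (X i) (vfield u X n w i) (X (S i)) (vfield u X n w (S i)) s)).
    intros i Hi. apply (is_derive_leg U u MA); [ apply (HU i) | apply (HU (S i)) ]; lia. }
  assert (V0 : forall i, varied u X n w 0 i = X i) by (intros; apply shift_0).
  assert (E0 : E 0 = chain_energy u X n).
  { unfold E, chain_energy; f_equal; apply psum_ext; intros; now rewrite !V0. }
  assert (CE : exists d', 0 < d' /\ d' <= d /\ forall s, Rabs s < d' -> E s < r ^ 2).
  { assert (C := is_derive_continuous _ _ _ (DE 0 ltac:(rewrite Rabs_R0; trivial))).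
    destruct (proj1 (continuous_iff_continuous_in E 0) C (r ^ 2 - E 0)) as (d' & Hd' & A); [ rewrite E0; lra | ].
    exists (Rmin d d'); split; [ now apply Rmin_pos | split; [ apply Rmin_l | ] ].
    intros s Hs. assert (B := A s I). rewrite Rminus_0_r in B.
    specialize (B (Rlt_le_trans _ _ _ Hs (Rmin_r _ _))). apply Rabs_lt_between in B; lra. }
  destruct CE as (d' & Hd' & Hdd & HEs).
  assert (R := max_of_product_sqr (fun s => curvature u (varied u X n w s n))
    (fun s => fst v * partial ax1 (curvature u) (varied u X n w s n)
              + snd v * partial ax2 (curvature u) (varied u X n w s n))
    (fun s => r ^ 2 - E s)
    (fun s => - (INR n * psum (fun i => leg_d u (X i) (vfield u X n w i) (X (S i)) (vfield u X n w (S i)) s) n))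
    k2 (- (INR n * psum (fun i => leg_dd u (X i) (vfield u X n w i) (X (S i)) (vfield u X n w (S i))) n)) d' Hd').
  cbv beta in R. rewrite E0, V0 in R.
  fold (chain_gradient w) k1 e in R.
  assert (R' : k1 * e = -2 * curvature u (X n) * - chain_gradient w /\
    k2 * e ^ 2 - 6 * curvature u (X n) * (- chain_gradient w) ^ 2 +
    2 * curvature u (X n) * e *
    - (INR n * psum (fun i => leg_dd u (X i) (vfield u X n w i) (X (S i)) (vfield u X n w (S i))) n) <= 0).
  { apply R; clear R.
    - intros s Hs. destruct (Hadm w s ltac:(lra)) as [HU _].
      apply (is_derive_shift U u MA); trivial. apply (HU n); lia.
    - assert (D1 := is_derive_shift U u MA _ (X n) v 0 (smooth_partial U _ ax1 SK)
        ltac:(rewrite shift_0; auto)).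
      assert (D2 := is_derive_shift U u MA _ (X n) v 0 (smooth_partial U _ ax2 SK)
        ltac:(rewrite shift_0; auto)).
      rewrite shift_0 in D1, D2.
      rewrite <- (partial_comm U (curvature u) (X n) Ho SK (HXn n (le_n _))) in D1.
      apply (@is_derive_plus R_AbsRing R_NormedModule).
      + apply (is_derive_scal (fun s => partial ax1 (curvature u) (shift (X n) v s)) 0 (fst v) _ D1).
      + apply (is_derive_scal (fun s => partial ax2 (curvature u) (shift (X n) v s)) 0 (snd v) _ D2).
    - intros s Hs. assert (A := DE s ltac:(lra)).
      assert (B := is_derive_minus _ _ _ _ _ (@is_derive_const R_AbsRing R_NormedModule (r ^ 2) s) A).
      match goal with |- is_derive _ _ ?l => match type of B with is_derive _ _ ?l' => replace l with l'; [ exact B | ] end end.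
      unfold minus, plus, opp, zero; simpl; ring_R.
    - apply is_derive_opp with (f := fun s => INR n * psum (fun i => leg_d u (X i) (vfield u X n w i) (X (S i)) (vfield u X n w (S i)) s) n).
      apply (is_derive_scal (fun s => psum (fun i => leg_d u (X i) (vfield u X n w i) (X (S i)) (vfield u X n w (S i)) s) n)).
      assert (B := is_derive_psum (fun i s => leg_d u (X i) (vfield u X n w i) (X (S i)) (vfield u X n w (S i)) s)
        (fun i _ => leg_dd u (X i) (vfield u X n w i) (X (S i)) (vfield u X n w (S i))) n 0).
      apply B. intros i Hi; apply (is_derive_leg_d U u MA); apply HXn; lia.
    - intros s Hs. destruct (Hadm w s ltac:(lra)) as [_ HC].
      exact (Hmax _ HC (HEs s Hs)).
    - unfold e; lra. }
  destruct R' as [R1 R2]; split; lra.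
Qed.

(** Let [L] be the trace of the second derivatives of [K] and [G] the energy gradient. The two
    directions together give [L e^2 <= 6 K |G|^2 + 8 K e] and [|grad K|^2 e^2 = 4 K^2 |G|^2]. With
    [K L = 6 K^3 + |grad K|^2] this is the claim multiplied by [2 K]. *)
Lemma stationary_inequality :
  3 * (curvature u (X n) * (r ^ 2 - chain_energy u X n) ^ 2)
  <= 4 * (r ^ 2 - chain_energy u X n) + sum2 (fun w => chain_gradient w ^ 2).
Proof.
  destruct (stationary_direction ax1) as [A1 B1]. destruct (stationary_direction ax2) as [A2 B2].
  cbv zeta in A1, A2, B1, B2.
  assert (Hn' : 0 < INR n) by now apply lt_0_INR.
  assert (HM := frames_orthonormal X n HXn).
  destruct (orthonormal_outer _ _ _ _ HM) as (Eg & Ea & Eb).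
  assert (PDE := curvature_pde U u MA (X n) (HXn n (le_n _))). cbv zeta in PDE.
  assert (SDD : INR n * psum (fun i => leg_dd u (X i) (vfield u X n ax1 i) (X (S i)) (vfield u X n ax1 (S i))) n
    + INR n * psum (fun i => leg_dd u (X i) (vfield u X n ax2 i) (X (S i)) (vfield u X n ax2 (S i))) n <= 4).
  { rewrite <- Rmult_plus_distr_l, <- psum_plus.
    apply Rle_trans with (INR n * psum (fun _ => 4 / INR n ^ 2 * 1) n).
    - apply Rmult_le_compat_l; [ lra | ]. apply psum_le; intros i Hi. rewrite Rmult_1_r.
      apply (sum_leg_dd X n i Hn). intros j Hj; apply HXn; lia.
    - rewrite psum_scal. assert (P1 : psum (fun _ => 1) n = INR n).
      { clear. induction n as [|m IH]; [ reflexivity | rewrite S_INR; simpl psum; now rewrite IH ]. }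
      rewrite P1. apply Req_le; field; lra. }
  assert (Ef : forall w, vfield u X n w n = fvec w (frames u X n)).
  { intros w; unfold vfield. rewrite (surjective_pairing (fvec w _)); simpl.
    f_equal; field; lra. }
  rewrite !Ef in A1, A2, B1, B2. unfold fvec in A1, A2; cbn [fst snd] in A1, A2.
  set (k := curvature u (X n)) in *. set (e := r ^ 2 - chain_energy u X n) in *.
  assert (He : 0 < e) by (unfold e; lra).
  set (K1 := partial ax1 (curvature u) (X n)) in *. set (K2 := partial ax2 (curvature u) (X n)) in *.
  set (K11 := partial ax1 (partial ax1 (curvature u)) (X n)) in *.
  set (K12 := partial ax1 (partial ax2 (curvature u)) (X n)) in *.
  set (K22 := partial ax2 (partial ax2 (curvature u)) (X n)) in *.
  set (L := h22 u (X n) * K11 - 2 * h12 u (X n) * K12 + h11 u (X n) * K22) in *.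
  set (g1 := chain_gradient ax1) in *. set (g2 := chain_gradient ax2) in *.
  set (D1 := INR n * _) in B1. set (D2 := INR n * _) in B2.
  change (D1 + D2 <= 4) in SDD.
  assert (S2 : L * e ^ 2 - 6 * k * (g1 ^ 2 + g2 ^ 2) - 2 * k * e * (D1 + D2) <= 0).
  { unfold L. rewrite <- Eg, <- Ea.
    replace (h12 u (X n)) with (- (e1x (frames u X n) * e1y (frames u X n) + e2x (frames u X n) * e2y (frames u X n)))
      by (rewrite Eb; ring).
    unfold fvec in B1, B2; cbn [fst snd] in B1, B2. lra. }
  assert (S1 : (h22 u (X n) * K1 ^ 2 - 2 * h12 u (X n) * K1 * K2 + h11 u (X n) * K2 ^ 2) * e ^ 2
    = 4 * k ^ 2 * (g1 ^ 2 + g2 ^ 2)).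
  { transitivity (((e1x (frames u X n) * K1 + e1y (frames u X n) * K2) * e) ^ 2
      + ((e2x (frames u X n) * K1 + e2y (frames u X n) * K2) * e) ^ 2).
    - rewrite <- Eg, <- Ea.
      replace (h12 u (X n)) with (- (e1x (frames u X n) * e1y (frames u X n) + e2x (frames u X n) * e2y (frames u X n)))
        by (rewrite Eb; ring). ring.
    - rewrite A1, A2. ring. }
  set (Q := h22 u (X n) * K1 ^ 2 - 2 * h12 u (X n) * K1 * K2 + h11 u (X n) * K2 ^ 2) in *.
  assert (F : k * (L * e ^ 2) = 6 * k ^ 3 * e ^ 2 + 4 * k ^ 2 * (g1 ^ 2 + g2 ^ 2)).
  { rewrite <- S1. replace (k * (L * e ^ 2)) with (k * L * e ^ 2) by ring.
    replace (k * L) with (6 * k ^ 3 + Q) by lra. ring. }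
  assert (F' : L * e ^ 2 = 6 * k ^ 2 * e ^ 2 + 4 * k * (g1 ^ 2 + g2 ^ 2)).
  { apply Rmult_eq_reg_l with k; [ rewrite F; ring | lra ]. }
  assert (F2 : 6 * k ^ 2 * e ^ 2 <= 2 * k * (g1 ^ 2 + g2 ^ 2) + 2 * k * e * 4).
  { assert (2 * k * e * (D1 + D2) <= 2 * k * e * 4); [ | lra ].
    apply Rmult_le_compat_l; trivial. apply Rmult_le_pos; lra. }
  unfold sum2. fold g1 g2. apply Rmult_le_reg_l with (2 * k); [ lra | ]. lra.
Qed.
End AtMaximum.
End Stationary.

(** * Discretization errors and the curvature bound *)

Lemma psum_norm2 (f g : nat -> R) n :
  sqrt (psum f n ^ 2 + psum g n ^ 2) <= psum (fun i => sqrt (f i ^ 2 + g i ^ 2)) n.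
Proof.
  induction n as [|n IH]; cbn [psum].
  - replace (0 ^ 2 + 0 ^ 2) with 0 by ring. rewrite sqrt_0; lra.
  - eapply Rle_trans; [ apply norm2_triang | lra ].
Qed.

Section Bound.
Variables (U : R * R -> Prop) (u : R * R -> R).
Hypothesis MA : monge_ampere U u.

Let Ho := ma_open _ _ MA.
Let Hs := ma_smooth _ _ MA.

(** Bounds the two quantities by which a leg differs from a flat one. The Hessian is Lipschitz on an
    exhaustion set, so its change along the leg is [O(s)] and the Taylor remainder of the gradient
    is [O(s^2)], where [s^2 <= 2 T e]. *)
Lemma leg_constants n0 : exists C, 1 <= C /\ forall x y,
  (forall t, 0 <= t <= 1 -> exhaustion U n0 (seg x y t)) ->
  let w1 := partial ax1 u y - partial ax1 u x - (h11 u x * (fst y - fst x) + h12 u x * (snd y - snd x)) in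
  let w2 := partial ax2 u y - partial ax2 u x - (h12 u x * (fst y - fst x) + h22 u x * (snd y - snd x)) in
  (h12 u y - h12 u x) ^ 2 - (h11 u y - h11 u x) * (h22 u y - h22 u x) <= C * leg_energy u x y /\
  (h22 u x * w1 ^ 2 - 2 * h12 u x * w1 * w2 + h11 u x * w2 ^ 2) / 4 <= C * leg_energy u x y ^ 2.
Proof.
  destruct (htr_bounded U u MA n0) as (T & HT & HTb).
  assert (Hb : exists B, 0 < B /\ forall i j k q, exhaustion U n0 q -> Rabs (ts i j k u q) <= B).
  { assert (HB : forall i j k, exists B, 0 < B /\ forall q, exhaustion U n0 q -> Rabs (ts i j k u q) <= B).
    { intros i j k; apply bounded_on_exhaustion. intros q Hq; apply (smooth_continuous U); trivial.
      now apply (smooth_ts U u MA). }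
    destruct (HB ax1 ax1 ax1) as (B1 & P1 & Q1). destruct (HB ax1 ax1 ax2) as (B2 & P2 & Q2).
    destruct (HB ax1 ax2 ax2) as (B3 & P3 & Q3). destruct (HB ax2 ax2 ax2) as (B4 & P4 & Q4).
    exists (B1 + B2 + B3 + B4); split; [ lra | ]. intros i j k q Hq.
    specialize (Q1 q Hq); specialize (Q2 q Hq); specialize (Q3 q Hq); specialize (Q4 q Hq).
    destruct i, j, k; simpl in *; lra. }
  destruct Hb as (B & HB & HBb).
  assert (HT3 : 0 < T ^ 3) by now apply pow_lt.
  (* The first term serves the first estimate, the second term the second one, and 1 ensures
     [1 <= C]. *)
  exists (4 * B ^ 2 * T + 2 * T ^ 3 * B ^ 2 + 1); split.
  { assert (0 <= B ^ 2 * T) by nra. assert (0 <= T ^ 3 * B ^ 2) by nra. lra. }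
  intros x y Hxy w1 w2.
  assert (HU : in_seg U x y) by (intros t Ht; apply (exhaustion_in U n0); auto).
  assert (Hx := in_seg_fst U x y HU).
  set (d1 := fst y - fst x) in *. set (d2 := snd y - snd x) in *. set (e := leg_energy u x y).
  set (s := Rabs d1 + Rabs d2).
  assert (Hs0 : 0 <= s) by (assert (P1 := Rabs_pos d1); assert (P2 := Rabs_pos d2); unfold s; lra).
  assert (He : 0 <= e) by now apply (leg_energy_nonneg U).
  assert (Hs2 : s ^ 2 <= 2 * T * e).
  { destruct (leg_energy_MVT U u MA x y HU) as (t & Ht & E). fold e d1 d2 in E.
    assert (A := hform_ge U u MA (seg x y t) d1 d2 (HU t Ht)). rewrite <- E in A.
    assert (B1 := HTb _ (Hxy t Ht)).
    assert (A' : d1 ^ 2 + d2 ^ 2 <= T * e) by (eapply Rle_trans; [ exact A | now apply Rmult_le_compat_r ]).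
    unfold s. rewrite <- (pow2_abs d1), <- (pow2_abs d2) in A'.
    assert (Z := pow2_ge_0 (Rabs d1 - Rabs d2)). nra. }
  assert (Hd : forall i j t, 0 <= t <= 1 -> Rabs (hs i j u (seg x y t) - hs i j u x) <= B * s).
  { intros i j t Ht.
    destruct (MVT_seg U (hs i j u) x (seg x y t) Ho (smooth_hs U u MA i j)) as (t' & Ht' & E).
    { now apply in_seg_l. }
    rewrite seg_seg_l in E. assert (Htt : 0 <= t' * t <= 1) by nra.
    rewrite !(partial_hs U u MA) in E by (apply HU; trivial).
    replace (fst (seg x y t) - fst x) with (t * d1) in E by (unfold seg, d1; simpl; ring).
    replace (snd (seg x y t) - snd x) with (t * d2) in E by (unfold seg, d2; simpl; ring).
    rewrite E. eapply Rle_trans; [ apply Rabs_triang | ]. rewrite !Rabs_mult, (Rabs_right t) by lra.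
    assert (K1 := HBb ax1 i j _ (Hxy _ Htt)). assert (K2 := HBb ax2 i j _ (Hxy _ Htt)).
    assert (P1 := Rabs_pos d1). assert (P2 := Rabs_pos d2).
    assert (P3 := Rabs_pos (ts ax1 i j u (seg x y (t' * t)))).
    assert (P4 := Rabs_pos (ts ax2 i j u (seg x y (t' * t)))).
    assert (t * Rabs d1 * Rabs (ts ax1 i j u (seg x y (t' * t))) <= Rabs d1 * B).
    { apply Rmult_le_compat; trivial; nra. }
    assert (t * Rabs d2 * Rabs (ts ax2 i j u (seg x y (t' * t))) <= Rabs d2 * B).
    { apply Rmult_le_compat; trivial; nra. }
    unfold s; lra. }
  assert (HBs : 0 <= B * s) by nra.
  split.
  - assert (K1 := Hd ax1 ax2 1 ltac:(lra)). assert (K2 := Hd ax1 ax1 1 ltac:(lra)).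
    assert (K3 := Hd ax2 ax2 1 ltac:(lra)). rewrite seg_1 in K1, K2, K3. simpl in K1, K2, K3.
    assert (E1 : (h12 u y - h12 u x) ^ 2 <= (B * s) ^ 2).
    { rewrite <- pow2_abs. apply pow_incr; split; [ apply Rabs_pos | trivial ]. }
    assert (E2 : - ((h11 u y - h11 u x) * (h22 u y - h22 u x)) <= (B * s) ^ 2).
    { apply Rle_trans with (Rabs ((h11 u y - h11 u x) * (h22 u y - h22 u x))).
      - rewrite <- Rabs_Ropp; apply Rle_abs.
      - rewrite Rabs_mult. simpl; rewrite Rmult_1_r. apply Rmult_le_compat; trivial; apply Rabs_pos. }
    assert (E3 : (B * s) ^ 2 <= B ^ 2 * (2 * T * e)).
    { replace ((B * s) ^ 2) with (B ^ 2 * s ^ 2) by ring. apply Rmult_le_compat_l; trivial. apply pow2_ge_0. }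
    assert (0 <= T ^ 3 * B ^ 2 * e) by (apply Rmult_le_pos; trivial; nra). lra.
  - assert (W : Rabs w1 <= B * s ^ 2 /\ Rabs w2 <= B * s ^ 2).
    { assert (G : forall c1 c2, Rabs c1 <= B * s -> Rabs c2 <= B * s ->
        Rabs (d1 * c1 + d2 * c2) <= B * s ^ 2).
      { intros c1 c2 H1 H2. eapply Rle_trans; [ apply Rabs_triang | ]. rewrite !Rabs_mult.
        assert (P1 := Rabs_pos d1). assert (P2 := Rabs_pos d2).
        replace (B * s ^ 2) with (Rabs d1 * (B * s) + Rabs d2 * (B * s)) by (unfold s; ring).
        apply Rplus_le_compat; now apply Rmult_le_compat_l. }
      split.
      - destruct (MVT_seg U (partial ax1 u) x y Ho (smooth_partial U u ax1 Hs) HU) as (t & Ht & E).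
        fold d1 d2 in E.
        assert (E' : partial ax2 (partial ax1 u) (seg x y t) = h12 u (seg x y t)) by exact (Hess_hs U u MA _ ax2 ax1 (HU t Ht)).
        rewrite E' in E. change (partial ax1 (partial ax1 u) (seg x y t)) with (h11 u (seg x y t)) in E.
        replace w1 with (d1 * (h11 u (seg x y t) - h11 u x) + d2 * (h12 u (seg x y t) - h12 u x))
          by (unfold w1; lra).
        apply G; [ exact (Hd ax1 ax1 t Ht) | exact (Hd ax1 ax2 t Ht) ].
      - destruct (MVT_seg U (partial ax2 u) x y Ho (smooth_partial U u ax2 Hs) HU) as (t & Ht & E).
        fold d1 d2 in E. change (partial ax1 (partial ax2 u) (seg x y t)) with (h12 u (seg x y t)) in E.
        change (partial ax2 (partial ax2 u) (seg x y t)) with (h22 u (seg x y t)) in E.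
        replace w2 with (d1 * (h12 u (seg x y t) - h12 u x) + d2 * (h22 u (seg x y t) - h22 u x))
          by (unfold w2; lra).
        apply G; [ exact (Hd ax1 ax2 t Ht) | exact (Hd ax2 ax2 t Ht) ]. }
    destruct W as [W1 W2].
    assert (V1 : w1 ^ 2 <= (B * s ^ 2) ^ 2) by (rewrite <- (pow2_abs w1); apply pow_incr; split; [ apply Rabs_pos | trivial ]).
    assert (V2 : w2 ^ 2 <= (B * s ^ 2) ^ 2) by (rewrite <- (pow2_abs w2); apply pow_incr; split; [ apply Rabs_pos | trivial ]).
    (* For determinant 1 the inverse form at [w] is the form itself at [w] rotated by a right
       angle. *)
    assert (F := hform_le U u MA x w2 (- w1) Hx). unfold hform in F.
    assert (Tx := HTb x ltac:(rewrite <- (seg_0 x y); apply Hxy; lra)).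
    assert (T2 := htr_ge U u MA x Hx).
    assert (Z : s ^ 2 * s ^ 2 <= (2 * T * e) * (2 * T * e)).
    { assert (0 <= s ^ 2) by apply pow2_ge_0. apply Rmult_le_compat; trivial. }
    assert (Z' : (B * s ^ 2) ^ 2 <= B ^ 2 * (4 * T ^ 2 * e ^ 2)).
    { replace ((B * s ^ 2) ^ 2) with (B ^ 2 * (s ^ 2 * s ^ 2)) by ring.
      apply Rmult_le_compat_l; [ apply pow2_ge_0 | ]. eapply Rle_trans; [ exact Z | apply Req_le; ring ]. }
    assert (F' : htr u x * (w2 ^ 2 + (- w1) ^ 2) <= T * (2 * (B ^ 2 * (4 * T ^ 2 * e ^ 2)))).
    { apply Rmult_le_compat; trivial; [ lra | | ].
      - apply Rplus_le_le_0_compat; apply pow2_ge_0.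
      - replace ((- w1) ^ 2) with (w1 ^ 2) by ring. lra. }
    assert (Y : 0 <= e ^ 2) by apply pow2_ge_0.
    assert (0 <= B ^ 2 * T * e ^ 2) by (apply Rmult_le_pos; trivial; nra).
    replace (T * (2 * (B ^ 2 * (4 * T ^ 2 * e ^ 2)))) with (8 * (T ^ 3 * B ^ 2 * e ^ 2)) in F' by ring.
    lra.
Qed.

(** The term [2 l / n] is the one of the flat plane; all others carry the factors [C] and
    [l ^ 2]. *)
Lemma leg_gradient_bound C X n i :
  1 <= C -> (i < n)%nat -> (forall j, (j <= n)%nat -> U (X j)) -> in_seg U (X i) (X (S i)) ->
  let e := leg_energy u (X i) (X (S i)) in
  let l := sqrt e in
  (h12 u (X (S i)) - h12 u (X i)) ^ 2 - (h11 u (X (S i)) - h11 u (X i)) * (h22 u (X (S i)) - h22 u (X i)) <= C * e ->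
  (let w1 := partial ax1 u (X (S i)) - partial ax1 u (X i)
      - (h11 u (X i) * (fst (X (S i)) - fst (X i)) + h12 u (X i) * (snd (X (S i)) - snd (X i))) in
   let w2 := partial ax2 u (X (S i)) - partial ax2 u (X i)
      - (h12 u (X i) * (fst (X (S i)) - fst (X i)) + h22 u (X i) * (snd (X (S i)) - snd (X i))) in
   (h22 u (X i) * w1 ^ 2 - 2 * h12 u (X i) * w1 * w2 + h11 u (X i) * w2 ^ 2) / 4 <= C * e ^ 2) ->
  let D w := leg_d u (X i) (vfield u X n w i) (X (S i)) (vfield u X n w (S i)) 0 in
  sqrt (D ax1 ^ 2 + D ax2 ^ 2) <= (2 / INR n + C * l ^ 2) * (l + C * l ^ 2) + C * l ^ 3.
Proof.
  intros HC Hi HU Hseg e l H1 H2 D.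
  assert (Hn : 0 < INR n) by (apply lt_0_INR; lia).
  assert (Hin := pos_INR i).
  assert (HM := frames_orthonormal U u MA X i (fun j Hj => HU j ltac:(lia))).
  assert (HUS := HU (S i) ltac:(lia)).
  assert (He : 0 <= e) by now apply (leg_energy_nonneg U).
  assert (Hl : 0 <= INR i / INR n <= INR (S i) / INR n).
  { split; [ apply Rle_div_r; trivial; lra | ].
    apply Rmult_le_compat_r; [ apply Rlt_le, Rinv_0_lt_compat, Hn | rewrite S_INR; lra ]. }
  assert (Hl1 : INR (S i) / INR n <= 1).
  { apply Rle_div_l; trivial. rewrite Rmult_1_l. apply le_INR; lia. }
  destruct (transport_gradient _ _ _ (h11 u (X (S i))) (h12 u (X (S i))) (h22 u (X (S i))) _
    (INR i / INR n) (INR (S i) / INR n) (vsub (X (S i)) (X i)) (vsub (grad u (X (S i))) (grad u (X i)))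
    (h11_pos U u MA _ HUS) (h_det U u MA _ HUS) HM Hl He) as (K1 & K2 & K3).
  change (frame_step _ _ _ (frames u X i)) with (frames u X (S i)) in K3.
  change (dot (vsub (X (S i)) (X i)) (vsub (grad u (X (S i))) (grad u (X i)))) with e in K3.
  unfold vsub at 1 2 3 4 5 6 in K2. unfold grad in K2. cbn [fst snd] in K2.
  cbv zeta in H2.
  set (th := (h12 u (X (S i)) - h12 u (X i)) ^ 2 - _) in *.
  match type of H2 with ?a <= _ => set (q := a) in * end.
  match type of K3 with _ <= _ * sqrt (e + ?a) + _ => change a with q in K3 end.
  change (0 <= q) in K2.
  assert (EE : forall w, D w = dot (lin (INR (S i) / INR n) (INR i / INR n) (fvec w (frames u X (S i))) (fvec w (frames u X i)))
        (vsub (grad u (X (S i))) (grad u (X i))) +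
      dot (vsub (X (S i)) (X i)) (lin (INR (S i) / INR n) (INR i / INR n)
          (hmul (h11 u (X (S i))) (h12 u (X (S i))) (h22 u (X (S i))) (fvec w (frames u X (S i))))
          (hmul (h11 u (X i)) (h12 u (X i)) (h22 u (X i)) (fvec w (frames u X i))))).
  { intros w. unfold D, leg_d; rewrite !shift_0.
    unfold vfield, dot, vsub, lin, hvec, hmul; cbn [fst snd]. ring. }
  rewrite !EE. eapply Rle_trans; [ exact K3 | ].
  assert (El : INR (S i) / INR n - INR i / INR n = / INR n) by (rewrite S_INR; field; lra).
  rewrite El.
  assert (Pl : 0 <= l) by apply sqrt_pos.
  assert (L2 : l ^ 2 = e) by now apply pow2_sqrt.
  assert (Sq : sqrt q <= C * l ^ 2).
  { rewrite <- (sqrt_pow2 (C * l ^ 2)) by nra. apply sqrt_le_1_alt.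
    eapply Rle_trans; [ exact H2 | ]. rewrite L2. nra. }
  assert (Seq : sqrt (e + q) <= l + C * l ^ 2).
  { eapply Rle_trans; [ | apply Rplus_le_compat_l, Sq ].
    assert (Q1 := sqrt_pos q). rewrite <- (sqrt_pow2 (l + sqrt q)) by lra. apply sqrt_le_1_alt.
    replace ((l + sqrt q) ^ 2) with (l ^ 2 + sqrt q ^ 2 + 2 * (l * sqrt q)) by ring.
    rewrite L2, (pow2_sqrt q) by trivial. assert (0 <= l * sqrt q) by now apply Rmult_le_pos. lra. }
  assert (Sth : sqrt (th * q) <= C * l ^ 3).
  { rewrite <- (sqrt_pow2 (C * l ^ 3)) by (assert (0 <= l ^ 3) by (now apply pow_le); nra).
    apply sqrt_le_1_alt. apply Rle_trans with ((C * e) * (C * e ^ 2)).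
    - apply Rmult_le_compat; trivial.
    - rewrite <- L2. apply Req_le; ring. }
  assert (Th : 0 <= INR (S i) / INR n * th <= C * e).
  { split; [ apply Rmult_le_pos; lra | ]. eapply Rle_trans; [ | exact H1 ].
    rewrite <- (Rmult_1_l th) at 2. now apply Rmult_le_compat_r. }
  assert (Hn1 : 0 < / INR n) by now apply Rinv_0_lt_compat.
  apply Rplus_le_compat.
  - apply Rmult_le_compat; trivial; [ | apply sqrt_pos | ].
    + lra.
    + rewrite L2. unfold Rdiv at 1 3. lra.
  - apply Rle_trans with (1 * sqrt (th * q)); [ | lra ].
    apply Rmult_le_compat_r; [ apply sqrt_pos | trivial ].
Qed.

(* The maximum principle gives [3 K(p) r^4 <= 4 r^2 + O(1 / sqrt n)] for chains
   with [n] legs. *)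
Lemma curvature_bound_in_reach p r n0 : U p -> 0 < r ->
  (forall y c, path U u p y c -> c < r -> exhaustion U n0 y) ->
  curvature u p * r ^ 2 <= 4 / 3.
Proof.
  intros Hp Hr Hreach.
  destruct (Rle_lt_dec (curvature u p) 0) as [HK | HK].
  { assert (0 < r ^ 2) by now apply pow_lt. nra. }
  destruct (leg_constants n0) as (C & HC & HCb).
  set (C3 := (2 * C + 2 * C * r + C ^ 2 * r ^ 2) * r ^ 2).
  assert (HC3 : 0 <= C3).
  { unfold C3. apply Rmult_le_pos; [ | apply pow2_ge_0 ].
    assert (0 <= C ^ 2 * r ^ 2) by (apply Rmult_le_pos; apply pow2_ge_0). nra. }
  assert (Main : forall m : nat, 3 * curvature u p * r ^ 4 <= 4 * r ^ 2 + (4 * r * C3 + C3 ^ 2) * / (INR m + 1)).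
  (* A square number of legs makes [1 / sqrt n] equal to [dl = 1 / (m0 + 1)]. *)
  { intros m0. set (n := ((S m0) * (S m0))%nat). set (dl := / (INR m0 + 1)).
    assert (Hdl : 0 < dl) by apply inv_INR1_pos.
    assert (Hdl1 : dl <= 1).
    { unfold dl. rewrite <- Rinv_1. apply Rinv_le_contravar; [ lra | assert (P := pos_INR m0); lra ]. }
    assert (Hn : (0 < n)%nat) by (unfold n; lia).
    assert (En : / INR n = dl ^ 2).
    { unfold n, dl; rewrite mult_INR, S_INR. field. assert (P := INR1_pos m0); lra. }
    assert (Hn' : 0 < INR n) by now apply lt_0_INR.
    destruct (chain_maximizer U u MA p r n0 Hp Hr Hreach n Hn HK) as (X & HX & HE & HV & Hmax).
    assert (HXn : forall i, (i <= n)%nat -> U (X i)).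
    { intros i Hi; now apply (exhaustion_in U n0), (chain_vertex_in U u MA p r n0 Hp Hr Hreach X n). }
    set (E := chain_energy u X n) in *. unfold chain_value in HV. fold E in HV.
    assert (HE0 : 0 <= E) by now apply (chain_energy_nonneg U u MA p).
    assert (HKn : 0 < curvature u (X n)).
    { destruct (Rle_lt_dec (curvature u (X n)) 0) as [h | h]; trivial. exfalso.
      assert (0 < curvature u p * r ^ 4) by (apply Rmult_lt_0_compat; trivial; now apply pow_lt).
      assert (0 <= (r ^ 2 - E) ^ 2) by apply pow2_ge_0. nra. }
    assert (S := stationary_inequality U u MA p r n0 n X Hr Hn Hreach HX HE Hmax HKn).
    fold E in S.
    set (l := fun i => sqrt (leg_energy u (X i) (X (Datatypes.S i)))).
    assert (Hl0 : forall i, 0 <= l i) by (intros; apply sqrt_pos).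
    assert (Hl2 : forall i, (i < n)%nat -> l i ^ 2 = leg_energy u (X i) (X (Datatypes.S i))).
    { intros i Hi; apply pow2_sqrt. now apply (leg_energy_nonneg U), HX. }
    assert (HSl : INR n * psum (fun i => l i ^ 2) n = E).
    { unfold E, chain_energy; f_equal; apply psum_ext; auto. }
    (* No leg has more than the total energy, [n l^2 <= E < r^2]; so every leg is of size at most
       [r / sqrt n]. *)
    assert (Hlr : forall i, (i < n)%nat -> l i <= r * dl).
    { intros i Hi.
      assert (A : INR n * l i ^ 2 <= r ^ 2).
      { apply Rle_trans with E; [ | lra ]. rewrite <- HSl. apply Rmult_le_compat_l; [ lra | ].
        eapply Rle_trans; [ | apply (psum_mono (fun i => l i ^ 2) n (Datatypes.S i)); [ lia | intros; apply pow2_ge_0 ] ].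
        cbn [psum]. assert (B : 0 <= psum (fun i => l i ^ 2) i) by (apply psum_nonneg; intros; apply pow2_ge_0). lra. }
      apply Rsqr_incr_0_var; [ | nra ]. rewrite !Rsqr_pow2.
      apply Rmult_le_reg_l with (INR n); trivial. eapply Rle_trans; [ exact A | ].
      replace ((r * dl) ^ 2) with (r ^ 2 * dl ^ 2) by ring. rewrite <- En. apply Req_le; field; lra. }
    assert (HG : sqrt (chain_gradient u n X ax1 ^ 2 + chain_gradient u n X ax2 ^ 2) <= 2 * sqrt E + C3 * dl).
    { unfold chain_gradient.
      match goal with |- sqrt ((_ * psum ?f n) ^ 2 + (_ * psum ?g n) ^ 2) <= _ =>
        replace ((INR n * psum f n) ^ 2 + (INR n * psum g n) ^ 2) with (INR n ^ 2 * (psum f n ^ 2 + psum g n ^ 2)) by ring end.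
      rewrite sqrt_mult_alt, sqrt_pow2 by (try apply pow2_ge_0; lra).
      eapply Rle_trans; [ apply Rmult_le_compat_l; [ lra | apply psum_norm2 ] | ].
      (* The errors are collected as multiples of [dl * l i ^ 2], because [n] times the sum of the
         squares is the energy and stays bounded. *)
      apply Rle_trans with (INR n * psum (fun i => 2 / INR n * l i +
        (2 * C + 2 * C * r + C ^ 2 * r ^ 2) * dl * l i ^ 2) n).
      - apply Rmult_le_compat_l; [ lra | ]. apply psum_le. intros i Hi.
        destruct (HCb (X i) (X (Datatypes.S i))) as [c1 c2].
        { intros t Ht; now apply (chain_seg_in U u MA p r n0 Hp Hr Hreach X n). }
        eapply Rle_trans; [ apply (leg_gradient_bound C X n i HC Hi HXn (proj2 HX i Hi) c1 c2) | ].
        fold (l i). specialize (Hlr i Hi). specialize (Hl0 i).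
        unfold Rdiv; rewrite En. set (x := l i) in *.
        assert (X2 : 0 <= x ^ 2) by apply pow2_ge_0.
        assert (A1 : dl ^ 2 * x ^ 2 <= dl * x ^ 2) by (apply Rmult_le_compat_r; trivial; nra).
        assert (A2 : x ^ 3 <= r * dl * x ^ 2).
        { replace (x ^ 3) with (x * x ^ 2) by ring. now apply Rmult_le_compat_r. }
        assert (A3 : x ^ 4 <= r ^ 2 * dl * x ^ 2).
        { replace (x ^ 4) with (x * x * x ^ 2) by ring. apply Rmult_le_compat_r; trivial.
          apply Rle_trans with ((r * dl) * (r * dl)); [ now apply Rmult_le_compat | ].
          replace (r * dl * (r * dl)) with (r ^ 2 * (dl * dl)) by ring.
          apply Rmult_le_compat_l; [ apply pow2_ge_0 | nra ]. }
        assert (C2 : 0 <= C ^ 2) by apply pow2_ge_0.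
        apply Rmult_le_compat_l with (r := 2 * C) in A1; [ | lra ].
        apply Rmult_le_compat_l with (r := 2 * C) in A2; [ | lra ].
        apply Rmult_le_compat_l with (r := C ^ 2) in A3; trivial. lra.
      - rewrite psum_plus, !psum_scal.
        assert (A : psum l n <= sqrt E) by (apply (chain_length_le U u MA p); trivial).
        replace (INR n * _) with (2 * psum l n + (2 * C + 2 * C * r + C ^ 2 * r ^ 2) * dl * (INR n * psum (fun i => l i ^ 2) n))
          by (field; lra).
        rewrite HSl. apply Rplus_le_compat; [ lra | ]. unfold C3.
        replace (_ * r ^ 2 * dl) with ((2 * C + 2 * C * r + C ^ 2 * r ^ 2) * dl * r ^ 2) by ring.
        apply Rmult_le_compat_l; [ | lra ]. apply Rmult_le_pos; [ | lra ].
        assert (0 <= C ^ 2 * r ^ 2) by (apply Rmult_le_pos; apply pow2_ge_0). nra. }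
    (* The leading term [4 E] cancels the [- 4 E] in [stationary_inequality], which makes the final
       bound independent of where the maximizer ends. *)
    assert (HG2 : chain_gradient u n X ax1 ^ 2 + chain_gradient u n X ax2 ^ 2 <= 4 * E + (4 * r * C3 + C3 ^ 2) * dl).
    { set (G := chain_gradient u n X ax1 ^ 2 + _) in *.
      assert (G0 : 0 <= G) by (apply Rplus_le_le_0_compat; apply pow2_ge_0).
      rewrite <- (pow2_sqrt G G0).
      assert (SE : sqrt E <= r) by (rewrite <- (sqrt_pow2 r) by lra; apply sqrt_le_1_alt; lra).
      assert (SE0 := sqrt_pos E). assert (SE2 := pow2_sqrt E HE0).
      apply Rle_trans with ((2 * sqrt E + C3 * dl) ^ 2).
      - apply pow_incr; split; [ apply sqrt_pos | trivial ].
      - replace ((2 * sqrt E + C3 * dl) ^ 2) with (4 * sqrt E ^ 2 + (4 * (sqrt E * C3) + C3 ^ 2 * dl) * dl) by ring.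
        rewrite SE2. apply Rplus_le_compat_l, Rmult_le_compat_r; [ lra | ].
        assert (sqrt E * C3 <= r * C3) by now apply Rmult_le_compat_r.
        assert (0 <= C3 ^ 2) by apply pow2_ge_0. nra. }
    unfold sum2 in S. lra. }
  set (c5 := 4 * r * C3 + C3 ^ 2) in Main.
  assert (Hc5 : 0 <= c5) by (unfold c5; assert (0 <= C3 ^ 2) by apply pow2_ge_0; nra).
  assert (Fin : 3 * curvature u p * r ^ 4 <= 4 * r ^ 2).
  { apply le_epsilon; intros eps He. destruct (inv_INR1_small (eps / (c5 + 1))) as [m Hm].
    { apply Rdiv_lt_0_compat; lra. }
    eapply Rle_trans; [ apply (Main m) | ]. apply Rplus_le_compat_l.
    assert (P := inv_INR1_pos m).
    apply Rmult_lt_compat_l with (r := c5 + 1) in Hm; [ | lra ].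
    replace ((c5 + 1) * (eps / (c5 + 1))) with eps in Hm by (field; lra). lra. }
  assert (R2 : 0 < r ^ 2) by now apply pow_lt.
  apply Rmult_le_reg_l with (3 * r ^ 2); [ lra | ]. lra.
Qed.
End Bound.

Lemma bilin_of_gnorm_1 g p v : gnorm g p v = 1 -> bilin (g p) v v = 1.
Proof.
  unfold gnorm; intros N. destruct (Rle_lt_dec (bilin (g p) v v) 0) as [h | h].
  (* [sqrt] is 0 on negative reals, so norm 1 excludes this case. *)
  - rewrite sqrt_neg_0 in N by trivial. lra.
  - rewrite <- (sqrt_sqrt (bilin (g p) v v)) by lra. rewrite N; ring.
Qed.

Lemma ricci_bound_116 : ricci_bound (116 / 100).
Proof.
  intros U u Ho Hs Hpd Hdet gamma C C' Hg RD s Hs'.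
  assert (MA : monge_ampere U u) by now split.
  assert (HU : U (C s)) by now apply (rdb_in _ _ _ _ _ RD).
  rewrite (Ric_bilin U u MA) by trivial.
  assert (E : bilin (Hess u (C s)) (C' s) (C' s) = 1)
    by exact (bilin_of_gnorm_1 _ _ _ (rdb_unit_speed _ _ _ _ _ RD s Hs')).
  rewrite E, Rmult_1_r. set (d := gamma - s). assert (Hd : 0 < d) by (unfold d; lra).
  (* The loss is affordable: [4 / 3] divided by [0.999^2] is [1.3360...], below
     [1.16^2 = 1.3456]. *)
  set (r := 999 / 1000 * d).
  assert (Hb := no_escape U u MA gamma C C' RD s r Hs' ltac:(fold d; unfold r; lra)).
  assert (Hn : exists n0, forall y c, path U u (C s) y c -> c < r -> exhaustion U n0 y).
  { apply not_all_ex_not in Hb. destruct Hb as [n0 Hn0]; exists n0. intros y c Hp Hc.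
    apply NNPP; intros Hne; apply Hn0; now exists y, c. }
  destruct Hn as [n0 Hn0].
  assert (B := curvature_bound_in_reach U u MA (C s) r n0 HU ltac:(unfold r; lra) Hn0).
  assert (P : 0 < 116 / 100 / d) by (apply Rdiv_lt_0_compat; lra).
  rewrite <- (sqrt_pow2 (116 / 100 / d)) by lra. apply sqrt_le_1_alt.
  assert (D2 : 0 < d ^ 2) by now apply pow_lt.
  apply Rmult_le_reg_r with (d ^ 2); trivial.
  replace ((116 / 100 / d) ^ 2 * d ^ 2) with ((116 / 100) ^ 2) by (field; lra).
  unfold r in B. lra.
Qed.

(** * The deltoid example *)

(* The length of the radius [[0, r]] for the metric [(1 - |z|^2) |dz|^2]. *)
Definition rlen (r : R) : R := (r * sqrt (1 - r ^ 2) + asin r) / 2.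

Lemma is_derive_asin r : -1 < r < 1 -> is_derive asin r (/ sqrt (1 - r ^ 2)).
Proof.
  intros Hr; apply is_derive_Reals. replace (/ sqrt (1 - r ^ 2)) with (1 / sqrt (1 - r²)).
  - apply derive_pt_eq_1 with (derivable_pt_asin r Hr), derive_pt_asin.
  - rewrite Rsqr_pow2; unfold Rdiv; ring.
Qed.

Lemma one_minus_sqr_pos r : -1 < r < 1 -> 0 < 1 - r ^ 2.
Proof. intros; nra. Qed.

Lemma is_derive_rlen r : -1 < r < 1 -> is_derive rlen r (sqrt (1 - r ^ 2)).
Proof.
  intros Hr; assert (P := one_minus_sqr_pos r Hr).
  assert (S := sqrt_lt_R0 _ P). assert (S2 := sqrt_sqrt _ (Rlt_le _ _ P)).
  assert (D := is_derive_asin r Hr).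
  unfold rlen; auto_derive.
  - simpl in P; repeat split; [ lra | eexists; exact D ].
  - rewrite_derivatives.
    replace (1 + - (r * (r * 1))) with (1 - r ^ 2) by ring.
    set (q := sqrt (1 - r ^ 2)) in *. apply Rmult_eq_reg_r with (2 * q); [ | lra ].
    field_simplify; [ | lra ]. nra.
Qed.

Lemma rlen_MVT r s : -1 < r < 1 -> -1 < s < 1 ->
  exists c, Rmin r s <= c <= Rmax r s /\ -1 < c < 1 /\ rlen s - rlen r = sqrt (1 - c ^ 2) * (s - r).
Proof.
  intros Hr Hs.
  assert (B : forall c, Rmin r s <= c <= Rmax r s -> -1 < c < 1).
  { intros c; unfold Rmin, Rmax; destruct Rle_dec; lra. }
  destruct (MVT_gen rlen r s (fun c => sqrt (1 - c ^ 2))) as (c & Hc & E).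
  - intros x Hx; apply is_derive_rlen, B; lra.
  - intros x Hx; apply continuity_pt_filterlim, (is_derive_continuous rlen x (sqrt (1 - x ^ 2))),
      is_derive_rlen, B, Hx.
  - exists c; auto.
Qed.

Lemma rlen_0 : rlen 0 = 0.
Proof. unfold rlen; rewrite asin_0; field. Qed.

Lemma rlen_le r s : -1 < r -> r <= s -> s < 1 -> rlen r <= rlen s <= rlen r + (s - r).
Proof.
  intros Hr Hrs Hs. destruct (rlen_MVT r s) as (c & _ & Hc & E); [ lra | lra | ].
  assert (P := sqrt_pos (1 - c ^ 2)).
  assert (Q : sqrt (1 - c ^ 2) <= 1) by (eapply Rle_trans; [ apply (sqrt_le_1_alt _ 1); nra | rewrite sqrt_1; lra ]).
  nra.
Qed.

Lemma rlen_lt r s : -1 < r -> r < s -> s < 1 -> rlen r < rlen s.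
Proof.
  intros Hr Hrs Hs. destruct (rlen_MVT r s) as (c & _ & Hc & E); [ lra | lra | ].
  assert (P := sqrt_lt_R0 _ (one_minus_sqr_pos c Hc)). nra.
Qed.

Lemma rlen_lt_inv r s : -1 < r < 1 -> -1 < s < 1 -> rlen r < rlen s -> r < s.
Proof.
  intros Hr Hs H; apply Rnot_le_lt; intros Hle.
  assert (A := rlen_le s r ltac:(lra) Hle ltac:(lra)). lra.
Qed.

(* The example lives over the disc of radius [rad0], close to 1; as [asin rad0 = 3 / 2],
   [gam0] reduces to a value of [sin]. *)
Definition rad0 : R := sin (3 / 2).
Definition gam0 : R := rlen rad0.

Lemma rad0_bounds : 0 < rad0 < 1.
Proof.
  assert (P := PI2_3_2). split.
  - apply sin_gt_0; lra.
  - unfold rad0; rewrite <- sin_PI2. apply sin_increasing_1; lra.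
Qed.

Lemma gam0_eq : gam0 = (3 / 2 + sin 3 / 2) / 2.
Proof.
  assert (P := PI2_3_2). unfold gam0, rlen, rad0. rewrite asin_sin by lra.
  assert (C : 0 <= cos (3 / 2)) by (apply cos_ge_0; lra).
  replace (1 - sin (3 / 2) ^ 2) with (cos (3 / 2) ^ 2).
  - rewrite sqrt_pow2 by trivial. replace 3 with (2 * (3 / 2)) at 5 by field. rewrite sin_2a. field.
  - assert (E := sin2_cos2 (3 / 2)). unfold Rsqr in E. simpl; lra.
Qed.

(** The bound lies just above [1.11 / sqrt 2 = 0.784888...], and [pi / 4] is [0.785398...]. It
    amounts to [sin 3 >= 0.13956]; the alternating Taylor sum up to degree 11 gives [0.14]. *)
Lemma gam0_ge : 78489 / 100000 <= gam0.
Proof.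
  rewrite gam0_eq. destruct (pre_sin_bound 3 2) as [A _]; [ lra | lra | ].
  assert (B : 14 / 100 <= sin_approx 3 (2 * 2 + 1)).
  { assert (F : forall n, INR (fact (S n)) = INR (S n) * INR (fact n)).
    { intros n; rewrite fact_simpl; apply mult_INR. }
    unfold sin_approx, sin_term; cbn [Nat.add Nat.mul sum_f_R0].
    rewrite !F. cbn [INR fact]. lra. }
  lra.
Qed.

Lemma gam0_pos : 0 < gam0.
Proof. assert (A := gam0_ge); lra. Qed.

(** A slightly larger radius, since [rho], the inverse of [rlen], is used on a neighbourhood of
    [[0, gam0]], with two-sided derivatives at both ends. *)
Definition rad1 : R := (1 + rad0) / 2.

Lemma rad1_bounds : rad0 < rad1 < 1.
Proof. assert (P := rad0_bounds); unfold rad1; lra. Qed.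

Definition rho (s : R) : R := epsilon (inhabits 0) (fun r => - rad1 <= r <= rad1 /\ rlen r = s).

Lemma rho_spec s : rlen (- rad1) <= s <= rlen rad1 -> - rad1 <= rho s <= rad1 /\ rlen (rho s) = s.
Proof.
  intros Hs; unfold rho; apply epsilon_spec.
  assert (P0 := rad0_bounds). assert (P1 := rad1_bounds).
  (* The argument is clamped to [[- rad1, rad1]], as continuity is required on the whole line while
     [rlen] is controlled inside [(-1, 1)]. *)
  destruct (IVT_cor (fun r => rlen (Rmax (- rad1) (Rmin r rad1)) - s) (- rad1) rad1) as (r & Hr & E).
  - intros r. apply continuity_pt_filterlim.
    apply (continuous_minus (fun r => rlen (Rmax (- rad1) (Rmin r rad1))) (fun _ => s)); [ | apply continuous_const ].
    apply (continuous_comp (fun r => Rmax (- rad1) (Rmin r rad1)) rlen).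
    + apply continuous_iff_continuous_in; intros eps He; exists eps; split; trivial.
      intros y _ Hy. eapply Rle_lt_trans; [ | exact Hy ].
      unfold Rmax, Rmin; repeat destruct Rle_dec; unfold Rabs; repeat destruct Rcase_abs; lra.
    + assert (B : -1 < Rmax (- rad1) (Rmin r rad1) < 1).
      { unfold Rmax, Rmin; repeat destruct Rle_dec; lra. }
      apply (is_derive_continuous rlen _ _ (is_derive_rlen _ B)).
  - lra.
  - rewrite (Rmin_left (- rad1)), (Rmin_left rad1), (Rmax_left (- rad1)), (Rmax_right (- rad1)) by lra. nra.
  - rewrite (Rmin_left r), Rmax_right in E by lra. exists r; split; lra.
Qed.

Lemma rho_rlen r : - rad1 <= r <= rad1 -> rho (rlen r) = r.
Proof.
  intros Hr. assert (P0 := rad0_bounds). assert (P1 := rad1_bounds).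
  destruct (rho_spec (rlen r)) as [A B].
  - assert (L1 := rlen_le (- rad1) r). assert (L2 := rlen_le r rad1). lra.
  - destruct (Rtotal_order (rho (rlen r)) r) as [h | [h | h]]; trivial.
    + assert (L := rlen_lt (rho (rlen r)) r ltac:(lra) h ltac:(lra)); lra.
    + assert (L := rlen_lt r (rho (rlen r)) ltac:(lra) h ltac:(lra)); lra.
Qed.

Lemma rlen_rad1_bounds : rlen (- rad1) < 0 /\ gam0 < rlen rad1.
Proof.
  assert (P0 := rad0_bounds). assert (P1 := rad1_bounds). split.
  - rewrite <- rlen_0; apply rlen_lt; lra.
  - apply rlen_lt; lra.
Qed.

(** The mean value theorem for [rlen] gives [rho y - rho s = (y - s) f c] with [c] between the two
    values of [rho]. The lower bound [k] for the slope of [rlen] on [[- rad1, rad1]] brings [c]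
    close to [rho s], where [f] is continuous. *)
Lemma is_derive_rho s : rlen (- rad1) < s < rlen rad1 -> is_derive rho s (/ sqrt (1 - rho s ^ 2)).
Proof.
  intros Hs. assert (P0 := rad0_bounds). assert (P1 := rad1_bounds).
  destruct (rho_spec s) as [Hr Er]; [ lra | ].
  assert (Hr' : -1 < rho s < 1) by lra.
  set (k := sqrt (1 - rad1 ^ 2)).
  assert (Hk : 0 < k) by (apply sqrt_lt_R0, one_minus_sqr_pos; lra).
  set (f := fun c => / sqrt (1 - c ^ 2)).
  assert (Cf : continuous f (rho s)).
  { assert (Q := one_minus_sqr_pos _ Hr').
    apply (is_derive_continuous f (rho s) (rho s * / (sqrt (1 - rho s ^ 2)) ^ 3)).
    assert (S := sqrt_lt_R0 _ Q).
    unfold f; auto_derive.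
    - replace (1 + - (rho s * (rho s * 1))) with (1 - rho s ^ 2) by ring. repeat split; lra.
    - replace (1 + - (rho s * (rho s * 1))) with (1 - rho s ^ 2) by ring.
      field. lra. }
  apply is_derive_iff_derive_in; intros eps He.
  destruct (proj1 (continuous_iff_continuous_in f (rho s)) Cf eps He) as (d & Hd & A).
  set (m := Rmin (s - rlen (- rad1)) (rlen rad1 - s)).
  assert (Hm : 0 < m) by (apply Rmin_pos; lra).
  exists (Rmin m (k * d)); split; [ apply Rmin_pos; trivial; now apply Rmult_lt_0_compat | ].
  intros y _ Hy.
  assert (Hy1 := Rlt_le_trans _ _ _ Hy (Rmin_l _ _)). assert (Hy2 := Rlt_le_trans _ _ _ Hy (Rmin_r _ _)).
  apply Rabs_lt_between in Hy1.
  assert (M1 : m <= s - rlen (- rad1)) by apply Rmin_l. assert (M2 : m <= rlen rad1 - s) by apply Rmin_r.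
  destruct (rho_spec y) as [Gr Gy]; [ lra | ].
  destruct (rlen_MVT (rho s) (rho y)) as (c & Hc & Hc1 & E); [ lra | lra | ].
  rewrite Er, Gy in E.
  assert (Sc := sqrt_lt_R0 _ (one_minus_sqr_pos c Hc1)).
  assert (Hkc : k <= sqrt (1 - c ^ 2)).
  { apply sqrt_le_1_alt. assert (- rad1 <= c <= rad1) by (revert Hc; unfold Rmin, Rmax; destruct Rle_dec; lra).
    nra. }
  assert (Ey : rho y - rho s = (y - s) * f c) by (unfold f; rewrite E; field; lra).
  assert (Hyr : Rabs (rho y - rho s) < d).
  { apply Rmult_lt_reg_l with k; trivial. eapply Rle_lt_trans; [ | exact Hy2 ].
    rewrite E, Rabs_mult, (Rabs_right (sqrt _)) by lra.
    apply Rmult_le_compat_r; [ apply Rabs_pos | trivial ]. }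
  assert (Hcr : Rabs (c - rho s) < d).
  { eapply Rle_lt_trans; [ | exact Hyr ]. revert Hc; unfold Rmin, Rmax; destruct Rle_dec; intros Hc;
      unfold Rabs; destruct (Rcase_abs (c - rho s)), (Rcase_abs (rho y - rho s)); lra. }
  rewrite Ey. replace ((y - s) * f c - (y - s) * / sqrt (1 - rho s ^ 2)) with
    ((f c - f (rho s)) * (y - s)) by (unfold f; ring).
  rewrite Rabs_mult. apply Rmult_le_compat_r; [ apply Rabs_pos | ]. apply Rlt_le, A; trivial.
Qed.

Lemma rho_range s : 0 <= s < gam0 -> 0 <= rho s < rad0.
Proof.
  intros Hs. assert (P0 := rad0_bounds). assert (P1 := rad1_bounds). assert (P2 := rlen_rad1_bounds).
  destruct (rho_spec s) as [Hr Er]; [ lra | ]. split.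
  - apply Rnot_lt_le; intros h. assert (A := rlen_lt (rho s) 0 ltac:(lra) h ltac:(lra)).
    rewrite rlen_0, Er in A; lra.
  - apply rlen_lt_inv; [ lra | lra | ]. rewrite Er. apply Hs.
Qed.

Lemma rho_0 : rho 0 = 0.
Proof.
  assert (P0 := rad0_bounds). assert (P1 := rad1_bounds).
  rewrite <- rlen_0 at 1. apply rho_rlen; lra.
Qed.

(* [z + conj z ^ 2 / 2] *)
Definition delt (z : R * R) : R * R :=
  (fst z + (fst z ^ 2 - snd z ^ 2) / 2, snd z - fst z * snd z).

(** * Injectivity, openness and the smooth inverse of the deltoid map *)

Definition nsq (z : R * R) : R := fst z ^ 2 + snd z ^ 2.

Definition disc0 (z : R * R) : Prop := nsq z < rad0 ^ 2.

Definition deltU (x : R * R) : Prop := exists z, disc0 z /\ delt z = x.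

Definition dinv (x : R * R) : R * R := epsilon (inhabits (0, 0)) (fun z => disc0 z /\ delt z = x).

Lemma dinv_spec x : deltU x -> disc0 (dinv x) /\ delt (dinv x) = x.
Proof. intros H; unfold dinv; apply epsilon_spec; exact H. Qed.

(** The difference of [conj z ^ 2 / 2] and [conj w ^ 2 / 2] is [conj (z - w)] times the conjugate of
    the midpoint, whose modulus is at most [rad0]. So [delt] is the identity plus a map of Lipschitz
    constant [rad0 < 1]. *)
Lemma delt_expand z w : nsq z <= rad0 ^ 2 -> nsq w <= rad0 ^ 2 ->
  (1 - rad0) ^ 2 * nsq (vsub z w) <= nsq (vsub (delt z) (delt w)).
Proof.
  intros Hz Hw. destruct z as [a b], w as [a' b']. unfold nsq, vsub, delt in *; cbn [fst snd] in *.
  assert (P := rad0_bounds).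
  set (p := a - a'). set (q := b - b'). set (m := (a + a') / 2). set (n := (b + b') / 2).
  assert (Hmn : m ^ 2 + n ^ 2 <= rad0 ^ 2).
  { assert (Z : (m ^ 2 + n ^ 2) * 2 <= (a ^ 2 + b ^ 2) + (a' ^ 2 + b' ^ 2)).
    { unfold m, n. assert (Y1 := pow2_ge_0 (a - a')). assert (Y2 := pow2_ge_0 (b - b')). nra. }
    lra. }
  replace (a + (a ^ 2 - b ^ 2) / 2 - (a' + (a' ^ 2 - b' ^ 2) / 2)) with (p + (m * p - n * q))
    by (unfold p, q, m, n; field).
  replace (b - a * b - (b' - a' * b')) with (q - (m * q + n * p)) by (unfold p, q, m, n; field).
  set (w := p ^ 2 + q ^ 2). set (mu := m ^ 2 + n ^ 2) in *.
  assert (Hw0 : 0 <= w) by (apply Rplus_le_le_0_compat; apply pow2_ge_0).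
  assert (Hmu : 0 <= mu) by (apply Rplus_le_le_0_compat; apply pow2_ge_0).
  replace ((p + (m * p - n * q)) ^ 2 + (q - (m * q + n * p)) ^ 2) with
    ((1 + mu) * w + 2 * (m * (p ^ 2 - q ^ 2) - n * (2 * p * q))) by (unfold mu, w; ring).
  set (s := sqrt mu). assert (Hs : 0 <= s) by apply sqrt_pos.
  assert (Hs2 : s ^ 2 = mu) by now apply pow2_sqrt.
  assert (Hsr : s <= rad0).
  { rewrite <- (sqrt_pow2 rad0) by lra. now apply sqrt_le_1_alt. }
  assert (K : - (s * w) <= m * (p ^ 2 - q ^ 2) - n * (2 * p * q)).
  { assert (H2 : (m * (p ^ 2 - q ^ 2) - n * (2 * p * q)) ^ 2 <= (s * w) ^ 2).
    { replace ((s * w) ^ 2) with (s ^ 2 * w ^ 2) by ring. rewrite Hs2.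
      replace (mu * w ^ 2) with ((m * (p ^ 2 - q ^ 2) - n * (2 * p * q)) ^ 2
        + (m * (2 * p * q) + n * (p ^ 2 - q ^ 2)) ^ 2) by (unfold mu, w; ring).
      assert (Y := pow2_ge_0 (m * (2 * p * q) + n * (p ^ 2 - q ^ 2))). lra. }
    apply Rsqr_neg_pos_le_0; [ now rewrite !Rsqr_pow2 | now apply Rmult_le_pos ]. }
  assert (L : (1 - rad0) ^ 2 <= (1 - s) ^ 2) by (apply pow_incr; lra).
  apply Rmult_le_compat_r with (r := w) in L; trivial.
  replace ((1 - s) ^ 2 * w) with ((1 + s ^ 2) * w - 2 * (s * w)) in L by ring. rewrite Hs2 in L. lra.
Qed.

Lemma nsq_vsub_0 z w : nsq (vsub z w) <= 0 -> z = w.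
Proof.
  destruct z as [a b], w as [a' b']; unfold nsq, vsub; cbn [fst snd]; intros H.
  assert (P := pow2_ge_0 (a - a')). assert (Q := pow2_ge_0 (b - b')).
  f_equal; nra.
Qed.

Lemma nsq_nonneg z : 0 <= nsq z.
Proof. apply Rplus_le_le_0_compat; apply pow2_ge_0. Qed.

Lemma delt_inj z w : nsq z <= rad0 ^ 2 -> nsq w <= rad0 ^ 2 -> delt z = delt w -> z = w.
Proof.
  intros Hz Hw E; apply nsq_vsub_0. assert (A := delt_expand z w Hz Hw). rewrite E in A.
  assert (Z : nsq (vsub (delt w) (delt w)) = 0) by (unfold nsq, vsub; cbn [fst snd]; ring).
  rewrite Z in A. assert (P := rad0_bounds). assert (N := nsq_nonneg (vsub z w)).
  assert (0 < (1 - rad0) ^ 2) by (apply pow_lt; lra). nra.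
Qed.

Lemma dinv_delt z : disc0 z -> dinv (delt z) = z.
Proof.
  intros Hz; destruct (dinv_spec (delt z)) as [A B]; [ now exists z | ].
  unfold disc0 in *; apply delt_inj; trivial; lra.
Qed.

Lemma delt_in z : disc0 z -> deltU (delt z).
Proof. intros Hz; now exists z. Qed.

Lemma continuous_delt z : continuous delt z.
Proof.
  destruct z as [a b].
  assert (Ca : continuous (fun z : R * R => fst z) (a, b)) by apply continuous_fst.
  assert (Cb : continuous (fun z : R * R => snd z) (a, b)) by apply continuous_snd.
  assert (C1 : continuous (fun z : R * R => fst z + (fst z * fst z + -1 * (snd z * snd z)) * / 2) (a, b)).
  { repeat first [ exact Ca | exact Cb | apply continuous_const | apply @continuous_plus
      | apply @continuous_mult ]. }
  assert (C2 : continuous (fun z : R * R => snd z + -1 * (fst z * snd z)) (a, b)).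
  { repeat first [ exact Ca | exact Cb | apply continuous_const | apply @continuous_plus
      | apply @continuous_mult ]. }
  assert (E : forall z, (fst z + (fst z * fst z + -1 * (snd z * snd z)) * / 2,
    snd z + -1 * (fst z * snd z)) = delt z).
  { intros z; unfold delt; f_equal; field. }
  apply (filterlim_ext _ _ E). rewrite <- E.
  apply filterlim_locally; intros e.
  assert (D1 := proj1 (filterlim_locally _ _) C1 e). assert (D2 := proj1 (filterlim_locally _ _) C2 e).
  exact (filter_imp _ _ (fun k H => H) (filter_and _ _ D1 D2)).
Qed.

Definition n2 (z : R * R) : R := sqrt (nsq z).

Lemma n2_triang z w y : n2 (vsub z y) <= n2 (vsub z w) + n2 (vsub w y).
Proof.
  unfold n2, nsq, vsub; cbn [fst snd].
  replace (fst z - fst y) with ((fst z - fst w) + (fst w - fst y)) by ring.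
  replace (snd z - snd y) with ((snd z - snd w) + (snd w - snd y)) by ring. apply norm2_triang.
Qed.

Lemma n2_nonneg z : 0 <= n2 z.
Proof. apply sqrt_pos. Qed.

Lemma n2_sqr z : n2 z ^ 2 = nsq z.
Proof. apply pow2_sqrt, nsq_nonneg. Qed.

Lemma supd_le_n2 z w : supd z w <= n2 (vsub z w).
Proof.
  rewrite <- (sqrt_pow2 (supd z w)) by apply supd_nonneg. apply sqrt_le_1_alt, supd_sqr_le.
Qed.

Lemma n2_le_supd z w : n2 (vsub z w) <= 2 * supd z w.
Proof.
  assert (P := supd_nonneg z w). rewrite <- (sqrt_pow2 (2 * supd z w)) by lra.
  apply sqrt_le_1_alt. unfold nsq, vsub; cbn [fst snd].
  destruct (proj1 (supd_le z w _) (Rle_refl _)) as [H1 H2].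
  rewrite <- (pow2_abs (fst z - fst w)), <- (pow2_abs (snd z - snd w)).
  assert (P1 := Rabs_pos (fst z - fst w)). assert (P2 := Rabs_pos (snd z - snd w)). nra.
Qed.

(* Solving [delt z = x] is finding a fixed point of [x - conj z ^ 2 / 2]. *)
Definition picard (x z : R * R) : R * R :=
  (fst x - (fst z ^ 2 - snd z ^ 2) / 2, snd x + fst z * snd z).

Lemma picard_delt x z : vsub (picard x z) z = vsub x (delt z).
Proof. unfold vsub, picard, delt; cbn [fst snd]; f_equal; ring. Qed.

Lemma picard_contract x z w : nsq z <= rad0 ^ 2 -> nsq w <= rad0 ^ 2 ->
  n2 (vsub (picard x z) (picard x w)) <= rad0 * n2 (vsub z w).
Proof.
  intros Hz Hw. assert (P := rad0_bounds).
  rewrite <- (sqrt_pow2 rad0) by lra. unfold n2. rewrite <- sqrt_mult_alt by apply pow2_ge_0.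
  apply sqrt_le_1_alt. destruct z as [a b], w as [a' b']; unfold nsq, vsub, picard in *; cbn [fst snd] in *.
  replace (_ ^ 2 + _ ^ 2) with ((((a + a') / 2) ^ 2 + ((b + b') / 2) ^ 2) * ((a - a') ^ 2 + (b - b') ^ 2)) by field.
  apply Rmult_le_compat_r; [ apply Rplus_le_le_0_compat; apply pow2_ge_0 | ].
  assert (Y1 := pow2_ge_0 (a - a')). assert (Y2 := pow2_ge_0 (b - b')). nra.
Qed.

(** A fixed point argument in the closed ball of radius [d] around [z0]: the first step has length
    at most [(1 - rad0) d], so the geometric series keeps the iterates in the ball. A limit along a
    subsequence is a solution because the steps tend to 0. *)
Lemma open_deltU : open deltU.
Proof.
  intros x0 (z0 & Hz0 & E0). assert (P := rad0_bounds). apply locally_supd.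
  set (r0 := n2 z0).
  assert (Hr0 : 0 <= r0 < rad0).
  { split; [ apply sqrt_pos | ]. rewrite <- (sqrt_pow2 rad0) by lra. apply sqrt_lt_1_alt.
    split; [ apply nsq_nonneg | exact Hz0 ]. }
  set (d := (rad0 - r0) / 2). assert (Hd : 0 < d) by (unfold d; lra).
  assert (Hball : forall z, n2 (vsub z z0) <= d -> disc0 z).
  { intros z Hz. unfold disc0. rewrite <- n2_sqr.
    assert (T := n2_triang z z0 (0, 0)).
    assert (EZ : forall w, vsub w (0, 0) = w) by (intros [a b]; unfold vsub; cbn [fst snd]; f_equal; ring).
    rewrite !EZ in T. fold r0 in T. assert (N := n2_nonneg z).
    assert (n2 z < rad0) by (unfold d in Hz; lra).
    replace (n2 z ^ 2) with (n2 z * n2 z) by ring. replace (rad0 ^ 2) with (rad0 * rad0) by ring.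
    apply Rmult_le_0_lt_compat; lra. }
  (* The division by 2 makes up for the factor in [n2_le_supd]. *)
  exists ((1 - rad0) * d / 2); split.
  { apply Rdiv_lt_0_compat; [ apply Rmult_lt_0_compat; lra | lra ]. }
  intros x Hx.
  set (Z := fix Z k := match k with O => z0 | S j => picard x (Z j) end).
  assert (He : n2 (vsub (Z 1%nat) (Z O)) <= (1 - rad0) * d).
  { simpl. rewrite picard_delt, E0. eapply Rle_trans; [ apply n2_le_supd | ]. lra. }
  assert (HZ : forall k, n2 (vsub (Z k) z0) <= (1 - rad0 ^ k) * d /\
    n2 (vsub (Z (S k)) (Z k)) <= rad0 ^ k * ((1 - rad0) * d)).
  { assert (HB : forall k, n2 (vsub (Z k) z0) <= (1 - rad0 ^ k) * d -> nsq (Z k) <= rad0 ^ 2).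
    { intros k Hk. apply Rlt_le, Hball. eapply Rle_trans; [ exact Hk | ].
      assert (0 <= rad0 ^ k) by (apply pow_le; lra). nra. }
    induction k as [|k [IH1 IH2]].
    - split; [ | simpl in He |- *; lra ]. simpl.
      assert (E : nsq (vsub z0 z0) = 0) by (unfold nsq, vsub; cbn [fst snd]; ring).
      unfold n2; rewrite E, sqrt_0; lra.
    - assert (S1 : n2 (vsub (Z (S k)) z0) <= (1 - rad0 ^ S k) * d).
      { eapply Rle_trans; [ apply (n2_triang _ (Z k)) | ]. simpl pow. lra. }
      split; trivial. change (Z (S (S k))) with (picard x (Z (S k))).
      change (Z (S k)) with (picard x (Z k)) at 2.
      eapply Rle_trans; [ apply picard_contract; apply HB; trivial | ]. simpl pow.
      rewrite Rmult_assoc. apply Rmult_le_compat_l; [ lra | exact IH2 ]. }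
  assert (HZd : forall k, n2 (vsub (Z k) z0) <= d).
  { intros k; eapply Rle_trans; [ apply HZ | ]. assert (0 <= rad0 ^ k) by (apply pow_le; lra). nra. }
  destruct (bounded_subsequence_2 Z (supd z0 (0, 0) + d)) as (phi & l & Hphi & Hl).
  { intros k. assert (A := supd_triang (Z k) z0 (0, 0)). assert (B := supd_le_n2 (Z k) z0).
    assert (C := HZd k). assert (D : supd (Z k) (0, 0) <= supd z0 (0, 0) + d) by lra.
    apply supd_le in D; simpl in D. now rewrite !Rminus_0_r in D. }
  assert (Hld : n2 (vsub l z0) <= d).
  { apply le_epsilon; intros eps Heps.
    assert (He2 : 0 < eps / 2) by lra.
    destruct (proj1 (filterlim_locally _ _) Hl (mkposreal _ He2)) as [N HN].
    assert (A := n2_triang l (Z (phi N)) z0). assert (B := n2_le_supd l (Z (phi N))).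
    assert (C : supd (Z (phi N)) l < eps / 2) by (apply supd_lt; exact (HN N (le_n _))).
    rewrite supd_sym in C. specialize (HZd (phi N)). lra. }
  exists l; split; [ now apply Hball | ].
  apply nsq_vsub_0. rewrite <- n2_sqr.
  assert (G : n2 (vsub (delt l) x) <= 0).
  { apply le_epsilon; intros eps Heps.
    assert (He4 : 0 < eps / 4) by lra.
    assert (Hc := filterlim_comp _ _ _ _ _ _ _ _ Hl (continuous_delt l)).
    destruct (proj1 (filterlim_locally _ _) Hc (mkposreal _ He4)) as [N1 HN1].
    assert (Hpow : exists N2, forall k, (N2 <= k)%nat -> rad0 ^ k * ((1 - rad0) * d) < eps / 2).
    { assert (L := is_lim_seq_scal_r _ ((1 - rad0) * d) _ (is_lim_seq_geom rad0 ltac:(rewrite Rabs_right; lra))).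
      simpl in L. rewrite Rmult_0_l in L. apply is_lim_seq_spec in L.
      assert (He2 : 0 < eps / 2) by lra. destruct (L (mkposreal _ He2)) as [N2 HN2].
      exists N2; intros k Hk; specialize (HN2 k Hk); simpl in HN2. apply Rabs_lt_between in HN2. lra. }
    destruct Hpow as [N2 HN2]. set (k := Nat.max N1 N2).
    assert (A := n2_triang (delt l) (delt (Z (phi k))) x).
    assert (B := n2_le_supd (delt l) (delt (Z (phi k)))).
    assert (C : supd (delt (Z (phi k))) (delt l) < eps / 4) by (apply supd_lt; exact (HN1 k (Nat.le_max_l _ _))).
    rewrite supd_sym in C.
    assert (D : n2 (vsub (delt (Z (phi k))) x) < eps / 2).
    { replace (n2 (vsub (delt (Z (phi k))) x)) with (n2 (vsub (Z (S (phi k))) (Z (phi k)))).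
      - eapply Rle_lt_trans; [ apply HZ | ]. apply HN2. specialize (Hphi k). unfold k in *; lia.
      - change (Z (S (phi k))) with (picard x (Z (phi k))). rewrite picard_delt.
        unfold n2; f_equal; unfold nsq, vsub; cbn [fst snd]; ring. }
    lra. }
  assert (N := n2_nonneg (vsub (delt l) x)). nra.
Qed.

Lemma dinv_lipschitz x y : deltU x -> deltU y ->
  (1 - rad0) * n2 (vsub (dinv x) (dinv y)) <= n2 (vsub x y).
Proof.
  intros Hx Hy. destruct (dinv_spec x Hx) as [A1 A2], (dinv_spec y Hy) as [B1 B2].
  unfold disc0 in A1, B1. assert (P := rad0_bounds).
  assert (E := delt_expand (dinv x) (dinv y) ltac:(lra) ltac:(lra)). rewrite A2, B2 in E.
  apply sqrt_le_1_alt in E. rewrite sqrt_mult_alt, sqrt_pow2 in E by (try apply pow2_ge_0; lra).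
  exact E.
Qed.

(** The Jacobian determinant of [delt], taken at the preimage of [x]. *)
Definition jac (x : R * R) : R := 1 - fst (dinv x) ^ 2 - snd (dinv x) ^ 2.

Lemma jac_pos x : deltU x -> 0 < jac x.
Proof.
  intros Hx; destruct (dinv_spec x Hx) as [A _]. unfold disc0, nsq in A. unfold jac.
  assert (P := rad0_bounds). nra.
Qed.

Lemma derive_in_quadratic (f : R -> R) (t l C d : R) : 0 < d -> 0 <= C ->
  (forall y, Rabs (y - t) < d -> Rabs (f y - f t - (y - t) * l) <= C * (y - t) ^ 2) ->
  is_derive f t l.
Proof.
  intros Hd HC H; apply is_derive_iff_derive_in; intros eps He.
  exists (Rmin d (eps / (C + 1))); split; [ apply Rmin_pos; trivial; apply Rdiv_lt_0_compat; lra | ].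
  intros y _ Hy. eapply Rle_trans; [ apply H; eapply Rlt_le_trans; [ exact Hy | apply Rmin_l ] | ].
  assert (B := Rlt_le_trans _ _ _ Hy (Rmin_r _ _)). rewrite <- pow2_abs.
  assert (P := Rabs_pos (y - t)).
  apply Rmult_lt_compat_l with (r := C + 1) in B; [ | lra ].
  replace ((C + 1) * (eps / (C + 1))) with eps in B by (field; lra).
  replace (C * Rabs (y - t) ^ 2) with (C * Rabs (y - t) * Rabs (y - t)) by ring.
  apply Rmult_le_compat_r; trivial. nra.
Qed.

(* The inverse of the Jacobian matrix of [delt]. *)
Definition dmat (c i : axis) (x : R * R) : R :=
  match c, i with
  | ax1, ax1 => (1 - fst (dinv x)) / jac x
  | ax2, ax2 => (1 + fst (dinv x)) / jac x
  | _, _ => snd (dinv x) / jac x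
  end.

(** As [delt] is quadratic, the increments [p], [q] of the inverse satisfy an exact equation: the
    Jacobian matrix applied to them plus a quadratic term is the increment of [x]. Solving it leaves
    an error of order [p^2 + q^2], at most [h^2 / (1 - rad0)^2] times a constant by
    [delt_expand]. *)
Lemma is_derive_dinv c i x : deltU x ->
  is_derive (fun t => coord c (dinv (update i x t))) (coord i x) (dmat c i x).
Proof.
  intros Hx. assert (P := rad0_bounds). assert (J := jac_pos x Hx).
  destruct (dinv_spec x Hx) as [Hz Ez].
  assert (Hloc := locally_slice i deltU x (open_deltU x Hx)).
  destruct Hloc as [d Hd].
  set (z := dinv x) in *.
  assert (Hzb : Rabs (fst z) <= 1 /\ Rabs (snd z) <= 1).
  { unfold disc0, nsq in Hz. split; apply Rabs_le_between; nra. }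
  assert (Hk : 0 < (1 - rad0) ^ 2) by (apply pow_lt; lra).
  set (C := 4 / jac x / (1 - rad0) ^ 2).
  assert (HC : 0 < C) by (unfold C; apply Rdiv_lt_0_compat; trivial; apply Rdiv_lt_0_compat; lra).
  apply (derive_in_quadratic _ _ _ C d); [ apply cond_pos | lra | ].
  intros t Ht. rewrite update_coord. fold z.
  assert (Hy : deltU (update i x t)) by (apply Hd, Ht).
  destruct (dinv_spec _ Hy) as [Hw Ew]. set (w := dinv (update i x t)) in *.
  set (p := fst w - fst z). set (q := snd w - snd z). set (h := t - coord i x).
  assert (Hpq : (1 - rad0) ^ 2 * (p ^ 2 + q ^ 2) <= h ^ 2).
  { unfold disc0 in Hz, Hw. assert (A := delt_expand w z ltac:(lra) ltac:(lra)).
    rewrite Ew, Ez in A. unfold nsq, vsub in A; cbn [fst snd] in A. fold p q in A.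
    eapply Rle_trans; [ exact A | ]. apply Req_le. unfold h; destruct x, i; simpl; ring. }
  assert (E1 : fst (update i x t) - fst x = (1 + fst z) * p - snd z * q + (p ^ 2 - q ^ 2) / 2).
  { transitivity (fst (delt w) - fst (delt z)); [ now rewrite Ew, Ez | ].
    unfold delt; cbn [fst snd]. unfold p, q. field. }
  assert (E2 : snd (update i x t) - snd x = - snd z * p + (1 - fst z) * q - p * q).
  { transitivity (snd (delt w) - snd (delt z)); [ now rewrite Ew, Ez | ].
    unfold delt; cbn [fst snd]. unfold p, q. ring. }
  assert (Ej : jac x = 1 - fst z ^ 2 - snd z ^ 2) by reflexivity.
  assert (F1 : p - ((1 - fst z) * (fst (update i x t) - fst x) + snd z * (snd (update i x t) - snd x)) / jac x
    = - ((1 - fst z) * ((p ^ 2 - q ^ 2) / 2) - snd z * (p * q)) / jac x).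
  { rewrite E1, E2. rewrite Ej in J |- *. field. lra. }
  assert (F2 : q - (snd z * (fst (update i x t) - fst x) + (1 + fst z) * (snd (update i x t) - snd x)) / jac x
    = - (snd z * ((p ^ 2 - q ^ 2) / 2) - (1 + fst z) * (p * q)) / jac x).
  { rewrite E1, E2. rewrite Ej in J |- *. field. lra. }
  assert (B : forall c1 c2, Rabs c1 <= 2 -> Rabs c2 <= 2 ->
    Rabs (- (c1 * ((p ^ 2 - q ^ 2) / 2) - c2 * (p * q)) / jac x) <= C * h ^ 2).
  { intros c1 c2 H1 H2. unfold Rdiv at 1. rewrite Rabs_mult, Rabs_Ropp, (Rabs_right (/ jac x))
      by (apply Rle_ge, Rlt_le, Rinv_0_lt_compat, J).
    assert (Q1 : Rabs ((p ^ 2 - q ^ 2) / 2) <= p ^ 2 + q ^ 2).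
    { assert (Y1 := pow2_ge_0 p). assert (Y2 := pow2_ge_0 q). apply Rabs_le_between; lra. }
    assert (Q2 : Rabs (p * q) <= p ^ 2 + q ^ 2).
    { assert (Y1 := pow2_ge_0 (p - q)). assert (Y2 := pow2_ge_0 (p + q)). apply Rabs_le_between; split; nra. }
    assert (Q3 : Rabs (c1 * ((p ^ 2 - q ^ 2) / 2) - c2 * (p * q)) <= 4 * (p ^ 2 + q ^ 2)).
    { assert (R1 := Rmult_le_compat _ _ _ _ (Rabs_pos c1) (Rabs_pos _) H1 Q1).
      assert (R2 := Rmult_le_compat _ _ _ _ (Rabs_pos c2) (Rabs_pos _) H2 Q2).
      rewrite <- Rabs_mult in R1, R2.
      eapply Rle_trans; [ apply Rabs_triang | ]. rewrite Rabs_Ropp. lra. }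
    apply Rle_trans with (4 * (p ^ 2 + q ^ 2) * / jac x).
    - apply Rmult_le_compat_r; trivial. apply Rlt_le, Rinv_0_lt_compat, J.
    - unfold C. apply Rmult_le_reg_r with ((1 - rad0) ^ 2 * jac x); [ now apply Rmult_lt_0_compat | ].
      replace (4 * (p ^ 2 + q ^ 2) * / jac x * ((1 - rad0) ^ 2 * jac x)) with (4 * ((1 - rad0) ^ 2 * (p ^ 2 + q ^ 2))) by (field; lra).
      replace (4 / jac x / (1 - rad0) ^ 2 * h ^ 2 * ((1 - rad0) ^ 2 * jac x)) with (4 * h ^ 2) by (field; lra). lra. }
  assert (Hz1 : Rabs (1 - fst z) <= 2 /\ Rabs (1 + fst z) <= 2 /\ Rabs (snd z) <= 2).
  { destruct Hzb as [G1 G2]. apply Rabs_le_between in G1; apply Rabs_le_between in G2.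
    repeat split; apply Rabs_le_between; lra. }
  destruct Hz1 as (G1 & G2 & G3).
  destruct c; cbn [coord]; fold p q.
  - replace (p - h * dmat ax1 i x) with
      (p - ((1 - fst z) * (fst (update i x t) - fst x) + snd z * (snd (update i x t) - snd x)) / jac x).
    + rewrite F1. now apply B.
    + unfold h; destruct i; unfold dmat; fold z; cbn [coord update fst snd]; field; lra.
  - replace (q - h * dmat ax2 i x) with
      (q - (snd z * (fst (update i x t) - fst x) + (1 + fst z) * (snd (update i x t) - snd x)) / jac x).
    + rewrite F2. now apply B.
    + unfold h; destruct i; unfold dmat; fold z; cbn [coord update fst snd]; field; lra.
Qed.

Definition dfst (x : R * R) : R := fst (dinv x).
Definition dsnd (x : R * R) : R := snd (dinv x).

Lemma continuous_dinv c x : deltU x -> continuous (fun y => coord c (dinv y)) x.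
Proof.
  intros Hx. assert (P := rad0_bounds). apply filterlim_locally; intros eps.
  destruct (proj1 (locally_supd deltU x) (open_deltU x Hx)) as (d & Hd & H).
  apply locally_supd. assert (He := cond_pos eps).
  exists (Rmin d ((1 - rad0) * eps / 2)); split.
  { apply Rmin_pos; trivial. apply Rdiv_lt_0_compat; [ apply Rmult_lt_0_compat | ]; lra. }
  intros y Hy.
  assert (A := dinv_lipschitz y x (H y (Rlt_le_trans _ _ _ Hy (Rmin_l _ _))) Hx).
  assert (B := n2_le_supd y x). assert (C := Rlt_le_trans _ _ _ Hy (Rmin_r _ _)).
  assert (D := supd_le_n2 (dinv y) (dinv x)).
  assert (E : supd (dinv y) (dinv x) < eps).
  { eapply Rle_lt_trans; [ exact D | ]. apply Rmult_lt_reg_l with (1 - rad0); lra. }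
  apply supd_lt in E. destruct c; apply E.
Qed.

(** Bootstrapping: the derivatives [dmat] are rational in the components of [dinv], so class C^n
    passes to them and [dinv] is of class C^(n+1). *)
Lemma smooth_dinv c : smooth_on deltU (fun x => coord c (dinv x)).
Proof.
  assert (Ho := open_deltU).
  assert (G : forall n, Ck_on n deltU dfst /\ Ck_on n deltU dsnd).
  { induction n as [|n [IH1 IH2]].
    - split; split; trivial; intros p Hp; [ exact (continuous_dinv ax1 p Hp) | exact (continuous_dinv ax2 p Hp) ].
    - assert (Kc : forall c, Ck_on n deltU (fun _ => c)) by (intros; now apply Ck_on_const).
      assert (KJ : Ck_on n deltU jac).
      { apply Ck_ext_on with (fun x => 1 + -1 * (dfst x * dfst x) + -1 * (dsnd x * dsnd x)); trivial.
        - intros q _; unfold jac, dfst, dsnd; ring.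
        - repeat first [ exact IH1 | exact IH2 | apply Kc | apply Ck_on_plus | apply Ck_on_mult ]; trivial. }
      assert (KI : Ck_on n deltU (fun x => / jac x)).
      { apply Ck_on_inv; trivial. intros p Hp; assert (A := jac_pos p Hp); lra. }
      assert (KM : forall c i, Ck_on n deltU (dmat c i)).
      { intros e i; destruct e, i; unfold dmat.
        - apply Ck_on_mult; trivial. apply Ck_ext_on with (fun x => 1 + -1 * dfst x); trivial.
          + intros q _; unfold dfst; ring.
          + apply Ck_on_plus; trivial. apply Ck_on_mult; trivial.
        - apply Ck_on_mult; trivial.
        - apply Ck_on_mult; trivial.
        - apply Ck_on_mult; trivial. apply Ck_on_plus; trivial. }
      split.
      + apply Ck_on_S with (dmat ax1); trivial.
        * intros p Hp; exact (continuous_dinv ax1 p Hp).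
        * intros i p Hp; exact (is_derive_dinv ax1 i p Hp).
      + apply Ck_on_S with (dmat ax2); trivial.
        * intros p Hp; exact (continuous_dinv ax2 p Hp).
        * intros i p Hp; exact (is_derive_dinv ax2 i p Hp). }
  intros n; destruct c; apply (G n).
Qed.

(** The derivative of [F] is asked for along arbitrary curves [A], [B] through the point; in this
    form [auto_derive] can compute it. *)
Lemma is_derive_through_dinv (F : R -> R -> R) (Fa Fb : R) i x : deltU x ->
  (forall (A B : R -> R) t a b, A t = dfst x -> B t = dsnd x -> is_derive A t a -> is_derive B t b ->
    is_derive (fun s => F (A s) (B s)) t (Fa * a + Fb * b)) ->
  partial i (fun y => F (dfst y) (dsnd y)) x = Fa * dmat ax1 i x + Fb * dmat ax2 i x.
Proof.
  intros Hx H. apply is_derive_partial_eq.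
  apply (H (fun t => dfst (update i x t)) (fun t => dsnd (update i x t))).
  - now rewrite update_coord.
  - now rewrite update_coord.
  - exact (is_derive_dinv ax1 i x Hx).
  - exact (is_derive_dinv ax2 i x Hx).
Qed.

(* The potential whose gradient at [delt z] is [z - conj z ^ 2 / 2]. *)
Definition uex (x : R * R) : R :=
  let a := dfst x in let b := dsnd x in
  a ^ 2 / 2 + b ^ 2 / 2 + a ^ 3 / 6 - a * b ^ 2 / 2 - (a ^ 2 + b ^ 2) ^ 2 / 8.

Ltac chain_rule :=
  intros A B t a b EA EB HA HB; auto_derive; [ repeat split; eexists; eassumption | ];
  rewrite_derivatives;
  rewrite EA, EB; field.

Lemma partial_uex i x : deltU x -> partial i uex x =
  match i with
  | ax1 => dfst x - (dfst x ^ 2 - dsnd x ^ 2) / 2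
  | ax2 => dsnd x + dfst x * dsnd x
  end.
Proof.
  intros Hx. assert (J := jac_pos x Hx).
  unfold uex; cbv zeta.
  rewrite (is_derive_through_dinv (fun a b => a ^ 2 / 2 + b ^ 2 / 2 + a ^ 3 / 6 - a * b ^ 2 / 2 - (a ^ 2 + b ^ 2) ^ 2 / 8)
    (dfst x + dfst x ^ 2 / 2 - dsnd x ^ 2 / 2 - (dfst x ^ 2 + dsnd x ^ 2) * dfst x / 2)
    (dsnd x - dfst x * dsnd x - (dfst x ^ 2 + dsnd x ^ 2) * dsnd x / 2)); trivial.
  - unfold jac, dmat in *. fold (dfst x) (dsnd x) in *. unfold jac in *. fold (dfst x) (dsnd x) in *.
    destruct i; field; lra.
  - chain_rule.
Qed.

(** The matrix [N = (1 - a, b; b, 1 + a)] is both the derivative of [z - conj z ^ 2 / 2] and [jac]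
    times the inverse Jacobian matrix of [delt]. The Hessian is therefore [N^2 / det N], which is
    symmetric, positive and of determinant 1. *)
Lemma Hess_uex x i j : deltU x -> Hess uex x i j =
  match i, j with
  | ax1, ax1 => ((1 - dfst x) ^ 2 + dsnd x ^ 2) / (1 - dfst x ^ 2 - dsnd x ^ 2)
  | ax2, ax2 => ((1 + dfst x) ^ 2 + dsnd x ^ 2) / (1 - dfst x ^ 2 - dsnd x ^ 2)
  | _, _ => 2 * dsnd x / (1 - dfst x ^ 2 - dsnd x ^ 2)
  end.
Proof.
  intros Hx. assert (J := jac_pos x Hx). assert (Ho := open_deltU). unfold Hess.
  rewrite (partial_ext_on deltU _ _ i x Ho (partial_uex j) Hx).
  destruct j.
  - rewrite (is_derive_through_dinv (fun a b => a - (a ^ 2 - b ^ 2) / 2) (1 - dfst x) (dsnd x)); trivial.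
    + unfold jac, dmat in *. fold (dfst x) (dsnd x) in *. unfold jac in *. fold (dfst x) (dsnd x) in *.
      destruct i; field; lra.
    + chain_rule.
  - rewrite (is_derive_through_dinv (fun a b => b + a * b) (dsnd x) (1 + dfst x)); trivial.
    + unfold jac, dmat in *. fold (dfst x) (dsnd x) in *. unfold jac in *. fold (dfst x) (dsnd x) in *.
      destruct i; field; lra.
    + chain_rule.
Qed.

Lemma smooth_uex : smooth_on deltU uex.
Proof.
  assert (Ho := open_deltU).
  assert (S1 : smooth_on deltU dfst) by exact (smooth_dinv ax1).
  assert (S2 : smooth_on deltU dsnd) by exact (smooth_dinv ax2).
  unfold uex; cbv zeta.
  repeat first [ exact S1 | exact S2 | exact Ho | apply smooth_minus | apply smooth_plus
    | apply smooth_mult | apply smooth_pow | apply smooth_const ].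
Qed.

Lemma ma_uex : monge_ampere deltU uex.
Proof.
  split; [ exact open_deltU | exact smooth_uex | | ].
  - intros x Hx. assert (J := jac_pos x Hx). unfold jac in J; fold (dfst x) (dsnd x) in J. split.
    + intros i j; rewrite !Hess_uex by trivial; now destruct i, j.
    + intros [v w] Hv. unfold bilin, sum2; rewrite !Hess_uex by trivial; cbn [coord fst snd].
      set (a := dfst x) in *. set (b := dsnd x) in *.
      replace (_ + _ + (_ + _)) with ((((1 - a) * v + b * w) ^ 2 + (b * v + (1 + a) * w) ^ 2) / (1 - a ^ 2 - b ^ 2))
        by (field; lra).
      apply Rdiv_lt_0_compat; trivial.
      assert (P1 := pow2_ge_0 ((1 - a) * v + b * w)). assert (P2 := pow2_ge_0 (b * v + (1 + a) * w)).
      destruct (Req_dec (((1 - a) * v + b * w) ^ 2 + (b * v + (1 + a) * w) ^ 2) 0) as [E | E]; [ | lra ].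
      exfalso; apply Hv.
      assert (E1 : (1 - a) * v + b * w = 0) by (apply Rsqr_0_uniq; rewrite Rsqr_pow2; lra).
      assert (E2 : b * v + (1 + a) * w = 0) by (apply Rsqr_0_uniq; rewrite Rsqr_pow2; lra).
      assert (V : (1 - a ^ 2 - b ^ 2) * v = 0).
      { transitivity ((1 + a) * ((1 - a) * v + b * w) - b * (b * v + (1 + a) * w)); [ ring | rewrite E1, E2; ring ]. }
      assert (W : (1 - a ^ 2 - b ^ 2) * w = 0).
      { transitivity ((1 - a) * (b * v + (1 + a) * w) - b * ((1 - a) * v + b * w)); [ ring | rewrite E1, E2; ring ]. }
      apply Rmult_integral in V; apply Rmult_integral in W. f_equal; lra.
  - intros x Hx. assert (J := jac_pos x Hx). unfold jac in J; fold (dfst x) (dsnd x) in J.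
    unfold det2; rewrite !Hess_uex by trivial. field. lra.
Qed.

(** The derivatives of [h11] determine the curvature and the Christoffel symbols that enter the
    radial geodesic. *)
Lemma partial_h11_uex i x : deltU x ->
  let a := dfst x in let b := dsnd x in let J := 1 - a ^ 2 - b ^ 2 in
  let N := (1 - a) ^ 2 + b ^ 2 in
  partial i (h11 uex) x =
    (2 * a * N - 2 * (1 - a) * J) / J ^ 2 * dmat ax1 i x
    + (2 * b * N + 2 * b * J) / J ^ 2 * dmat ax2 i x.
Proof.
  intros Hx a b J N. assert (HJ := jac_pos x Hx). unfold jac in HJ; fold (dfst x) (dsnd x) in HJ.
  rewrite (partial_ext_on deltU (h11 uex) (fun y => ((1 - dfst y) ^ 2 + dsnd y ^ 2) / (1 - dfst y ^ 2 - dsnd y ^ 2))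
    i x open_deltU (fun q Hq => Hess_uex q ax1 ax1 Hq) Hx).
  apply (is_derive_through_dinv (fun a b => ((1 - a) ^ 2 + b ^ 2) / (1 - a ^ 2 - b ^ 2))); trivial.
  fold a b in HJ |- *. fold J in HJ.
  intros A B t a' b' EA EB HA HB.
  assert (D1 : is_derive (fun s => (1 - A s) ^ 2 + B s ^ 2) t (- 2 * (1 - a) * a' + 2 * b * b')).
  { auto_derive; [ repeat split; eexists; eassumption | ].
    rewrite_derivatives.
    rewrite EA, EB. ring. }
  assert (D2 : is_derive (fun s => 1 - A s ^ 2 - B s ^ 2) t (- 2 * a * a' - 2 * b * b')).
  { auto_derive; [ repeat split; eexists; eassumption | ].
    rewrite_derivatives.
    rewrite EA, EB. ring. }
  assert (E0 : 1 - A t ^ 2 - B t ^ 2 = J) by (rewrite EA, EB; reflexivity).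
  assert (NZ : 1 - A t ^ 2 - B t ^ 2 <> 0) by lra.
  assert (D := is_derive_div _ _ t _ _ D1 D2 NZ). cbv beta in D.
  rewrite E0, EA, EB in D. fold N in D.
  match type of D with is_derive _ _ ?l => replace (_ * a' + _ * b') with l; [ exact D | ] end.
  field. lra.
Qed.

(** * The radial geodesic on the real axis *)

Section OnAxis.
Variable r : R.
Hypothesis Hr : 0 <= r < rad0.

Let p : R * R := delt (r, 0).

Lemma disc_axis : disc0 (r, 0).
Proof. unfold disc0, nsq; cbn [fst snd]. nra. Qed.

Lemma axis_in : deltU p.
Proof. exact (delt_in _ disc_axis). Qed.

Lemma dfst_axis : dfst p = r.
Proof. unfold dfst, p. now rewrite (dinv_delt _ disc_axis). Qed.

Lemma dsnd_axis : dsnd p = 0.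
Proof. unfold dsnd, p. now rewrite (dinv_delt _ disc_axis). Qed.

Lemma r_lt_1 : r < 1.
Proof. assert (P := rad0_bounds); lra. Qed.

Lemma h11_axis : h11 uex p = (1 - r) / (1 + r).
Proof.
  assert (H := r_lt_1). change (h11 uex p) with (Hess uex p ax1 ax1).
  rewrite (Hess_uex _ _ _ axis_in), dfst_axis, dsnd_axis. field. split; nra.
Qed.

Lemma h12_axis : h12 uex p = 0.
Proof.
  assert (H := r_lt_1). change (h12 uex p) with (Hess uex p ax1 ax2).
  rewrite (Hess_uex _ _ _ axis_in), dfst_axis, dsnd_axis. field. nra.
Qed.

Lemma h22_axis : h22 uex p = (1 + r) / (1 - r).
Proof.
  assert (H := r_lt_1). change (h22 uex p) with (Hess uex p ax2 ax2).
  rewrite (Hess_uex _ _ _ axis_in), dfst_axis, dsnd_axis. field. split; nra.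
Qed.

Lemma t111_axis : t111 uex p = - 2 / (1 + r) ^ 3.
Proof.
  assert (H := r_lt_1). unfold t111. rewrite (partial_h11_uex ax1 p axis_in). unfold dmat, jac.
  fold (dfst p) (dsnd p). rewrite dfst_axis, dsnd_axis. field. repeat split; nra.
Qed.

Lemma t112_axis : t112 uex p = 0.
Proof.
  assert (H := r_lt_1). unfold t112. rewrite (partial_h11_uex ax2 p axis_in). unfold dmat, jac.
  fold (dfst p) (dsnd p). rewrite dfst_axis, dsnd_axis. field. nra.
Qed.

Lemma christoffel_axis : christoffel (Hess uex) p ax1 ax1 ax1 = - / ((1 - r) * (1 + r) ^ 2) /\
  christoffel (Hess uex) p ax2 ax1 ax1 = 0.
Proof.
  assert (H := r_lt_1). rewrite !(christoffel_eq deltU uex ma_uex) by exact axis_in.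
  unfold chr, inv_hs; cbn [ts].
  rewrite h11_axis, h12_axis, h22_axis, t111_axis, t112_axis. split; field; repeat split; lra.
Qed.
End OnAxis.

Lemma curvature_origin : curvature uex (delt (0, 0)) = 2.
Proof.
  assert (P := rad0_bounds). assert (H : 0 <= 0 < rad0) by lra.
  unfold curvature, curvature_expr.
  rewrite (h11_axis 0 H), (h12_axis 0 H), (t111_axis 0 H), (t112_axis 0 H). field.
Qed.

Definition geo (s : R) : R * R := delt (rho s, 0).
(** The map [delt] is [r + r^2 / 2] on the real axis; its slope [1 + r] is multiplied by the
    derivative of [rho]. *)
Definition geo' (s : R) : R * R := ((1 + rho s) / sqrt (1 - rho s ^ 2), 0).

Lemma geo_derivatives s : 0 <= s < gam0 ->
  is_derive (fun t => fst (geo t)) s (fst (geo' s)) /\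
  is_derive (fun t => snd (geo t)) s (snd (geo' s)) /\
  is_derive (fun t => fst (geo' t)) s (/ ((1 - rho s) * (1 - rho s ^ 2))) /\
  is_derive (fun t => snd (geo' t)) s 0.
Proof.
  intros Hs. assert (Hr := rho_range s Hs). assert (P0 := rad0_bounds). assert (P1 := rlen_rad1_bounds).
  assert (Q : 0 < 1 - rho s ^ 2) by (apply one_minus_sqr_pos; lra).
  assert (S := sqrt_lt_R0 _ Q). assert (S2 := pow2_sqrt _ (Rlt_le _ _ Q)).
  assert (D := is_derive_rho s ltac:(lra)).
  assert (ED : Derive (fun t => rho t) s = / sqrt (1 - rho s ^ 2)) by (apply is_derive_unique, D).
  unfold geo, geo', delt; cbn [fst snd]. split; [ | split; [ | split ] ].
  - auto_derive; [ repeat split; eexists; exact D | ]. rewrite ED. field. lra.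
  - auto_derive; [ repeat split; eexists; exact D | ]. ring.
  - assert (E1 : 1 + - (rho s * (rho s * 1)) = 1 - rho s ^ 2) by ring.
    auto_derive.
    + rewrite E1. repeat split; try lra; try (eexists; exact D).
    + rewrite ED, E1. set (q := sqrt (1 - rho s ^ 2)) in *.
      rewrite <- S2. replace (1 - rho s) with (q ^ 2 / (1 + rho s)) by (rewrite S2; field; lra).
      field_simplify_eq; [ | repeat split; try lra; nra ].
      replace (rho s ^ 2) with (1 - q ^ 2) by lra. ring.
  - apply (@is_derive_const R_AbsRing R_NormedModule).
Qed.

Lemma geo_unit_speed s : 0 <= s < gam0 -> gnorm (Hess uex) (geo s) (geo' s) = 1.
Proof.
  intros Hs. assert (Hr := rho_range s Hs). assert (P0 := rad0_bounds).
  assert (Q : 0 < 1 - rho s ^ 2) by (apply one_minus_sqr_pos; lra).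
  assert (S := sqrt_lt_R0 _ Q). assert (S2 := pow2_sqrt _ (Rlt_le _ _ Q)).
  rewrite (gnorm_hform deltU _ _ _ ma_uex) by (apply axis_in; trivial).
  unfold hform, geo, geo'; cbn [fst snd]. rewrite (h11_axis _ Hr).
  set (q := sqrt (1 - rho s ^ 2)) in *. transitivity (sqrt 1); [ f_equal | apply sqrt_1 ].
  transitivity ((1 - rho s ^ 2) / q ^ 2); [ field; lra | rewrite S2; field; lra ].
Qed.

Lemma geo_geodesic : geodesic (Hess uex) (ivl_co 0 gam0) geo geo'.
Proof.
  intros s Hs. assert (Hr := rho_range s Hs). assert (P0 := rad0_bounds).
  destruct (geo_derivatives s Hs) as (D1 & D2 & D3 & D4).
  split; apply is_derive_within_iff; trivial.
  - split; now apply is_derive_derive_in.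
  - destruct (christoffel_axis (rho s) Hr) as [C1 C2].
    change (delt (rho s, 0)) with (geo s) in C1, C2.
    assert (B : forall A : axis -> axis -> R, bilin A (geo' s) (geo' s) = A ax1 ax1 * fst (geo' s) ^ 2).
    { intros A; unfold bilin, sum2; cbn [coord geo' fst snd]. unfold geo'; cbn [fst snd]. ring. }
    cbn [fst snd]. rewrite !B, C1, C2. split; apply is_derive_derive_in.
    + match type of D3 with is_derive _ _ ?l => match goal with |- is_derive _ _ ?l' => replace l' with l; [ exact D3 | ] end end.
      unfold geo'; cbn [fst snd].
      assert (Q : 0 < 1 - rho s ^ 2) by (apply one_minus_sqr_pos; lra).
      assert (S := sqrt_lt_R0 _ Q). assert (S2 := pow2_sqrt _ (Rlt_le _ _ Q)).
      rewrite <- S2 at 1. field. repeat split; nra.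
    + rewrite Rmult_0_l, Ropp_0. exact D4.
Qed.

(** * The radial length as a calibration *)

Definition rad (x : R * R) : R := n2 (dinv x).

Lemma rad_range x : deltU x -> 0 <= rad x < rad0.
Proof.
  intros Hx; destruct (dinv_spec x Hx) as [A _]. assert (P := rad0_bounds).
  split; [ apply n2_nonneg | ]. rewrite <- (sqrt_pow2 rad0) by lra.
  apply sqrt_lt_1_alt; split; [ apply nsq_nonneg | exact A ].
Qed.

(* [rlen |z|] is not differentiable at the centre, hence the smoothing by [h]. *)
Definition calib (h : R) (x : R * R) : R := rlen (sqrt (nsq (dinv x) + h ^ 2)).

Section Calibration.
Variable h : R.
Hypothesis Hh : 0 < h.
Hypothesis Hh1 : rad0 ^ 2 + h ^ 2 < 1.

Lemma calib_arg x : deltU x -> 0 < sqrt (nsq (dinv x) + h ^ 2) < 1.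
Proof.
  intros Hx; destruct (dinv_spec x Hx) as [A _]. unfold disc0 in A.
  assert (N := nsq_nonneg (dinv x)). assert (H2 : 0 < h ^ 2) by now apply pow_lt.
  split; [ apply sqrt_lt_R0; lra | ]. apply Rlt_le_trans with (sqrt 1); [ apply sqrt_lt_1_alt; lra | rewrite sqrt_1; lra ].
Qed.

Lemma calib_near x : deltU x -> rlen (rad x) <= calib h x <= rlen (rad x) + h.
Proof.
  intros Hx; assert (A := calib_arg x Hx). assert (B := rad_range x Hx). assert (P := rad0_bounds).
  assert (E := n2_sqr (dinv x)). fold (rad x) in E.
  assert (K1 : rad x <= sqrt (nsq (dinv x) + h ^ 2)).
  { rewrite <- (sqrt_pow2 (rad x)) by lra. apply sqrt_le_1_alt. assert (Q := pow2_ge_0 h). lra. }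
  assert (K2 : sqrt (nsq (dinv x) + h ^ 2) <= rad x + h).
  { rewrite <- (sqrt_pow2 (rad x + h)) by lra. apply sqrt_le_1_alt. nra. }
  unfold calib. assert (L := rlen_le (rad x) (sqrt (nsq (dinv x) + h ^ 2)) ltac:(lra) K1 ltac:(lra)). lra.
Qed.

(** The smoothed radius [m] satisfies [|dm| <= |dz|] and [m >= |z|], so that [sqrt (1 - m^2) |dm|]
    is at most the length element. *)
Lemma calib_along (x y : R -> R) t x' y' : deltU (x t, y t) -> is_derive x t x' -> is_derive y t y' ->
  exists l, is_derive (fun s => calib h (x s, y s)) t l /\
    l <= gnorm (Hess uex) (x t, y t) (x', y').
Proof.
  intros HU Hx Hy. set (p := (x t, y t)) in *.
  assert (J := jac_pos p HU). assert (CA := calib_arg p HU).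
  assert (Dm : forall c i, partial i (fun q => coord c (dinv q)) p = dmat c i p).
  { intros c i; apply is_derive_partial_eq, is_derive_dinv; trivial. }
  assert (D1 := is_derive_along_path deltU _ x y x' y' t open_deltU (smooth_dinv ax1) HU Hx Hy).
  assert (D2 := is_derive_along_path deltU _ x y x' y' t open_deltU (smooth_dinv ax2) HU Hx Hy).
  fold p in D1, D2. rewrite !Dm in D1, D2. cbn [coord] in D1, D2.
  set (a' := x' * dmat ax1 ax1 p + y' * dmat ax1 ax2 p) in D1.
  set (b' := x' * dmat ax2 ax1 p + y' * dmat ax2 ax2 p) in D2.
  set (a := fst (dinv p)) in *. set (b := snd (dinv p)) in *.
  set (m := sqrt (nsq (dinv p) + h ^ 2)) in *.
  assert (H2 : 0 < h ^ 2) by now apply pow_lt.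
  assert (Em : m ^ 2 = a ^ 2 + b ^ 2 + h ^ 2).
  { unfold m; rewrite pow2_sqrt; [ reflexivity | ]. assert (N := nsq_nonneg (dinv p)). lra. }
  assert (Dq : is_derive (fun s => sqrt (nsq (dinv (x s, y s)) + h ^ 2)) t ((a * a' + b * b') / m)).
  { assert (Dn : is_derive (fun s => nsq (dinv (x s, y s)) + h ^ 2) t (2 * (a * a' + b * b'))).
    { assert (G : forall (f g : R -> R) f' g', is_derive f t f' -> is_derive g t g' ->
        is_derive (fun s => f s ^ 2 + g s ^ 2 + h ^ 2) t (2 * (f t * f' + g t * g'))).
      { intros f g f' g' Hf Hg; auto_derive; [ repeat split; eexists; eassumption | ].
        rewrite_derivatives. ring. }
      exact (G _ _ _ _ D1 D2). }
    assert (D := is_derive_sqrt _ t _ Dn). cbv beta in D. fold p m in D.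
    replace ((a * a' + b * b') / m) with (2 * (a * a' + b * b') / (2 * m)) by (field; lra).
    apply D. assert (N := nsq_nonneg (dinv p)). lra. }
  exists (sqrt (1 - m ^ 2) * ((a * a' + b * b') / m)); split.
  - assert (Dr : is_derive rlen (sqrt (nsq (dinv (x t, y t)) + h ^ 2)) (sqrt (1 - m ^ 2))).
    { apply (is_derive_rlen m); lra. }
    assert (D := is_derive_comp rlen (fun s => sqrt (nsq (dinv (x s, y s)) + h ^ 2)) t _ _ Dr Dq).
    match type of D with is_derive _ _ ?l => replace (sqrt (1 - m ^ 2) * ((a * a' + b * b') / m)) with l; [ exact D | ] end.
    unfold scal; simpl; unfold mult; simpl; ring_R.
  - rewrite (gnorm_hform deltU uex p _ ma_uex HU). cbn [fst snd].
    (* The pullback of the Hessian metric by [delt] is conformal. *)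
    assert (EH : hform uex p x' y' = jac p * (a' ^ 2 + b' ^ 2)).
    { unfold hform. change (h11 uex p) with (Hess uex p ax1 ax1). change (h12 uex p) with (Hess uex p ax1 ax2).
      change (h22 uex p) with (Hess uex p ax2 ax2). rewrite !Hess_uex by trivial.
      unfold a', b', dmat, jac, dfst, dsnd in *. fold a b in J |- *. field. lra. }
    rewrite EH. rewrite sqrt_mult_alt by lra.
    assert (Ej : jac p = 1 - a ^ 2 - b ^ 2) by reflexivity.
    assert (S0 : 0 <= a' ^ 2 + b' ^ 2) by (apply Rplus_le_le_0_compat; apply pow2_ge_0).
    assert (K : (a * a' + b * b') / m <= sqrt (a' ^ 2 + b' ^ 2)).
    { apply Rle_div_l; [ lra | ]. apply Rsqr_incr_0_var; [ | apply Rmult_le_pos; [ apply sqrt_pos | lra ] ].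
      rewrite Rsqr_mult, Rsqr_sqrt, !Rsqr_pow2, Em by trivial.
      assert (Y := pow2_ge_0 (a * b' - b * a')). nra. }
    apply Rle_trans with (sqrt (1 - m ^ 2) * sqrt (a' ^ 2 + b' ^ 2)).
    + apply Rmult_le_compat_l; [ apply sqrt_pos | trivial ].
    + apply Rmult_le_compat_r; [ apply sqrt_pos | ]. apply sqrt_le_1_alt. rewrite Em, Ej. lra.
Qed.

Lemma continuous_calib x : deltU x -> continuous (calib h) x.
Proof.
  intros Hx. assert (CA := calib_arg x Hx).
  assert (S1 := smooth_continuous deltU _ x (smooth_dinv ax1) Hx).
  assert (S2 := smooth_continuous deltU _ x (smooth_dinv ax2) Hx). cbn [coord] in S1, S2.
  apply (continuous_comp (fun x => sqrt (nsq (dinv x) + h ^ 2)) rlen).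
  - apply (continuous_comp (fun x => nsq (dinv x) + h ^ 2) sqrt); [ | apply continuous_sqrt ].
    apply continuous_ext with (fun y => fst (dinv y) * fst (dinv y) + snd (dinv y) * snd (dinv y) + h ^ 2).
    { intros y; unfold nsq; ring_R. }
    repeat first [ exact S1 | exact S2 | apply continuous_const | apply @continuous_plus | apply @continuous_mult ].
  - assert (B : -1 < sqrt (nsq (dinv x) + h ^ 2) < 1) by lra.
    exact (is_derive_continuous rlen _ _ (is_derive_rlen _ B)).
Qed.
End Calibration.

(** Freezes a curve outside [[a, b]], so that continuity relative to the interval becomes continuity
    on the line. *)
Definition clamp (a b t : R) : R := Rmax a (Rmin t b).

Lemma clamp_in a b t : a <= b -> a <= clamp a b t <= b.
Proof. unfold clamp, Rmax, Rmin; intros H; repeat destruct Rle_dec; lra. Qed.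

Lemma clamp_id a b t : a <= t <= b -> clamp a b t = t.
Proof. unfold clamp, Rmax, Rmin; intros H; repeat destruct Rle_dec; lra. Qed.

Lemma clamp_lipschitz a b s t : Rabs (clamp a b s - clamp a b t) <= Rabs (s - t).
Proof.
  unfold clamp, Rmax, Rmin; repeat destruct Rle_dec; unfold Rabs; repeat destruct Rcase_abs; lra.
Qed.

Lemma continuous_clamp (S : R -> Prop) f a b : a <= b ->
  (forall t, a <= t <= b -> S t) -> (forall t, a <= t <= b -> continuous_in S f t) ->
  forall t, continuous (fun s => f (clamp a b s)) t.
Proof.
  intros Hab HS Hf t; apply continuous_iff_continuous_in; intros eps He.
  destruct (Hf _ (clamp_in a b t Hab) eps He) as (d & Hd & A).
  exists d; split; trivial. intros y _ Hy. apply A; [ now apply HS, clamp_in | ].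
  eapply Rle_lt_trans; [ apply clamp_lipschitz | exact Hy ].
Qed.

Section LengthBound.
Variables (U : R * R -> Prop) (u : R * R -> R).
Hypothesis MA : monge_ampere U u.
Variable L : R * R -> R.
Hypothesis HLc : forall x, U x -> continuous L x.
Hypothesis HLd : forall (x y : R -> R) (t x' y' : R), U (x t, y t) ->
  is_derive x t x' -> is_derive y t y' ->
  exists l, is_derive (fun s => L (x s, y s)) t l /\ l <= gnorm (Hess u) (x t, y t) (x', y').

(** Arc length minus [L] has nonnegative derivative inside the interval. The velocity is known only
    within the piece, so the integrand is replaced by a clamped continuous function that agrees with
    the speed in the interior. *)
Lemma piece_length (D : R -> Prop) a b T e v :
  C1_within (fun t => D t /\ ivl_cc a b t) e v -> a <= T <= b ->
  (forall t, a <= t <= T -> D t) -> (forall t, a <= t <= T -> U (e t)) ->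
  exists I, is_RInt (speed (Hess u) e) a T I /\ L (e T) - L (e a) <= I.
Proof.
  intros HC HT HD HU.
  destruct (Req_dec a T) as [<- | Hne].
  { exists 0; split; [ apply (@is_RInt_point R_NormedModule) | lra ]. }
  set (S := fun t => D t /\ ivl_cc a b t) in *.
  assert (HS : forall t, a <= t <= T -> S t) by (intros t Ht; split; [ auto | split; lra ]).
  assert (HD' : forall t, a <= t <= T ->
    derive_in S (fun s => fst (e s)) t (fst (v t)) /\ derive_in S (fun s => snd (e s)) t (snd (v t)) /\
    continuous_in S (fun s => fst (v s)) t /\ continuous_in S (fun s => snd (v s)) t).
  { intros t Ht; destruct (HC t (HS t Ht)) as [A B].
    apply is_derive_within_iff in A; [ | now apply HS ]. apply continuous_within_iff in B.
    tauto. }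
  set (x := fun s => fst (e (clamp a T s))). set (y := fun s => snd (e (clamp a T s))).
  set (x' := fun s => fst (v (clamp a T s))). set (y' := fun s => snd (v (clamp a T s))).
  assert (Cx : forall t, continuous x t).
  { apply (continuous_clamp S (fun s => fst (e s))); trivial; [ lra | ].
    intros t Ht; eapply derive_in_continuous_in; apply (HD' t Ht). }
  assert (Cy : forall t, continuous y t).
  { apply (continuous_clamp S (fun s => snd (e s))); trivial; [ lra | ].
    intros t Ht; eapply derive_in_continuous_in; apply (HD' t Ht). }
  assert (Cx' : forall t, continuous x' t).
  { apply (continuous_clamp S (fun s => fst (v s))); trivial; [ lra | ]. intros t Ht; apply (HD' t Ht). }
  assert (Cy' : forall t, continuous y' t).
  { apply (continuous_clamp S (fun s => snd (v s))); trivial; [ lra | ]. intros t Ht; apply (HD' t Ht). }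
  assert (Hxy : forall t, (x t, y t) = e (clamp a T t)) by (intros; unfold x, y; now rewrite <- surjective_pairing).
  assert (HUxy : forall t, U (x t, y t)) by (intros t; rewrite Hxy; apply HU, clamp_in; lra).
  set (sp := curve_speed u x y x' y').
  assert (Csp : forall t, continuous sp t) by (intros t; now apply (continuous_curve_speed U u MA)).
  assert (Esp : forall t, a < t < T ->
    is_derive (fun s => fst (e s)) t (fst (v t)) /\ is_derive (fun s => snd (e s)) t (snd (v t)) /\
    sp t = gnorm (Hess u) (e t) (v t)).
  { intros t Ht. destruct (HD' t ltac:(lra)) as (A1 & A2 & _).
    split; [ | split ].
    - eapply derive_in_interior; [ exact Ht | | exact A1 ]. intros r Hr; apply HS; lra.
    - eapply derive_in_interior; [ exact Ht | | exact A2 ]. intros r Hr; apply HS; lra.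
    - rewrite (gnorm_hform U u _ _ MA) by (apply HU; lra).
      unfold sp, curve_speed. rewrite Hxy. unfold x', y'. rewrite clamp_id by lra. reflexivity. }
  assert (ExI : forall c d, ex_RInt sp c d) by (intros; apply (ex_RInt_continuous sp); intros; apply Csp).
  exists (RInt sp a T); split.
  - apply is_RInt_ext with sp; [ | apply (@RInt_correct R_CompleteNormedModule), ExI ].
    rewrite Rmin_left, Rmax_right by lra. intros t Ht. destruct (Esp t Ht) as (A1 & A2 & ->).
    assert (A1' : Derive (fun r : R => fst (e r)) t = fst (v t)) by exact (is_derive_unique _ _ _ A1).
    assert (A2' : Derive (fun r : R => snd (e r)) t = snd (v t)) by exact (is_derive_unique _ _ _ A2).
    unfold speed, velocity. rewrite A1', A2'.
    now rewrite <- surjective_pairing.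
  - set (F := fun s => RInt sp a s - L (x s, y s)).
    assert (DI : forall t, is_derive (fun s => RInt sp a s) t (sp t)).
    { intros t; apply (is_derive_RInt sp (fun s => RInt sp a s) a); trivial.
      apply filter_forall; intros s; apply (@RInt_correct R_CompleteNormedModule), ExI. }
    assert (DF : forall t, a < t < T -> exists l, is_derive F t l /\ 0 <= l).
    { intros t Ht. destruct (Esp t Ht) as (A1 & A2 & A3).
      assert (HUt : U (fst (e t), snd (e t))) by (rewrite <- surjective_pairing; apply HU; lra).
      destruct (HLd (fun s => fst (e s)) (fun s => snd (e s)) t _ _ HUt A1 A2) as (l & Dl & Bl).
      cbv beta in Bl. rewrite <- !surjective_pairing, <- A3 in Bl.
      exists (sp t - l); split; [ | lra ].
      apply (@is_derive_minus R_AbsRing R_NormedModule); [ apply DI | ].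
      apply is_derive_ext_loc with (fun s => L (fst (e s), snd (e s))); trivial.
      assert (Hm : 0 < Rmin (t - a) (T - t)) by (apply Rmin_pos; lra).
      exists (mkposreal _ Hm); intros s Hs. change (Rabs (s - t) < Rmin (t - a) (T - t)) in Hs.
      assert (B1 := Rmin_l (t - a) (T - t)). assert (B2 := Rmin_r (t - a) (T - t)).
      apply Rabs_lt_between in Hs. rewrite Hxy, clamp_id by lra. now rewrite <- surjective_pairing. }
    (* The intermediate point of the mean value theorem may be an endpoint; the value 0 there keeps
       the sign. *)
    set (dF := fun t => match Rlt_dec a t, Rlt_dec t T with left _, left _ => Derive F t | _, _ => 0 end).
    assert (HdF : forall t, 0 <= dF t).
    { intros t; unfold dF; destruct (Rlt_dec a t); [ destruct (Rlt_dec t T) | ]; try lra.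
      destruct (DF t ltac:(lra)) as (l & Dl & Pl). now rewrite (is_derive_unique _ _ _ Dl). }
    destruct (MVT_gen F a T dF) as (c & _ & E).
    + rewrite Rmin_left, Rmax_right by lra. intros t Ht. destruct (DF t Ht) as (l & Dl & _).
      unfold dF; destruct (Rlt_dec a t); [ destruct (Rlt_dec t T) | ]; try lra.
      now rewrite (is_derive_unique _ _ _ Dl).
    + intros t _. apply continuity_pt_filterlim.
      apply (continuous_minus (fun s => RInt sp a s) (fun s => L (x s, y s))).
      * apply (is_derive_continuous _ t _ (DI t)).
      * apply continuous_along; trivial. now apply HLc.
    + assert (A := HdF c). unfold F in E.
      rewrite RInt_point, !Hxy, !clamp_id in E by lra. unfold zero in E; simpl in E.
      assert (0 <= dF c * (T - a)) by (apply Rmult_le_pos; lra). lra.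
Qed.

Lemma curve_length_ge (D : R -> Prop) T e : D T -> 0 <= T ->
  (forall t, 0 <= t <= T -> D t) -> (forall t, D t -> U (e t)) -> (forall t, D t -> t <= 1) ->
  piecewise_C1 D 0 1 e ->
  exists I, is_RInt (speed (Hess u) e) 0 T I /\ L (e T) - L (e 0) <= I.
Proof.
  intros HDT HT0 Hconv HU H1 (n & sg & E0 & En & Hp).
  assert (Hpos : forall k, (k <= n)%nat -> 0 <= sg k).
  { induction k as [|k IH]; intros Hk; [ lra | ]. destruct (Hp k ltac:(lia)) as [A _].
    specialize (IH ltac:(lia)); lra. }
  assert (G : forall k, (k <= n)%nat -> forall t, 0 <= t <= T -> t <= sg k ->
    exists I, is_RInt (speed (Hess u) e) 0 t I /\ L (e t) - L (e 0) <= I).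
  { induction k as [|k IH]; intros Hk t Ht Htk.
    - rewrite E0 in Htk. assert (t = 0) by lra. subst t.
      exists 0; split; [ apply (@is_RInt_point R_NormedModule) | lra ].
    - destruct (Rle_lt_dec t (sg k)) as [h | h]; [ now apply IH; [ lia | | ] | ].
      destruct (Hp k ltac:(lia)) as [A (v & Hv)]. assert (Pk := Hpos k ltac:(lia)).
      destruct (IH ltac:(lia) (sg k) ltac:(lra) (Rle_refl _)) as (I1 & R1 & B1).
      destruct (piece_length D (sg k) (sg (S k)) t e v Hv) as (I2 & R2 & B2).
      + lra.
      + intros r Hr; apply Hconv; lra.
      + intros r Hr; apply HU, Hconv; lra.
      + exists (I1 + I2); split; [ exact (is_RInt_Chasles _ _ _ _ _ _ R1 R2) | lra ]. }
  apply (G n (le_n _) T); [ lra | ]. rewrite En; auto.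
Qed.
End LengthBound.

(** The smoothed calibration loses at most [h], and the integral does not depend on [h], so the loss
    can be sent to 0. *)
Lemma rlen_rad_length (D : R -> Prop) T e : D T -> 0 <= T ->
  (forall t, 0 <= t <= T -> D t) -> (forall t, D t -> deltU (e t)) -> (forall t, D t -> t <= 1) ->
  piecewise_C1 D 0 1 e ->
  exists I, is_RInt (speed (Hess uex) e) 0 T I /\ rlen (rad (e T)) - rlen (rad (e 0)) <= I.
Proof.
  intros HDT HT0 Hconv HU H1 Hp. assert (P := rad0_bounds).
  assert (HG : forall h, 0 < h -> rad0 ^ 2 + h ^ 2 < 1 ->
    exists I, is_RInt (speed (Hess uex) e) 0 T I /\ rlen (rad (e T)) - rlen (rad (e 0)) - h <= I).
  { intros h Hh Hh1.
    destruct (curve_length_ge deltU uex ma_uex (calib h) (continuous_calib h Hh Hh1)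
      (calib_along h Hh Hh1) D T e HDT HT0 Hconv HU H1 Hp) as (I & RI & BI).
    exists I; split; trivial.
    assert (A := calib_near h Hh Hh1 (e T) (HU _ HDT)).
    assert (B := calib_near h Hh Hh1 (e 0) (HU _ (Hconv 0 ltac:(lra)))). lra. }
  set (h0 := (1 - rad0) / 2).
  assert (Hh0 : 0 < h0) by (unfold h0; lra).
  assert (Hsm : forall h, 0 < h <= h0 -> rad0 ^ 2 + h ^ 2 < 1) by (intros h Hh; unfold h0 in Hh; nra).
  destruct (HG h0 Hh0 (Hsm h0 ltac:(lra))) as (I & RI & _).
  exists I; split; trivial. apply le_epsilon; intros eps He.
  set (h := Rmin h0 eps). assert (Hh : 0 < h) by now apply Rmin_pos.
  assert (M1 : h <= h0) by apply Rmin_l. assert (M2 : h <= eps) by apply Rmin_r.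
  destruct (HG h Hh (Hsm h ltac:(lra))) as (I' & RI' & B').
  rewrite <- (is_RInt_unique _ _ _ _ RI), (is_RInt_unique _ _ _ _ RI'). lra.
Qed.

(** [Q] is closed in a square. A gauge gives each point a ball that either is mapped into one member
    of the cover or misses [Q]; the gauge form of compactness of the square selects finitely many
    balls. *)
Lemma compact_set_image (Q : R * R -> Prop) (f : R * R -> R * R) (B : R) :
  (forall z, Q z -> Rabs (fst z) <= B /\ Rabs (snd z) <= B) ->
  (forall z, ~ Q z -> locally z (fun w => ~ Q w)) -> (forall z, continuous f z) ->
  compact_set (fun x => exists z, Q z /\ f z = x).
Proof.
  intros HB Hcl Hf F HF Hcov.
  assert (HP : forall z, exists d : posreal, exists l, (forall V, In V l -> F V) /\
    forall w, supd w z < d -> Q w -> exists V, In V l /\ V (f w)).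
  { intros z. destruct (classic (Q z)) as [Hz | Hz].
    - destruct (Hcov (f z)) as (V & FV & Vz); [ now exists z | ].
      assert (A : locally z (fun w => V (f w))) by exact (Hf z V (HF V FV _ Vz)).
      apply locally_supd in A. destruct A as (d & Hd & A).
      exists (mkposreal d Hd), (V :: nil); split.
      + intros W [<- | []]; trivial.
      + intros w Hw _; exists V; split; [ now left | now apply A ].
    - assert (A := Hcl z Hz). apply locally_supd in A. destruct A as (d & Hd & A).
      exists (mkposreal d Hd), nil; split; [ intros W [] | ].
      intros w Hw Qw; now destruct (A w Hw). }
  set (pt := fun t : Compactness.Tn 2 R => (fst t, fst (snd t))).
  set (delta := fun t => proj1_sig (constructive_indefinite_description _ (HP (pt t)))).
  assert (Hdelta : forall t, exists l, (forall V, In V l -> F V) /\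
    forall w, supd w (pt t) < delta t -> Q w -> exists V, In V l /\ V (f w)).
  { intros t; exact (proj2_sig (constructive_indefinite_description _ (HP (pt t)))). }
  destruct (NNPP _ (Compactness.compactness_list 2 (- B, (- B, tt)) (B, (B, tt)) delta)) as [ts Hts].
  assert (HL : exists l, (forall V, In V l -> F V) /\
    forall t, In t ts -> forall w, supd w (pt t) < delta t -> Q w -> exists V, In V l /\ V (f w)).
  { clear Hts; induction ts as [|t ts (l & H1 & H2)].
    - exists nil; split; [ intros V [] | intros t [] ].
    - destruct (Hdelta t) as (l' & H1' & H2'). exists (l' ++ l); split.
      + intros V HV; apply in_app_or in HV; destruct HV; auto.
      + intros t' [<- | Ht'] w Hw Qw.
        * destruct (H2' w Hw Qw) as (V & HV & HVw); exists V; split; trivial. apply in_or_app; now left.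
        * destruct (H2 t' Ht' w Hw Qw) as (V & HV & HVw); exists V; split; trivial. apply in_or_app; now right. }
  destruct HL as (l & H1 & H2). exists l; split; trivial.
  intros x (w & Qw & <-). destruct (HB w Qw) as [B1 B2].
  apply Rabs_le_between in B1; apply Rabs_le_between in B2.
  destruct (Hts (fst w, (snd w, tt))) as (t & Ht & _ & Hc); [ simpl; tauto | ].
  apply (H2 t Ht w); trivial. destruct t as [t1 [t2 []]]. unfold pt; simpl in Hc |- *.
  apply supd_lt; simpl; tauto.
Qed.

Lemma compact_rad_le r : 0 <= r < rad0 -> compact_set (fun x => deltU x /\ rad x <= r).
Proof.
  intros Hr. assert (P := rad0_bounds).
  assert (HK := compact_set_image (fun z => n2 z <= r) delt r).
  assert (EZ : forall w, vsub w (0, 0) = w) by (intros [a b]; unfold vsub; cbn [fst snd]; f_equal; ring).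
  assert (HK' : compact_set (fun x => exists z, n2 z <= r /\ delt z = x)).
  { apply HK.
    - intros z Hz. assert (A := supd_le_n2 z (0, 0)). rewrite EZ in A.
      assert (B : supd z (0, 0) <= r) by lra. apply supd_le in B; cbn [fst snd] in B.
      now rewrite !Rminus_0_r in B.
    - intros z Hz. apply locally_supd. exists ((n2 z - r) / 2); split; [ lra | ].
      intros w Hw Hwr. assert (A := n2_triang z w (0, 0)). rewrite !EZ in A.
      assert (B := n2_le_supd z w). rewrite supd_sym in Hw. lra.
    - intros z; apply continuous_delt. }
  assert (E : forall x, deltU x /\ rad x <= r <-> exists z, n2 z <= r /\ delt z = x).
  { intros x; split.
    - intros [Hx Hrx]. exists (dinv x); split; [ exact Hrx | apply dinv_spec, Hx ].
    - intros (z & Hz & <-). assert (Hd : disc0 z).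
      { unfold disc0. rewrite <- n2_sqr. assert (N := n2_nonneg z). nra. }
      split; [ now apply delt_in | ]. unfold rad; now rewrite dinv_delt. }
  intros F HF Hc. destruct (HK' F HF) as (l & H1 & H2).
  - intros x Hx; now apply Hc, E.
  - exists l; split; trivial. intros x Hx; now apply H2, E.
Qed.

Lemma geo_in s : 0 <= s < gam0 -> deltU (geo s).
Proof. intros Hs; apply axis_in, rho_range, Hs. Qed.

Lemma rlen_rad_geo s : 0 <= s < gam0 -> rlen (rad (geo s)) = s.
Proof.
  intros Hs. assert (Hr := rho_range s Hs). assert (P := rlen_rad1_bounds).
  unfold rad, geo. rewrite (dinv_delt _ (disc_axis _ Hr)). unfold n2, nsq; cbn [fst snd].
  replace (rho s ^ 2 + 0 ^ 2) with (rho s ^ 2) by ring.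
  rewrite sqrt_pow2 by lra. apply rho_spec; lra.
Qed.

Lemma speed_geo s : 0 <= s < gam0 -> speed (Hess uex) geo s = 1.
Proof.
  intros Hs. destruct (geo_derivatives s Hs) as (D1 & D2 & _).
  unfold speed, velocity.
  assert (E1 : Derive (fun r : R => fst (geo r)) s = fst (geo' s)) by exact (is_derive_unique _ _ _ D1).
  assert (E2 : Derive (fun r : R => snd (geo r)) s = snd (geo' s)) by exact (is_derive_unique _ _ _ D2).
  rewrite E1, E2, <- surjective_pairing. now apply geo_unit_speed.
Qed.

Lemma is_RInt_1 a b : is_RInt (fun _ => 1) a b (b - a).
Proof.
  assert (A := is_RInt_const a b 1). replace (b - a) with (scal (b - a) 1); [ exact A | ].
  unfold scal; simpl; unfold mult; simpl; ring_R.
Qed.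

Lemma is_RInt_speed_geo a b : 0 <= a -> a <= b -> b <= gam0 -> is_RInt (speed (Hess uex) geo) a b (b - a).
Proof.
  intros Ha Hab Hb. apply is_RInt_ext with (fun _ => 1); [ | apply is_RInt_1 ].
  rewrite Rmin_left, Rmax_right by trivial. intros x Hx; rewrite speed_geo; lra.
Qed.

(** Along [geo] the function [rlen (rad x)] is the arc length, and along any other curve it grows at
    most by the length. *)
Lemma geo_minimizing : minimizing deltU (Hess uex) (ivl_co 0 gam0) geo.
Proof.
  intros s1 s2 H1 H2 H12 e He Hp E0 E1.
  unfold curve_length. rewrite (is_RInt_unique _ _ _ _ (is_RInt_speed_geo s1 s2 (proj1 H1) H12 (Rlt_le _ _ (proj2 H2)))).
  destruct (rlen_rad_length (ivl_cc 0 1) 1 e) as (I & RI & BI); trivial.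
  - split; lra.
  - lra.
  - intros t Ht; apply Ht.
  - rewrite (is_RInt_unique _ _ _ _ RI). rewrite E0, E1, !rlen_rad_geo in BI by trivial. exact BI.
Qed.

(** The endpoint comes from the boundary circle, and [delt] is injective on the closed disc as
    well. *)
Lemma geo_gam0_out : ~ deltU (geo gam0).
Proof.
  intros (z & Hz & E). assert (P := rad0_bounds). assert (P1 := rad1_bounds).
  assert (R0 : rho gam0 = rad0) by (apply rho_rlen; lra).
  unfold geo in E; rewrite R0 in E. unfold disc0 in Hz.
  assert (N : nsq (rad0, 0) = rad0 ^ 2) by (unfold nsq; cbn [fst snd]; ring).
  apply delt_inj in E; [ | lra | lra ]. subst z. lra.
Qed.

Lemma continuous_geo_gam0 : continuous geo gam0.
Proof.
  assert (P := rlen_rad1_bounds). assert (G := gam0_pos).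
  apply (continuous_comp (fun s => (rho s, 0)) delt); [ | apply continuous_delt ].
  assert (C : continuous rho gam0) by (apply (is_derive_continuous rho _ _ (is_derive_rho gam0 ltac:(lra)))).
  apply filterlim_locally; intros e.
  assert (D1 := proj1 (filterlim_locally _ _) C e).
  revert D1; apply filter_imp; intros s Hs; split; [ exact Hs | apply (ball_center 0 e) ].
Qed.

(** Otherwise points [geo (t k)] with [t k] tending to [gam0] stay in one exhaustion set; being
    closed, it would contain [geo gam0]. *)
Lemma geo_leaves : leaves_compacts deltU geo 0 gam0.
Proof.
  intros K HK HKU. assert (G := gam0_pos).
  destruct (compact_in_exhaustion deltU K open_deltU HK HKU) as [n Hn].
  apply NNPP; intros Hne.
  assert (Ht : forall k, exists t, gam0 - gam0 / (INR k + 1) < t < gam0 /\ exhaustion deltU n (geo t)).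
  { intros k. apply NNPP; intros Hk. apply Hne. exists (gam0 - gam0 / (INR k + 1)).
    assert (Q := INR1_pos k). assert (Q' := pos_INR k).
    assert (0 < gam0 / (INR k + 1)) by now apply Rdiv_lt_0_compat.
    assert (gam0 / (INR k + 1) <= gam0).
    { apply Rle_div_l; [ lra | ]. nra. }
    split; [ lra | ]. intros t Ht HKt; apply Hk; exists t; auto. }
  destruct (choice _ Ht) as [t Hts]. clear Ht.
  apply geo_gam0_out, (exhaustion_in deltU n), (exhaustion_limit deltU n (fun k => geo (t k))).
  - apply (filterlim_comp _ _ _ t geo eventually (locally gam0)); [ | apply continuous_geo_gam0 ].
    apply filterlim_locally; intros e.
    destruct (inv_INR1_small (e / gam0)) as [N HN]; [ apply Rdiv_lt_0_compat; [ apply cond_pos | trivial ] | ].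
    exists N; intros k Hk. change (Rabs (t k - gam0) < e).
    destruct (Hts k) as [A _]. apply Rabs_lt_between.
    assert (B : gam0 / (INR k + 1) < e).
    { assert (L := le_INR _ _ Hk). assert (Q := INR1_pos N).
      assert (/ (INR k + 1) <= / (INR N + 1)) by (apply Rinv_le_contravar; lra).
      apply Rlt_div_r in HN; trivial. unfold Rdiv. nra. }
    lra.
  - intros k; apply Hts.
Qed.

Lemma geo_has_length : has_length (Hess uex) geo 0 gam0 gam0.
Proof.
  assert (G := gam0_pos). apply is_RInt_gen_at_left with (L := fun T => T).
  - exists 0; split; trivial. intros T HT.
    assert (A := is_RInt_speed_geo 0 T (Rle_refl _) ltac:(lra) ltac:(lra)). now rewrite Rminus_0_r in A.
  - intros e He; exists (gam0 - e); split; [ lra | ]. intros T HT; apply Rabs_lt_between; lra.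
Qed.

(** A curve to the boundary leaves the compact set [rad x <= r] for each [r < rad0], so its length
    is at least [rlen r]; then [r] tends to [rad0]. *)
Lemma gam0_le_length c l : curve_to_boundary deltU (geo 0) c -> has_length (Hess uex) c 0 1 l -> gam0 <= l.
Proof.
  intros (HU & Hp & H0 & Hleave) Hl. assert (P := rad0_bounds). assert (G := gam0_pos).
  assert (HR : forall r, 0 <= r < rad0 -> rlen r <= l).
  { intros r Hr. destruct (Hleave _ (compact_rad_le r Hr)) as (T0 & HT0 & HT); [ tauto | ].
    apply le_epsilon; intros eps He.
    destruct (is_RInt_gen_at_left_inv _ _ _ _ _ Hl He) as (T1 & HT1 & HI).
    set (T := (Rmax T0 T1 + 1) / 2). assert (M1 := Rmax_l T0 T1). assert (M2 := Rmax_r T0 T1).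
    assert (M3 : Rmax T0 T1 < 1) by now apply Rmax_lub_lt.
    destruct (HI T) as (y & RI & Hy); [ unfold T; lra | ].
    assert (HUT : deltU (c T)) by (apply HU; split; unfold T; lra).
    assert (HrT : r < rad (c T)).
    { apply Rnot_le_lt; intros h; apply (HT T); [ unfold T; lra | now split ]. }
    destruct (rlen_rad_length (ivl_co 0 1) T c) as (I & RI' & BI); trivial.
    - split; unfold T; lra.
    - unfold T; lra.
    - intros t Ht; split; unfold T in Ht; lra.
    - intros t Ht; destruct Ht; lra.
    - assert (EI : y = I) by (rewrite <- (is_RInt_unique _ _ _ _ RI); apply is_RInt_unique, RI').
      rewrite H0, rlen_rad_geo in BI by lra. rewrite <- EI in BI.
      assert (Q := rad_range _ HUT).
      assert (A := rlen_lt r (rad (c T)) ltac:(lra) HrT ltac:(lra)).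
      apply Rabs_lt_between in Hy. lra. }
  apply le_epsilon; intros eps He.
  set (h := Rmin rad0 eps). assert (Hh : 0 < h) by (apply Rmin_pos; lra).
  assert (M1 : h <= rad0) by apply Rmin_l. assert (M2 : h <= eps) by apply Rmin_r.
  assert (A := HR (rad0 - h) ltac:(lra)).
  assert (B := rlen_le (rad0 - h) rad0 ltac:(lra) ltac:(lra) ltac:(lra)). unfold gam0. lra.
Qed.

(** Competitors for the distance are parametrized by [[0, 1)]; this one shows that the infimum is
    attained. *)
Definition geo_scaled (t : R) : R * R := geo (gam0 * t).

Lemma speed_geo_scaled t : 0 <= t < 1 -> speed (Hess uex) geo_scaled t = gam0.
Proof.
  intros Ht. assert (G := gam0_pos). assert (Hs : 0 <= gam0 * t < gam0) by nra.
  destruct (geo_derivatives _ Hs) as (D1 & D2 & _).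
  assert (L : is_derive (fun s => gam0 * s) t gam0) by (auto_derive; trivial; ring).
  unfold speed, velocity, geo_scaled.
  assert (E1 : Derive (fun r : R => fst (geo (gam0 * r))) t = gam0 * fst (geo' (gam0 * t)))
    by exact (is_derive_unique _ _ _ (is_derive_comp (fun r => fst (geo r)) (fun r => gam0 * r) t _ _ D1 L)).
  assert (E2 : Derive (fun r : R => snd (geo (gam0 * r))) t = gam0 * snd (geo' (gam0 * t)))
    by exact (is_derive_unique _ _ _ (is_derive_comp (fun r => snd (geo r)) (fun r => gam0 * r) t _ _ D2 L)).
  rewrite E1, E2. assert (N := geo_unit_speed _ Hs).
  assert (HU := geo_in _ Hs).
  rewrite (gnorm_hform deltU _ _ _ ma_uex HU) in N. rewrite (gnorm_hform deltU _ _ _ ma_uex HU).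
  unfold hform in *; cbn [fst snd].
  match goal with |- sqrt ?a = _ => match type of N with sqrt ?b = _ =>
    replace a with (gam0 ^ 2 * b) by ring end end.
  rewrite sqrt_mult_alt by apply pow2_ge_0. rewrite N, sqrt_pow2 by lra. ring.
Qed.

Lemma geo_scaled_to_boundary : curve_to_boundary deltU (geo 0) geo_scaled.
Proof.
  assert (G := gam0_pos).
  assert (HS : forall t, 0 <= t < 1 -> 0 <= gam0 * t < gam0) by (intros; nra).
  split; [ | split; [ | split ] ].
  - intros t Ht; now apply geo_in, HS.
  - exists 1%nat, (fun k => INR k). split; [ reflexivity | split; [ reflexivity | ] ].
    intros i Hi. assert (i = O) by lia. subst i. split; [ simpl; lra | ].
    exists (fun t => (gam0 * fst (geo' (gam0 * t)), gam0 * snd (geo' (gam0 * t)))).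
    intros t [Ht _]. assert (H := HS t Ht). destruct (geo_derivatives _ H) as (D1 & D2 & D3 & D4).
    split.
    + apply is_derive_within_iff; [ split; [ exact Ht | split; simpl; destruct Ht; lra ] | ].
      cbn [fst snd]. split.
      * apply (derive_in_comp_linear (fun _ => True) _ (fun s => fst (geo s)) gam0 t); [ lra | trivial | ].
        apply is_derive_iff_derive_in, D1.
      * apply (derive_in_comp_linear (fun _ => True) _ (fun s => snd (geo s)) gam0 t); [ lra | trivial | ].
        apply is_derive_iff_derive_in, D2.
    + apply (continuous_within_iff _ (fun t => (gam0 * fst (geo' (gam0 * t)), gam0 * snd (geo' (gam0 * t)))));
        cbn [fst snd]; split.
      * apply (continuous_in_comp_linear (fun _ => True) _ (fun s => fst (geo' s)) gam0 t); [ lra | trivial | ].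
        apply continuous_iff_continuous_in, (is_derive_continuous _ _ _ D3).
      * apply (continuous_in_comp_linear (fun _ => True) _ (fun s => snd (geo' s)) gam0 t); [ lra | trivial | ].
        apply continuous_iff_continuous_in, (is_derive_continuous _ _ _ D4).
  - unfold geo_scaled; now rewrite Rmult_0_r.
  - intros K HK HKU. destruct (geo_leaves K HK HKU) as (T & HT & A).
    exists (T / gam0). split.
    + split; [ apply Rle_div_r; lra | apply Rlt_div_l; lra ].
    + intros t [Ht1 Ht2]. apply A. apply Rlt_div_l in Ht1; [ | lra ]. nra.
Qed.

Lemma geo_scaled_has_length : has_length (Hess uex) geo_scaled 0 1 gam0.
Proof.
  assert (G := gam0_pos). apply is_RInt_gen_at_left with (L := fun T => T * gam0).
  - exists 0; split; [ lra | ]. intros T HT.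
    apply is_RInt_ext with (fun _ => gam0).
    + rewrite Rmin_left, Rmax_right by lra. intros x Hx; rewrite speed_geo_scaled; lra.
    + assert (A := is_RInt_const 0 T gam0).
      replace (T * gam0) with (scal (T - 0) gam0); [ exact A | ].
      unfold scal; simpl; unfold mult; simpl; ring_R.
  - intros e He; exists (1 - e / gam0). assert (0 < e / gam0) by now apply Rdiv_lt_0_compat.
    split; [ lra | ]. intros T HT. assert (A : 1 - T < e / gam0) by lra.
    apply Rlt_div_r in A; trivial. apply Rabs_lt_between; nra.
Qed.

Lemma geo_realizes : realizes_dist_boundary deltU (Hess uex) geo geo' gam0.
Proof.
  split.
  - exact geo_in.
  - exact geo_unit_speed.
  - exact geo_geodesic.
  - exact geo_minimizing.
  - exact geo_leaves.
  - exact geo_has_length.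
  - apply is_glb_Rbar_unique; split.
    + intros l (c & Hc & Hl). exact (gam0_le_length c l Hc Hl).
    + intros b Hb; apply Hb. exists geo_scaled.
      exact (conj geo_scaled_to_boundary geo_scaled_has_length).
Qed.

(** At [s = 0], the centre of the disc, the bound reads [sqrt 2 <= c / gam0]. *)
Lemma ricci_bound_ge c : ricci_bound c -> 111 / 100 <= c.
Proof.
  intros H. assert (G := gam0_ge). destruct ma_uex as [Ho Hs Hpd Hdet].
  assert (B := H deltU uex Ho Hs Hpd Hdet gam0 geo geo' gam0_pos geo_realizes 0 ltac:(lra)).
  assert (H0 : 0 <= 0 < gam0) by lra.
  rewrite (Ric_bilin deltU uex ma_uex) in B by now apply geo_in.
  assert (E : bilin (Hess uex (geo 0)) (geo' 0) (geo' 0) = 1)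
    by exact (bilin_of_gnorm_1 _ _ _ (geo_unit_speed 0 H0)).
  assert (E0 : geo 0 = delt (0, 0)) by (unfold geo; now rewrite rho_0).
  rewrite E, E0, curvature_origin, Rmult_1_r, Rminus_0_r in B.
  apply Rle_div_r in B; [ | lra ]. eapply Rle_trans; [ | exact B ].
  assert (S := sqrt_pos 2). assert (S2 := sqrt_sqrt 2 ltac:(lra)).
  assert (141421 / 100000 <= sqrt 2) by nra. nra.
Qed.

Theorem theorem1p4 :
  (exists c : R, c <= 116 / 100 /\ ricci_bound c) /\
  (forall c : R, ricci_bound c -> 111 / 100 <= c).
Proof.
  split; [ | exact ricci_bound_ge ].
  exists (116 / 100); split; [ apply Rle_refl | exact ricci_bound_116 ].
Qed.
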